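(* Let $g\ge 2$. There is a constant $c_g>0$, depending only on $g$, such that for every $X\in\mathcal{M}_g$, with $s=\min(\mathrm{sys}(X),1/2)$, $$\frac{1}{c_g}\cdot\frac{1}{s\log(1/s)}\le I(X)\le c_g\cdot\frac{1}{s\log(1/s)}.$$
   Context: $\mathcal{M}_g$ is the moduli space of compact hyperbolic surfaces of genus $g$. For $X\in\mathcal{M}_g$, $\ell_X(\gamma)$ is the length of a closed geodesic $\gamma$ on $X$, and $\mathrm{sys}(X)$ is the minimum of $\ell_X(\gamma)$ over all closed geodesics $\gamma$. For closed geodesics $\gamma_1,\gamma_2$, $i(\gamma_1,\gamma_2)$ is the geometric intersection number: the minimal number of transversal intersection points, counted with multiplicity, between a representative of the homotopy class $[\gamma_1]$ and a representative of $[\gamma_2]$. The interaction strength of $X$ is $$I(X)=\sup_{\gamma_1,\gamma_2}\frac{i(\gamma_1,\gamma_2)}{\ell_X(\gamma_1)\ell_X(\gamma_2)},$$ the supremum being over all pairs of closed geodesics on $X$. *)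

(* Defs.v *)
From mathcomp Require Import all_boot all_order all_algebra.
From mathcomp Require Import all_classical all_reals all_analysis.

Set Implicit Arguments.
Unset Strict Implicit.
Unset Printing Implicit Defensive.

Import Order.TTheory GRing.Theory Num.Theory.
Import numFieldNormedType.Exports.

Local Open Scope classical_set_scope.
Local Open Scope ring_scope.

(* The upper half-plane model: (x, y) stands for the complex number x + iy. *)
Definition halfplane {R : realType} : set (R * R) := [set z | 0 < z.2].

(* arcosh (1 + |z - w|^2 / (2 Im z Im w)) *)
Definition hdist {R : realType} (z w : R * R) : R :=
  let u := 1 + ((z.1 - w.1) ^+ 2 + (z.2 - w.2) ^+ 2) / (2 * z.2 * w.2) in
  ln (u + Num.sqrt (u ^+ 2 - 1)).

(* Real and imaginary part of (az + b) / (cz + d), for A = [a, b; c, d] of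
   determinant 1. *)
Definition mobius {R : realType} (A : 'M[R]_2) (z : R * R) : R * R :=
  let a := A 0 0 in let b := A 0 1 in let c := A 1 0 in let d := A 1 1 in
  let n := (c * z.1 + d) ^+ 2 + (c * z.2) ^+ 2 in
  ((a * c * (z.1 ^+ 2 + z.2 ^+ 2) + (a * d + b * c) * z.1 + b * d) / n,
   z.2 / n).

(* Equality in PSL_2(R) of two elements of SL_2(R). *)
Definition eq_pm {R : realType} (A B : 'M[R]_2) : Prop := A = B \/ A = - B.

(* The fundamental group of the closed orientable surface of genus g, as
   < a_i, b_i (i < g) | [a_0, b_0] ... [a_(g-1), b_(g-1)] >.
   Generators: (i, false) is a_i and (i, true) is b_i. A letter is a generator
   together with a flag telling whether it is inverted. *)
Definition surface_letter (g : nat) : Type := (('I_g * bool) * bool)%type.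

Definition letter_inv (g : nat) (x : surface_letter g) : surface_letter g :=
  (x.1, ~~ x.2).

Definition surface_relator (g : nat) : seq (surface_letter g) :=
  flatten [seq [:: ((i, false), false); ((i, true), false);
                   ((i, false), true); ((i, true), true)] | i <- enum 'I_g].

Inductive surface_word_eq (g : nat) :
    seq (surface_letter g) -> seq (surface_letter g) -> Prop :=
| swe_refl u : surface_word_eq u u
| swe_sym u v : surface_word_eq u v -> surface_word_eq v u
| swe_trans u v w :
    surface_word_eq u v -> surface_word_eq v w -> surface_word_eq u w
| swe_cancel u v x : surface_word_eq (u ++ [:: x; letter_inv x] ++ v) (u ++ v)
| swe_relator u v : surface_word_eq (u ++ surface_relator g ++ v) (u ++ v).

Definition word_eval {R : realType} (g : nat) (gen : 'I_g * bool -> 'M[R]_2)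
    (w : seq (surface_letter g)) : 'M[R]_2 :=
  \prod_(x <- w) (if x.2 then invmx (gen x.1) else gen x.1).

(* Gamma / {1, -1} is isomorphic to the genus-g surface group. *)
Definition is_surface_group {R : realType} (g : nat) (Gamma : set 'M[R]_2)
    : Prop :=
  exists gen : 'I_g * bool -> 'M[R]_2,
    [/\ forall x, Gamma (gen x),
        forall A, Gamma A -> exists w, eq_pm A (word_eval gen w) &
        forall v w, eq_pm (word_eval gen v) (word_eval gen w) <->
                    surface_word_eq v w].

(* A compact hyperbolic surface of genus g is X = halfplane / Gamma, where
   Gamma, given by its preimage in SL_2(R) (hence hs_opp), is a group acting
   freely, properly discontinuously and cocompactly with quotient of
   fundamental group the surface group. As the action is isometric, freeness
   and proper discontinuity amount to hs_free_discontinuous: every point is at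
   positive distance from its images by the non-trivial elements. *)
Record hyperbolic_surface {R : realType} (g : nat) (Gamma : set 'M[R]_2)
    : Prop := HyperbolicSurface {
  hs_det : forall A, Gamma A -> \det A = 1;
  hs_one : Gamma 1%:M;
  hs_opp : forall A, Gamma A -> Gamma (- A);
  hs_mul : forall A B, Gamma A -> Gamma B -> Gamma (A *m B);
  hs_inv : forall A, Gamma A -> Gamma (invmx A);
  hs_free_discontinuous : forall z, halfplane z ->
    exists2 r : R, 0 < r &
      forall A, Gamma A -> hdist z (mobius A z) < r -> eq_pm A 1%:M;
  hs_cocompact : exists K : set (R * R),
    [/\ compact K, K `<=` halfplane &
        forall z, halfplane z -> exists2 A, Gamma A & K (mobius A z)];
  hs_genus : is_surface_group g Gamma }.

(* Equality in X of the points represented by z and w. Below, maps from the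
   line or the strip [0, 1] x R to X are given by their lifts to the
   half-plane; what is required of them in X is stated with same_point. *)
Definition same_point {R : realType} (Gamma : set 'M[R]_2) (z w : R * R)
    : Prop :=
  exists2 A, Gamma A & w = mobius A z.

(* c represents a map from R / Z to X. *)
Definition closed_in {R : realType} (Gamma : set 'M[R]_2) (c : R -> R * R)
    : Prop :=
  (forall t, halfplane (c t)) /\ (forall t, same_point Gamma (c t) (c (t + 1))).

(* c : R / Z -> X is a closed geodesic of length l: it is locally distance
   minimizing, with constant speed l. *)
Definition closed_geodesic {R : realType} (Gamma : set 'M[R]_2)
    (c : R -> R * R) (l : R) : Prop :=
  [/\ 0 < l, closed_in Gamma c &
      forall t : R, exists2 e : R, 0 < e &
        forall s s', `|s - t| < e -> `|s' - t| < e ->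
          hdist (c s) (c s') = l * `|s - s'|].

Definition systole {R : realType} (Gamma : set 'M[R]_2) : R :=
  inf [set l | exists c, closed_geodesic Gamma c l].

Definition freely_homotopic {R : realType} (Gamma : set 'M[R]_2)
    (c c' : R -> R * R) : Prop :=
  exists F : R * R -> R * R,
    [/\ {within [set p : R * R | 0 <= p.1 <= 1], continuous F},
        forall u, 0 <= u <= 1 -> closed_in Gamma (fun t => F (u, t)),
        forall t, same_point Gamma (c t) (F (0, t)) &
        forall t, same_point Gamma (c' t) (F (1, t))].

Definition C1 {R : realType} (f : R -> R) : Prop :=
  (forall t, derivable f t 1) /\ continuous (f^`())%classic.

Definition velocity {R : realType} (c : R -> R * R) (t : R) : R * R :=
  (derive1 (fun s => (c s).1) t, derive1 (fun s => (c s).2) t).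

Definition C1_closed_curve {R : realType} (Gamma : set 'M[R]_2)
    (c : R -> R * R) : Prop :=
  [/\ closed_in Gamma c, C1 (fun t => (c t).1) & C1 (fun t => (c t).2)].

(* At every common point in X, the two tangent vectors, brought to the same
   point of the half-plane by an element of Gamma, are linearly independent. *)
Definition transverse {R : realType} (Gamma : set 'M[R]_2)
    (c1 c2 : R -> R * R) : Prop :=
  forall A (t1 t2 : R), Gamma A -> mobius A (c1 t1) = c2 t2 ->
    let u := velocity (fun t => mobius A (c1 t)) t1 in
    let v := velocity c2 t2 in
    u.1 * v.2 - u.2 * v.1 != 0.

(* Intersection points are counted with multiplicity as pairs of parameters:
   a point through which c1 passes p times and c2 passes q times counts pq
   times. *)
Definition intersections {R : realType} (Gamma : set 'M[R]_2)
    (c1 c2 : R -> R * R) : set (R * R) :=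
  [set t | [/\ 0 <= t.1 < 1, 0 <= t.2 < 1 &
               same_point Gamma (c1 t.1) (c2 t.2)]].

Definition geometric_intersection {R : realType} (Gamma : set 'M[R]_2)
    (c1 c2 : R -> R * R) : \bar R :=
  ereal_inf [set x | exists (n : nat) (d1 d2 : R -> R * R),
    [/\ C1_closed_curve Gamma d1 /\ freely_homotopic Gamma c1 d1,
        C1_closed_curve Gamma d2 /\ freely_homotopic Gamma c2 d2,
        transverse Gamma d1 d2,
        (intersections Gamma d1 d2 #= `I_n)%card &
        x = (n%:R)%:E]].

Definition interaction_strength {R : realType} (Gamma : set 'M[R]_2)
    : \bar R :=
  ereal_sup [set x | exists (c1 c2 : R -> R * R) (l1 l2 : R),
    [/\ closed_geodesic Gamma c1 l1, closed_geodesic Gamma c2 l2 &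
        x = (geometric_intersection Gamma c1 c2 * ((l1 * l2)^-1)%:E)%E]].

(* Main.v *)
Require Import Defs.
From mathcomp Require Import all_boot all_order all_algebra.
From mathcomp Require Import all_classical all_reals all_analysis.
From mathcomp Require Import ring lra.

(* Distances are handled through their hyperbolic cosine ch.

   Lower bound. A winding argument on the Cayley graph of the surface group
   shows that the translates of 4g geodesic triangles cover the half-plane, so
   that X contains at most 96 g n^2 + O(n) points pairwise 1/n apart. Hence the
   systole is bounded, and on each side of the axis of a shortest geodesic a strip
   of area of order g cannot embed: some element of the group moves the strip back
   to itself, with entries bounded by a power of 1/s in the frame of the axis.
   Combining such elements for the two sides gives a matrix with positive
   entries: its axis crosses that of the shortest geodesic and its length is
   O(log (1/s)). The crossing persists under homotopy by a planar separation
   argument on lifts.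

   Upper bound. The first geodesic is replaced by a hypercycle of generic width
   at its axis, which is homotopic to it, transverse to the second geodesic, and
   meets each of its lifts at most twice. Cut both curves into arcs of length
   w = log (1/s) / 16. If two arcs met more than C w / s times, then by the
   pigeonhole principle some group element would have a displacement so small
   along the arcs that, by the Margulis lemma, all elements carrying one arc to
   the other would differ by translations along a single axis. These are s apart
   and bounded by O(w), so there are at most O(w / s) of them. *)

Set Implicit Arguments.
Unset Strict Implicit.
Unset Printing Implicit Defensive.

Import Order.TTheory GRing.Theory Num.Theory.
Import numFieldNormedType.Exports archimedean.Num.Theory.

Local Open Scope classical_set_scope.
Local Open Scope ring_scope.

(** * The Moebius action and the distance *)

Section Mobius.
Variable R : realType.
Implicit Types (A B M : 'M[R]_2) (z w p : R * R).

(** With [ch] in place of distances, invariance, the triangle inequality and the convexity of balls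
    become polynomial or linear statements. The area of X enters only through a packing count: its
    coefficient of n^2 depends on g alone but its linear term depends on X, so grids have to be
    refined indefinitely before they contradict it. In a frame where a geodesic is the imaginary
    axis, B with rows (a, b) and (c, d) sends this axis to the geodesic ending at a/c and b/d, so
    the sign of abcd tells whether the two cross; this is the test for intersection throughout the
    lower bound. The logarithm of the upper bound comes from the arcs: about l1 l2 / w^2 pairs of
    arcs with O(w / s) meetings each give O(l1 l2 / (w s)). Displacements grow exponentially along
    an arc, so w can only be a small multiple of log (1/s). A hypercycle is needed because the two
    geodesics may overlap in X, where they are not transverse. *)

Lemma mul2E A B i j : (A *m B) i j = A i 0 * B 0 j + A i 1 * B 1 j.
Proof.
rewrite mxE !big_ord_recl big_ord0 addr0.
by have -> : lift ord0 (ord0 : 'I_1) = 1 by exact/val_inj.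
Qed.

Lemma ord2P (P : 'I_2 -> Prop) : P 0 -> P 1 -> forall i, P i.
Proof.
move=> h0 h1 [[|[|//]] hi].
- by have -> : Ordinal hi = 0 by exact/val_inj.
- by have -> : Ordinal hi = 1 by exact/val_inj.
Qed.

Lemma ler_pM1 (x y u v : R) : 1 <= x -> x <= u -> 1 <= y -> y <= v -> x * y <= u * v.
Proof. by move=> x1 xu y1 yv; apply: ler_pM => //; apply: le_trans ler01 _. Qed.

Definition mx2 (a b c d : R) : 'M[R]_2 :=
  \matrix_(i, j) if i == 0 then (if j == 0 then a else b)
                 else (if j == 0 then c else d).

Lemma mx2E a b c d : [/\ mx2 a b c d 0 0 = a, mx2 a b c d 0 1 = b,
  mx2 a b c d 1 0 = c & mx2 a b c d 1 1 = d].
Proof. by split; rewrite mxE. Qed.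

Definition mx2_00 a b c d : mx2 a b c d 0 0 = a. Proof. by case: (mx2E a b c d). Qed.
Definition mx2_01 a b c d : mx2 a b c d 0 1 = b. Proof. by case: (mx2E a b c d). Qed.
Definition mx2_10 a b c d : mx2 a b c d 1 0 = c. Proof. by case: (mx2E a b c d). Qed.
Definition mx2_11 a b c d : mx2 a b c d 1 1 = d. Proof. by case: (mx2E a b c d). Qed.
Definition mx2V := (mx2_00, mx2_01, mx2_10, mx2_11).

Lemma mx2P A B : A 0 0 = B 0 0 -> A 0 1 = B 0 1 -> A 1 0 = B 1 0 ->
  A 1 1 = B 1 1 -> A = B.
Proof.
move=> h00 h01 h10 h11; apply/matrixP => i j.
by move: i; apply: ord2P; move: j; apply: ord2P.
Qed.

Lemma det2E A : \det A = A 0 0 * A 1 1 - A 0 1 * A 1 0.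
Proof.
rewrite (expand_det_row A 0) !big_ord_recl big_ord0 addr0.
have -> : lift ord0 (ord0 : 'I_1) = 1 by exact/val_inj.
rewrite /cofactor !det_mx11 !mxE /= expr0 expr1.
have -> : lift (0:'I_2) (0:'I_1) = 1 by exact/val_inj.
have -> : lift (1:'I_2) (0:'I_1) = 0 by exact/val_inj.
ring.
Qed.

Lemma id2E : [/\ (1%:M : 'M[R]_2) 0 0 = 1, (1%:M : 'M[R]_2) 0 1 = 0,
  (1%:M : 'M[R]_2) 1 0 = 0 & (1%:M : 'M[R]_2) 1 1 = 1].
Proof. by split; rewrite mxE. Qed.

Definition id2_00 : (1%:M : 'M[R]_2) 0 0 = 1. Proof. by case: id2E. Qed.
Definition id2_01 : (1%:M : 'M[R]_2) 0 1 = 0. Proof. by case: id2E. Qed.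
Definition id2_10 : (1%:M : 'M[R]_2) 1 0 = 0. Proof. by case: id2E. Qed.
Definition id2_11 : (1%:M : 'M[R]_2) 1 1 = 1. Proof. by case: id2E. Qed.
Definition id2V := (id2_00, id2_01, id2_10, id2_11).

Lemma opp2E A i j : (- A) i j = - A i j. Proof. by rewrite mxE. Qed.

Definition adj2 A := mx2 (A 1 1) (- A 0 1) (- A 1 0) (A 0 0).

Lemma adj2V A : [/\ adj2 A 0 0 = A 1 1, adj2 A 0 1 = - A 0 1,
  adj2 A 1 0 = - A 1 0 & adj2 A 1 1 = A 0 0].
Proof. by rewrite /adj2 !mx2V. Qed.

Lemma mul_adj2 A : \det A = 1 -> A *m adj2 A = 1%:M.
Proof.
rewrite det2E => h; case: (adj2V A) => e1 e2 e3 e4.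
by apply: mx2P; rewrite mul2E ?e1 ?e2 ?e3 ?e4 !id2V; lra.
Qed.

Lemma invmx2 A : \det A = 1 -> invmx A = adj2 A.
Proof.
move=> h; have u : A \in unitmx by rewrite unitmxE h unitr1.
by rewrite -[RHS](mulKmx u) mul_adj2 // mulmx1.
Qed.

Lemma invmx2E A : \det A = 1 -> [/\ invmx A 0 0 = A 1 1,
  invmx A 0 1 = - A 0 1, invmx A 1 0 = - A 1 0 & invmx A 1 1 = A 0 0].
Proof. by move=> h; rewrite invmx2 //; exact: adj2V. Qed.

Lemma det_invmx2 A : \det A = 1 -> \det (invmx A) = 1.
Proof. by move=> h; rewrite det_inv h invr1. Qed.

Lemma unit2 A : \det A = 1 -> A \in unitmx.
Proof. by move=> h; rewrite unitmxE h unitr1. Qed.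

Lemma det_mul1 A B : \det A = 1 -> \det B = 1 -> \det (A *m B) = 1.
Proof. by move=> hA hB; rewrite det_mulmx hA hB mulr1. Qed.

Lemma invmx_mul2 A B : \det A = 1 -> \det B = 1 ->
  invmx (A *m B) = invmx B *m invmx A.
Proof.
move=> hA hB; have hAB := det_mul1 hA hB.
rewrite -[LHS]mulmx1.
have -> : 1%:M = (A *m B) *m (invmx B *m invmx A).
  by rewrite mulmxA -(mulmxA A) mulmxV ?unit2 // mulmx1 mulmxV ?unit2.
by rewrite mulmxA mulVmx ?unit2 // mul1mx.
Qed.

Lemma eq_pm_sym A B : eq_pm A B -> eq_pm B A.
Proof. by case=> ->; [left|right; rewrite opprK]. Qed.

Lemma eq_pm_trans A B C : eq_pm A B -> eq_pm B C -> @eq_pm R A C.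
Proof.
move=> [->|->] [->|->]; rewrite ?opprK; [by left|by right|by right|by left].
Qed.

Lemma eq_pm_mull C A B : eq_pm A B -> eq_pm (C *m A) (C *m B).
Proof. by case=> ->; [left|right; rewrite mulmxN]. Qed.

Lemma eq_pm_mulr C A B : eq_pm A B -> eq_pm (A *m C) (B *m C).
Proof. by case=> ->; [left|right; rewrite mulNmx]. Qed.

Lemma eq_pm_inv1 A B : \det B = 1 -> eq_pm (A *m invmx B) 1%:M -> eq_pm A B.
Proof.
move=> hB /(eq_pm_mulr B); rewrite -mulmxA mulVmx ?unit2 // mulmx1 mul1mx.
by [].
Qed.

(** The automorphy factor |cz + d|^2. *)
Definition mden A z := (A 1 0 * z.1 + A 1 1) ^+ 2 + (A 1 0 * z.2) ^+ 2.

Lemma mobiusE A z : mobius A z =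
  ((A 0 0 * A 1 0 * (z.1 ^+ 2 + z.2 ^+ 2)
    + (A 0 0 * A 1 1 + A 0 1 * A 1 0) * z.1 + A 0 1 * A 1 1) / mden A z,
   z.2 / mden A z).
Proof. by []. Qed.

Lemma mden_gt0 A z : \det A = 1 -> halfplane z -> 0 < mden A z.
Proof.
rewrite det2E /halfplane /mden /= => h hz.
have [c0|c0] := eqVneq (A 1 0) 0.
  have d0 : A 1 1 != 0.
    apply/eqP => d0; move: h; rewrite c0 d0 !mulr0 subrr => /eqP.
    by rewrite eq_sym oner_eq0.
  by rewrite c0 !mul0r add0r expr0n /= addr0 exprn_even_gt0.
rewrite ltr_wpDl ?sqr_ge0 // exprn_even_gt0 //=.
by rewrite mulf_neq0 // gt_eqF.
Qed.

Lemma mobius_half A z : \det A = 1 -> halfplane z -> halfplane (mobius A z).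
Proof. by move=> h hz; rewrite /halfplane /= divr_gt0 // mden_gt0. Qed.

Lemma mobius_opp A z : mobius (- A) z = mobius A z.
Proof. by rewrite !mobiusE /mden !opp2E; congr (_ / _, _ / _); ring. Qed.

Lemma mobius_pm A B z : eq_pm A B -> mobius A z = mobius B z.
Proof. by case=> ->; rewrite ?mobius_opp. Qed.

Lemma mobius1 z : mobius 1%:M z = z.
Proof.
by rewrite mobiusE /mden !id2V; case: z => x y /=; congr pair; field.
Qed.

Lemma mobius_mul A B z : \det A = 1 -> \det B = 1 -> halfplane z ->
  mobius (A *m B) z = mobius A (mobius B z).
Proof.
move=> hA hB hz.
have h1 := mden_gt0 hB hz; have h2 := mden_gt0 hA (mobius_half hB hz).
have h3 := mden_gt0 (det_mul1 hA hB) hz.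
(* The cocycle rule of the automorphy factor. Here and below, factors equal to det B = 1 are
   inserted to reach polynomial identities. *)
have e : mden (A *m B) z = mden A (mobius B z) * mden B z.
  rewrite {1}/mden {1}/mden mobiusE /= !mul2E; move: (gt_eqF h1).
  move: hB; rewrite det2E /mden; move: (A 1 0) (A 1 1) => c d.
  move: (B 0 0) (B 0 1) (B 1 0) (B 1 1) z.1 z.2 => a' b' c' d' x y hB hd.
  have -> : a' * c' * (x ^+ 2 + y ^+ 2) + (a' * d' + b' * c') * x + b' * d' =
    (a' * x + b') * (c' * x + d') + a' * c' * y ^+ 2 by ring.
  have ey : y = (a' * d' - b' * c') * y by rewrite hB mul1r.
  set n := (c' * x + d') ^+ 2 + (c' * y) ^+ 2 in hd *.
  apply: (@mulIf _ n); first by rewrite hd.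
  transitivity (((c * ((a' * x + b') * (c' * x + d') + a' * c' * y ^+ 2) + d * n) ^+ 2
     + (c * y) ^+ 2)); last by field; rewrite hd.
  by rewrite [in (c * y)]ey /n; ring.
rewrite !(mobiusE A) !(mobiusE (_ *m _)) e; congr pair; last first.
  by rewrite mobiusE /=; field; rewrite !gt_eqF.
apply: (@mulIf _ (mden A (mobius B z) * mden B z * mden B z)).
  by rewrite !mulf_neq0 // gt_eqF.
rewrite mobiusE /= -!mobiusE.
move: (mden A _) h2 => mA h2.
transitivity (((A *m B) 0 0 * (A *m B) 1 0 * (z.1 ^+ 2 + z.2 ^+ 2)
   + ((A *m B) 0 0 * (A *m B) 1 1 + (A *m B) 0 1 * (A *m B) 1 0) * z.1
   + (A *m B) 0 1 * (A *m B) 1 1) * mden B z).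
  by field; rewrite !gt_eqF.
set u := B 0 0 * B 1 0 * (z.1 ^+ 2 + z.2 ^+ 2)
   + (B 0 0 * B 1 1 + B 0 1 * B 1 0) * z.1 + B 0 1 * B 1 1.
transitivity (A 0 0 * A 1 0 * (u ^+ 2 + z.2 ^+ 2)
  + (A 0 0 * A 1 1 + A 0 1 * A 1 0) * u * mden B z + A 0 1 * A 1 1 * mden B z ^+ 2);
  last by field; rewrite !gt_eqF.
have -> : u ^+ 2 + z.2 ^+ 2 = u ^+ 2 + ((B 0 0 * B 1 1 - B 0 1 * B 1 0) * z.2) ^+ 2.
  by rewrite -det2E hB mul1r.
by rewrite !mul2E /u /mden; ring.
Qed.

(* ch z w = cosh (hdist z w). *)
Definition ch z w := 1 + ((z.1 - w.1) ^+ 2 + (z.2 - w.2) ^+ 2) / (2 * z.2 * w.2).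

Lemma chE z w : halfplane z -> halfplane w ->
  ch z w = ((z.1 - w.1) ^+ 2 + z.2 ^+ 2 + w.2 ^+ 2) / (2 * z.2 * w.2).
Proof.
by rewrite /halfplane /ch /= => hz hw; field; rewrite !gt_eqF.
Qed.

Lemma ch_ge1 z w : halfplane z -> halfplane w -> 1 <= ch z w.
Proof.
rewrite /halfplane /ch /= => hz hw; rewrite lerDl divr_ge0 ?addr_ge0 ?sqr_ge0 //.
by rewrite !mulr_ge0 // ltW.
Qed.

Lemma chC z w : ch z w = ch w z.
Proof.
rewrite /ch; congr (1 + _ / _); last by ring.
by rewrite -(sqrrN (z.1 - _)) -(sqrrN (z.2 - _)) !opprB.
Qed.

Lemma chzz z : ch z z = 1.
Proof. by rewrite /ch !subrr expr0n /= addr0 mul0r addr0. Qed.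

Lemma ch_eq1 z w : halfplane z -> halfplane w -> ch z w = 1 -> z = w.
Proof.
rewrite /halfplane /ch /= => hz hw /eqP; rewrite -subr_eq0 addrC addKr.
rewrite mulf_eq0 invr_eq0 !mulf_eq0 !(gt_eqF hz) !(gt_eqF hw) pnatr_eq0 /= !orbF.
rewrite paddr_eq0 ?sqr_ge0 // !sqrf_eq0 !subr_eq0 => /andP[/eqP e1 /eqP e2].
by case: z w e1 e2 {hz hw} => [? ?] [? ?] /= -> ->.
Qed.

(** For det A = 1, |Az - Aw|^2 is |z - w|^2 divided by both automorphy factors, and each imaginary
    part is divided by its own factor. *)
Lemma ch_mobius A z w : \det A = 1 -> halfplane z -> halfplane w ->
  ch (mobius A z) (mobius A w) = ch z w.
Proof.
move=> hA hz hw; have h1 := mden_gt0 hA hz; have h2 := mden_gt0 hA hw.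
rewrite /ch !mobiusE /=; congr (1 + _).
set u := (X in X / mden A z); set v := (X in X / mden A w).
have [hz' hw'] : z.2 != 0 /\ w.2 != 0 by split; rewrite gt_eqF.
transitivity (((u * mden A w - v * mden A z) ^+ 2
  + (z.2 * mden A w - w.2 * mden A z) ^+ 2) / (mden A z * mden A w)
   / (2 * z.2 * w.2)).
  by field; rewrite hz' hw' !gt_eqF.
congr (_ / _); apply: (@mulIf _ (mden A z * mden A w)).
  by rewrite mulf_neq0 // gt_eqF.
rewrite divfK ?mulf_neq0 ?gt_eqF //.
suff e : u * mden A w - v * mden A z = (A 0 0 * A 1 1 - A 0 1 * A 1 0) *
    ((z.1 - w.1) * (A 1 0 ^+ 2 * (z.1 * w.1 - z.2 * w.2)
        + A 1 0 * A 1 1 * (z.1 + w.1) + A 1 1 ^+ 2)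
     + (z.2 - w.2) * (A 1 0 ^+ 2 * (z.1 * w.2 + w.1 * z.2)
        + A 1 0 * A 1 1 * (z.2 + w.2))).
  by rewrite e -det2E hA mul1r /mden; ring.
by rewrite /u /v /mden; ring.
Qed.

(* cosh (a + b) <= 2 cosh a cosh b - 1 *)
Lemma ch_triangle z w v : halfplane z -> halfplane w -> halfplane v ->
  ch z w <= 2 * ch z v * ch v w - 1.
Proof.
rewrite /halfplane /= => hz hw hv; rewrite !chE //.
move: z.1 z.2 w.1 w.2 v.1 v.2 hz hw hv => a p b q c r hp hq hr.
rewrite -subr_ge0.
have -> : 2 * (((a - c) ^+ 2 + p ^+ 2 + r ^+ 2) / (2 * p * r)) *
    (((c - b) ^+ 2 + r ^+ 2 + q ^+ 2) / (2 * r * q)) - 1 -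
     (((a - b) ^+ 2 + p ^+ 2 + q ^+ 2) / (2 * p * q)) =
   (((a - c) ^+ 2 + p ^+ 2 + r ^+ 2) * ((c - b) ^+ 2 + r ^+ 2 + q ^+ 2)
     - 2 * p * q * r ^+ 2 - ((a - b) ^+ 2 + p ^+ 2 + q ^+ 2) * r ^+ 2)
     / (2 * p * q * r ^+ 2) by field; rewrite !gt_eqF.
apply: divr_ge0; last by rewrite !mulr_ge0 // ?sqr_ge0 ?ltW.
have -> : ((a - c) ^+ 2 + p ^+ 2 + r ^+ 2) * ((c - b) ^+ 2 + r ^+ 2 + q ^+ 2)
     - 2 * p * q * r ^+ 2 - ((a - b) ^+ 2 + p ^+ 2 + q ^+ 2) * r ^+ 2 =
  (((a - c) * (c - b) - r ^+ 2 + p * q) ^+ 2 + ((a - c) * q - (c - b) * p) ^+ 2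
   ) + 0 * a by ring.
by rewrite mul0r addr0 addr_ge0 ?sqr_ge0.
Qed.
End Mobius.

(** * Hyperbolic cosine, and [hdist] in terms of [ch] *)

Section Cosh.
Variable R : realType.
Implicit Types (x y : R) (z w : R * R).

Definition cosh x := (expR x + expR (- x)) / 2.

Lemma coshN x : cosh (- x) = cosh x.
Proof. by rewrite /cosh opprK addrC. Qed.

Lemma cosh_abs x : cosh `|x| = cosh x.
Proof. by have [h|h] := ger0P x; rewrite ?coshN. Qed.

Lemma cosh_ge1 x : 1 <= cosh x.
Proof.
rewrite /cosh expRN; have := expR_gt0 x; move: (expR x) => X X0.
rewrite -subr_ge0; have -> : (X + X^-1) / 2 - 1 = (X - 1) ^+ 2 / (2 * X) by field; lra.
by rewrite divr_ge0 ?sqr_ge0 // mulr_ge0 // ltW.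
Qed.

Lemma cosh_lt x y : 0 <= x -> x < y -> cosh x < cosh y.
Proof.
move=> x0 xy; rewrite /cosh !expRN.
have := expR_ge1Dx x; have : expR x < expR y by rewrite ltr_expR.
move: (expR x) (expR y) => X Y XY hX.
have X1 : 1 <= X by lra.
have hXY : 0 < 2 * X * Y by rewrite !mulr_gt0 //; lra.
rewrite -subr_gt0; have -> : (Y + Y^-1) / 2 - (X + X^-1) / 2 = (Y - X) * (X * Y - 1) / (2 * X * Y).
  by field; rewrite !gt_eqF //; lra.
rewrite divr_gt0 // mulr_gt0 ?subr_gt0 //; nra.
Qed.

Lemma cosh_le x y : 0 <= x -> x <= y -> cosh x <= cosh y.
Proof.
move=> x0; rewrite le_eqVlt => /predU1P[->//|xy]; exact/ltW/cosh_lt.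
Qed.

Lemma cosh_ltE x y : 0 <= x -> 0 <= y -> (cosh x < cosh y) = (x < y).
Proof.
move=> x0 y0; apply/idP/idP => h; last exact: cosh_lt.
by rewrite ltNge; apply/negP => /(cosh_le y0); rewrite leNgt h.
Qed.

Lemma cosh_leE x y : 0 <= x -> 0 <= y -> (cosh x <= cosh y) = (x <= y).
Proof. by move=> x0 y0; rewrite !leNgt cosh_ltE. Qed.

Lemma cosh_inj x y : 0 <= x -> 0 <= y -> cosh x = cosh y -> x = y.
Proof.
by move=> x0 y0 e; apply/eqP; rewrite eq_le -(cosh_leE x0 y0) -(cosh_leE y0 x0) e lexx.
Qed.

Lemma cosh_surj y : 1 <= y -> exists2 x, 0 <= x & cosh x = y.
Proof.
move=> y1; pose s := Num.sqrt (y ^+ 2 - 1).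
have s0 : 0 <= s by exact: sqrtr_ge0.
have s2 : s ^+ 2 = y ^+ 2 - 1 by rewrite sqr_sqrtr //; nra.
have h : 0 < y + s by lra.
exists (ln (y + s)); first by apply: ln_ge0; lra.
rewrite /cosh expRN lnK ?posrE //.
have -> : (y + s)^-1 = y - s; last by lra.
apply: (@mulfI _ (y + s)); first by rewrite gt_eqF.
rewrite mulfV ?gt_eqF //; lra.
Qed.

Lemma hdist_ge0 z w : halfplane z -> halfplane w -> 0 <= hdist z w.
Proof.
move=> hz hw; have := ch_ge1 hz hw; rewrite /ch /hdist.
set u := 1 + _ => u1; apply: ln_ge0.
by have := sqrtr_ge0 (u ^+ 2 - 1); lra.
Qed.

Lemma cosh_hdist z w : halfplane z -> halfplane w -> cosh (hdist z w) = ch z w.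
Proof.
move=> hz hw; have := ch_ge1 hz hw; rewrite /hdist -/(ch z w) => u1.
move: (ch z w) u1 => y y1; set s := Num.sqrt _.
have s0 : 0 <= s by exact: sqrtr_ge0.
have s2 : s ^+ 2 = y ^+ 2 - 1 by rewrite sqr_sqrtr //; nra.
have h : 0 < y + s by lra.
rewrite /cosh expRN lnK ?posrE //.
have -> : (y + s)^-1 = y - s; last by lra.
apply: (@mulfI _ (y + s)); first by rewrite gt_eqF.
rewrite mulfV ?gt_eqF //; lra.
Qed.

Lemma hdist_cosh z w x : halfplane z -> halfplane w -> 0 <= x ->
  ch z w = cosh x -> hdist z w = x.
Proof.
move=> hz hw x0 e; apply: cosh_inj => //; first exact: hdist_ge0.
by rewrite cosh_hdist.
Qed.

Lemma ch_axis (s t : R) : ch (0, expR s) (0, expR t) = cosh (s - t).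
Proof.
rewrite /ch /= subrr expr0n /= add0r /cosh opprB !expRD !expRN.
have := expR_gt0 s; have := expR_gt0 t; move: (expR s) (expR t) => X Y Y0 X0.
by field; rewrite !gt_eqF.
Qed.
End Cosh.

(** * Discreteness and closed geodesics *)

Section Discrete.
Variables (R : realType) (g : nat) (Gamma : set 'M[R]_2).
Hypothesis hG : hyperbolic_surface g Gamma.
Implicit Types (A B : 'M[R]_2) (z w p : R * R).

Lemma near_ch z (e : R) : halfplane z -> 0 < e ->
  \forall z' \near z, halfplane z' /\ ch z z' < 1 + e.
Proof.
move=> hz e0; pose d := z.2 * Num.min (1 / 2) (e / 4).
have m0 : 0 < Num.min (1 / 2) (e / 4 : R) by rewrite lt_min; lra.
have m1 : Num.min (1 / 2) (e / 4 : R) <= 1 / 2 by rewrite ge_min lexx.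
have m2 : Num.min (1 / 2) (e / 4 : R) <= e / 4 by rewrite ge_min lexx orbT.
have d0 : 0 < d by rewrite mulr_gt0.
near=> z'.
have [h1 h2] : `|z.1 - z'.1| < d /\ `|z.2 - z'.2| < d.
  have : ball z d z' by near: z'; exact: nbhsx_ballx.
  by move=> [].
move: h1 h2; rewrite /d; move: (Num.min _ _) m0 m1 m2 => m m0 m1 m2.
rewrite !ltr_norml => /andP[a1 a2] /andP[b1 b2].
move: hz; rewrite /halfplane /ch /=.
move: z.1 z.2 z'.1 z'.2 a1 a2 b1 b2 => x y x' y' a1 a2 b1 b2 y0.
have y'0 : y / 2 <= y' by nra.
split; first by lra.
have y2 : 0 < y * y' by rewrite mulr_gt0 //; lra.
rewrite ltrD2l ltr_pdivrMr; last by rewrite -mulrA mulr_gt0.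
have : (x - x') ^+ 2 <= (y * m) ^+ 2 by nra.
have : (y - y') ^+ 2 <= (y * m) ^+ 2 by nra.
have : (y * m) ^+ 2 * 2 < e * (2 * y * y').
  have : (y * m) ^+ 2 * 2 <= (y * y) * e / 4.
    have : m ^+ 2 * 2 <= e / 4 by nra.
    rewrite exprMn; nra.
  have : y * y <= 2 * (y * y') by nra.
  nra.
lra.
Unshelve. all: by end_near. Qed.

Lemma discG z : halfplane z -> exists2 e : R, 0 < e &
  forall A, Gamma A -> ch z (mobius A z) < 1 + e -> eq_pm A 1%:M.
Proof.
move=> hz; have [r r0 hr] := hs_free_discontinuous hG hz.
exists (cosh r - 1).
  have := @cosh_lt R 0 r (lexx _) r0; rewrite {1}/cosh oppr0 expR0; lra.
move=> A GA hA; apply: hr => //.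
have hAz : halfplane (mobius A z) by apply: mobius_half => //; exact: hs_det hG _ GA.
rewrite -cosh_ltE ?hdist_ge0 ?ltW // cosh_hdist //; lra.
Qed.

(** Two triangle inequalities: the excess over 1 grows to 6 e, then to at most 26 e since e is
    small. *)
Lemma ch_disp_near A z z' e : \det A = 1 -> halfplane z -> halfplane z' ->
  0 <= e -> e <= 1 / 30 -> ch z z' <= 1 + e -> ch z' (mobius A z') <= 1 + e ->
  ch z (mobius A z) <= 1 + 26 * e.
Proof.
move=> dA hz hz' e0 e1 h1 h2.
have hAz' := mobius_half dA hz'; have hAz := mobius_half dA hz.
have t1 := ch_triangle hz hAz hz'.
have t2 := ch_triangle hz' hAz hAz'.
have t3 := ch_mobius dA hz' hz; rewrite [in RHS]chC in t3; rewrite t3 in t2.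
have g1 := ch_ge1 hz hz'; have g2 := ch_ge1 hz' hAz'; have g3 := ch_ge1 hz' hAz.
move: (ch z z') (ch z' (mobius A z')) (ch z' (mobius A z)) (ch z (mobius A z)) h1 h2 t1 t2 g1 g2 g3 {t3}.
move=> p q r s h1 h2 t1 t2 g1 g2 g3.
have : q * p <= (1 + e) * (1 + e) by apply: ler_pM1 => //; apply: ltW.
have u1 : r <= 1 + 6 * e by nra.
have : p * r <= (1 + e) * (1 + 6 * e) by apply: ler_pM; lra.
nra.
Qed.

(** Compactness of K makes the radius of [discG] uniform on K, and conjugation by an element
    carrying z into K extends it to the half-plane. *)
Lemma unif_discG : exists2 e : R, 0 < e &
  forall z A, halfplane z -> Gamma A -> ch z (mobius A z) < 1 + e ->
    eq_pm A 1%:M.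
Proof.
have [K [cK KH Kc]] := hs_cocompact hG.
have /compact_near_coveringP ncK := cK.
pose P (e : R) z := forall A, Gamma A -> ch z (mobius A z) < 1 + e -> eq_pm A 1%:M.
have : \forall e \near 0^'+, K `<=` P e.
  apply: ncK => z Kz; have hz := KH _ Kz.
  have [e e0 he] := discG hz.
  pose e' := Num.min 1 e / 30.
  have m0 : 0 < Num.min 1 e by rewrite lt_min; lra.
  have m1 : Num.min 1 e <= 1 by rewrite ge_min lexx.
  have m2 : Num.min 1 e <= e by rewrite ge_min lexx orbT.
  have e'0 : 0 < e' by rewrite divr_gt0.
  near=> z' x => A GA hA; apply: he => //.
  have [hz' hzz] : halfplane z' /\ ch z z' < 1 + e'.
    by near: z'; exact: near_ch.
  have dA := hs_det hG GA.
  have hx : x < e' by near: x; exact: nbhs_right_lt.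
  have hAz' := mobius_half dA hz'; have hAz := mobius_half dA hz.
  have m1' : e' <= 1 / 30 by rewrite /e'; lra.
  have m2' : 26 * e' < e by rewrite /e'; lra.
  have := @ch_disp_near A z z' e' dA hz hz' (ltW e'0) m1' (ltW hzz).
  by move: hA => /= hA /(_ (ltW (lt_trans hA _))) h; lra.
move=> h; have [e [e0 he]] : exists e : R, 0 < e /\ K `<=` P e.
  have [e [? ?]] := @filter_ex _ _ (at_right_proper_filter (0 : R)) _
    (filterI h (@nbhs_right_gt R 0)).
  by exists e.
exists e => // z A hz GA hA.
have [B GB KB] := Kc _ hz.
have dB := hs_det hG GB; have dA := hs_det hG GA.
have dBi := det_invmx2 dB.
have hBz := mobius_half dB hz.
have hAz := mobius_half dA hz.
have : eq_pm (B *m A *m invmx B) 1%:M.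
  apply: (he _ KB); first exact/(hs_mul hG)/(hs_inv hG)/GB/(hs_mul hG).
  rewrite mobius_mul ?det_mul1 // -(mobius_mul dBi dB) // mulVmx ?unit2 // mobius1.
  by rewrite mobius_mul // ch_mobius.
move=> /(eq_pm_mulr B); rewrite -mulmxA mulVmx ?unit2 // mulmx1 mul1mx.
move=> /(eq_pm_mull (invmx B)); rewrite mulmxA mulVmx ?unit2 // mul1mx.
by [].
Unshelve. all: by end_near. Qed.

(** The numerator is |c z^2 + (d - a) z - b|^2, the polynomial whose roots are the fixed points of
    A. *)
Lemma ch_disp A z : \det A = 1 -> halfplane z -> ch z (mobius A z) = 1 +
  ((A 1 0 * (z.1 ^+ 2 - z.2 ^+ 2) + (A 1 1 - A 0 0) * z.1 - A 0 1) ^+ 2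
   + (2 * A 1 0 * z.1 * z.2 + (A 1 1 - A 0 0) * z.2) ^+ 2) / (2 * z.2 ^+ 2).
Proof.
move=> dA hz; have h := mden_gt0 dA hz; rewrite /ch mobiusE /=.
move: hz; rewrite /halfplane /= => hz; congr (1 + _).
have := dA; rewrite det2E => d1.
set u := (X in X / mden A z).
transitivity (((z.1 * mden A z - u) ^+ 2 + (z.2 * (mden A z - (A 0 0 * A 1 1 - A 0 1 * A 1 0))) ^+ 2) / mden A z
   / (2 * z.2 ^+ 2)).
  by rewrite d1; field; rewrite !gt_eqF.
congr (_ / _); apply: (@mulIf _ (mden A z)); first by rewrite gt_eqF.
rewrite divfK ?gt_eqF //.
by rewrite /u /mden; ring.
Qed.

(* Take the fixed point, or points near the ideal fixed point. *)
Lemma small_disp A (e : R) : \det A = 1 -> `|A 0 0 + A 1 1| <= 2 -> 0 < e ->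
  exists2 z, halfplane z & ch z (mobius A z) < 1 + e.
Proof.
move=> dA tA e0; have := dA; rewrite det2E => d1.
move: tA; rewrite ler_norml => /andP[t1 t2].
have [c0|c0] := eqVneq (A 1 0) 0.
  rewrite c0 mulr0 subr0 in d1.
  have ad : A 1 1 = A 0 0.
    apply/eqP; rewrite -subr_eq0 -sqrf_eq0 eq_le sqr_ge0 andbT; nra.
  pose y : R := `|A 0 1| / e + 1 + `|A 0 1|.
  have y0 : 1 <= y by rewrite /y -addrA addrCA lerDl addr_ge0 // divr_ge0 // ltW.
  exists (0, y); first by rewrite /halfplane /=; lra.
  rewrite ch_disp // /=; last by rewrite /halfplane /=; lra.
  rewrite ltrD2l c0 ad ltr_pdivrMr; last by rewrite mulr_gt0 // exprn_gt0 //; lra.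
  have -> : (0 * (0 ^+ 2 - y ^+ 2) + (A 0 0 - A 0 0) * 0 - A 0 1) ^+ 2 +
     (2 * 0 * 0 * y + (A 0 0 - A 0 0) * y) ^+ 2 = A 0 1 ^+ 2 by ring.
  rewrite -real_normK ?num_real //.
  have h0 : 0 <= `|A 0 1| by [].
  have yy : `|A 0 1| < y * e.
    rewrite /y !mulrDl divfK ?gt_eqF // mul1r; nra.
  have yy' : `|A 0 1| <= y.
    by rewrite /y -[X in X <= _]add0r lerD2r addr_ge0 // divr_ge0 // ltW.
  nra.
(* At x = (a - d) / 2c the displacement numerator is c y^2 + (tr^2 - 4) / 4c. *)
set q := 4 - (A 0 0 + A 1 1) ^+ 2.
have q0 : 0 <= q by rewrite /q; nra.
have C0 : 0 < A 1 0 ^+ 2 by rewrite exprn_even_gt0.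
pose m := Num.min 1 e.
have m0 : 0 < m by rewrite lt_min; lra.
have m1 : m <= 1 by rewrite ge_min lexx.
have m2 : m <= e by rewrite ge_min lexx orbT.
pose Y : R := q / (4 * A 1 0 ^+ 2) + (if q == 0 then m / A 1 0 ^+ 2 else 0).
have Y0 : 0 < Y.
  rewrite /Y; case: eqP => [->|/eqP qn]; first by rewrite mul0r add0r divr_gt0.
  have qp : 0 < q by rewrite lt_neqAle eq_sym qn.
  by rewrite addr0 divr_gt0 // mulr_gt0.
pose y := Num.sqrt Y; have y0 : 0 < y by rewrite sqrtr_gt0.
have y2 : y ^+ 2 = Y by rewrite sqr_sqrtr // ltW.
exists ((A 0 0 - A 1 1) / (2 * A 1 0), y); first by [].
rewrite ch_disp //= ltrD2l y2 ltr_pdivrMr ?mulr_gt0 //.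
have -> : (A 1 0 * (((A 0 0 - A 1 1) / (2 * A 1 0)) ^+ 2 - Y) +
  (A 1 1 - A 0 0) * ((A 0 0 - A 1 1) / (2 * A 1 0)) - A 0 1) ^+ 2 +
  (2 * A 1 0 * ((A 0 0 - A 1 1) / (2 * A 1 0)) * y + (A 1 1 - A 0 0) * y) ^+ 2
  = (A 1 0 * Y - (4 * (A 0 0 * A 1 1 - A 0 1 * A 1 0) - (A 0 0 + A 1 1) ^+ 2) / (4 * A 1 0)) ^+ 2.
  by field.
rewrite d1 mulr1 -/q.
have -> : A 1 0 * Y - q / (4 * A 1 0) = (if q == 0 then m / A 1 0 else 0).
  by rewrite /Y; case: ifP => _; field.
case: ifP => [/eqP qe|_]; last by rewrite expr0n /= !mulr_gt0.
rewrite /Y qe mul0r add0r eqxx.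
rewrite exprMn exprVn mulrA mulrCA mulrA ltr_pM2r ?invr_gt0 //; nra.
Qed.

(** Elliptic and parabolic elements move some points arbitrarily little, which [unif_discG]
    forbids. *)
Lemma hypG A : Gamma A -> ~ eq_pm A 1%:M -> 2 < `|A 0 0 + A 1 1|.
Proof.
move=> GA nA; rewrite ltNge; apply/negP => h; apply: nA.
have [e e0 he] := unif_discG.
have [z hz hA] := small_disp (hs_det hG GA) h e0.
exact: he hA.
Qed.

(** The difference of the two sides is (c |z|^2 + (d - a) x - b)^2 / (2 y^2), which for hyperbolic A
    vanishes exactly on its axis; the left side is then the cosine of the translation length. *)
Lemma disp_trace A z : \det A = 1 -> halfplane z ->
  (A 0 0 + A 1 1) ^+ 2 / 2 - 1 <= ch z (mobius A z).
Proof.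
move=> dA hz; rewrite ch_disp //; have := dA; rewrite det2E.
move: hz; rewrite /halfplane /=; move: z.1 z.2 => x y y0.
move: (A 0 0) (A 0 1) (A 1 0) (A 1 1) => a b c d d1.
rewrite -subr_ge0.
have -> : 1 + ((c * (x ^+ 2 - y ^+ 2) + (d - a) * x - b) ^+ 2 + (2 * c * x * y + (d - a) * y) ^+ 2) / (2 * y ^+ 2) - ((a + d) ^+ 2 / 2 - 1) =
  ((c * (x ^+ 2 + y ^+ 2) + (d - a) * x - b) ^+ 2 ) / (2 * y ^+ 2)
   + 2 * (1 - (a * d - b * c)) by field; rewrite gt_eqF.
by rewrite d1 subrr mulr0 addr0 divr_ge0 ?sqr_ge0 // mulr_ge0 ?sqr_ge0.
Qed.
End Discrete.

(** * Connectedness and uncountability of the line *)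

Section RealTools.
Variable R : realType.
Implicit Types (P : R -> Prop) (A : set R).

(** Connectedness of the line: the indicator of P is locally constant, so its derivative is 0
    everywhere. *)
Lemma loc_const P a b :
  (forall t, exists2 e : R, 0 < e & forall s s', `|s - t| < e -> `|s' - t| < e ->
     P s -> P s') -> P a -> P b.
Proof.
move=> h Pa; pose f (t : R) : R := if `[< P t >] then 1 else 0.
have : f a = f b.
  apply: is_derive_0_is_cst => t.
  have [e e0 he] := h t.
  have hc : is_derive t (1 : R) (cst (f t)) (0 : R) by exact: is_derive_cst.
  apply: near_eq_is_derive hc.
  near=> s.
  have hs : `|s - t| < e.
    by rewrite distrC; near: s; exact: nbhsx_ballx.
  have ht : `|t - t| < e by rewrite subrr normr0.
  rewrite /f /=; case: asboolP => p; case: asboolP => q //.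
  - by case: q; exact: he p.
  - by case: p; exact: he q.
rewrite /f; case: asboolP => // _; case: asboolP => // _ /eqP.
by rewrite oner_eq0.
Unshelve. all: by end_near. Qed.

Lemma itv01_uncountable : ~ countable ([set` `]0, 1[%R] : set R).
Proof.
move=> /countable_lebesgue_measure0; rewrite lebesgue_measure_itv /=.
rewrite lte_fin ltr01 oppr0 adde0 => /eqP.
by rewrite eqe oner_eq0.
Qed.

Lemma notin_countable A : countable A -> exists2 x : R, 0 < x < 1 & ~ A x.
Proof.
move=> cA; apply: contrapT => h; apply: itv01_uncountable.
apply: sub_countable cA; apply: subset_card_le => x /=.
rewrite in_itv /= => hx; apply: contrapT => nA; apply: h; by exists x.
Qed.

Lemma pigeon_R (f : R -> nat) : exists s t, s != t /\ f s = f t.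
Proof.
apply: contrapT => h; apply: itv01_uncountable; apply/countable_injP.
exists f => x y _ _ e; apply/eqP; apply: contrapT => /negP n.
by apply: h; exists x, y.
Qed.
End RealTools.

(** * The imaginary axis and transitivity on pairs of points *)

Section Axis.
Variable R : realType.
Implicit Types (A B M : 'M[R]_2) (z w p : R * R) (a b s t l : R).

Lemma half_axis t : halfplane (0, expR t : R).
Proof. exact: expR_gt0. Qed.

(** Subtracting the two distance equations determines the height of z, and either of them then
    forces its real part to be 0. *)
Lemma axis_det z a b s : halfplane z -> a != b ->
  ch z (0, expR a) = cosh (s - a) -> ch z (0, expR b) = cosh (s - b) ->
  z = (0, expR s).
Proof.
case: z => x y hz ab; rewrite -!(ch_axis s); move: hz; rewrite /halfplane /= => y0.
have : expR a != expR b by rewrite (inj_eq (@expR_inj R)).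
move: (expR_gt0 s) (expR_gt0 a) (expR_gt0 b).
move: (expR s) (expR a) (expR b) => p q r p0 q0 r0 qr.
rewrite !chE //= => e1 e2.
have f1 : (x ^+ 2 + y ^+ 2 + q ^+ 2) * p = (p ^+ 2 + q ^+ 2) * y.
  have : (x ^+ 2 + y ^+ 2 + q ^+ 2) / (2 * y * q) * (2 * y * q * p) =
    (p ^+ 2 + q ^+ 2) / (2 * p * q) * (2 * y * q * p).
    by move: e1; rewrite !subr0 => ->; congr (_ / _ * _); ring.
  move=> e; apply: (@mulfI _ 1); rewrite ?oner_eq0 // !mul1r.
  have -> : (x ^+ 2 + y ^+ 2 + q ^+ 2) * p = (x ^+ 2 + y ^+ 2 + q ^+ 2) / (2 * y * q) * (2 * y * q * p).
    by field; rewrite !gt_eqF.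
  by rewrite e; field; rewrite !gt_eqF.
have f2 : (x ^+ 2 + y ^+ 2 + r ^+ 2) * p = (p ^+ 2 + r ^+ 2) * y.
  have : (x ^+ 2 + y ^+ 2 + r ^+ 2) / (2 * y * r) * (2 * y * r * p) =
    (p ^+ 2 + r ^+ 2) / (2 * p * r) * (2 * y * r * p).
    by move: e2; rewrite !subr0 => ->; congr (_ / _ * _); ring.
  move=> e; have -> : (x ^+ 2 + y ^+ 2 + r ^+ 2) * p = (x ^+ 2 + y ^+ 2 + r ^+ 2) / (2 * y * r) * (2 * y * r * p).
    by field; rewrite !gt_eqF.
  by rewrite e; field; rewrite !gt_eqF.
have /eqP : (q - r) * (q + r) * (p - y) = 0 by lra.
rewrite !mulf_eq0 subr_eq0 (negbTE qr) /= gt_eqF ?addr_gt0 //= subr_eq0.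
move=> /eqP e; rewrite -e in f1 *.
have /eqP : x ^+ 2 * p = 0 by lra.
by rewrite mulf_eq0 (gt_eqF p0) orbF sqrf_eq0 => /eqP ->.
Qed.

(** Translation by l along the imaginary axis. *)
Definition dg l : 'M[R]_2 := mx2 (expR (l / 2)) 0 0 (expR (- (l / 2))).

Lemma det_dg l : \det (dg l) = 1.
Proof. by rewrite det2E /dg !mx2V mulr0 subr0 -expRD addrN expR0. Qed.

Lemma expR_half l : expR (l / 2) ^+ 2 = expR l.
Proof. by rewrite expr2 -expRD; congr expR; field. Qed.

Lemma dg_mob l z : mobius (dg l) z = (expR l * z.1, expR l * z.2).
Proof.
rewrite mobiusE /mden /dg !mx2V expRN -(expR_half l).
have := expR_gt0 (l / 2); move: (expR _) => e e0.
by congr pair; field; rewrite gt_eqF.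
Qed.

Lemma dg_axis l t : mobius (dg l) (0, expR t) = (0, expR (l + t)).
Proof. by rewrite dg_mob /= mulr0 expRD. Qed.

Lemma dg_add l l' : dg l *m dg l' = dg (l + l').
Proof.
apply: mx2P; rewrite mul2E /dg !mx2V ?mulr0 ?mul0r ?addr0 ?add0r // -expRD;
  by congr expR; field.
Qed.

Lemma dg0 : dg 0 = 1%:M.
Proof. by apply: mx2P; rewrite /dg !mx2V id2V // ?mul0r ?oppr0 ?expR0. Qed.

Lemma axis_fix B (k p q : R) : \det B = 1 -> 0 < p -> 0 < q -> p != q ->
  mobius B (0, p) = (0, expR k * p) -> mobius B (0, q) = (0, expR k * q) ->
  eq_pm B (dg k).
Proof.
move=> dB p0 q0 pq; have := dB; rewrite det2E => d1.
have hp : halfplane (0, p) by []. have hq : halfplane (0, q) by [].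
move: (mden_gt0 dB hp) (mden_gt0 dB hq); rewrite !mobiusE /mden /=.
have k0 := expR_gt0 (k / 2); rewrite -(expR_half k).
set e := expR (k / 2) in k0 *.
rewrite !mulr0 !add0r !addr0 !expr0n /= !add0r => n1 n2 [e1 e2] [e3 e4].
have {}e2 : (B 1 1 ^+ 2 + (B 1 0 * p) ^+ 2) * e ^+ 2 = 1.
  apply: (@mulfI _ p); rewrite ?gt_eqF // mulr1 -[RHS](divfK (lt0r_neq0 n1)) e2; ring.
have {}e4 : (B 1 1 ^+ 2 + (B 1 0 * q) ^+ 2) * e ^+ 2 = 1.
  apply: (@mulfI _ q); rewrite ?gt_eqF // mulr1 -[RHS](divfK (lt0r_neq0 n2)) e4; ring.
have c0 : B 1 0 = 0.
  have : B 1 0 ^+ 2 * ((p - q) * (p + q)) * e ^+ 2 = 0 by lra.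
  move/eqP; rewrite !mulf_eq0 subr_eq0 (negbTE pq) (gt_eqF k0) (gt_eqF (addr_gt0 p0 q0)) /=.
  by rewrite !orbF orbb => /eqP.
rewrite c0 mul0r expr0n addr0 /= -exprMn in e2.
have d0 : B 1 1 != 0.
  by apply/eqP => d0; move: e2; rewrite d0 mul0r expr0n /= => /eqP; rewrite eq_sym oner_eq0.
have b0 : B 0 1 = 0.
  have : B 0 0 * B 1 0 * p ^+ 2 + B 0 1 * B 1 1 = 0.
    by apply: (mulIf (invr_neq0 (lt0r_neq0 n1))); rewrite mul0r.
  rewrite c0 mulr0 mul0r add0r => /eqP; rewrite mulf_eq0 (negbTE d0) orbF.
  by move=> /eqP.
rewrite b0 mul0r subr0 in d1.
have ne : e != 0 by rewrite gt_eqF.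
have ee : expR (- (k / 2)) = e^-1 by rewrite expRN.
move: e2 => /eqP; rewrite sqrf_eq1 => /orP[] /eqP h.
  have dE : B 1 1 = e^-1 by apply: (mulIf ne); rewrite h mulVf.
  have aE : B 0 0 = e by apply: (mulIf d0); rewrite d1 dE mulfV.
  by left; apply: mx2P; rewrite /dg !mx2V // ee.
have dE : B 1 1 = - e^-1 by apply: (mulIf ne); rewrite h mulNr mulVf.
have aE : B 0 0 = - e by apply: (mulIf d0); rewrite d1 dE mulrNN mulfV.
by right; apply: mx2P; rewrite opp2E /dg !mx2V ?oppr0 // ee.
Qed.

Lemma sqrt_pair (al be ga : R) : 0 <= al -> 0 <= be -> al * be = ga ^+ 2 ->
  exists c s : R, [/\ c ^+ 2 = al, s ^+ 2 = be & c * s = ga].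
Proof.
move=> a0 b0 h; exists (Num.sqrt al).
have e : Num.sqrt al * Num.sqrt be = `|ga| by rewrite -sqrtrM // h sqrtr_sqr.
have [g0|g0] := ger0P ga.
  by exists (Num.sqrt be); rewrite !sqr_sqrtr // e ger0_norm.
exists (- Num.sqrt be); rewrite sqrrN !sqr_sqrtr // mulrN e ltr0_norm //.
by rewrite opprK.
Qed.

(** K is a rotation about i with rows (c, -s) and (s, c). The values al, be, ga of c^2, s^2, cs are
    read off from the target z, and the distance hypothesis is what makes al * be = ga^2. *)
Lemma rot_to z (t : R) : halfplane z -> 0 < t -> t != 1 ->
  ch (0, 1) z = (t ^+ 2 + 1) / (2 * t) ->
  exists K, [/\ \det K = 1, mobius K (0, 1) = (0, 1) & mobius K (0, t) = z].
Proof.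
case: z => u v; rewrite /halfplane /= => v0 t0 t1.
have h1 : halfplane ((0, 1) : R * R) by rewrite /halfplane /=.
rewrite chE //= sub0r sqrrN expr1n => h.
have {}h : (u ^+ 2 + 1 + v ^+ 2) * t = (t ^+ 2 + 1) * v.
  have -> : (u ^+ 2 + 1 + v ^+ 2) * t = (u ^+ 2 + 1 + v ^+ 2) / (2 * 1 * v) * (2 * v * t).
    by field; rewrite gt_eqF.
  by rewrite h; field; rewrite gt_eqF.
pose k := t - t^-1.
have tt : t * t - 1 != 0.
  rewrite -[t * t]expr2 subr_eq0 sqrf_eq1 negb_or t1 /=.
  by rewrite gt_eqF // (lt_trans _ t0) // oppr_lt0.
have ek : k = (t * t - 1) / t by rewrite /k; field; rewrite gt_eqF.
have k0 : k != 0 by rewrite ek mulf_neq0 // invr_neq0 // gt_eqF.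
have [tn vn] : t != 0 /\ v != 0 by rewrite !gt_eqF.
pose al := ((u ^+ 2 + v ^+ 2) / v - t^-1) / k.
pose be := (t - (u ^+ 2 + v ^+ 2) / v) / k.
pose ga := (u / v) / k.
have hu : u ^+ 2 = (t + t^-1) * v - 1 - v ^+ 2.
  apply: (mulIf tn); transitivity ((t ^+ 2 + 1) * v - t - v ^+ 2 * t); last by field.
  by rewrite -h; ring.
have ab : al + be = 1 by rewrite /al /be -mulrDl addrC addrA subrK divff.
have abg : al * be = ga ^+ 2.
  by rewrite /al /be /ga ek !expr_div_n hu; field; rewrite tn vn tt.
have [a0 b0] : 0 <= al /\ 0 <= be.
  have : 0 <= al * be by rewrite abg sqr_ge0.
  by split; nra.
have [c [s [hc hs hcs]]] := sqrt_pair a0 b0 abg.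
have cs1 : c ^+ 2 + s ^+ 2 = 1 by rewrite hc hs.
exists (mx2 c (- s) s c); split.
- by rewrite det2E !mx2V mulNr opprK -!expr2.
- rewrite mobiusE /mden !mx2V /= !mulr0 !mulr1 add0r expr0n /= add0r expr1n mulr1 cs1.
  by rewrite addr0 !divr1 mulNr (mulrC s c) subrr.
rewrite mobiusE /mden !mx2V /= !mulr0 !add0r addr0 expr0n /= add0r mulNr (mulrC s c) hcs.
have eD : c ^+ 2 + (s * t) ^+ 2 = t / v.
  by rewrite exprMn hc hs /al /be ek hu; field; rewrite tn vn tt.
rewrite eD; congr pair; last by field; rewrite tn vn.
rewrite -{2}[ga]mulr1 -mulrBr /ga ek; field.
by rewrite tn vn tt.
Qed.

(** The triangular matrix N takes i to z; a rotation about i then places the second point, and [dg]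
    adjusts the starting parameter. *)
Lemma two_trans z w a b : halfplane z -> halfplane w -> a != b ->
  ch z w = cosh (b - a) -> exists M, [/\ \det M = 1,
    mobius M (0, expR a) = z & mobius M (0, expR b) = w].
Proof.
move=> hz hw ab h; pose r := Num.sqrt z.2.
have r0 : 0 < r by rewrite sqrtr_gt0.
have r2 : r ^+ 2 = z.2 by rewrite sqr_sqrtr // ltW.
pose N := mx2 r (z.1 / r) 0 r^-1.
have dN : \det N = 1 by rewrite det2E !mx2V mulr0 subr0 mulfV // gt_eqF.
have Ni : mobius N (0, 1) = z.
  rewrite mobiusE /mden !mx2V /= [RHS]surjective_pairing -r2.
  by congr pair; field; rewrite gt_eqF.
have dNi := det_invmx2 dN.
have hi : halfplane ((0, 1) : R * R) by rewrite /halfplane /=.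
have hw' := mobius_half dNi hw.
have Nw : mobius N (mobius (invmx N) w) = w.
  by rewrite -mobius_mul // mulmxV ?unit2 // mobius1.
have hd : ch (0, 1) (mobius (invmx N) w) = (expR (b - a) ^+ 2 + 1) / (2 * expR (b - a)).
  rewrite -(ch_mobius dN) // Ni Nw h /cosh expRN.
  by field; rewrite gt_eqF ?expR_gt0.
have [|K [dK K1 K2]] := rot_to hw' (expR_gt0 _) _ hd.
  by rewrite -expR0 (inj_eq (@expR_inj R)) subr_eq0 eq_sym.
exists (N *m K *m dg (- a)).
have d2 := det_mul1 dN dK.
split; first by rewrite det_mul1 // det_dg.
- by rewrite mobius_mul ?det_dg // ?dg_axis ?addNr ?expR0 ?mobius_mul ?K1 //; exact: half_axis.
- rewrite mobius_mul ?det_dg // ?dg_axis ?mobius_mul //; try exact: half_axis.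
  by rewrite addrC K2.
Qed.
End Axis.

(** * Closed geodesics as axes of group elements *)

Section Geodesics.
Variables (R : realType) (g : nat) (Gamma : set 'M[R]_2).
Hypothesis hG : hyperbolic_surface g Gamma.
Implicit Types (A B M T : 'M[R]_2) (z w p : R * R) (c : R -> R * R) (l t : R).

Definition std M l t := mobius M (0, expR (l * t)).

Lemma std_half M l t : \det M = 1 -> halfplane (std M l t).
Proof. by move=> dM; apply: mobius_half => //; exact: half_axis. Qed.

Lemma ch_std M l s t : \det M = 1 -> ch (std M l s) (std M l t) = cosh (l * (s - t)).
Proof.
by move=> dM; rewrite ch_mobius ?ch_axis ?mulrBr //; exact: half_axis.
Qed.

Lemma std_det M l a b t z : \det M = 1 -> l != 0 -> a != b -> halfplane z ->
  ch z (std M l a) = cosh (l * (t - a)) ->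
  ch z (std M l b) = cosh (l * (t - b)) -> z = std M l t.
Proof.
move=> dM l0 ab hz; have dMi := det_invmx2 dM.
have hz' := mobius_half dMi hz.
have e x : ch z (std M l x) = ch (mobius (invmx M) z) (0, expR (l * x)).
  rewrite -(ch_mobius dM hz' (half_axis _)) -mobius_mul //.
  by rewrite mulmxV ?unit2 // mobius1.
rewrite !e !mulrBr => h1 h2.
have := axis_det hz' _ h1 h2; rewrite /std (inj_eq (mulfI l0)) => /(_ ab) <-.
by rewrite -mobius_mul // mulmxV ?unit2 // mobius1.
Qed.

Lemma enumG : exists e : nat -> 'M[R]_2, forall A, Gamma A -> exists n, eq_pm A (e n).
Proof.
have [gen [_ hw _]] := hs_genus hG.
exists (fun n => if @unpickle (seq (('I_g * bool) * bool)) n is Some w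
                 then word_eval gen w else 0).
by move=> A /hw[w hA]; exists (pickle w); rewrite pickleK.
Qed.

(** By [axis_det] the curve is standard near 0, and [loc_const] propagates this along the line.
    [closed_in] gives one group element for each t, a priori depending on t; the group being
    countable, one element serves for two parameters, and two points determine its action on the
    axis. *)
Lemma closed_geodesic_std c l : closed_geodesic Gamma c l ->
  exists M, [/\ \det M = 1, forall t, c t = std M l t &
    exists2 T, Gamma T & eq_pm T (M *m dg l *m invmx M)].
Proof.
move=> [l0 [hc sc] loc].
have ln0 : l != 0 by rewrite gt_eqF.
have chc t : exists2 e : R, 0 < e & forall s s', `|s - t| < e -> `|s' - t| < e ->
    ch (c s) (c s') = cosh (l * (s - s')).
  have [e e0 he] := loc t; exists e => // s s' hs hs'.
  by rewrite -cosh_hdist // he // -[RHS]cosh_abs normrM (gtr0_norm l0).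
have [e e0 he] := chc 0.
have e2 : `|e / 2 - 0| < e by rewrite subr0 gtr0_norm; lra.
have e1 : `|(0 : R) - 0| < e by rewrite subr0 normr0.
have [||M [dM M0 M1]] := @two_trans _ (c 0) (c (e / 2)) (l * 0) (l * (e / 2)) (hc _) (hc _).
- by rewrite (inj_eq (mulfI ln0)) eq_sym gt_eqF; lra.
- by rewrite he // -[LHS]coshN; congr cosh; ring.
pose P t := exists2 n : R, 0 < n & forall s, `|s - t| < n -> c s = std M l s.
have P0 : P 0.
  exists e => // s hs; apply: (@std_det _ _ 0 (e / 2)) => //.
  - by rewrite eq_sym gt_eqF; lra.
  - by rewrite /std M0 he.
  - by rewrite /std M1 he.
have Pt t : P t.
  apply: loc_const P0 => {}t.
  have [n n0 hn] := chc t; exists n => // s s' hs hs' [m m0 hm].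
  (* s + k is a second reference point, both in the neighbourhood of s where c is known to be
     standard and in the one of t where distances are known. *)
  pose k := Num.min m (n - `|s - t|) / 2.
  have k0 : 0 < k by rewrite divr_gt0 // lt_min m0 subr_gt0.
  have km : k < m /\ k < n - `|s - t|.
    have : k < Num.min m (n - `|s - t|).
      by move: k0; rewrite /k; move: (Num.min _ _) => x; lra.
    by rewrite lt_min => /andP.
  have hsk : `|s + k - t| < n.
    apply: le_lt_trans (_ : `|s - t| + k < n); last by lra.
    have -> : s + k - t = (s - t) + k by ring.
    by apply: le_trans (ler_normD _ _) _; rewrite (gtr0_norm k0).
  have all x : `|x - t| < n -> c x = std M l x.
    move=> hx; apply: (@std_det _ _ s (s + k)) => //.
    - by rewrite lt_eqF // ltrDl.
    - by rewrite -hm ?hn // subrr normr0.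
    - rewrite -hm ?hn // (_ : s + k - s = k); last by ring.
      by rewrite gtr0_norm //; lra.
  exists (n - `|s' - t|); first by rewrite subr_gt0.
  move=> x hx; apply: all.
  have -> : x - t = (x - s') + (s' - t) by ring.
  by apply: le_lt_trans (ler_normD _ _) _; lra.
have cE t : c t = std M l t.
  by have [n n0 hn] := Pt t; apply: hn; rewrite subrr normr0.
exists M; split => //.
have [en hen] := enumG.
have /choice[f hf] : forall t, exists n, exists2 A, Gamma A & c (t + 1) = mobius A (c t) /\ eq_pm A (en n).
  move=> t; have [A GA cA] := sc t; have [n hn] := hen A GA.
  by exists n, A.
have [a [b [ab fab]]] := pigeon_R f.
have [A GA [cA An]] := hf a; have [B GB [cB Bn]] := hf b.
have AB : eq_pm B A by rewrite fab in An; exact: eq_pm_trans Bn (eq_pm_sym An).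
rewrite (mobius_pm _ AB) in cB.
exists A => //.
have dA := hs_det hG GA; have dMi := det_invmx2 dM.
have cA' t : c (t + 1) = mobius A (c t).
  rewrite cE; apply/esym; apply: (@std_det _ _ (a + 1) (b + 1)) => //.
  - by rewrite (inj_eq (@addIr _ 1)).
  - exact: mobius_half.
  - rewrite -cE cA ch_mobius // !cE ch_std //; congr cosh; ring.
  - rewrite -cE cB ch_mobius // !cE ch_std //; congr cosh; ring.
have hB x : mobius (invmx M *m A *m M) (0, expR (l * x)) = (0, expR l * expR (l * x)).
  rewrite !mobius_mul ?det_mul1 // -/(std M l x) -?cE -?cA'; try exact: half_axis; last exact: hc.
  rewrite cE /std -mobius_mul //; last exact: half_axis.
  by rewrite mulVmx ?unit2 // mobius1 mulrDr mulr1 addrC expRD.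
have := axis_fix (det_mul1 (det_mul1 dMi dA) dM) (expR_gt0 _) (expR_gt0 _) _ (hB 0) (hB 1).
rewrite (inj_eq (@expR_inj R)) (inj_eq (mulfI ln0)) eq_sym oner_eq0 => /(_ isT).
move/(eq_pm_mull M)/(eq_pm_mulr (invmx M)).
by rewrite !mulmxA mulmxV ?unit2 // mul1mx -mulmxA mulmxV ?unit2 // mulmx1.
Qed.

Lemma std_closed_geodesic M l : \det M = 1 -> 0 < l ->
  Gamma (M *m dg l *m invmx M) -> closed_geodesic Gamma (std M l) l.
Proof.
move=> dM l0 GT; split => //.
  split=> t; first exact: std_half.
  exists (M *m dg l *m invmx M) => //.
  have hx := @half_axis R (l * t).
  have hs := std_half l t dM.
  rewrite mobius_mul ?det_mul1 ?det_dg ?det_invmx2 //.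
  rewrite /std -[mobius (invmx M) _]mobius_mul ?det_invmx2 // mulVmx ?unit2 // mobius1.
  rewrite mobius_mul ?det_dg // dg_axis; congr (mobius M (0, expR _)); ring.
move=> t; exists 1 => // s s' _ _; apply: hdist_cosh; rewrite ?mulr_ge0 ?(ltW l0) //; try exact: std_half.
by rewrite ch_std // -cosh_abs normrM (gtr0_norm l0).
Qed.

Lemma hyp_diag A : \det A = 1 -> 2 < A 0 0 + A 1 1 -> exists M l,
  [/\ 0 < l, \det M = 1, A = M *m dg l *m invmx M & A 0 0 + A 1 1 = 2 * cosh (l / 2)].
Proof.
move=> dA tA; have := dA; rewrite det2E => d1.
have [x x0 hx] : exists2 x : R, 0 <= x & cosh x = (A 0 0 + A 1 1) / 2.
  by apply: cosh_surj; lra.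
have x1 : 0 < x.
  rewrite lt_neqAle x0 andbT; apply/negP => /eqP xe.
  by move: hx; rewrite -xe /cosh oppr0 expR0; lra.
suff [M dM AM] : exists2 M, \det M = 1 & A *m M = M *m dg (2 * x).
  exists M, (2 * x); split => //; first by rewrite mulr_gt0.
    by rewrite -AM -mulmxA mulmxV ?unit2 // mulmx1.
  by rewrite (_ : 2 * x / 2 = x) ?hx; field.
rewrite /dg (_ : 2 * x / 2 = x); last by field.
rewrite expRN; move: hx; rewrite /cosh expRN.
have L1 : 1 < expR x by rewrite -expR0 ltr_expR.
move: (expR x) L1 => L L1 hL; have L0 : L != 0 by rewrite gt_eqF //; lra.
have LL : L * L - 1 != 0 by rewrite gt_eqF //; nra.
have hd : A 1 1 = L + L^-1 - A 0 0 by lra.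
have k0 : L - L^-1 != 0.
  have -> : L - L^-1 = (L * L - 1) / L by field.
  by rewrite mulf_neq0 // invr_neq0.
have [c0|c0] := eqVneq (A 1 0) 0.
  rewrite c0 mulr0 subr0 hd in d1.
  have /eqP : (A 0 0 - L) * (A 0 0 - L^-1) = 0.
    by rewrite mulrBl !mulrBr mulfV // -{}d1; ring.
  rewrite mulf_eq0 !subr_eq0 => /orP[] /eqP aE; rewrite aE in hd.
  - exists (mx2 1 (- A 0 1 / (L - L^-1)) 0 1).
      by rewrite det2E !mx2V; ring.
    apply: mx2P; rewrite !mul2E !mx2V ?aE ?hd ?c0; field; by rewrite ?k0 ?L0 ?LL.
  - exists (mx2 (A 0 1 / (L - L^-1)) (-1) 1 0).
      by rewrite det2E !mx2V; ring.
    apply: mx2P; rewrite !mul2E !mx2V ?aE ?hd ?c0; field; by rewrite ?k0 ?L0 ?LL.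
(* The columns are eigenvectors for L and L^-1, scaled to determinant 1. *)
exists (mx2 (L - A 1 1) ((L^-1 - A 1 1) / (A 1 0 * (L - L^-1))) (A 1 0) (L - L^-1)^-1).
  by rewrite det2E !mx2V; field; rewrite c0 L0 LL.
have hb : A 0 1 = (A 0 0 * A 1 1 - 1) / A 1 0.
  by apply: (mulIf c0); rewrite divfK // -d1; ring.
by apply: mx2P; rewrite !mul2E !mx2V ?hb ?hd; field; rewrite ?c0 ?L0 ?LL.
Qed.

Lemma conj_dg_trace M l A : \det M = 1 -> A = M *m dg l *m invmx M ->
  A 0 0 + A 1 1 = 2 * cosh (l / 2).
Proof.
move=> dM ->; have [e1 e2 e3 e4] := invmx2E dM.
rewrite !mul2E e1 e2 e3 e4 /dg !mx2V /cosh.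
have := dM; rewrite det2E; move: (M 0 0) (M 0 1) (M 1 0) (M 1 1) => a b c d d1.
transitivity ((expR (l / 2) + expR (- (l / 2))) * (a * d - b * c)); first by ring.
by rewrite d1; field.
Qed.

Lemma cosh2 x : 2 * cosh (x / 2) ^+ 2 - 1 = cosh (x : R).
Proof.
rewrite /cosh -(expR_half x) -(expR_half (- x)) mulNr.
have : expR (x / 2) * expR (- (x / 2)) = 1 by rewrite -expRD addrN expR0.
move: (expR (x / 2)) (expR (- (x / 2))) => u v e.
transitivity ((u ^+ 2 + v ^+ 2) / 2 + (u * v - 1)); first by field.
by rewrite e subrr addr0.
Qed.

Lemma geodesic_of A : Gamma A -> ~ eq_pm A 1%:M -> exists M l, [/\ 0 < l,
  \det M = 1, eq_pm A (M *m dg l *m invmx M), closed_geodesic Gamma (std M l) l &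
  `|A 0 0 + A 1 1| = 2 * cosh (l / 2)].
Proof.
move=> GA nA; have := hypG hG GA nA; rewrite lter_normr => /orP[] tA.
  have [M [l [l0 dM AE tE]]] := hyp_diag (hs_det hG GA) tA.
  exists M, l; split => //; first by left.
    by apply: std_closed_geodesic => //; rewrite -AE.
  by rewrite -tE ger0_norm //; lra.
have GN := hs_opp hG GA.
have [M [l [l0 dM AE tE]]] : exists M l,
  [/\ 0 < l, \det M = 1, - A = M *m dg l *m invmx M & (- A) 0 0 + (- A) 1 1 = 2 * cosh (l / 2)].
  by apply: hyp_diag; rewrite ?(hs_det hG GN) // !opp2E; lra.
exists M, l; split => //; first by right; rewrite -AE opprK.
  by apply: std_closed_geodesic => //; rewrite -AE.
by rewrite -tE !opp2E -opprD -normrN ger0_norm //; lra.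
Qed.

Lemma geodesic_not1 M l A : \det M = 1 -> 0 < l ->
  eq_pm A (M *m dg l *m invmx M) -> ~ eq_pm A 1%:M.
Proof.
move=> dM l0 h1 h2; have := eq_pm_trans (eq_pm_sym h1) h2.
have := conj_dg_trace (l := l) dM erefl.
have := @cosh_lt R 0 (l / 2) (lexx _); rewrite {1}/cosh oppr0 expR0.
move=> /(_ ltac:(lra)) h tr [e|e]; move: tr; rewrite e ?opp2E !id2V; lra.
Qed.

(** For a trivial group the whole half-plane would lie in the compact, hence bounded, set K. *)
Lemma nontrivG : exists2 A, Gamma A & ~ eq_pm A 1%:M.
Proof.
apply: contrapT => h.
have triv A : Gamma A -> eq_pm A 1%:M.
  by move=> GA; apply: contrapT => n; apply: h; exists A.
have [K [cK KH Kc]] := hs_cocompact hG.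
have [M [Mr MK]] := compact_bounded cK.
pose y : R := `|M| + 2.
have y0 : 0 < y by rewrite /y; have := normr_ge0 M; lra.
have [A GA] := Kc (0, y) y0.
rewrite (mobius_pm _ (triv A GA)) mobius1 => Ky.
have := MK (`|M| + 1) _ _ Ky.
have -> : M < `|M| + 1 by have := ler_norm M; lra.
move=> /(_ isT) /=; rewrite prod_normE /= normr0 ge_max => /andP[_].
rewrite /y gtr0_norm //; lra.
Qed.

Lemma sys_gt0 : 0 < systole Gamma.
Proof.
have [e e0 he] := unif_discG hG.
have [x x0 hx] : exists2 x : R, 0 <= x & cosh x = 1 + e by apply: cosh_surj; lra.
have x1 : 0 < x.
  rewrite lt_neqAle x0 andbT; apply/negP => /eqP xe.
  by move: hx; rewrite -xe /cosh oppr0 expR0; lra.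
apply: lt_le_trans x1 _; apply: lb_le_inf.
  have [A GA nA] := nontrivG.
  by have [M [l [l0 dM AM cg tr]]] := geodesic_of GA nA; exists l, (std M l).
move=> l [c cg]; have l0 : 0 < l by case: cg.
have [M [dM cE [T GT TM]]] := closed_geodesic_std cg.
rewrite -(cosh_leE x0 (ltW l0)) hx leNgt; apply/negP => hl.
apply: (geodesic_not1 dM l0 TM); apply: (he (std M l 0)) => //; first exact: std_half.
rewrite (mobius_pm _ TM).
have hx0 := @half_axis R (l * 0).
have hs := std_half l 0 dM.
rewrite mobius_mul ?det_mul1 ?det_dg ?det_invmx2 //.
rewrite {2}/std -[mobius (invmx M) _]mobius_mul ?det_invmx2 // mulVmx ?unit2 // mobius1.
rewrite mobius_mul ?det_dg // ch_mobius //; last exact/mobius_half/half_axis/det_dg.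
by rewrite dg_axis ch_axis -coshN opprB addrK.
Qed.

Lemma sys_le c l : closed_geodesic Gamma c l -> systole Gamma <= l.
Proof.
move=> cg; apply: ge_inf; last by exists c.
by exists 0 => x [c' [x0 _ _]]; exact: ltW.
Qed.

(** A near-minimiser does all that a shortest geodesic would: the factor 2 disappears in the
    constants. *)
Lemma sys_approx : exists c l, closed_geodesic Gamma c l /\ l < 2 * systole Gamma.
Proof.
have s0 := sys_gt0.
have hi : has_inf [set l | exists c, closed_geodesic Gamma c l].
  split; last by exists 0 => x [c' [x0 _ _]]; exact: ltW.
  have [A GA nA] := nontrivG.
  by have [M [l [l0 dM AM cg tr]]] := geodesic_of GA nA; exists l, (std M l).
have [l [c cg] hl] := inf_adherent s0 hi.
by exists c, l; split => //; rewrite mulr_natl mulr2n.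
Qed.

Lemma sys_disp A z : Gamma A -> ~ eq_pm A 1%:M -> halfplane z ->
  cosh (systole Gamma) <= ch z (mobius A z).
Proof.
move=> GA nA hz; have [M [l [l0 dM AM cg tr]]] := geodesic_of GA nA.
apply: le_trans (disp_trace (hs_det hG GA) hz).
have -> : (A 0 0 + A 1 1) ^+ 2 / 2 - 1 = cosh l.
  by rewrite -real_normK ?num_real // tr -[RHS]cosh2; field.
by apply: cosh_le; [exact/ltW/sys_gt0|exact: sys_le cg].
Qed.

(** Continuity measured by [ch], a form that [mobius] visibly preserves. *)
Definition chcont (c : R -> R * R) := forall t (n : R), 0 < n ->
  exists2 e : R, 0 < e & forall s, `|s - t| < e -> ch (c t) (c s) < 1 + n.

(** By uniform discreteness, the group elements relating c and c' at nearby parameters agree up to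
    sign, so one element serves for the whole line. *)
Lemma deck_const c c' : (forall t, halfplane (c t)) -> (forall t, halfplane (c' t)) ->
  chcont c -> chcont c' -> (forall t, same_point Gamma (c t) (c' t)) ->
  exists2 A, Gamma A & forall t, c' t = mobius A (c t).
Proof.
move=> hc hc' cc cc' sc; have [e e0 he] := unif_discG hG.
have [A GA cA] := sc 0; exists A => // t.
move: t; suff: forall t, (fun t => c' t = mobius A (c t)) t by [].
move=> t; apply: (@loc_const _ (fun t => c' t = mobius A (c t)) 0) => // {}t.
pose n := Num.min 1 e / 10.
have m0 : 0 < Num.min 1 e by rewrite lt_min; lra.
have m1 : Num.min 1 e <= 1 by rewrite ge_min lexx.
have m2 : Num.min 1 e <= e by rewrite ge_min lexx orbT.
have n0 : 0 < n by rewrite divr_gt0.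
have [e1 e10 h1] := cc t n n0; have [e2 e20 h2] := cc' t n n0.
exists (Num.min e1 e2); first by rewrite lt_min e10.
have [B GB cB] := sc t.
have dB := hs_det hG GB; have dBi := det_invmx2 dB.
have key s D : `|s - t| < Num.min e1 e2 -> Gamma D -> c' s = mobius D (c s) -> eq_pm D B.
  rewrite lt_min => /andP[s1 s2] GD cD; have dD := hs_det hG GD.
  suff : eq_pm (invmx B *m D) 1%:M.
    by move=> /(eq_pm_mull B); rewrite mulmxA mulmxV ?unit2 // mul1mx mulmx1.
  apply: (he (c s)) => //; first exact: (hs_mul hG) (hs_inv hG _) _.
  rewrite mobius_mul // -cD -(ch_mobius dB) //; last exact: mobius_half.
  rewrite -mobius_mul // mulmxV ?unit2 // mobius1.
  apply: le_lt_trans (ch_triangle (mobius_half dB (hc s)) (hc' s) (hc' t)) _.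
  rewrite {1}cB ch_mobius // chC.
  have := h1 _ s1; have := h2 _ s2; have := ch_ge1 (hc t) (hc s).
  have := ch_ge1 (hc' t) (hc' s); move: (ch _ _) (ch _ _) => p q p1 q1 p2 q2.
  have : q * p <= (1 + n) * (1 + n) by apply: ler_pM1 => //; apply: ltW.
  by rewrite /n in p2 q2 *; nra.
move=> s s' hs hs' cs; have [D GD cD] := sc s'.
rewrite cD (mobius_pm _ (key _ _ hs' GD cD)).
by rewrite (mobius_pm _ (key _ _ hs GA cs)).
Qed.
End Geodesics.

(** * Crossing axes *)

Section Planar.
Variable R : realType.
Implicit Types (a b c : R * R).

Definition chi a : R := if 0 <= a.1 then 1 else 0.

(* Signed number of crossings of the segment [a, b] with the ray
   {0} x ]-oo, 0[, where points of the ray count as lying on its right. *)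
Definition cr a b : R :=
  if (a.1 < 0) && (0 <= b.1) then
    (if a.2 * b.1 - b.2 * a.1 < 0 then 1 else 0)
  else if (b.1 < 0) && (0 <= a.1) then
    (if b.2 * a.1 - a.2 * b.1 < 0 then -1 else 0)
  else 0.

Lemma cr_anti a b : cr b a = - cr a b.
Proof.
rewrite /cr; case: (ltP a.1 0) => ha; case: (ltP b.1 0) => hb //=;
  rewrite ?oppr0 //; case: ifP => _; rewrite ?oppr0 ?opprK //.
Qed.

Lemma cr_half0 (p q : R) a b : 0 <= q -> 0 < p * a.1 + q * a.2 ->
  0 < p * b.1 + q * b.2 -> cr a b = 0.
Proof.
rewrite /cr => q0; case: (ltP a.1 0) => ha; case: (ltP b.1 0) => hb //= h1 h2;
  case: ifP => // h; exfalso.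
- have : q * (a.2 * b.1 - b.2 * a.1) <= 0 by rewrite mulr_ge0_le0 // ltW.
  nra.
- have : q * (b.2 * a.1 - a.2 * b.1) <= 0 by rewrite mulr_ge0_le0 // ltW.
  nra.
Qed.

Lemma cr_below a b : a.2 < 0 -> b.2 < 0 -> cr a b = chi b - chi a.
Proof.
rewrite /cr /chi; case: (ltP a.1 0) => ha; case: (ltP b.1 0) => hb //= h1 h2;
  rewrite ?subrr //.
- by rewrite ifT ?subr0 //; nra.
- by rewrite ifT ?sub0r //; nra.
Qed.

Lemma cr_same a b : (0 <= a.1) = (0 <= b.1) -> cr a b = 0.
Proof.
by rewrite /cr !ltNge => ->; case: (0 <= b.1).
Qed.

(** The origin lies in the triangle a, b, c; the weights are not normalised. *)
Definition hull0 a b c := exists al be ga : R,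
  [/\ 0 <= al, 0 <= be, 0 <= ga, 0 < al + be + ga &
  al * a.1 + be * b.1 + ga * c.1 = 0 /\ al * a.2 + be * b.2 + ga * c.2 = 0].

Lemma hull0_rot a b c : hull0 a b c -> hull0 b c a.
Proof.
move=> [al [be [ga [h1 h2 h3 h4 [e1 e2]]]]]; exists be, ga, al; split=> //; first lra.
by split; lra.
Qed.

Lemma hull0_flip a b c : hull0 a b c -> hull0 a c b.
Proof.
move=> [al [be [ga [h1 h2 h3 h4 [e1 e2]]]]]; exists al, ga, be; split=> //; first lra.
by split; lra.
Qed.

(** v and w have the signs of the heights at which the segments ab and ac meet the vertical axis:
    one below the origin, the other not. The weights combine these two points. *)
Lemma hull0_aux1 a b c : a.1 < 0 -> 0 <= b.1 -> 0 <= c.1 ->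
  a.2 * b.1 - b.2 * a.1 < 0 -> 0 <= a.2 * c.1 - c.2 * a.1 -> hull0 a b c.
Proof.
move=> ha hb hc; set v := _ - _; set w := (X in 0 <= X) => v0 w0.
exists (w * b.1 - v * c.1), (- a.1 * w), (a.1 * v).
have hv : 0 < a.1 * v by nra.
have hw : 0 <= - a.1 * w by nra.
have hu : 0 <= w * b.1 - v * c.1 by nra.
split; [exact: hu|exact: hw|exact: ltW|lra|by rewrite /v /w; split; ring].
Qed.

Lemma hull0_aux2 a b c : 0 <= a.1 -> b.1 < 0 -> c.1 < 0 ->
  b.2 * a.1 - a.2 * b.1 < 0 -> 0 <= c.2 * a.1 - a.2 * c.1 -> hull0 a b c.
Proof.
move=> ha hb hc; set v := _ - _; set w := (X in 0 <= X) => v0 w0.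
exists (- w * b.1 + v * c.1), (a.1 * w), (- a.1 * v).
have hv : 0 <= - a.1 * v by nra.
have hw : 0 <= a.1 * w by nra.
have hu : 0 < - w * b.1 + v * c.1.
  by apply: ltr_wpDl; [nra|rewrite nmulr_lgt0].
split; [exact: ltW|exact: hw|exact: hv|lra|by rewrite /v /w; split; ring].
Qed.

Ltac hull0_try :=
  first [ by apply: hull0_aux1 | by apply: hull0_aux2
        | by apply: hull0_aux1; lra | by apply: hull0_aux2; lra ].

Ltac hull0_perms :=
  first [ hull0_try | apply: hull0_flip; hull0_try
        | apply: hull0_rot; hull0_try | apply: hull0_rot; apply: hull0_flip; hull0_try
        | apply: hull0_rot; apply: hull0_rot; hull0_try
        | apply: hull0_rot; apply: hull0_rot; apply: hull0_flip; hull0_try ].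

(** The boundary of a triangle that misses the origin has winding number 0. Of the positions of the
    three points about the vertical axis, symmetry leaves the two cases of [hull0_aux1] and
    [hull0_aux2]. *)
Lemma cr_sum a b c : cr a b + cr b c + cr c a != 0 -> hull0 a b c.
Proof.
rewrite /cr; case: (ltP a.1 0) => ha; case: (ltP b.1 0) => hb;
  case: (ltP c.1 0) => hc /=; rewrite ?addr0 ?add0r ?eqxx //;
  do 2 (case: ltP => ?); rewrite ?addr0 ?add0r ?addrN ?addNr ?eqxx // => _;
  hull0_perms.
Qed.

Lemma cr_tri (p q : R) a b c : 0 < p * a.1 + q * a.2 ->
  0 < p * b.1 + q * b.2 -> 0 < p * c.1 + q * c.2 ->
  cr a b + cr b c + cr c a = 0.
Proof.
move=> ha hb hc; apply/eqP; apply: contrapT => /negP /cr_sum.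
move=> [al [be [ga [h1 h2 h3 h4 [e1 e2]]]]].
have : al * (p * a.1 + q * a.2) + be * (p * b.1 + q * b.2)
   + ga * (p * c.1 + q * c.2) = 0.
  transitivity (p * (al * a.1 + be * b.1 + ga * c.1)
    + q * (al * a.2 + be * b.2 + ga * c.2)); first by ring.
  by rewrite e1 e2 !mulr0 addr0.
have := mulr_ge0 h1 (ltW ha); have := mulr_ge0 h2 (ltW hb).
have := mulr_ge0 h3 (ltW hc) => k3 k2 k1 e.
have /eqP : al * (p * a.1 + q * a.2) = 0 by lra.
have /eqP : be * (p * b.1 + q * b.2) = 0 by lra.
have /eqP : ga * (p * c.1 + q * c.2) = 0 by lra.
rewrite !mulf_eq0 !(gt_eqF ha, gt_eqF hb, gt_eqF hc) !orbF.
by move=> /eqP ga0 /eqP be0 /eqP al0; move: h4; rewrite ga0 be0 al0; lra.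
Qed.

(** Discrete homotopy invariance: each cell lies in an open half-plane, so its boundary contributes
    0, and the cells telescope to the boundary of the grid. *)
Lemma cr_grid (f : nat -> nat -> R * R) (n m : nat) :
  (forall i j, (i < n)%N -> (j < m)%N -> exists p q : R,
     forall i' j', (i <= i' <= i.+1)%N -> (j <= j' <= j.+1)%N ->
     0 < p * (f i' j').1 + q * (f i' j').2) ->
  \sum_(i < n) (cr (f i 0%N) (f i.+1 0%N) - cr (f i m) (f i.+1 m)) =
  \sum_(j < m) (cr (f 0%N j) (f 0%N j.+1) - cr (f n j) (f n j.+1)).
Proof.
move=> h.
have cell i j : (i < n)%N -> (j < m)%N ->
    cr (f i j) (f i.+1 j) - cr (f i j.+1) (f i.+1 j.+1) =
    cr (f i j) (f i j.+1) - cr (f i.+1 j) (f i.+1 j.+1).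
  move=> hi hj; have [p [q hpq]] := h i j hi hj.
  have h00 := hpq i j; have h10 := hpq i.+1 j.
  have h01 := hpq i j.+1; have h11 := hpq i.+1 j.+1.
  rewrite !leqnn !leqnSn /= in h00 h10 h01 h11.
  have t1 := cr_tri (h00 isT isT) (h10 isT isT) (h11 isT isT).
  have t2 := cr_tri (h00 isT isT) (h01 isT isT) (h11 isT isT).
  lra.
transitivity (\sum_(i < n) \sum_(j < m) (cr (f i j) (f i.+1 j) - cr (f i j.+1) (f i.+1 j.+1))).
  apply: eq_bigr => i _.
  rewrite -(big_mkord xpredT (fun j => cr (f i j) (f i.+1 j) - cr (f i j.+1) (f i.+1 j.+1))).
  under eq_bigr do rewrite -opprB.
  by rewrite sumrN telescope_sumr // opprB.
rewrite exchange_big /=; apply: eq_bigr => j _.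
transitivity (\sum_(i < n) (cr (f i j) (f i j.+1) - cr (f i.+1 j) (f i.+1 j.+1))).
  by apply: eq_bigr => i _; apply: cell.
rewrite -(big_mkord xpredT (fun i => cr (f i j) (f i j.+1) - cr (f i.+1 j) (f i.+1 j.+1))).
under eq_bigr do rewrite -opprB.
by rewrite sumrN telescope_sumr // opprB.
Qed.
End Planar.

(** * Curves forced to cross in the plane *)

Section Crossing.
Variable R : realType.

Definition ccont (c : R -> R * R) :=
  continuous (fun t => (c t).1) /\ continuous (fun t => (c t).2).

(** If the curves never met, (s, t) |-> c s - d t would map a rectangle to the punctured plane, so
    its boundary would have winding number 0 by [cr_grid]. The four inequalities place the sides of
    the rectangle in four half-planes which make that number non-zero. The slope k is there because
    c will only be known to stay in a cone. *)
Lemma planar_cross (c d : R -> R * R) (S T k : R) : ccont c -> ccont d ->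
  0 < S -> 0 < T -> 0 <= k ->
  (forall t, -T <= t <= T -> (d t).2 < (c S).2) ->
  (forall t, -T <= t <= T -> (c (- S)).2 < (d t).2) ->
  (forall s, -S <= s <= S -> k * (d T).2 - (d T).1 < k * (c s).2 - (c s).1) ->
  (forall s, -S <= s <= S -> k * (d (- T)).2 + (d (- T)).1 < k * (c s).2 + (c s).1) ->
  exists s t, c s = d t.
Proof.
move=> [c1 c2] [d1 d2] S0 T0 k0 hS hmS hT hmT; apply: contrapT => hcd.
have ncd s t : c s != d t.
  by apply/eqP => e; apply: hcd; exists s, t.
pose f s t : R * R := ((c s).1 - (d t).1, (c s).2 - (d t).2).
(* On squares of size e the difference stays in one half-plane; compactness of the rectangle yields
   an e valid everywhere. *)
pose P (e : R) (z : R * R) := exists p q : R, forall s t,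
  `|s - z.1| <= e -> `|t - z.2| <= e -> 0 < p * (f s t).1 + q * (f s t).2.
have K : compact (`[-S, S] `*` `[-T, T])%classic.
  by apply: compact_setX; exact: segment_compact.
have [e [e0 he]] : exists e : R, 0 < e /\ (`[-S, S] `*` `[-T, T] `<=` P e)%classic.
  have /compact_near_coveringP ncK := K.
  have : \forall e \near 0^'+, (`[-S, S] `*` `[-T, T] `<=` P e)%classic.
    apply: ncK => -[s0 t0] _.
    pose p := (f s0 t0).1; pose q := (f s0 t0).2.
    pose h (z : R * R) : R := p * ((c z.1).1 - (d z.2).1) + q * ((c z.1).2 - (d z.2).2).
    have h0 : 0 < h (s0, t0).
      have e : h (s0, t0) = p ^+ 2 + q ^+ 2 by [].
      rewrite e lt_neqAle addr_ge0 ?sqr_ge0 // andbT eq_sym paddr_eq0 ?sqr_ge0 //.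
      rewrite !sqrf_eq0 !subr_eq0; apply/negP => /andP[/eqP a /eqP b].
      by have := ncd s0 t0; rewrite (surjective_pairing (c s0)) (surjective_pairing (d t0)) a b eqxx.
    have ch : {for (s0, t0), continuous h}.
      apply: cvgD; apply: cvgM; try exact: cvg_cst; apply: cvgB.
      - exact: (@cvg_comp _ _ _ (fst : R * R -> R) (fun t => (c t).1) (nbhs (s0, t0)) (nbhs s0)
           _ cvg_fst (c1 s0)).
      - exact: (@cvg_comp _ _ _ (snd : R * R -> R) (fun t => (d t).1) (nbhs (s0, t0)) (nbhs t0)
           _ cvg_snd (d1 t0)).
      - exact: (@cvg_comp _ _ _ (fst : R * R -> R) (fun t => (c t).2) (nbhs (s0, t0)) (nbhs s0)
           _ cvg_fst (c2 s0)).
      - exact: (@cvg_comp _ _ _ (snd : R * R -> R) (fun t => (d t).2) (nbhs (s0, t0)) (nbhs t0)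
           _ cvg_snd (d2 t0)).
    have /nbhs_ballP[r r0 hr] : \forall z \near (s0, t0), 0 < h z.
      by apply: (ch _ (lt_nbhsr h0)).
    near=> z e; exists p, q => s t hs ht.
    apply: (hr (s, t)).
    have [b1 b2] : ball (s0, t0) (r / 2) z by near: z; apply: nbhsx_ballx; rewrite divr_gt0.
    have er : e < r / 2 by near: e; apply: nbhs_right_lt; rewrite divr_gt0.
    split => /=.
    - change (`|s0 - s| < r); have -> : s0 - s = (s0 - z.1) - (s - z.1) by ring.
      by apply: le_lt_trans (ler_normB _ _) _; move: (b1 : `|s0 - z.1| < r / 2) (hs : `|s - z.1| <= e); lra.
    - change (`|t0 - t| < r); have -> : t0 - t = (t0 - z.2) - (t - z.2) by ring.
      by apply: le_lt_trans (ler_normB _ _) _; move: (b2 : `|t0 - z.2| < r / 2) (ht : `|t - z.2| <= e); lra.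
  move=> h; have [e [? ?]] := @filter_ex _ _ (at_right_proper_filter (0 : R)) _
    (filterI h (@nbhs_right_gt R 0)).
  by exists e.
pose n := (Num.truncn (2 * (S + T) / e)).+1.
have n0 : 0 < n%:R :> R by rewrite ltr0n.
have hn : 2 * (S + T) / e < n%:R.
  by apply: truncnS_gt.
pose u i : R := - S + 2 * S * i%:R / n%:R.
pose v i : R := - T + 2 * T * i%:R / n%:R.
have u0 : u 0%N = - S by rewrite /u mulr0 mul0r addr0.
have v0 : v 0%N = - T by rewrite /v mulr0 mul0r addr0.
have un : u n = S by rewrite /u mulfK ?gt_eqF //; ring.
have vn : v n = T by rewrite /v mulfK ?gt_eqF //; ring.
have [su sv] : 2 * S / n%:R < e /\ 2 * T / n%:R < e.
  move: hn; rewrite ltr_pdivrMr // !ltr_pdivrMr // => hn; split; nra.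
have ule i : (i <= n)%N -> - S <= u i <= S.
  move=> hi; have : 0 <= (i%:R / n%:R : R) <= 1.
    by rewrite divr_ge0 ?ler0n //= ler_pdivrMr // mul1r ler_nat.
  by rewrite /u -mulrA => /andP[? ?]; apply/andP; split; nra.
have vle i : (i <= n)%N -> - T <= v i <= T.
  move=> hi; have : 0 <= (i%:R / n%:R : R) <= 1.
    by rewrite divr_ge0 ?ler0n //= ler_pdivrMr // mul1r ler_nat.
  by rewrite /v -mulrA => /andP[? ?]; apply/andP; split; nra.
pose F i j := f (u i) (v j).
have step (x : R) i i' : (i <= i' <= i.+1)%N -> 0 < x -> 2 * x / n%:R < e ->
    `|2 * x * i'%:R / n%:R - 2 * x * i%:R / n%:R| <= e.
  move=> /andP[h1 h2] x0 hx; rewrite -mulrBl -mulrBr mulrAC.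
  have : 0 <= (i'%:R - i%:R : R) <= 1.
    by rewrite subr_ge0 ler_nat h1 lerBlDr -(natrD _ 1) add1n ler_nat.
  move=> /andP[g1 g2]; have w0 : 0 < 2 * x / n%:R by rewrite divr_gt0 // mulr_gt0.
  by rewrite ger0_norm; nra.
have cells i j : (i < n)%N -> (j < n)%N -> exists p q : R,
     forall i' j', (i <= i' <= i.+1)%N -> (j <= j' <= j.+1)%N ->
     0 < p * (F i' j').1 + q * (F i' j').2.
  move=> hi hj.
  have [p [q hpq]] : P e (u i, v j).
    by apply: he; split => /=; rewrite in_itv /=; [exact/ule/ltnW|exact/vle/ltnW].
  exists p, q => i' j' hi' hj'; apply: hpq => /=.
  - have -> : u i' - u i = 2 * S * i'%:R / n%:R - 2 * S * i%:R / n%:R by rewrite /u; ring.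
    exact: step.
  - have -> : v j' - v j = 2 * T * j'%:R / n%:R - 2 * T * j%:R / n%:R by rewrite /v; ring.
    exact: step.
have := cr_grid cells.
rewrite big1; last first.
  move=> i _; have hi := ltn_ord i.
  have z1 : cr (F i 0%N) (F i.+1 0%N) = 0.
    apply: (@cr_half0 R 1 k); rewrite // mul1r /F /f /= v0.
    - by have := hmT _ (ule _ (ltnW hi)); lra.
    - by have := hmT _ (ule _ hi); lra.
  have z2 : cr (F i n) (F i.+1 n) = 0.
    apply: (@cr_half0 R (-1) k); rewrite // mulN1r /F /f /= vn.
    - by have := hT _ (ule _ (ltnW hi)); lra.
    - by have := hT _ (ule _ hi); lra.
  by rewrite z1 z2 subrr.
under eq_bigr => j _.
  have hj := ltn_ord j.
  have z : cr (F n j) (F n j.+1) = 0.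
    apply: (@cr_half0 R 0 1); rewrite // mul0r add0r mul1r /F /f /= un subr_gt0.
    - exact/hS/vle/ltnW.
    - exact/hS/vle.
  rewrite z subr0 cr_below; last first.
  - by rewrite /F /f /= u0 subr_lt0; exact/hmS/vle.
  - by rewrite /F /f /= u0 subr_lt0; exact/hmS/vle/ltnW.
  over.
(* Only the side s = - S crosses the cut, and the remaining sum is the change of [chi] from its
   first corner to its last. *)
rewrite -(big_mkord xpredT (fun j => chi (F 0%N j.+1) - chi (F 0%N j))) telescope_sumr //.
have mS : - S <= - S <= S by apply/andP; split; lra.
have mT : - T <= - T <= T by apply/andP; split; lra.
have pT : - T <= T <= T by apply/andP; split; lra.
have := hT _ mS; have := hmT _ mS; have := hmS _ mT; have := hmS _ pT.
rewrite /chi /F /f /= u0 v0 vn => a1 a2 a3 a4.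
rewrite ifF; last by apply/negbTE; rewrite -ltNge; nra.
rewrite ifT; last by nra.
by lra.
Unshelve. all: by end_near. Qed.
End Crossing.

(** * Lifting free homotopies *)

Section Homotopy.
Variables (R : realType) (g : nat) (Gamma : set 'M[R]_2).
Hypothesis hG : hyperbolic_surface g Gamma.
Implicit Types (A B M T : 'M[R]_2) (z w p : R * R) (c d : R -> R * R) (l t : R).

Lemma mobiusK A z : \det A = 1 -> halfplane z -> mobius (invmx A) (mobius A z) = z.
Proof.
by move=> dA hz; rewrite -mobius_mul ?det_invmx2 // mulVmx ?unit2 // mobius1.
Qed.

Lemma mobiusVK A z : \det A = 1 -> halfplane z -> mobius A (mobius (invmx A) z) = z.
Proof.
by move=> dA hz; rewrite -mobius_mul ?det_invmx2 // mulmxV ?unit2 // mobius1.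
Qed.

Lemma chcont_mobius A c : \det A = 1 -> (forall t, halfplane (c t)) -> chcont c ->
  chcont (fun t => mobius A (c t)).
Proof.
move=> dA hc cc t n n0; have [e e0 he] := cc t n n0.
by exists e => // s hs; rewrite ch_mobius // he.
Qed.

Lemma ch_near_coord z w (n : R) : halfplane z -> halfplane w -> 0 < n -> n <= 1 / 8 ->
  ch z w < 1 + n -> (z.1 - w.1) ^+ 2 <= 4 * n * z.2 ^+ 2 /\
                    (z.2 - w.2) ^+ 2 <= 4 * n * z.2 ^+ 2.
Proof.
rewrite /halfplane /ch /=; move: z.1 z.2 w.1 w.2 => x y x' y' y0 y'0 n0 n1.
rewrite ltrD2l ltr_pdivrMr ?mulr_gt0 // => h.
have k1 := sqr_ge0 (x - x'); have k2 := sqr_ge0 (y - y').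
have yy : y' <= 2 * y.
  rewrite leNgt; apply/negP => hy.
  have : 2 * y * y' * n <= 2 * y * y' * (1 / 8) by rewrite ler_pM2l // !mulr_gt0.
  have : (y' / 2) * (y' / 2) <= (y - y') ^+ 2 by nra.
  have : y * y' <= y' / 2 * y' by rewrite ler_pM2r //; lra.
  have : 0 < y' * y' by rewrite mulr_gt0.
  lra.
have : n * (2 * y * y') <= n * (2 * y * (2 * y)).
  by rewrite ler_pM2l // ler_pM2l // mulr_gt0.
by move=> k; split; nra.
Qed.

Lemma chcont_ccont c : (forall t, halfplane (c t)) -> chcont c -> ccont c.
Proof.
move=> hc cc; have key t (r : R) : 0 < r -> exists2 e : R, 0 < e & forall s, `|s - t| < e ->
    (c t).1 - (c s).1 < r /\ (c s).1 - (c t).1 < r /\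
    (c t).2 - (c s).2 < r /\ (c s).2 - (c t).2 < r.
  move=> r0; have y0 := hc t; rewrite /halfplane /= in y0.
  pose n := Num.min (1 / 8) (r ^+ 2 / (8 * (c t).2 ^+ 2)).
  have n0 : 0 < n by rewrite lt_min !divr_gt0 ?mulr_gt0 ?exprn_gt0.
  have n1 : n <= 1 / 8 by rewrite ge_min lexx.
  have n2 : n <= r ^+ 2 / (8 * (c t).2 ^+ 2) by rewrite ge_min lexx orbT.
  have [e e0 he] := cc t n n0; exists e => // s hs.
  have [h1 h2] := ch_near_coord (hc t) (hc s) n0 n1 (he s hs).
  have n3 : 8 * n * (c t).2 ^+ 2 <= r ^+ 2.
    by rewrite mulrAC -ler_pdivlMl ?mulr_gt0 ?exprn_gt0 // mulrC.
  have r2 : 0 < r ^+ 2 by rewrite exprn_gt0.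
  by do !split; rewrite ltNge; apply/negP => h3; nra.
split=> t; apply/cvgrPdist_lt => r r0; have [e e0 he] := key t r r0.
- exists e => // s hs; have [|h1 [h2 _]] := he s; first by rewrite distrC.
  by rewrite /= ltr_norml; apply/andP; split; lra.
- exists e => // s hs; have [|_ [_ [h1 h2]]] := he s; first by rewrite distrC.
  by rewrite /= ltr_norml; apply/andP; split; lra.
Qed.

Lemma cont_chcont (F : R * R -> R * R) (A : set (R * R)) (p : R -> R * R) :
  {within A, continuous F} -> ccont p -> (forall t, A (p t)) ->
  (forall z, A z -> halfplane (F z)) -> chcont (fun t => F (p t)).
Proof.
move=> /subspace_continuousP cF [p1 p2] pA hF t n n0.
have := cF _ (pA t) _ (near_ch (hF _ (pA t)) n0).
move=> /nbhs_ballP[r r0 hr].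
have /nbhs_ballP[e1 e10 h1] : nbhs t [set s | ball (p t).1 r (p s).1].
  exact: p1 t _ (nbhsx_ballx _ _ r0).
have /nbhs_ballP[e2 e20 h2] : nbhs t [set s | ball (p t).2 r (p s).2].
  exact: p2 t _ (nbhsx_ballx _ _ r0).
exists (Num.min e1 e2); first by rewrite lt_min; apply/andP; split.
move=> s; rewrite lt_min distrC => /andP[s1 s2].
by have [] := hr (p s) (conj (h1 s s1) (h2 s s2)) (pA s).
Qed.

Lemma std_chcont M l : \det M = 1 -> 0 < l -> chcont (std M l).
Proof.
move=> dM l0 t n n0.
have [x x0 hx] : exists2 x : R, 0 <= x & cosh x = 1 + n by apply: cosh_surj; lra.
have x1 : 0 < x.
  rewrite lt_neqAle x0 andbT; apply/negP => /eqP xe.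
  by move: hx; rewrite -xe /cosh oppr0 expR0; lra.
exists (x / l); first by rewrite divr_gt0.
move=> s hs; rewrite ch_std // -hx -cosh_abs cosh_ltE // normrM (gtr0_norm l0).
by rewrite distrC mulrC -ltr_pdivlMr.
Qed.

Lemma freeG A B z : Gamma A -> Gamma B -> halfplane z ->
  mobius A z = mobius B z -> eq_pm A B.
Proof.
move=> GA GB hz e; have dA := hs_det hG GA; have dB := hs_det hG GB.
have [r r0 hr] := discG hG hz.
have : eq_pm (invmx B *m A) 1%:M.
  apply: hr; first exact: (hs_mul hG) (hs_inv hG GB) GA.
  by rewrite mobius_mul ?det_invmx2 // e mobiusK // chzz ltrDl.
by move=> /(eq_pm_mull B); rewrite mulmxA mulmxV ?unit2 // mul1mx mulmx1.
Qed.

Lemma ch_triangle3 z z' w' w : halfplane z -> halfplane z' -> halfplane w' ->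
  halfplane w -> ch z w <= 4 * ch z z' * ch z' w' * ch w' w.
Proof.
move=> h1 h2 h3 h4; have t1 := ch_triangle h1 h4 h2; have t2 := ch_triangle h2 h4 h3.
have := ch_ge1 h1 h2; have := ch_ge1 h2 h3; have := ch_ge1 h3 h4; have := ch_ge1 h2 h4.
move: (ch z z') (ch z' w') (ch w' w) (ch z' w) (ch z w) t1 t2 => p q r s u t1 t2 s1 r1 q1 p1.
have : p * s <= p * (2 * q * r) by rewrite ler_pM2l; lra.
lra.
Qed.

(** [ch (c t) (d t)] has period 1 since both curves are moved by the same isometry, so a bound on
    [0, 1] suffices. *)
Lemma periodic_bounded c d T : \det T = 1 ->
  (forall t, halfplane (c t)) -> (forall t, halfplane (d t)) ->
  chcont c -> chcont d ->
  (forall t, c (t + 1) = mobius T (c t)) -> (forall t, d (t + 1) = mobius T (d t)) ->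
  exists2 L, 1 <= L & forall t, ch (c t) (d t) <= L.
Proof.
move=> dT hc hd cc cd pc pd.
have [L [L1 hL]] : exists L : R, 1 < L /\ (`[0, 1] `<=` (fun t => ch (c t) (d t) <= L))%classic.
  have /compact_near_coveringP ncK := @segment_compact R 0 1.
  have : \forall L \near +oo, (`[0, 1] `<=` (fun t => ch (c t) (d t) <= L))%classic.
    apply: ncK => t _.
    have [e1 e10 h1] := cc t 1 ltr01; have [e2 e20 h2] := cd t 1 ltr01.
    near=> s L => /=.
    have hs1 : `|s - t| < e1 by rewrite distrC; near: s; exact: nbhsx_ballx.
    have hs2 : `|s - t| < e2 by rewrite distrC; near: s; exact: nbhsx_ballx.
    have := ch_triangle3 (hc s) (hc t) (hd t) (hd s).
    have := h1 s hs1; have := h2 s hs2; rewrite (chC (c s) (c t)).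
    have hL : 16 * ch (c t) (d t) <= L by near: L; apply: nbhs_pinfty_ge; exact: num_real.
    have := ch_ge1 (hc t) (hd t); have := ch_ge1 (hc t) (hc s); have := ch_ge1 (hd t) (hd s).
    move: (ch (c s) (d s)) (ch (c t) (c s)) (ch (d t) (d s)) (ch (c t) (d t)) hL => x p q r hL q1 p1 r1 q2 p2 hx.
    have : p * q <= 2 * 2 by apply: ler_pM1 => //; apply: ltW.
    nra.
  move=> h; have [L [? ?]] := @filter_ex _ _ (@proper_pinfty_nbhs R) _
    (filterI h (@nbhs_pinfty_gt R 1 (num_real 1))).
  by exists L.
exists L; first exact: ltW.
have per t : ch (c (t + 1)) (d (t + 1)) = ch (c t) (d t) by rewrite pc pd ch_mobius.
have pern t (n : nat) : ch (c (t + n%:R)) (d (t + n%:R)) = ch (c t) (d t).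
  elim: n => [|n IH]; first by rewrite addr0.
  by rewrite -natr1 addrA per.
move=> t; have /andP[f1 f2] := mem_rg1_floor t.
have hr : 0 <= t - (Num.floor t)%:~R <= 1 by apply/andP; split; lra.
suff -> : ch (c t) (d t) = ch (c (t - (Num.floor t)%:~R)) (d (t - (Num.floor t)%:~R)).
  by apply: hL; rewrite /= in_itv /=.
move: {f1 f2 hr} (Num.floor t) => [n|n].
- by rewrite -(pern (t - _) n) subrK.
- by rewrite NegzE mulrNz opprK -pmulrn pern.
Unshelve. all: by end_near. Qed.

Lemma clamp_le (u v d : R) : 0 <= d -> u - v <= d ->
  Num.max 0 (Num.min u 1) - Num.max 0 (Num.min v 1) <= d.
Proof.
move=> d0 uv; rewrite lerBlDl ge_max; apply/andP; split.
  by rewrite addr_ge0 // le_max lexx.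
have : Num.min v 1 <= Num.max 0 (Num.min v 1) by rewrite le_max lexx orbT.
by move: (Num.max _ _) => m; have [u1|u1] := leP u 1; have [v1|v1] := leP v 1; lra.
Qed.

(** [deck_const] is applied to the two ends of the homotopy and to the path traced by t = 0. By
    freeness the three resulting elements agree, so the two end curves share their period and stay
    at bounded distance. *)
Lemma homotopy_lift M l T d : \det M = 1 -> 0 < l -> Gamma T ->
  eq_pm T (M *m dg l *m invmx M) -> (forall t, halfplane (d t)) ->
  freely_homotopic Gamma (std M l) d -> exists d' : R -> R * R, [/\ forall t, halfplane (d' t), chcont d',
    forall t, same_point Gamma (d t) (d' t) &
    exists2 L, 1 <= L & forall t, ch (std M l t) (d' t) <= L].
Proof.
move=> dM l0 GT TM hdd [F [cF clF hc hd]].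
pose S := [set p : R * R | 0 <= p.1 <= 1].
have hF z : S z -> halfplane (F z).
  by case: z => u t /= hu; have [h _] := clF u hu; exact: h.
have cst (u : R) : ccont (fun t => (u, t)).
  by split; [exact: cst_continuous|move=> t; exact: cvg_id].
have s0 t : S (0, t) by rewrite /S /= lexx ler01.
have s1 t : S (1, t) by rewrite /S /= lexx ler01.
(* [deck_const] wants curves on the whole line, whereas F is controlled only for u in [0, 1]; hence
   the clamping. *)
pose cl (u : R) := Num.max 0 (Num.min u 1).
have scl u t : S (cl u, t).
  rewrite /S /= /cl le_max lexx /= ge_max ler01 /=.
  by rewrite ge_min lexx orbT.
have ccl t : ccont (fun u => (cl u, t)).
  split; last exact: cst_continuous.
  move=> u; apply/cvgrPdist_lt => e e0; exists e => // v hv.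
  apply: le_lt_trans (hv : `|u - v| < e); have /ler_normlP[a1 a2] := lexx `|u - v|.
  by apply/ler_normlP; rewrite /= /cl opprB; split; apply: clamp_le => //; rewrite -opprB.
have cc0 := cont_chcont cF (cst 0) s0 hF.
have cc1 := cont_chcont cF (cst 1) s1 hF.
have ccu t := cont_chcont cF (ccl t) (fun u => scl u t) hF.
have sh c : chcont c -> chcont (fun t => c (t + 1)).
  move=> h t n n0; have [e e0 he] := h (t + 1) n n0; exists e => // s hs.
  by apply: he; rewrite opprD addrACA subrr addr0.
have [B GB hB] := deck_const hG (fun t => std_half l t dM) (fun t => hF _ (s0 t))
  (std_chcont dM l0) cc0 hc.
have z01 : 0 <= (0 : R) <= 1 by rewrite lexx ler01.
have z11 : 0 <= (1 : R) <= 1 by rewrite lexx ler01.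
have [A0 GA0 hA0] := deck_const hG (fun t => hF _ (s0 t)) (fun t => hF _ (s0 (t + 1)))
  cc0 (sh _ cc0) (proj2 (clF 0 z01)).
have [A1 GA1 hA1] := deck_const hG (fun t => hF _ (s1 t)) (fun t => hF _ (s1 (t + 1)))
  cc1 (sh _ cc1) (proj2 (clF 1 z11)).
have [A GA hA] : exists2 A, Gamma A & forall u, F (cl u, 1) = mobius A (F (cl u, 0)).
  apply: (deck_const hG) (ccu 0) (ccu 1) _ => u; try exact: (hF _ (scl _ _)).
  have [_ h] := clF (cl u) (scl u 0).
  by have := h 0; rewrite add0r.
have cl0 : cl 0 = 0 by rewrite /cl min_l // max_l.
have cl1 : cl 1 = 1 by rewrite /cl min_l // max_r.
have e0 : eq_pm A0 A.
  apply: (freeG GA0 GA (hF _ (s0 0))).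
  by rewrite -hA0 add0r; have := hA 0; rewrite cl0.
have e1 : eq_pm A1 A.
  apply: (freeG GA1 GA (hF _ (s1 0))).
  by rewrite -hA1 add0r; have := hA 1; rewrite cl1.
have dB := hs_det hG GB; have dBi := det_invmx2 dB.
exists (fun t => mobius (invmx B) (F (1, t))); split.
- by move=> t; apply: mobius_half => //; exact: (hF _ (s1 t)).
- by apply: chcont_mobius => // t; exact: (hF _ (s1 t)).
- move=> t; have [D GD hD] := hd t; exists (invmx B *m D).
    exact: (hs_mul hG) (hs_inv hG GB) GD.
  have dD := hs_det hG GD; by rewrite mobius_mul // hD.
have [L L1 hL] := @periodic_bounded (fun t => F (0, t)) (fun t => F (1, t)) A
  (hs_det hG GA) (fun t => hF _ (s0 t)) (fun t => hF _ (s1 t)) cc0 cc1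
  (fun t => etrans (hA0 t) (mobius_pm _ e0)) (fun t => etrans (hA1 t) (mobius_pm _ e1)).
exists L => // t; rewrite -(ch_mobius dB (std_half l t dM) (mobius_half dBi (hF _ (s1 t)))).
by rewrite -hB mobiusVK //; exact: (hF _ (s1 t)).
Qed.
End Homotopy.

(** * Curves near two crossing geodesics meet *)

Section AxisCross.
Variables (R : realType) (g : nat) (Gamma : set 'M[R]_2).
Hypothesis hG : hyperbolic_surface g Gamma.
Implicit Types (A B M T : 'M[R]_2) (z w p : R * R) (c d : R -> R * R) (l t : R).

Lemma near_bounds z w L : halfplane z -> halfplane w -> ch z w <= L ->
  w.2 <= 2 * L * z.2 /\ (z.1 - w.1) ^+ 2 + z.2 ^+ 2 + w.2 ^+ 2 <= 2 * L * z.2 * w.2.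
Proof.
move=> hz hw; rewrite chE // ler_pdivrMr ?mulr_gt0 // => h.
have z0 : 0 < z.2 by []. have w0 : 0 < w.2 by [].
have k := sqr_ge0 (z.1 - w.1); have k2 := sqr_ge0 z.2.
have h' : (z.1 - w.1) ^+ 2 + z.2 ^+ 2 + w.2 ^+ 2 <= 2 * L * z.2 * w.2 by lra.
split => //; rewrite -(ler_pM2r w0) -expr2; lra.
Qed.

Lemma near_axis (q : R) z L : 0 < q -> halfplane z -> ch (0, q) z <= L ->
  [/\ q <= 2 * L * z.2, z.2 <= 2 * L * q, `|z.1| <= 2 * L * z.2 &
      z.1 ^+ 2 + z.2 ^+ 2 <= 2 * L * q * z.2].
Proof.
move=> q0 hz hL; have hq : halfplane (0, q) by [].
have [h1 h2] := near_bounds hq hz hL; rewrite chC in hL.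
have [h3 _] := near_bounds hz hq hL; rewrite /= in h1 h2 h3.
have z0 : 0 < z.2 by [].
have h4 : z.1 ^+ 2 + z.2 ^+ 2 <= 2 * L * q * z.2.
  by have := sqr_ge0 q; rewrite sub0r sqrrN in h2; lra.
have L0 : 0 < L.
  have : 0 < 2 * L * z.2 by apply: lt_le_trans q0 h3.
  by rewrite pmulr_lgt0 // pmulr_rgt0.
have k : 2 * L * z.2 * q <= 2 * L * z.2 * (2 * L * z.2) by rewrite ler_pM2l // !mulr_gt0.
have K0 : 0 < 2 * L * z.2 by rewrite !mulr_gt0.
have h5 : z.1 ^+ 2 + z.2 ^+ 2 <= 2 * L * z.2 * q by lra.
split => //; move: K0 k h5 (sqr_ge0 z.2); move: (2 * L * z.2) => K K0 k h5 k2.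
by rewrite ler_norml; apply/andP; split; rewrite leNgt; apply/negP => h; nra.
Qed.

(** As the height of z grows, B z tends to a/c, a real number of the sign of ac. The hypothesis
    makes z high enough for B z to have left, on the side given by the sign e, the cone of slope k
    about the axis. *)
Lemma re_large B z (k e : R) : \det B = 1 -> halfplane z -> 0 <= k -> e ^+ 2 = 1 ->
  1 / 2 + k < e * (B 0 0 * B 1 0) * z.2 ->
  k * (mobius B z).2 < e * (mobius B z).1.
Proof.
move=> dB hz k0 e1 h; have n0 := mden_gt0 dB hz; rewrite mobiusE /=.
rewrite !mulrA ltr_pM2r ?invr_gt0 //.
have := dB; rewrite det2E; move: hz h n0; rewrite /halfplane /mden /=.
move: z.1 z.2 (B 0 0) (B 0 1) (B 1 0) (B 1 1) => x y a b c d y0 h n0 d1.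
have c0 : c != 0.
  apply/eqP => c0; move: h; rewrite c0 !mulr0 mul0r; lra.
have cc : 0 < c ^+ 2 by rewrite exprn_even_gt0.
rewrite -(ltr_pM2l cc) -(ltr_pM2r y0).
have -> : c ^+ 2 * (e * (a * c * (x ^+ 2 + y ^+ 2) + (a * d + b * c) * x + b * d)) * y =
  (e * (a * c) * y) * ((c * x + d) ^+ 2 + (c * y) ^+ 2) - e * c * (c * x + d) * y * (a * d - b * c).
  by ring.
rewrite d1 mulr1.
have := sqr_ge0 (c * x + d - e * c * y).
have -> : (c * x + d - e * c * y) ^+ 2 = (c * x + d) ^+ 2 - 2 * (e * c * (c * x + d) * y)
   + e ^+ 2 * (c * y) ^+ 2 by ring.
rewrite e1 mul1r => q1.
have := ltr_pM2r n0 (1 / 2 + k) (e * (a * c) * y); rewrite h => q2.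
have := sqr_ge0 (c * x + d) => q3.
have : 0 <= k * (c * x + d) ^+ 2 by rewrite mulr_ge0.
lra.
Qed.

(** [re_large] for z near 0 instead of infinity: J is z |-> -1/z, which exchanges the two. *)
Lemma re_small B z (k e : R) : \det B = 1 -> halfplane z -> 0 <= k -> e ^+ 2 = 1 ->
  (1 / 2 + k) * (z.1 ^+ 2 + z.2 ^+ 2) < e * (B 0 1 * B 1 1) * z.2 ->
  k * (mobius B z).2 < e * (mobius B z).1.
Proof.
move=> dB hz k0 e1 h.
pose J : 'M[R]_2 := mx2 0 (-1) 1 0.
have dJ : \det J = 1 by rewrite det2E !mx2V; ring.
have dJi := det_invmx2 dJ.
have hJz := mobius_half dJi hz.
have [j1 j2 j3 j4] := invmx2E dJ.
have z0 : 0 < z.2 by [].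
have r0 : 0 < z.1 ^+ 2 + z.2 ^+ 2 by rewrite ltr_wpDl ?sqr_ge0 // exprn_gt0.
have e2 : (mobius (invmx J) z).2 = z.2 / (z.1 ^+ 2 + z.2 ^+ 2).
  rewrite mobiusE /mden j3 j4 /J !mx2V /=; congr (_ / _); ring.
have -> : mobius B z = mobius (B *m J) (mobius (invmx J) z).
  by rewrite mobius_mul // mobiusVK.
apply: re_large => //; first by rewrite det_mul1.
rewrite e2 !mul2E /J !mx2V mulrA ltr_pdivlMr //.
by rewrite !mulr0 !mulr1 !add0r.
Qed.

Lemma expR_big (l x : R) : 0 < l -> exists2 T : R, 0 < T & x < expR (l * T).
Proof.
move=> l0; exists ((`|x| + 1) / l); first by rewrite divr_gt0 // ltr_wpDl.
rewrite mulrCA mulfV ?gt_eqF // mulr1.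
by have := expR_ge1Dx (`|x| + 1); have := ler_norm x; lra.
Qed.

(** abcd < 0 means that the ends a/c and b/d of the image of the axis are separated by the axis.
    Being at bounded distance of the two geodesics, c stays in a cone while B d leaves that cone on
    either side, as [planar_cross] requires. *)
Lemma lift_cross B c d l1 l2 L1 L2 : \det B = 1 ->
  B 0 0 * B 1 0 * (B 0 1 * B 1 1) < 0 -> 0 < l1 -> 0 < l2 -> 1 <= L1 -> 1 <= L2 ->
  (forall t, halfplane (c t)) -> (forall t, halfplane (d t)) ->
  chcont c -> chcont d ->
  (forall t, ch (0, expR (l1 * t)) (c t) <= L1) ->
  (forall t, ch (0, expR (l2 * t)) (d t) <= L2) ->
  exists s t, c s = mobius B (d t).
Proof.
move=> dB hB l10 l20 L11 L21 hc hd cc cd hL1 hL2.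
pose Q t := mobius B (d t).
have hQ t : halfplane (Q t) by exact: mobius_half.
have cQ : chcont Q by exact: chcont_mobius.
have [p1 p2 p3] : [/\ 0 < 2 * L1, 0 < 2 * L2 & 0 < 1 / 2 + 2 * L1] by split; lra.
have k0 := ltW p1.
have [e [e2 ee ac bd]] : exists e : R, [/\ e ^+ 2 = 1, (e = 1) \/ (e = -1),
    0 < e * (B 0 0 * B 1 0) & 0 < - e * (B 0 1 * B 1 1)].
  have [h|h] := ltP 0 (B 0 0 * B 1 0).
    exists 1; rewrite expr1n; split => //; [by left|by rewrite mul1r|].
    by rewrite mulN1r oppr_gt0; rewrite pmulr_rlt0 in hB.
  exists (-1); rewrite sqrrN expr1n opprK; split => //; first by right.
    by rewrite mulN1r oppr_gt0 lt_neqAle h andbT; apply/eqP => h0; rewrite h0 mul0r ltxx in hB.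
  rewrite mul1r ltNge; apply/negP => h'.
  by have := mulr_le0 h h'; rewrite leNgt hB.
set ac_ := e * _ in ac; set bd_ := - e * _ in bd.
have cd0 : B 1 0 * B 1 1 != 0.
  apply/eqP => /eqP; rewrite mulf_eq0 => /orP[] /eqP h0; move: hB; rewrite h0.
  - by rewrite mulr0 mul0r ltxx.
  - by rewrite !mulr0 ltxx.
have hax t := @half_axis R (l2 * t).
(* As cd is not 0, the image of the axis is a half-circle, of height at most 1 / |cd|; [Ym] below
   allows for the distance of d to the axis. *)
have imB (q : R) : 0 < q -> (mobius B (0, q)).2 * `|B 1 0 * B 1 1| <= 1.
  move=> q0; rewrite mobiusE /mden /= mulr0 add0r mulrAC ler_pdivrMr.
    rewrite mul1r normrM; have := sqr_ge0 (`|B 1 1| - `|B 1 0| * q).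
    have -> : (`|B 1 1| - `|B 1 0| * q) ^+ 2 = `|B 1 1| ^+ 2 + `|B 1 0| ^+ 2 * q ^+ 2
       - 2 * (q * (`|B 1 0| * `|B 1 1|)) by ring.
    rewrite !real_normK ?num_real // exprMn => h.
    have : 0 <= q * (`|B 1 0| * `|B 1 1|) by rewrite !mulr_ge0 // ltW.
    lra.
  have := mden_gt0 dB (q0 : halfplane (0, q)); rewrite /mden /= mulr0 add0r //.
pose Ym := 2 * L2 / `|B 1 0 * B 1 1|.
have n0 : 0 < `|B 1 0 * B 1 1| by rewrite normr_gt0.
have hYm t : (Q t).2 <= Ym.
  have [h _] : (Q t).2 <= 2 * L2 * (mobius B (0, expR (l2 * t))).2 /\ True.
    split => //; apply: (proj1 (near_bounds _ _ _)); rewrite ?ch_mobius //.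
    exact: mobius_half.
  apply: le_trans h _; rewrite /Ym ler_pM2l //.
  by rewrite -[leRHS]mul1r ler_pdivlMr // imB // expR_gt0.
have [T T0 hT] := expR_big (2 * L2 * (1 / 2 + 2 * L1) * (ac_^-1 + bd_^-1)) l20.
have ib : 0 < bd_^-1 by rewrite invr_gt0.
have ia : 0 < ac_^-1 by rewrite invr_gt0.
set E := expR (l2 * T) in hT; have E0 : 0 < E by exact: expR_gt0.
have LL := mulr_gt0 p2 p3.
have hac : 2 * L2 * (1 / 2 + 2 * L1) < ac_ * E.
  by rewrite [ltRHS]mulrC -ltr_pdivrMr //; apply: lt_trans hT; rewrite ltr_pM2l //; lra.
have hbd : 2 * L2 * (1 / 2 + 2 * L1) < bd_ * E.
  by rewrite [ltRHS]mulrC -ltr_pdivrMr //; apply: lt_trans hT; rewrite ltr_pM2l //; lra.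
have QT : 2 * L1 * (Q T).2 < e * (Q T).1.
  apply: re_large => //; rewrite -/ac_.
  have [h _ _ _] := near_axis E0 (hd T) (hL2 T).
  rewrite -(ltr_pM2l p2); apply: lt_le_trans hac _.
  rewrite mulrCA ler_pM2l // mulrA; lra.
have QmT : 2 * L1 * (Q (- T)).2 < - e * (Q (- T)).1.
  apply: re_small => //; rewrite ?sqrrN // -/bd_.
  have E'0 : 0 < expR (l2 * - T) by exact: expR_gt0.
  have [_ _ _ h] := near_axis E'0 (hd (- T)) (hL2 (- T)).
  have hd0 : 0 < (d (- T)).2 by exact: hd.
  rewrite mulrN expRN -/E in h.
  rewrite -(ltr_pM2r E0) [ltRHS]mulrAC; apply: le_lt_trans (_ : (2 * L2 * (1 / 2 + 2 * L1)) * (d (- T)).2 < _).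
    have := ler_wpM2l (ltW p3) (ler_wpM2r (ltW E0) h).
    have -> : (1 / 2 + 2 * L1) * (2 * L2 / E * (d (- T)).2 * E) = 2 * L2 * (1 / 2 + 2 * L1) * (d (- T)).2.
      by field; rewrite gt_eqF.
    by rewrite mulrA.
  by rewrite ltr_pM2r.
(* m bounds from below the height of B d on [- T, T]. S is then taken so large that the ends of c
   clear the heights [Ym] and m. *)
pose m := (E^-1 / (B 1 1 ^+ 2 + B 1 0 ^+ 2 * E ^+ 2)) / (2 * L2).
have D0 : 0 < B 1 1 ^+ 2 + B 1 0 ^+ 2 * E ^+ 2.
  have d0 : B 1 1 != 0 by apply: contraNneq cd0 => ->; rewrite mulr0.
  by rewrite ltr_pwDl ?exprn_even_gt0 // mulr_ge0 ?sqr_ge0.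
have m0 : 0 < m by rewrite !divr_gt0 ?invr_gt0.
have hm t : - T <= t <= T -> m <= (Q t).2.
  move=> /andP[t1 t2].
  have : (mobius B (0, expR (l2 * t))).2 <= 2 * L2 * (Q t).2.
    have hch : ch (Q t) (mobius B (0, expR (l2 * t))) <= L2.
      by rewrite ch_mobius // chC.
    exact: (proj1 (near_bounds (hQ t) (mobius_half dB (hax t)) hch)).
  rewrite [leRHS]mulrC -ler_pdivrMr //.
  apply: le_trans; rewrite /m ler_pM2r ?invr_gt0 //.
  rewrite mobiusE /mden /= mulr0 add0r exprMn.
  have r1 : E^-1 <= expR (l2 * t).
    by rewrite /E -expRN ler_expR -mulrN ler_pM2l //; lra.
  have r2 : expR (l2 * t) <= E by rewrite /E ler_expR ler_pM2l.
  have q0 := expR_gt0 (l2 * t).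
  apply: ler_pM => //; first by rewrite invr_ge0 ltW.
    by rewrite invr_ge0 ltW.
  rewrite lef_pV2 ?posrE //; last first.
    have d0 : B 1 1 != 0 by apply: contraNneq cd0 => ->; rewrite mulr0.
    by rewrite ltr_pwDl ?exprn_even_gt0 // mulr_ge0 ?sqr_ge0.
  rewrite lerD2l ler_wpM2l ?sqr_ge0 // ler_pXn2r ?nnegrE // ltW //.
have [S S0 hS] := expR_big (2 * L1 * (Ym + m^-1)) l10.
have Ym0 : 0 < Ym by rewrite divr_gt0.
have im0 : 0 < m^-1 by rewrite invr_gt0.
set G := expR (l1 * S) in hS; have G0 : 0 < G by exact: expR_gt0.
have cS : Ym < (c S).2.
  have [h _ _ _] := near_axis G0 (hc S) (hL1 S).
  rewrite -(ltr_pM2l p1); apply: lt_le_trans h; apply: le_lt_trans hS.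
  by rewrite ler_pM2l // lerDl ltW.
have cmS : (c (- S)).2 < m.
  have G'0 : 0 < expR (l1 * - S) by exact: expR_gt0.
  have [_ h _ _] := near_axis G'0 (hc (- S)) (hL1 (- S)).
  apply: le_lt_trans h _; rewrite mulrN expRN -/G ltr_pdivrMr // [ltRHS]mulrC -ltr_pdivrMr //.
  by apply: lt_trans hS; rewrite ltr_pM2l // ltrDr.
have csec s : `|(c s).1| <= 2 * L1 * (c s).2.
  by have [_ _ h _] := near_axis (expR_gt0 _) (hc s) (hL1 s).
have cc' := chcont_ccont hc cc.
(* If ac < 0 the second curve is run backwards, so that it ends on the sides expected by
   [planar_cross]. *)
have fin (f : R) (Q' := fun t => Q (f * t)) : (f = 1 \/ f = -1) -> f = e -> exists s t, c s = Q t.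
  move=> ff fe.
  have fT t : - T <= t <= T -> - T <= f * t <= T.
    by clear -ff; case: ff => -> /andP[? ?]; apply/andP; split; lra.
  have cQ' : chcont Q'.
    move=> t n n0'; have [r r0 hr] := cQ (f * t) n n0'; exists r => // s hs.
    by apply: hr; rewrite -mulrBr normrM; case: ff => ->; rewrite ?normrN normr1 mul1r.
  have [s [t hst]] : exists s t, c s = Q' t.
    apply: (@planar_cross R c Q' S T (2 * L1)) => //.
    - exact: (chcont_ccont (fun t => hQ (f * t))).
    - by move=> t _; apply: le_lt_trans cS; exact: hYm.
    - by move=> t ht; apply: lt_le_trans cmS _; exact/hm/fT.
    - move=> s _; have := csec s; rewrite ler_norml => /andP[g1 g2].
      rewrite /Q'; clear -ff fe QT QmT g1 g2.
      by case: ff => fE; rewrite -fe fE in QT QmT; rewrite fE ?mul1r ?mulN1r; lra.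
    - move=> s _; have := csec s; rewrite ler_norml => /andP[g1 g2].
      rewrite /Q'; clear -ff fe QT QmT g1 g2.
      by case: ff => fE; rewrite -fe fE in QT QmT; rewrite fE ?mul1r ?mulN1r ?opprK; lra.
  by exists s, (f * t).
exact: (fin e ee erefl).
Qed.
End AxisCross.

Section AxisIntersect.
Variables (R : realType) (g : nat) (Gamma : set 'M[R]_2).
Hypothesis hG : hyperbolic_surface g Gamma.
Implicit Types (A B M T : 'M[R]_2) (z w p : R * R) (c d : R -> R * R) (l t : R).

Lemma closed_in_shift d (n : int) t : closed_in Gamma d ->
  same_point Gamma (d t) (d (t + n%:~R)).
Proof.
move=> [hd sd]; have trans z w v : halfplane z ->
    same_point Gamma z w -> same_point Gamma w v -> same_point Gamma z v.
  move=> hz [A GA ->] [B GB ->]; exists (B *m A); first exact: (hs_mul hG).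
  by rewrite mobius_mul // ?(hs_det hG GA) ?(hs_det hG GB).
have sym z w : halfplane z -> same_point Gamma z w -> same_point Gamma w z.
  move=> hz [A GA ->]; exists (invmx A); first exact: (hs_inv hG).
  by rewrite mobiusK // (hs_det hG GA).
have pos (k : nat) s : same_point Gamma (d s) (d (s + k%:R)).
  elim: k => [|k IH]; first by rewrite addr0; exists 1%:M; [exact: (hs_one hG)|rewrite mobius1].
  by apply: trans IH _ => //; rewrite -natr1 addrA.
case: n => n; first by rewrite -pmulrn; exact: pos.
rewrite NegzE mulrNz -pmulrn; apply: sym => //.
by have := pos n.+1 (t - n.+1%:R); rewrite subrK.
Qed.

Lemma axis_intersect M1 l1 T1 M2 l2 T2 A d1 d2 :
  \det M1 = 1 -> 0 < l1 -> Gamma T1 -> eq_pm T1 (M1 *m dg l1 *m invmx M1) ->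
  \det M2 = 1 -> 0 < l2 -> Gamma T2 -> eq_pm T2 (M2 *m dg l2 *m invmx M2) ->
  Gamma A -> let B := invmx M1 *m A *m M2 in
  B 0 0 * B 1 0 * (B 0 1 * B 1 1) < 0 ->
  closed_in Gamma d1 -> closed_in Gamma d2 ->
  freely_homotopic Gamma (std M1 l1) d1 -> freely_homotopic Gamma (std M2 l2) d2 ->
  exists u : R * R, intersections Gamma d1 d2 u.
Proof.
move=> dM1 l10 GT1 TM1 dM2 l20 GT2 TM2 GA B hB cl1 cl2 h1 h2.
have [hd1 sd1] := cl1; have [hd2 sd2] := cl2.
have [c [hc cc sc [L1 L11 hL1]]] := homotopy_lift hG dM1 l10 GT1 TM1 hd1 h1.
have [d [hd cd sd [L2 L21 hL2]]] := homotopy_lift hG dM2 l20 GT2 TM2 hd2 h2.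
have dA := hs_det hG GA.
have dM1i := det_invmx2 dM1; have dM2i := det_invmx2 dM2.
have dB : \det B = 1 by rewrite /B !det_mul1.
have [||||s [t e]] := @lift_cross R B (fun t => mobius (invmx M1) (c t))
   (fun t => mobius (invmx M2) (d t)) l1 l2 L1 L2 dB hB l10 l20 L11 L21
   (fun t => mobius_half dM1i (hc t)) (fun t => mobius_half dM2i (hd t)).
- exact: chcont_mobius.
- exact: chcont_mobius.
- move=> t; rewrite -(ch_mobius dM1 (half_axis _) (mobius_half dM1i (hc t))) mobiusVK //.
  exact: hL1.
- move=> t; rewrite -(ch_mobius dM2 (half_axis _) (mobius_half dM2i (hd t))) mobiusVK //.
  exact: hL2.
have {}e : c s = mobius A (d t).
  rewrite -(mobiusVK dM1 (hc s)) e /B mobius_mul ?det_mul1 ?mobiusVK //; last exact: mobius_half.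
  rewrite mobius_mul // mobiusVK //; exact: mobius_half.
have trans z w v : halfplane z ->
    same_point Gamma z w -> same_point Gamma w v -> same_point Gamma z v.
  move=> hz [D GD ->] [E GE ->]; exists (E *m D); first exact: (hs_mul hG).
  by rewrite mobius_mul // ?(hs_det hG GD) ?(hs_det hG GE).
have sym z w : halfplane z -> same_point Gamma z w -> same_point Gamma w z.
  move=> hz [D GD ->]; exists (invmx D); first exact: (hs_inv hG).
  by rewrite mobiusK // (hs_det hG GD).
have st : same_point Gamma (d1 s) (d2 t).
  apply: (trans _ _ _ (hd1 s) (sc s)); apply: (trans _ (d t)) => //; last exact: (sym _ _ (hd2 t)).
  by apply: sym => //; rewrite e; exists A.
have /andP[f1 f2] := mem_rg1_floor s; have /andP[g1 g2] := mem_rg1_floor t.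
exists (s - (Num.floor s)%:~R, t - (Num.floor t)%:~R); split => /=.
- by apply/andP; split; lra.
- by apply/andP; split; lra.
- have := closed_in_shift (- Num.floor s) s cl1; rewrite mulrNz => h3.
  have := closed_in_shift (- Num.floor t) t cl2; rewrite mulrNz => h4.
  by apply: (trans _ (d1 s)) => //; [exact: sym|exact: (trans _ (d2 t))].
Qed.
End AxisIntersect.

(** * Covering by triangles, packing and the systole *)

Section Covering.
Variables (R : realType) (g : nat) (Gamma : set 'M[R]_2).
Hypothesis hG : hyperbolic_surface g Gamma.
Implicit Types (A B M T : 'M[R]_2) (z w p q a b c x : R * R).

(* The Minkowski model: z is sent to the form (1, x, |z|^2) / y, and polar p
   is the linear projection of forms with kernel the line of p. *)
Definition polar p z : R * R :=
  ((z.1 - p.1) / z.2, ((z.1 - p.1) ^+ 2 + z.2 ^+ 2 - p.2 ^+ 2) / z.2).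

(* In the Minkowski model, q is in the cone spanned by x, a and b. *)
Definition triangle x a b q := exists al be ga : R,
  [/\ [/\ 0 <= al, 0 <= be & 0 <= ga],
   al / x.2 + be / a.2 + ga / b.2 = 1 / q.2,
   al * (x.1 / x.2) + be * (a.1 / a.2) + ga * (b.1 / b.2) = q.1 / q.2 &
   al * ((x.1 ^+ 2 + x.2 ^+ 2) / x.2) + be * ((a.1 ^+ 2 + a.2 ^+ 2) / a.2)
     + ga * ((b.1 ^+ 2 + b.2 ^+ 2) / b.2) = (q.1 ^+ 2 + q.2 ^+ 2) / q.2].

(** Balls are convex: [ch z] is linear in the Minkowski vector of its second argument, and la times
    the vector of p is a combination of those of a, b, c whose weights sum to at most la, as
    evaluation at p itself shows. *)
Lemma hull0_ball p a b c z D : halfplane p -> halfplane a -> halfplane b ->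
  halfplane c -> halfplane z -> hull0 (polar p a) (polar p b) (polar p c) ->
  ch z a <= D -> ch z b <= D -> ch z c <= D -> ch z p <= D.
Proof.
move=> hp ha hb hc hz [al [be [ga [h1 h2 h3 h4]]]].
rewrite /polar /=.
have p0 : 0 < p.2 by []. have a0 : 0 < a.2 by []. have b0 : 0 < b.2 by [].
have c0 : 0 < c.2 by []. have z0 : 0 < z.2 by [].
have pa := ch_ge1 hp ha; have pb := ch_ge1 hp hb; have pc := ch_ge1 hp hc.
move=> [e1 e2] za zb zc.
set X := ((a.1 - p.1) / a.2) in e1; set Y := ((b.1 - p.1) / b.2) in e1.
set Z := ((c.1 - p.1) / c.2) in e1.
set X' := (_ / a.2) in e2; set Y' := (_ / b.2) in e2; set Z' := (_ / c.2) in e2.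
pose la := (al / a.2 + be / b.2 + ga / c.2) * p.2.
have form w d : halfplane w -> halfplane d -> ch w d =
    ((w.1 - p.1) ^+ 2 + w.2 ^+ 2 + p.2 ^+ 2) / (2 * w.2) / d.2
    + ((d.1 - p.1) ^+ 2 + d.2 ^+ 2 - p.2 ^+ 2) / d.2 / (2 * w.2)
    - (w.1 - p.1) / w.2 * ((d.1 - p.1) / d.2).
  move=> hw hd; rewrite chE //; have w0 : 0 < w.2 by []. have d0 : 0 < d.2 by [].
  by field; rewrite !gt_eqF.
have lin w : halfplane w -> al * ch w a + be * ch w b + ga * ch w c = la * ch w p.
  move=> hw; rewrite (form w a) // (form w b) // (form w c) // -/X -/Y -/Z -/X' -/Y' -/Z'.
  rewrite (form w p) // subrr expr0n /= add0r subrr !mul0r mulr0 addr0 subr0.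
  have w0 : 0 < w.2 by [].
  set K := (_ / (2 * w.2)); set H := (_ / w.2).
  transitivity (K * (al / a.2 + be / b.2 + ga / c.2)
    + (al * X' + be * Y' + ga * Z') / (2 * w.2) - H * (al * X + be * Y + ga * Z)).
    by ring.
  by rewrite e1 e2 mul0r mulr0 subr0 addr0 /la; field; rewrite !gt_eqF.
have l1 := lin p hp; rewrite chzz mulr1 in l1.
have lz := lin z hz.
have k1 := ler_wpM2l h1 pa; have k2 := ler_wpM2l h2 pb; have k3 := ler_wpM2l h3 pc.
have k4 := ler_wpM2l h1 za; have k5 := ler_wpM2l h2 zb; have k6 := ler_wpM2l h3 zc.
have la0 : 0 < la by lra.
rewrite -(ler_pM2l la0) -lz.
have D0 : 0 <= D by have := ch_ge1 hz ha; lra.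
have : (al + be + ga) * D <= la * D by apply: ler_wpM2r => //; lra.
lra.
Qed.

Lemma add3_eq0 (x y z : R) : 0 <= x -> 0 <= y -> 0 <= z -> x + y + z = 0 ->
  [/\ x = 0, y = 0 & z = 0].
Proof. by move=> x0 y0 z0 e; split; lra. Qed.

Lemma hull0_triangle p x a b A : \det A = 1 -> halfplane p -> halfplane x ->
  halfplane a -> halfplane b ->
  hull0 (polar p (mobius A x)) (polar p (mobius A a)) (polar p (mobius A b)) ->
  triangle x a b (mobius (invmx A) p).
Proof.
move=> dA hp hx ha hb [al [be [ga [h1 h2 h3 h4]]]].
have dAi := det_invmx2 dA.
have hq := mobius_half dAi hp.
set q := mobius (invmx A) p in hq *.
have ep : p = mobius A q by rewrite /q mobiusVK.
clearbody q.
have x0 : 0 < x.2 by []. have a0 : 0 < a.2 by []. have b0 : 0 < b.2 by []. have q0 : 0 < q.2 by [].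
have nx := mden_gt0 dA hx; have na := mden_gt0 dA ha; have nb := mden_gt0 dA hb; have nq := mden_gt0 dA hq.
have d1 := dA; rewrite det2E in d1.
(* F0, F1, F2 are the Minkowski coordinates 1 / y, x / y, |z|^2 / y of the point A z; they are
   linear in those of z and satisfy F1^2 + 1 = F0 F2. *)
pose F0 z := mden A z / z.2.
pose F1 z := (A 0 0 * A 1 0 * (z.1 ^+ 2 + z.2 ^+ 2)
    + (A 0 0 * A 1 1 + A 0 1 * A 1 0) * z.1 + A 0 1 * A 1 1) / z.2.
pose F2 z := ((A 0 0 * z.1 + A 0 1) ^+ 2 + A 0 0 ^+ 2 * z.2 ^+ 2) / z.2.
have p1 : p.1 = F1 q / F0 q.
  by rewrite ep mobiusE /F1 /F0 /=; field; rewrite !gt_eqF.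
have n2 z : F1 z ^+ 2 + 1 = F0 z * F2 z \/ z.2 = 0.
  have [z0|z0] := eqVneq z.2 0; [by right|left].
  rewrite /F1 /F0 /F2 /mden.
  transitivity (((A 0 0 * A 1 0 * (z.1 ^+ 2 + z.2 ^+ 2)
    + (A 0 0 * A 1 1 + A 0 1 * A 1 0) * z.1 + A 0 1 * A 1 1) ^+ 2
    + ((A 0 0 * A 1 1 - A 0 1 * A 1 0) * z.2) ^+ 2) / z.2 ^+ 2).
    by rewrite d1; field.
  by field.
have pol z : halfplane z -> polar p (mobius A z) = (F1 z - p.1 * F0 z,
    F2 z - 2 * p.1 * F1 z + (p.1 ^+ 2 - p.2 ^+ 2) * F0 z).
  move=> hz; have z0 : 0 < z.2 by []. have nz := mden_gt0 dA hz.
  have e1 : (mobius A z).1 = F1 z / F0 z.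
    by rewrite mobiusE /F1 /F0 /=; field; rewrite !gt_eqF.
  have e2 : (mobius A z).2 = (F0 z)^-1 by rewrite mobiusE /F0 /= invf_div.
  have F00 : F0 z != 0 by rewrite /F0 mulf_neq0 ?invr_neq0 ?gt_eqF.
  have [n2z|n2z] := n2 z; last by rewrite n2z ltxx in z0.
  have F2E : F2 z = (F1 z ^+ 2 + 1) / F0 z by rewrite n2z mulrC mulKf.
  by rewrite /polar e1 e2 F2E; congr pair; field.
rewrite !pol // /= => -[e1 e2].
have p2 : p.1 ^+ 2 + p.2 ^+ 2 = F2 q / F0 q.
  have F00 : F0 q != 0 by rewrite /F0 mulf_neq0 ?invr_neq0 ?gt_eqF.
  have [n2z|n2z] := n2 q; last by rewrite n2z ltxx in q0.
  rewrite p1 (_ : p.2 = (F0 q)^-1).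
    transitivity ((F1 q ^+ 2 + 1) / F0 q ^+ 2); first by field.
    by rewrite n2z; field.
  by rewrite ep mobiusE /F0 /= invf_div.
set C0 := al * F0 x + be * F0 a + ga * F0 b.
set C1 := al * F1 x + be * F1 a + ga * F1 b.
set C2 := al * F2 x + be * F2 a + ga * F2 b.
have c1 : C1 = p.1 * C0 by rewrite /C1 /C0; lra.
have c2 : C2 = (p.1 ^+ 2 + p.2 ^+ 2) * C0.
  have : C2 - 2 * p.1 * C1 + (p.1 ^+ 2 - p.2 ^+ 2) * C0 = 0.
    by rewrite /C2 /C1 /C0; lra.
  by rewrite c1; lra.
have F0q : 0 < F0 q by rewrite divr_gt0.
pose la := C0 / F0 q.
have c0 : C0 = la * F0 q by rewrite /la divfK // gt_eqF.
have {}c1 : C1 = la * F1 q by rewrite c1 p1 c0; field; rewrite gt_eqF.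
have {}c2 : C2 = la * F2 q by rewrite c2 p2 c0; field; rewrite gt_eqF.
(* Apply the inverse of A to the forms. *)
have f0 z : 0 < z.2 -> A 1 0 ^+ 2 * F2 z - 2 * (A 0 0 * A 1 0) * F1 z + A 0 0 ^+ 2 * F0 z = 1 / z.2.
  move=> z0; rewrite /F0 /F1 /F2 /mden.
  transitivity ((A 0 0 * A 1 1 - A 0 1 * A 1 0) ^+ 2 / z.2); last by rewrite d1 expr1n.
  by field; rewrite gt_eqF.
have f1 z : 0 < z.2 -> - (A 1 1 * A 1 0) * F2 z + (A 0 0 * A 1 1 + A 0 1 * A 1 0) * F1 z
     - (A 0 0 * A 0 1) * F0 z = z.1 / z.2.
  move=> z0; rewrite /F0 /F1 /F2 /mden.
  transitivity ((A 0 0 * A 1 1 - A 0 1 * A 1 0) ^+ 2 * z.1 / z.2); last by rewrite d1 expr1n mul1r.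
  by field; rewrite gt_eqF.
have f2 z : 0 < z.2 -> A 1 1 ^+ 2 * F2 z - 2 * (A 0 1 * A 1 1) * F1 z + A 0 1 ^+ 2 * F0 z
    = (z.1 ^+ 2 + z.2 ^+ 2) / z.2.
  move=> z0; rewrite /F0 /F1 /F2 /mden.
  transitivity ((A 0 0 * A 1 1 - A 0 1 * A 1 0) ^+ 2 * (z.1 ^+ 2 + z.2 ^+ 2) / z.2).
    by field; rewrite gt_eqF.
  by rewrite d1 expr1n mul1r.
have g0 : al / x.2 + be / a.2 + ga / b.2 = la / q.2.
  transitivity (A 1 0 ^+ 2 * C2 - 2 * (A 0 0 * A 1 0) * C1 + A 0 0 ^+ 2 * C0).
    transitivity (al * (1 / x.2) + be * (1 / a.2) + ga * (1 / b.2)); first by rewrite !mul1r.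
    by rewrite -f0 // -f0 // -f0 // /C0 /C1 /C2; ring.
  transitivity (la * (1 / q.2)); last by rewrite mul1r.
  by rewrite -f0 // c0 c1 c2; ring.
have g1 : al * (x.1 / x.2) + be * (a.1 / a.2) + ga * (b.1 / b.2) = la * (q.1 / q.2).
  transitivity (- (A 1 1 * A 1 0) * C2 + (A 0 0 * A 1 1 + A 0 1 * A 1 0) * C1 - (A 0 0 * A 0 1) * C0).
    by rewrite -f1 // -f1 // -f1 // /C0 /C1 /C2; ring.
  by rewrite -f1 // c0 c1 c2; ring.
have g2 : al * ((x.1 ^+ 2 + x.2 ^+ 2) / x.2) + be * ((a.1 ^+ 2 + a.2 ^+ 2) / a.2)
    + ga * ((b.1 ^+ 2 + b.2 ^+ 2) / b.2) = la * ((q.1 ^+ 2 + q.2 ^+ 2) / q.2).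
  transitivity (A 1 1 ^+ 2 * C2 - 2 * (A 0 1 * A 1 1) * C1 + A 0 1 ^+ 2 * C0).
    by rewrite -f2 // -f2 // -f2 // /C0 /C1 /C2; ring.
  by rewrite -f2 // c0 c1 c2; ring.
have xa : 0 <= al / x.2 by rewrite divr_ge0 // ltW.
have ba : 0 <= be / a.2 by rewrite divr_ge0 // ltW.
have gb : 0 <= ga / b.2 by rewrite divr_ge0 // ltW.
have la0 : 0 < la.
  rewrite -(@pmulr_lgt0 _ q.2^-1) ?invr_gt0 // -g0 lt_neqAle !addr_ge0 // andbT eq_sym.
  apply/negP => /eqP l0.
  have [/eqP + /eqP + /eqP] := add3_eq0 xa ba gb l0.
  rewrite !mulf_eq0 !invr_eq0 !(gt_eqF a0, gt_eqF b0, gt_eqF x0) !orbF.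
  by move=> /eqP al0 /eqP be0 /eqP ga0; move: h4; rewrite ga0 be0 al0 !addr0 ltxx.
have ln : la != 0 by rewrite gt_eqF.
exists (al / la), (be / la), (ga / la); split.
- by split; apply: divr_ge0 => //; exact: ltW.
- transitivity ((al / x.2 + be / a.2 + ga / b.2) / la); first by ring.
  by rewrite g0; field; rewrite ln gt_eqF.
- transitivity ((al * (x.1 / x.2) + be * (a.1 / a.2) + ga * (b.1 / b.2)) / la); first by ring.
  by rewrite g1 mulrAC divff // mul1r.
- transitivity ((al * ((x.1 ^+ 2 + x.2 ^+ 2) / x.2) + be * ((a.1 ^+ 2 + a.2 ^+ 2) / a.2)
    + ga * ((b.1 ^+ 2 + b.2 ^+ 2) / b.2)) / la); first by ring.
  by rewrite g2 mulrAC divff // mul1r.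
Qed.
End Covering.

(** * Winding in the Cayley graph of the surface group *)

Section Potential.
Variables (R : realType) (g : nat) (Gamma : set 'M[R]_2).
Hypothesis hG : hyperbolic_surface g Gamma.
Variable gen : 'I_g * bool -> 'M[R]_2.
Hypothesis gen_in : forall x, Gamma (gen x).
Hypothesis gen_surj : forall A, Gamma A -> exists w, eq_pm A (word_eval gen w).
Hypothesis gen_rel : forall v w,
  eq_pm (word_eval gen v) (word_eval gen w) <-> surface_word_eq v w.
Variables (z0 p : R * R).
Hypotheses (hz0 : halfplane z0) (hp : halfplane p).
Implicit Types (A B M T : 'M[R]_2) (u v w : seq (surface_letter g)) (x : surface_letter g).

Definition letter x : 'M[R]_2 := if x.2 then invmx (gen x.1) else gen x.1.
Notation ev := (word_eval gen).

Lemma mobiusG_half A z : Gamma A -> halfplane z -> halfplane (mobius A z).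
Proof. move=> GA; exact: (mobius_half (hs_det hG GA)). Qed.

Lemma ev_nil : ev [::] = 1%:M. Proof. by rewrite /word_eval big_nil. Qed.
Lemma ev_cons x w : ev (x :: w) = letter x *m ev w.
Proof. by rewrite /word_eval big_cons. Qed.
Lemma ev_cat u v : ev (u ++ v) = ev u *m ev v.
Proof. by rewrite /word_eval big_cat. Qed.

Lemma letter_in x : Gamma (letter x).
Proof. by rewrite /letter; case: x.2; [apply: (hs_inv hG)|]; exact: gen_in. Qed.

Lemma ev_in w : Gamma (ev w).
Proof.
elim: w => [|x w IH]; first by rewrite ev_nil; exact: (hs_one hG).
by rewrite ev_cons; exact: (hs_mul hG) (letter_in x) IH.
Qed.

Lemma letterV x : letter x *m letter (letter_inv x) = 1%:M.
Proof.
have dx := hs_det hG (gen_in x.1).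
by rewrite /letter /=; case: x.2 => /=; rewrite ?mulVmx ?mulmxV ?unit2.
Qed.

Lemma relator1 : eq_pm (ev (surface_relator g)) 1%:M.
Proof.
rewrite -ev_nil; apply/gen_rel.
by have := @swe_relator g [::] [::]; rewrite /= cats0.
Qed.

Definition vertex A := polar p (mobius A z0).

Lemma vertex_pm A B : eq_pm A B -> vertex A = vertex B.
Proof. by move=> h; rewrite /vertex (mobius_pm _ h). Qed.

(* Winding around p of the path of the Cayley graph from A labelled by w. *)
Fixpoint winding A w : R :=
  if w is x :: w' then cr (vertex A) (vertex (A *m letter x)) + winding (A *m letter x) w'
  else 0.

Lemma winding_cat A u v : winding A (u ++ v) = winding A u + winding (A *m ev u) v.
Proof.
elim: u A => [|x u IH] A /=; first by rewrite ev_nil mulmx1 add0r.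
by rewrite IH ev_cons mulmxA addrA.
Qed.

Lemma winding_pm A B w : eq_pm A B -> winding A w = winding B w.
Proof.
elim: w A B => [//|x w IH] A B h /=.
have h' := eq_pm_mulr (letter x) h.
by rewrite (vertex_pm h) (vertex_pm h') (IH _ _ h').
Qed.

Definition relator_vertex (k : nat) := mobius (ev (take k (surface_relator g))) z0.

Lemma ev_half w : halfplane (mobius (ev w) z0).
Proof. exact: mobiusG_half (ev_in w) hz0. Qed.

(* To be refuted: the 4g triangles over the edges of the relator polygon, with
   apex z0, have translates covering the half-plane. *)
Hypothesis uncovered : forall A k, Gamma A -> (k < size (surface_relator g))%N ->
  ~ triangle z0 (relator_vertex k) (relator_vertex k.+1) (mobius A p).

(** The relator path is coned off from the vertex A. None of the cone triangles contains p by
    [uncovered], so the crossings telescope. *)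
Lemma winding_fan A u v : Gamma A -> surface_relator g = u ++ v ->
  winding (A *m ev u) v = cr (vertex (A *m ev u)) (vertex A)
                        - cr (vertex (A *m ev (u ++ v))) (vertex A).
Proof.
move=> GA; elim: v u => [|x v IH] u hr; first by rewrite cats0 subrr.
have hr' : surface_relator g = (u ++ [:: x]) ++ v by rewrite -catA.
have e1 : A *m ev u *m letter x = A *m ev (u ++ [:: x]).
  by rewrite ev_cat ev_cons ev_nil mulmx1 mulmxA.
rewrite /= e1 (IH _ hr') -catA /=.
suff : cr (vertex A) (vertex (A *m ev u)) + cr (vertex (A *m ev u)) (vertex (A *m ev (u ++ [:: x])))
   + cr (vertex (A *m ev (u ++ [:: x]))) (vertex A) = 0.
  by rewrite (cr_anti (vertex (A *m ev u)) (vertex A)); lra.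
apply/eqP; apply: contrapT => /negP /cr_sum h.
have dA := hs_det hG GA.
have su : (size u < size (surface_relator g))%N.
  by rewrite hr size_cat /= -addSnnS leq_addr.
apply: (uncovered (hs_inv hG GA) su).
have -> : relator_vertex (size u) = mobius (ev u) z0.
  by rewrite /relator_vertex hr take_size_cat.
have -> : relator_vertex (size u).+1 = mobius (ev (u ++ [:: x])) z0.
  by rewrite /relator_vertex hr' take_size_cat // size_cat /= addn1.
apply: (hull0_triangle dA hp hz0 (ev_half _) (ev_half _)).
by rewrite -!mobius_mul // (hs_det hG (ev_in _)).
Qed.

Lemma winding_relator A : Gamma A -> winding A (surface_relator g) = 0.
Proof.
move=> GA; have := winding_fan (u := [::]) GA erefl.
rewrite ev_nil mulmx1 /= => ->.
have h := eq_pm_mull A relator1; rewrite mulmx1 in h.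
by rewrite (vertex_pm h) subrr.
Qed.

Lemma winding_eq u v : surface_word_eq u v -> forall A, Gamma A -> winding A u = winding A v.
Proof.
elim=> {u v} [//|u v _ IH A GA|u v w _ IH1 _ IH2 A GA|u v x A GA|u v A GA].
- by rewrite IH.
- by rewrite IH1 // IH2.
- rewrite !winding_cat /=; congr (_ + _).
  rewrite ev_cons ev_cons ev_nil mulmx1 letterV mulmx1 -(mulmxA _ (letter x)) letterV mulmx1.
  by rewrite (cr_anti (vertex (A *m ev u))) addr0 subrr add0r.
- rewrite !winding_cat winding_relator ?add0r; last exact: (hs_mul hG) GA (ev_in u).
  congr (_ + _); apply: winding_pm.
  by have := eq_pm_mull (A *m ev u) relator1; rewrite mulmx1.
Qed.

(** Since relators have winding 0, the winding of a path depends only on its ends; psi is the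
    winding from the identity along a chosen word. *)
Lemma potential : exists psi : 'M[R]_2 -> R,
  (forall A B, Gamma A -> Gamma B -> eq_pm A B -> psi A = psi B) /\
  forall A w, Gamma A -> psi (A *m ev w) = psi A + winding A w.
Proof.
have [f hf] : {f : 'M[R]_2 -> seq (surface_letter g) | forall A, Gamma A -> eq_pm A (ev (f A))}.
  have /choice[f hf] : forall A, exists w, Gamma A -> eq_pm A (ev w).
    move=> A; have [GA|nA] := pselect (Gamma A); last by exists [::].
    by have [w hw] := gen_surj GA; exists w.
  by apply: constructive_indefinite_description; exists f.
exists (fun A => winding 1%:M (f A)); split=> [A B GA GB AB|A w GA].
  apply: winding_eq (hs_one hG); apply/gen_rel.
  exact: eq_pm_trans (eq_pm_sym (hf _ GA)) (eq_pm_trans AB (hf _ GB)).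
have GAw : Gamma (A *m ev w) by exact: (hs_mul hG) GA (ev_in w).
have h : surface_word_eq (f (A *m ev w)) (f A ++ w).
  apply/gen_rel; apply: eq_pm_trans (eq_pm_sym (hf _ GAw)) _.
  by rewrite ev_cat; exact: eq_pm_mulr (hf _ GA).
rewrite (winding_eq h (hs_one hG)) winding_cat mul1mx; congr (_ + _).
exact/winding_pm/eq_pm_sym/hf.
Qed.

Fixpoint in_ball (c : R * R) (D : R) A w : Prop :=
  ch c (mobius A z0) <= D /\
  (if w is x :: w' then in_ball c D (A *m letter x) w' else True).

Lemma in_ball_mono c D D' A w : D <= D' -> in_ball c D A w -> in_ball c D' A w.
Proof.
move=> DD; elim: w A => [|x w IH] A /= [h1 h2]; split; try exact: le_trans h1 DD; last by exact: IH.
by [].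
Qed.

Lemma in_ball_ex c A w : exists D, in_ball c D A w.
Proof.
elim: w A => [|x w IH] A /=; first by exists (ch c (mobius A z0)).
have [D hD] := IH (A *m letter x).
exists (Num.max (ch c (mobius A z0)) D); rewrite le_max lexx; split => //.
by apply: in_ball_mono hD; rewrite le_max lexx orbT.
Qed.

Lemma in_ball_mobius c D A B w : halfplane c -> Gamma A -> Gamma B ->
  in_ball c D A w -> in_ball (mobius B c) D (B *m A) w.
Proof.
move=> hc GA GB; have dB := hs_det hG GB.
have e A' : Gamma A' -> ch (mobius B c) (mobius (B *m A') z0) = ch c (mobius A' z0).
  move=> GA'; rewrite (mobius_mul dB (hs_det hG GA') hz0) ch_mobius //.
  exact: mobiusG_half GA' hz0.
elim: w A GA => [|x w IH] A GA /= [h1 h2]; rewrite e //; split => //.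
by rewrite -mulmxA; apply: IH h2; exact: (hs_mul hG) GA (letter_in x).
Qed.

(** The path stays in a ball missing p, which is convex by [hull0_ball], so it may be replaced by
    the chord between its ends. *)
Lemma winding_ball c D A w : halfplane c -> Gamma A -> in_ball c D A w -> D < ch c p ->
  winding A w = cr (vertex A) (vertex (A *m ev w)).
Proof.
move=> hc GA hb hD; have hA : halfplane (mobius A z0) by exact: mobiusG_half GA hz0.
suff : forall u v, w = u ++ v -> in_ball c D (A *m ev u) v ->
    winding (A *m ev u) v = cr (vertex A) (vertex (A *m ev w)) - cr (vertex A) (vertex (A *m ev u)).
  move=> /(_ [::] w erefl); rewrite ev_nil mulmx1 => -> //.
  by rewrite (@cr_same R (vertex A) (vertex A)) // subr0.
have hA0 : ch c (mobius A z0) <= D by case: (w) hb => [|? ?] [].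
move=> u v; elim: v u => [|x v IH] u e; first by rewrite e cats0 /= subrr.
move=> /= [h1 h2].
have e1 : A *m ev u *m letter x = A *m ev (u ++ [:: x]).
  by rewrite ev_cat ev_cons ev_nil mulmx1 mulmxA.
rewrite e1 in h2 *; rewrite (IH (u ++ [:: x])) //; last by rewrite e -catA.
have h3 : ch c (mobius (A *m ev (u ++ [:: x])) z0) <= D by case: (v) h2 => [|? ?] [].
have hh w' : halfplane (mobius (A *m ev w') z0).
  exact: mobiusG_half (hs_mul hG GA (ev_in w')) hz0.
suff : cr (vertex A) (vertex (A *m ev u)) + cr (vertex (A *m ev u)) (vertex (A *m ev (u ++ [:: x])))
   + cr (vertex (A *m ev (u ++ [:: x]))) (vertex A) = 0.
  rewrite (cr_anti (vertex A) (vertex (A *m ev (u ++ [:: x])))); lra.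
apply/eqP; apply: contrapT => /negP /cr_sum h.
have := hull0_ball hp hA (hh u) (hh _) hc h hA0 h1 h3.
by rewrite leNgt hD.
Qed.

(** Up to sign, finitely many elements move z0 by a bounded amount; the ball contains the paths of
    one word for each. Compactness of a box around the orbit points takes the place of an
    enumeration. *)
Lemma ball_words (L : R) : exists D, forall A, Gamma A -> ch z0 (mobius A z0) <= L ->
  exists w, eq_pm A (ev w) /\ in_ball z0 D 1%:M w.
Proof.
have [e e0 he] := unif_discG hG.
have y0 : 0 < z0.2 by [].
pose L' := `|L| + 1; have L'0 : 0 < L' by rewrite /L' ltr_wpDl.
pose K := (`[z0.1 - 2 * L' * z0.2, z0.1 + 2 * L' * z0.2] `*`
   `[z0.2 / (2 * L'), 2 * L' * z0.2])%classic : set (R * R).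
have cK : compact K by apply: compact_setX; exact: segment_compact.
pose P D (q : R * R) := forall A, Gamma A -> mobius A z0 = q ->
  exists w, eq_pm A (ev w) /\ in_ball z0 D 1%:M w.
have [D hD] : exists D, K `<=` P D.
  have /compact_near_coveringP ncK := cK.
  have : \forall D \near +oo, K `<=` P D.
    apply: ncK => q [] /= _; rewrite in_itv /= => /andP[q2 _].
    have hq : halfplane q by rewrite /halfplane /=; apply: lt_le_trans q2; rewrite divr_gt0 ?mulr_gt0.
    pose n := Num.min 1 e / 10.
    have m0 : 0 < Num.min 1 e by rewrite lt_min; lra.
    have m1 : Num.min 1 e <= 1 by rewrite ge_min lexx.
    have m2 : Num.min 1 e <= e by rewrite ge_min lexx orbT.
    have n0 : 0 < n by rewrite divr_gt0.
    (* By discreteness at most one element, up to sign, sends z0 this close to q; its word serves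
       for all orbit points near q. *)
    have [[A0 [GA0 hA0]]|nA] := pselect (exists A, Gamma A /\ ch q (mobius A z0) < 1 + n); last first.
      near=> q' D => A GA /= eA; exfalso; apply: nA; exists A; split => //; rewrite eA.
      suff [] : halfplane q' /\ ch q q' < 1 + n by [].
      by near: q'; exact: near_ch.
    have [w0 hw0] := gen_surj GA0; have [D0 hD0] := in_ball_ex z0 1%:M w0.
    near=> q' D => A GA /= eA.
    have [hq' qq'] : halfplane q' /\ ch q q' < 1 + n by near: q'; exact: near_ch.
    have hA0' : halfplane (mobius A0 z0) by exact: mobiusG_half GA0 hz0.
    exists w0; split; last first.
      by apply: in_ball_mono hD0; near: D; apply: nbhs_pinfty_ge; exact: num_real.
    apply: eq_pm_trans hw0.
    suff : eq_pm (invmx A0 *m A) 1%:M.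
      have dA0 := hs_det hG GA0.
      by move=> /(eq_pm_mull A0); rewrite mulmxA mulmxV ?unit2 // mul1mx mulmx1.
    have dA0 := hs_det hG GA0; have dA := hs_det hG GA.
    apply: (he z0) => //; first exact: (hs_mul hG) (hs_inv hG GA0) GA.
    rewrite mobius_mul ?det_invmx2 // -(ch_mobius dA0) //; last first.
      by rewrite eA; apply: mobius_half => //; exact: det_invmx2.
    rewrite mobiusVK // eA //.
    apply: le_lt_trans (ch_triangle hA0' hq' hq) _.
    rewrite chC; have := ch_ge1 hq hA0'; have := ch_ge1 hq hq'.
    move: (ch q _) (ch q _) hA0 qq' => r s hr hs s1 r1.
    have : r * s <= (1 + n) * (1 + n) by apply: ler_pM1 => //; apply: ltW.
    by rewrite /n in hr hs *; nra.
  move=> h; have [D ?] := @filter_ex _ _ (@proper_pinfty_nbhs R) _ h.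
  by exists D.
exists D => A GA hA; apply: (hD (mobius A z0)) => //.
have hA' : halfplane (mobius A z0) by exact: mobiusG_half GA hz0.
have LL : L <= L' by rewrite /L'; have := ler_norm L; lra.
have hL : ch z0 (mobius A z0) <= L' by apply: le_trans hA LL.
have [b1 b3] := near_bounds hz0 hA' hL; rewrite chC in hL.
have [b2 _] := near_bounds hA' hz0 hL.
move: (mobius A z0) b1 b2 b3 => m b1 b2 b3 {hL hA'}.
split; rewrite /= in_itv /=; last first.
  by rewrite b1 andbT ler_pdivrMr ?mulr_gt0 // mulrC.
have k2 := sqr_ge0 z0.2; have k3 := sqr_ge0 m.2.
have k4 : 2 * L' * z0.2 * m.2 <= 2 * L' * z0.2 * (2 * L' * z0.2) by rewrite ler_pM2l // !mulr_gt0.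
have K0 : 0 < 2 * L' * z0.2 by rewrite !mulr_gt0.
have k5 : (z0.1 - m.1) ^+ 2 <= 2 * L' * z0.2 * (2 * L' * z0.2) by lra.
move: (2 * L' * z0.2) K0 k5 => X X0 k5.
apply/andP; split; rewrite leNgt; apply/negP => h; nra.
Unshelve. all: by end_near. Qed.
End Potential.

(** * Translates of the relator triangles cover the half-plane *)

Section CoveringTheorem.
Variables (R : realType) (g : nat) (Gamma : set 'M[R]_2).
Hypothesis hG : hyperbolic_surface g Gamma.
Implicit Types (A B M T : 'M[R]_2) (z p q : R * R) (c : R -> R * R).

Lemma size_relator : size (surface_relator g) = (4 * g)%N.
Proof.
rewrite /surface_relator -[in RHS](size_enum_ord g).
by elim: (enum 'I_g) => [//|i s IH] /=; rewrite IH mulnS.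
Qed.

Lemma cocompact_ball z0 : halfplane z0 -> exists L, forall z, halfplane z ->
  exists2 A, Gamma A & ch z (mobius A z0) <= L.
Proof.
move=> hz0; have [K [cK KH Kc]] := hs_cocompact hG.
have [L hL] : exists L, K `<=` (fun q => ch z0 q <= L).
  have /compact_near_coveringP ncK := cK.
  have : \forall L \near +oo, K `<=` (fun q => ch z0 q <= L).
    apply: ncK => q Kq; have hq := KH _ Kq.
    near=> q' L => /=.
    have [hq' hqq] : halfplane q' /\ ch q q' < 1 + 1 by near: q'; exact: near_ch.
    have hL : 4 * ch z0 q <= L by near: L; apply: nbhs_pinfty_ge; exact: num_real.
    have := ch_triangle hz0 hq' hq; have := ch_ge1 hz0 hq; have := ch_ge1 hq hq'.
    move: (ch z0 q) (ch q q') hL hqq => r s hL hs s1 r1; nra.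
  move=> h; have [L ?] := @filter_ex _ _ (@proper_pinfty_nbhs R) _ h.
  by exists L.
exists L => z hz; have [A GA KA] := Kc z hz.
have dA := hs_det hG GA; have dAi := det_invmx2 dA.
exists (invmx A); first exact: (hs_inv hG).
rewrite -(ch_mobius dA hz (mobius_half dAi hz0)) mobiusVK // chC.
exact: hL KA.
Unshelve. all: by end_near. Qed.

Lemma ccont_chcont c : ccont c -> (forall t, halfplane (c t)) -> chcont c.
Proof.
move=> cc hc; apply: (@cont_chcont R id halfplane c) => //.
by apply: continuous_subspaceT => x; exact: cvg_id.
Qed.

Section Far.
Variable p : R * R.
Hypothesis hp : halfplane p.
Variables (G : R * R -> R) (N : R).
(* G is the sum of a potential of the winding around p and a local correction. *)
Hypothesis hGN : forall z w, halfplane z -> halfplane w -> N < ch z p -> N < ch w p ->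
  ch z w <= 2 -> G w - G z = cr (polar p z) (polar p w).

Lemma far_const c a b : ccont c -> (forall t, halfplane (c t)) ->
  (forall t, N < ch (c t) p) ->
  (forall s t, cr (polar p (c s)) (polar p (c t)) = 0) -> G (c a) = G (c b).
Proof.
move=> cc hc hN h0; apply: (@loc_const R (fun t => G (c a) = G (c t)) a) => // t.
have n0 : 0 < (1 / 10 : R) by lra.
have [e e0 he] := ccont_chcont cc hc t n0.
exists e => // s s' hs hs' hE.
have := @hGN (c s) (c s') (hc _) (hc _) (hN _) (hN _); rewrite h0 => h.
have {}h := h _; apply/eqP; rewrite hE eq_sym -subr_eq0; apply/eqP/h.
have := ch_triangle (hc s) (hc s') (hc t); rewrite (chC (c s) (c t)).
have := he s hs; have := he s' hs'; have := ch_ge1 (hc t) (hc s); have := ch_ge1 (hc t) (hc s').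
move: (ch (c t) (c s)) (ch (c t) (c s')) => r u r1 u1 r2 u2.
have : u * r <= (1 + 1 / 10) * (1 + 1 / 10) by apply: ler_pM; lra.
lra.
Qed.

(** G is constant along a rectangular path, far from p, which goes around p without crossing the
    vertical ray below p. Closing the loop crosses this ray once, where G should jump by 1. *)
Lemma no_potential : False.
Proof.
have p0 : 0 < p.2 by [].
(* The lines at heights e and X and the verticals at horizontal distance X from p all stay outside
   the ball around p excluded by N. *)
pose N' := `|N| + 2.
have N'N : N < N' by rewrite /N'; have := ler_norm N; lra.
have N'2 : 2 <= N' by rewrite /N' lerDr.
pose e := p.2 / (2 * N'); pose X := 2 * N' * p.2.
have e0 : 0 < e by rewrite divr_gt0 ?mulr_gt0 //; lra.
have X0 : 0 < X by rewrite !mulr_gt0 //; lra.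
have ee : e * (2 * N') = p.2 by rewrite /e divfK // gt_eqF //; lra.
have far z : halfplane z -> 2 * N' * z.2 * p.2 <= (z.1 - p.1) ^+ 2 + z.2 ^+ 2 + p.2 ^+ 2 -> N < ch z p.
  move=> hz h; apply: lt_le_trans N'N _; rewrite chE // ler_pdivlMr ?mulr_gt0 //; lra.
have far1 x : N < ch (x, e) p.
  apply: far => //=; rewrite mulrAC -[leLHS]mulrA [leLHS]mulrC -mulrA ee.
  have := sqr_ge0 (x - p.1); have := sqr_ge0 e; rewrite -expr2; nra.
have farX x : N < ch (x, X) p.
  apply: far => //=; rewrite /X; have := sqr_ge0 (x - p.1); have := sqr_ge0 p.2; nra.
have fart (s t : R) : s ^+ 2 = 1 -> N < ch (p.1 + s * X, expR t) p.
  move=> s1; have t0 := expR_gt0 t.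
  apply: far => //=; have -> : p.1 + s * X - p.1 = s * X by ring.
  rewrite exprMn s1 mul1r; have := sqr_ge0 p.2; have := sqr_ge0 (X - expR t); rewrite /X; nra.
(* The curves of [far_const] run over the whole line: the absolute value keeps them on one side of
   p, and [expR] keeps heights positive. *)
have cabs (s x : R) : continuous (fun t : R => p.1 + s * `|t| + x).
  move=> t; apply: cvgD; last exact: cvg_cst.
  apply: cvgD; first exact: cvg_cst.
  apply: cvgM; first exact: cvg_cst.
  exact: (@norm_continuous _ R^o).
have chi1 (z w : R * R) : halfplane z -> halfplane w -> p.1 <= z.1 -> p.1 <= w.1 ->
    cr (polar p z) (polar p w) = 0.
  move=> hz hw h1 h2; apply: cr_same; rewrite /polar /=.
  by rewrite !divr_ge0 ?subr_ge0 // ltW.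
have chi0 (z w : R * R) : halfplane z -> halfplane w -> z.1 < p.1 -> w.1 < p.1 ->
    cr (polar p z) (polar p w) = 0.
  move=> hz hw h1 h2; apply: cr_same; rewrite /polar /= !leNgt.
  by rewrite !pmulr_llt0 ?invr_gt0 // !subr_lt0 h1 h2.
have k1 : G (p.1, e) = G (p.1 + X, e).
  have := @far_const (fun t => (p.1 + 1 * `|t| + 0, e)) 0 X.
  rewrite normr0 mulr0 !addr0 mul1r gtr0_norm //; apply.
  - by split; [exact: cabs|exact: cst_continuous].
  - by [].
  - by move=> t; exact: far1.
  - by move=> s t; apply: chi1 => //=; rewrite addr0 mul1r lerDl.
have k2 : G (p.1 + X, e) = G (p.1 + X, X).
  have := @far_const (fun t => (p.1 + X, expR t)) (ln e) (ln X).
  rewrite !lnK ?posrE //; apply.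
  - by split; [exact: cst_continuous|exact: continuous_expR].
  - by move=> t; exact: expR_gt0.
  - by move=> t; have := fart 1 t; rewrite expr1n mul1r; apply.
  - by move=> s t; apply: chi1 => //=; rewrite ?lerDl ?ltW // /halfplane /= expR_gt0.
have k3 : G (p.1 + X, X) = G (p.1 - X, X).
  apply: (@far_const (fun t => (t, X))).
  - by split; [move=> t; exact: cvg_id|exact: cst_continuous].
  - by [].
  - by move=> t; exact: farX.
  - have pos (t : R) : 0 < (polar p (t, X)).2.
      rewrite /polar /= divr_gt0 // subr_gt0 ltr_wpDl ?sqr_ge0 //.
      by rewrite ltr_pXn2r ?nnegrE ?ltW // /X ltr_pMl //; lra.
    by move=> s t; apply: (@cr_half0 R 0 1); rewrite // mul0r add0r mul1r; exact: pos.
have k4 : G (p.1 - X, X) = G (p.1 - X, e).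
  have := @far_const (fun t => (p.1 - X, expR t)) (ln X) (ln e).
  rewrite !lnK ?posrE //; apply.
  - by split; [exact: cst_continuous|exact: continuous_expR].
  - by move=> t; exact: expR_gt0.
  - by move=> t; have := fart (-1) t; rewrite sqrrN expr1n mulN1r; apply.
  - by move=> s t; apply: chi0 => //=; rewrite ?gtrBl // /halfplane /= expR_gt0.
have eX : e < X.
  rewrite /X -ee; have : e * 1 < (2 * N') * (e * (2 * N')); last by rewrite mulr1.
  rewrite mulrCA ltr_pM2l //; nra.
have k5 : G (p.1 - X, e) = G (p.1 - e, e).
  have := @far_const (fun t => (p.1 + (-1) * `|t| + (- e), e)) (X - e) 0.
  rewrite normr0 mulr0 !addr0 gtr0_norm ?subr_gt0 //.
  have -> : p.1 + -1 * (X - e) - e = p.1 - X by ring.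
  apply.
  - by split; [exact: cabs|exact: cst_continuous].
  - by [].
  - by move=> t; exact: far1.
  - move=> s t; apply: chi0 => //=; have := normr_ge0 s; have := normr_ge0 t; lra.
have p4 : 4 * e <= p.2 by rewrite -ee mulrC ler_pM2l //; lra.
have e2 : 2 * e ^+ 2 < p.2 ^+ 2 by nra.
have := @hGN (p.1 - e, e) (p.1, e) e0 e0 (far1 _) (far1 _).
rewrite chE //= {1}k1 k2 k3 k4 k5 subrr.
have -> : ((p.1 - e - p.1) ^+ 2 + e ^+ 2 + e ^+ 2) / (2 * e * e) = 3 / 2 by field; rewrite gt_eqF.
move=> /(_ ltac:(lra)); rewrite cr_below /chi /polar /=.
- rewrite subrr mul0r lexx ifF ?subr0; first by move/eqP; rewrite eq_sym oner_eq0.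
  by apply/negbTE; rewrite -ltNge pmulr_llt0 ?invr_gt0 //; lra.
- rewrite pmulr_llt0 ?invr_gt0 //.
  have -> : p.1 - e - p.1 = - e by ring.
  by rewrite sqrrN; lra.
- by rewrite pmulr_llt0 ?invr_gt0 // subrr expr0n /= add0r; have := sqr_ge0 e; lra.
Qed.
End Far.

(** A point p in no translate of the triangles would give a [potential] on the group. Adding the
    crossings from a nearby orbit point to z extends it to the function G, at large distance from p,
    that [no_potential] excludes. *)
Theorem covering : exists x (a : nat -> R * R), [/\ halfplane x, forall k, halfplane (a k) &
  forall p, halfplane p -> exists A k, [/\ Gamma A, (k < 4 * g)%N &
    triangle x (a k) (a k.+1) (mobius A p)]].
Proof.
have [gen [gen_in gen_surj gen_rel]] := hs_genus hG.
pose z0 : R * R := (0, 1).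
have hz0 : halfplane z0 by rewrite /halfplane /=.
exists z0, (relator_vertex gen z0); split => //.
  by move=> k; exact: (ev_half hG gen_in hz0).
move=> p hp; apply: contrapT => nc.
have uncovered A k : Gamma A -> (k < size (surface_relator g))%N ->
    ~ triangle z0 (relator_vertex gen z0 k) (relator_vertex gen z0 k.+1) (mobius A p).
  by rewrite size_relator => GA hk h; apply: nc; exists A, k.
have [psi [psi_pm psiE]] := potential hG gen_in gen_surj gen_rel hz0 hp uncovered.
have [L hL] := cocompact_ball hz0.
have /choice[gam hgam] : forall z, exists A, halfplane z -> Gamma A /\ ch z (mobius A z0) <= L.
  move=> z; have [hz|nz] := pselect (halfplane z); last by exists 0.
  by have [A GA hA] := hL z hz; exists A.
have L1 : 1 <= L.
  have [GA hA] := hgam _ hz0.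
  by apply: le_trans hA; apply: ch_ge1 => //; exact: (mobiusG_half hG GA hz0).
have [D hD] := ball_words hG gen_surj hz0 (8 * L ^+ 2).
pose V A := polar p (mobius A z0).
have loc A B : Gamma A -> Gamma B -> ch (mobius A z0) (mobius B z0) <= 8 * L ^+ 2 ->
    D < ch (mobius A z0) p -> psi B - psi A = cr (V A) (V B).
  move=> GA GB hAB hDp; have dA := hs_det hG GA; have dB := hs_det hG GB.
  have dAi := det_invmx2 dA.
  have GAB : Gamma (invmx A *m B) by exact: (hs_mul hG) (hs_inv hG GA) GB.
  have [|w [hw bw]] := hD _ GAB.
    rewrite mobius_mul // -(ch_mobius dA hz0); last exact/(mobius_half dAi)/(mobiusG_half hG GB).
    by rewrite mobiusVK //; exact: (mobiusG_half hG GB).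
  have eB : eq_pm B (A *m word_eval gen w).
    by have := eq_pm_mull A hw; rewrite mulmxA mulmxV ?unit2 // mul1mx.
  have bA := in_ball_mobius hG gen_in hz0 hz0 (hs_one hG) GA bw; rewrite mulmx1 in bA.
  have hA := mobiusG_half hG GA hz0.
  have wA := winding_ball hG gen_in hz0 hp hA GA bA hDp.
  rewrite (psi_pm _ _ GB _ eB); last exact: (hs_mul hG) GA (ev_in hG gen_in w).
  rewrite psiE // wA addrC addKr.
  by rewrite /V (mobius_pm _ eB).
pose G z := psi (gam z) + cr (V (gam z)) (polar p z).
(* Far enough that the ball of words around [gam z] misses p, and that the ball around z containing
   both orbit points and w misses it too. *)
apply: (@no_potential p hp G (4 * L * `|D| + 16 * L)).
move=> z w hz hw zp wp zw.
have [Gz hgz] := hgam z hz; have [Gw hgw] := hgam w hw.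
have hz' := mobiusG_half hG Gz hz0; have hw' := mobiusG_half hG Gw hz0.
have zw1 := ch_ge1 hz hw.
have dzw : ch z (mobius (gam w) z0) <= 4 * L.
  have := ch_triangle hz hw' hw; have := ch_ge1 hw hw'; nra.
have dgg : ch (mobius (gam z) z0) (mobius (gam w) z0) <= 8 * L ^+ 2.
  have := ch_triangle hz' hw' hz; rewrite (chC _ z); have := ch_ge1 hz hz'.
  have := ch_ge1 hz hw'; move: (ch z (mobius (gam z) z0)) (ch z (mobius (gam w) z0)) hgz dzw => r s hr hs s1 r1.
  have : r * s <= L * (4 * L) by apply: ler_pM1 => //; apply: ltW.
  lra.
have far : D < ch (mobius (gam z) z0) p.
  have := ch_triangle hz hp hz'; have := ch_ge1 hz hz'; have := ch_ge1 hz' hp.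
  move: (ch z p) (ch z (mobius (gam z) z0)) (ch (mobius (gam z) z0) p) zp hgz => r s u hr hs u1 s1 h.
  rewrite ltNge; apply/negP => uD.
  have : s * u <= L * `|D| by apply: ler_pM; rewrite ?(le_trans uD (ler_norm _)) //; lra.
  have := normr_ge0 D; nra.
have e1 := loc _ _ Gz Gw dgg far.
have far4 : 4 * L < ch z p by apply: le_lt_trans zp; have := normr_ge0 D; nra.
have tri (a b c : R * R) : halfplane a -> halfplane b -> halfplane c ->
    ch z a <= 4 * L -> ch z b <= 4 * L -> ch z c <= 4 * L ->
    cr (polar p a) (polar p b) + cr (polar p b) (polar p c) + cr (polar p c) (polar p a) = 0.
  move=> ha hb hc da db dc; apply/eqP; apply: contrapT => /negP /cr_sum h.
  by have := hull0_ball hp ha hb hc hz h da db dc; rewrite leNgt far4.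
have zz : ch z z <= 4 * L by rewrite chzz; lra.
have zgz : ch z (mobius (gam z) z0) <= 4 * L by lra.
have zw4 : ch z w <= 4 * L by lra.
have t1 := tri _ _ _ hz' hw' hw zgz dzw zw4.
have t2 := tri _ _ _ hz' hz hw zgz zz zw4.
rewrite /G /V in e1 *; lra.
Qed.
End CoveringTheorem.

(** * Separated points in boxes and in an ideal region *)

Section Packing.
Variable R : realType.
Implicit Types (A B M : 'M[R]_2) (z w p q a b x : R * R) (Q : seq (R * R)).

Lemma size_fibers (T : eqType) (f : T -> nat) (s : seq T) m :
  {in s, forall v, (f v < m)%N} ->
  size s = (\sum_(j < m) size [seq v <- s | f v == j])%N.
Proof.
move=> h; under eq_bigr do rewrite size_filter.
elim: s h => [|q s IH] h; first by rewrite big1.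
rewrite /= big_split /= -IH; last by move=> q' hq'; apply: h; rewrite inE hq' orbT.
have hq := h q (mem_head _ _).
rewrite (bigD1 (Ordinal hq)) //= eqxx big1 ?addn0 // => i.
by rewrite -val_eqE eq_sym /= => /negbTE ->.
Qed.

Lemma trunc_close (u v : R) : 0 <= u -> 0 <= v -> Num.truncn u = Num.truncn v ->
  `|u - v| < 1.
Proof.
move=> u0 v0 e; have /andP[h1 h2] := truncn_itv u0.
have /andP[h3 h4] := truncn_itv v0.
rewrite -natr1 in h2; rewrite -natr1 in h4; rewrite e in h1 h2.
by rewrite ltr_norml; apply/andP; split; lra.
Qed.

Definition separated (n : nat) Q := forall q q', q \in Q -> q' \in Q -> q != q' ->
  1 + n%:R ^- 2 < ch q q'.

Lemma separated_filter n Q (P : pred (R * R)) : separated n Q -> separated n [seq q <- Q | P q].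
Proof. by move=> h q q'; rewrite !mem_filter => /andP[_ h1] /andP[_ h2]; apply: h. Qed.

(** Squares of side s / n contain at most one point each: heights being at least s, two points in a
    square would have [ch] at most 1 + 1 / n^2. *)
Lemma box_count Q n (s al L : R) : (0 < n)%N -> 0 < s -> 0 <= L -> uniq Q ->
  separated n Q -> {in Q, forall q, [/\ s <= q.2, q.2 <= 2 * s, al <= q.1 & q.1 <= al + L]} ->
  (size Q)%:R <= (n%:R + 1) * (L * n%:R / s + 1).
Proof.
move=> n0 s0 L0 uQ sQ hQ; have nR : 0 < n%:R :> R by rewrite ltr0n.
pose m := Num.truncn (L * n%:R / s).
pose k1 q := Num.truncn ((q.2 / s - 1) * n%:R).
pose k2 q := Num.truncn ((q.1 - al) * n%:R / s).
have u1 q : q \in Q -> 0 <= (q.2 / s - 1) * n%:R /\ (k1 q <= n)%N.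
  move=> /hQ[h1 h2 _ _].
  have g1 : 0 <= q.2 / s - 1 by rewrite subr_ge0 ler_pdivlMr // mul1r.
  have g0 := mulr_ge0 g1 (ltW nR).
  split=> //; rewrite truncn_le_nat -natr1.
  have : (q.2 / s - 1) * n%:R <= 1 * n%:R by rewrite ler_pM2r // lerBlDr ler_pdivrMr.
  lra.
have u2 q : q \in Q -> 0 <= (q.1 - al) * n%:R / s /\ (k2 q <= m)%N.
  move=> /hQ[_ _ h1 h2]; have g1 : 0 <= q.1 - al by rewrite subr_ge0.
  have g0 := divr_ge0 (mulr_ge0 g1 (ltW nR)) (ltW s0).
  split=> //; apply: le_truncn.
  by rewrite ler_pM2r ?invr_gt0 // ler_pM2r //; lra.
pose key q : 'I_n.+1 * 'I_m.+1 := (inord (k1 q), inord (k2 q)).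
have kinj : {in Q &, injective key}.
  move=> q q' hq hq' [/(congr1 val) e1 /(congr1 val) e2].
  have [a1 b1] := u1 q hq; have [a2 b2] := u1 q' hq'.
  have [a3 b3] := u2 q hq; have [a4 b4] := u2 q' hq'.
  rewrite /= !inordK ?ltnS // in e1 e2.
  apply/eqP; apply: contrapT => /negP ne; have := sQ q q' hq hq' ne.
  apply/negP; rewrite -leNgt.
  have {}e1 := trunc_close a1 a2 e1; have {}e2 := trunc_close a3 a4 e2.
  have [h1 _ _ _] := hQ _ hq; have [h2 _ _ _] := hQ _ hq'.
  have d2 : `|q.2 - q'.2| * n%:R < s.
    move: e1; have -> : (q.2 / s - 1) * n%:R - (q'.2 / s - 1) * n%:R = (q.2 - q'.2) * n%:R / s by ring.
    by rewrite !normrM normfV (gtr0_norm s0) (gtr0_norm nR) ltr_pdivrMr // mul1r.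
  have d1 : `|q.1 - q'.1| * n%:R < s.
    move: e2; have -> : (q.1 - al) * n%:R / s - (q'.1 - al) * n%:R / s = (q.1 - q'.1) * n%:R / s by ring.
    by rewrite !normrM normfV (gtr0_norm s0) (gtr0_norm nR) ltr_pdivrMr // mul1r.
  have sq (u : R) : `|u| * n%:R < s -> u ^+ 2 * n%:R ^+ 2 <= s ^+ 2.
    move=> hu; rewrite -real_normK ?num_real // -exprMn.
    have p0 : 0 <= `|u| * n%:R by rewrite mulr_ge0.
    by rewrite !(expr2 (_ * _)) (expr2 s); apply: ler_pM => //; exact: ltW.
  have {}d1 := sq _ d1; have {}d2 := sq _ d2.
  rewrite /ch lerD2l ler_pdivrMr; last by rewrite !mulr_gt0 //; apply: lt_le_trans s0 _.
  rewrite mulrC -(ler_pM2r (exprn_gt0 2 nR)) divfK ?expf_neq0 ?gt_eqF // mulrDl.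
  have : s * s <= q.2 * q'.2 by apply: ler_pM => //; exact: ltW.
  lra.
have : (size Q <= n.+1 * m.+1)%N.
  rewrite -(size_map key).
  have /card_uniqP <- : uniq [seq key q | q <- Q] by rewrite map_inj_in_uniq.
  by apply: leq_trans (max_card _) _; rewrite card_prod !card_ord.
rewrite -(ler_nat R) natrM => /le_trans; apply.
rewrite -!natr1 ler_pM2l ?lerD2r; last by rewrite ltr_wpDl.
have h0 : 0 <= L * n%:R / s := divr_ge0 (mulr_ge0 L0 (ltW nR)) (ltW s0).
by case/andP: (truncn_itv h0).
Qed.

Lemma dyadic_level (y : R) : 1 <= y -> let j := trunc_log 2 (Num.truncn y) in
  2 ^+ j <= y /\ y < 2 ^+ j.+1.
Proof.
move=> y1 j; have y0 : 0 <= y by lra.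
have /andP[h1 h2] := truncn_itv y0.
have t0 : (0 < Num.truncn y)%N by rewrite -truncn_gt0 in y1 *.
have /andP[g1 g2] := trunc_log_bounds (isT : (1 < 2)%N) t0.
split; first by apply: le_trans h1; rewrite -natrX ler_nat.
by apply: lt_le_trans h2 _; rewrite -natrX ler_nat.
Qed.

Lemma level_lt (y : R) K : 1 <= y -> y < 2 ^+ K -> (trunc_log 2 (Num.truncn y) < K)%N.
Proof.
move=> y1 yK; have [h1 h2] := dyadic_level y1; rewrite ltnNge; apply/negP => hK.
have : (2 : R) ^+ K <= 2 ^+ (trunc_log 2 (Num.truncn y)).
  by rewrite -!natrX ler_nat leq_pexp2l.
lra.
Qed.

Lemma geom_half K : \sum_(j < K) (2 ^- j : R) <= 2.
Proof.
have : \sum_(j < K) (2 ^- j : R) = 2 - 2 * 2 ^- K.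
  elim: K => [|K IH]; first by rewrite big_ord0 expr0 invr1; ring.
  by rewrite big_ord_recr /= IH exprS invfM; field; rewrite expf_neq0.
by move=> ->; rewrite lerBlDr lerDl mulr_ge0 // invr_ge0 exprn_ge0.
Qed.

(** The region over [-1, 1] outside the unit circle has finite area, and a sum over dyadic heights
    converges independently of K. Only the one extra column of each box depends on the number K of
    heights. *)
Lemma normal_count Q n K : (0 < n)%N -> uniq Q -> separated n Q ->
  {in Q, forall q, [/\ 0 < q.2, q.2 < 2 ^+ K, q.2^-1 < 2 ^+ K, `|q.1| <= 1 &
     1 <= q.1 ^+ 2 + q.2 ^+ 2]} ->
  (size Q)%:R <= 24 * n%:R ^+ 2 + 6 * K%:R * n%:R :> R.
Proof.
move=> n0 uQ sQ hQ; have n1 : 1 <= n%:R :> R by rewrite ler1n.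
have p2 j : 0 < (2 : R) ^+ j by rewrite exprn_gt0.
have -> : size Q = (size [seq q <- Q | (1 <= q.2)%R] + size [seq q <- Q | ~~ (1 <= q.2)%R])%N.
  by rewrite !size_filter count_predC.
rewrite natrD.
have hi : (size [seq q <- Q | 1 <= q.2])%:R <= 8 * n%:R ^+ 2 + 2 * K%:R * n%:R :> R.
  rewrite (@size_fibers _ (fun q => trunc_log 2 (Num.truncn q.2)) _ K); last first.
    by move=> q; rewrite mem_filter => /andP[h /hQ[_ hK _ _ _]]; exact: level_lt.
  rewrite natr_sum; apply: le_trans (_ : \sum_(j < K) (2 * n%:R) * (2 * n%:R * 2 ^- j + 1) <= _).
    apply: ler_sum => j _; apply: le_trans (_ : (n%:R + 1) * (2 * n%:R / 2 ^+ j + 1) <= _).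
      apply: (@box_count _ _ _ (-1)) => //.
      - by rewrite !filter_uniq.
      - by do 2 apply: separated_filter.
      - move=> q; rewrite !mem_filter => /andP[/eqP e /andP[h1 /hQ[h2 h3 h4 h5 h6]]].
        have [g1 g2] := dyadic_level h1; rewrite e in g1 g2.
        move: h5; rewrite ler_norml => /andP[h5 h7]; split => //; last lra.
        by rewrite -exprS ltW.
    by rewrite ler_pM2r; [lra|rewrite ltr_wpDl // divr_ge0 ?mulr_ge0 // ltW].
  under eq_bigr do rewrite mulrDr mulr1.
  rewrite big_split /= sumr_const card_ord -[_ *+ K]mulr_natr.
  under eq_bigr do rewrite mulrA.
  rewrite -mulr_sumr; have := geom_half K.
  have : 0 <= 2 * n%:R * (2 * n%:R) :> R by rewrite !mulr_ge0.
  move=> h1 h2; have := ler_wpM2l h1 h2; lra.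
suff lo : (size [seq q <- Q | ~~ (1 <= q.2)])%:R <= 16 * n%:R ^+ 2 + 4 * K%:R * n%:R :> R.
  by lra.
rewrite (@size_fibers _ (fun q => trunc_log 2 (Num.truncn q.2^-1)) _ K); last first.
  move=> q; rewrite mem_filter -ltNge => /andP[h /hQ[h0 _ hK _ _]]; apply: level_lt => //.
  by rewrite invf_ge1 // ltW.
rewrite natr_sum; apply: le_trans (_ : \sum_(j < K) (4 * n%:R) * (2 * n%:R * 2 ^- j + 1) <= _); last first.
  under eq_bigr do rewrite mulrDr mulr1.
  rewrite big_split /= sumr_const card_ord -[_ *+ K]mulr_natr.
  under eq_bigr do rewrite mulrA.
  rewrite -mulr_sumr; have := geom_half K.
  have : 0 <= 4 * n%:R * (2 * n%:R) :> R by rewrite !mulr_ge0.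
  move=> h1 h2; have := ler_wpM2l h1 h2; lra.
apply: ler_sum => j _.
set Qj := [seq q <- _ | _].
have -> : size Qj = (size [seq q <- Qj | ((0 <= q.1) == true)%R] + size [seq q <- Qj | ((0 <= q.1) == false)%R])%N.
  rewrite -[LHS](count_predC (fun q : R * R => (0 <= q.1)%R == true)) -!size_filter.
  by congr (_ + size _)%N; apply: eq_filter => q /=; case: (_ <= _).
pose s : R := 2 ^- j.+1; have s0 : 0 < s by rewrite invr_gt0.
have es : 2 * s = 2 ^- j by rewrite /s exprS invfM mulrA divff // mul1r.
(* Below height 1 the points are squeezed towards 1 or -1: at height about s only a width 4 s^2
   remains, hence the two boxes, one for each sign of the real part. *)
have hj : {in Qj, forall q, [/\ s <= q.2, q.2 <= 2 * s, `|q.1| <= 1 & 1 - 4 * s ^+ 2 <= q.1 ^+ 2]}.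
  move=> q; rewrite !mem_filter -ltNge => /andP[/eqP e /andP[h1 /hQ[h2 h3 h4 h5 h6]]].
  have i1 : 1 <= q.2^-1 by rewrite invf_ge1 // ltW.
  have [g1 g2] := dyadic_level i1; rewrite e in g1 g2.
  have k1 : s <= q.2 by rewrite /s -[leRHS]invrK lef_pV2 ?posrE ?invr_gt0 // ltW.
  have k2 : q.2 <= 2 * s by rewrite es -[leLHS]invrK lef_pV2 ?posrE ?invr_gt0.
  split => //; nra.
have half e : (size [seq q <- Qj | (0 <= q.1) == e])%:R <= (2 * n%:R) * (2 * n%:R * 2 ^- j + 1) :> R.
  apply: le_trans (_ : (n%:R + 1) * (4 * s ^+ 2 * n%:R / s + 1) <= _).
    apply: (@box_count _ _ _ (if e then 1 - 4 * s ^+ 2 else - 1)) => //.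
    - by rewrite mulr_ge0 // sqr_ge0.
    - by rewrite !filter_uniq.
    - by do 3 apply: separated_filter.
    - move=> q; rewrite mem_filter => /andP[/eqP ee /hj[h1 h2]].
      rewrite ler_norml => /andP[h3 h4] h5; case: e ee => ee; split => //.
      + nra.
      + by rewrite subrK.
      + by move/negbT: ee; rewrite -ltNge => ee; nra.
  have -> : 4 * s ^+ 2 * n%:R / s = 2 * n%:R * 2 ^- j.
    by rewrite -es; field; rewrite gt_eqF.
  by rewrite ler_pM2r; [lra|rewrite ltr_wpDl // !mulr_ge0 // invr_ge0 ltW].
by rewrite natrD; have := half true; have := half false; lra.
Qed.
End Packing.

(** * Separated points in a triangle *)

Section TrianglePacking.
Variable R : realType.
Implicit Types (A B M : 'M[R]_2) (z w p q a b x : R * R) (Q : seq (R * R)).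

Lemma ch_form z w : halfplane z -> halfplane w -> ch z w =
  (z.1 ^+ 2 + z.2 ^+ 2) / (2 * z.2) * (1 / w.2) - z.1 / z.2 * (w.1 / w.2)
  + 1 / (2 * z.2) * ((w.1 ^+ 2 + w.2 ^+ 2) / w.2).
Proof.
move=> hz hw; have z0 : 0 < z.2 by []. have w0 : 0 < w.2 by [].
by rewrite chE //; field; rewrite !gt_eqF.
Qed.

Lemma triangle_ball x a b q z D : halfplane x -> halfplane a -> halfplane b ->
  halfplane q -> halfplane z -> triangle x a b q ->
  ch z x <= D -> ch z a <= D -> ch z b <= D -> ch z q <= D.
Proof.
move=> hx ha hb hq hz [al [be [ga [[h1 h2 h3] e0 e1 e2]]]] zx za zb.
have lin w : halfplane w -> al * ch w x + be * ch w a + ga * ch w b = ch w q.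
  move=> hw; rewrite !ch_form // -e0 -e1 -e2; ring.
have l1 := lin q hq; rewrite chzz in l1; have lz := lin z hz.
have k1 := ler_wpM2l h1 (ch_ge1 hq hx); have k2 := ler_wpM2l h2 (ch_ge1 hq ha).
have k3 := ler_wpM2l h3 (ch_ge1 hq hb).
have k4 := ler_wpM2l h1 zx; have k5 := ler_wpM2l h2 za; have k6 := ler_wpM2l h3 zb.
have D0 : 0 <= D by have := ch_ge1 hz ha; lra.
have : (al + be + ga) * D <= 1 * D by apply: ler_wpM2r => //; lra.
lra.
Qed.

Lemma triangle_mobius x a b q M : \det M = 1 -> halfplane x -> halfplane a ->
  halfplane b -> halfplane q -> triangle x a b q ->
  triangle (mobius M x) (mobius M a) (mobius M b) (mobius M q).
Proof.
move=> dM hx ha hb hq [al [be [ga [h e0 e1 e2]]]]; exists al, be, ga.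
have f0 z : halfplane z -> 1 / (mobius M z).2 = M 1 0 ^+ 2 * ((z.1 ^+ 2 + z.2 ^+ 2) / z.2)
    + 2 * (M 1 0 * M 1 1) * (z.1 / z.2) + M 1 1 ^+ 2 * (1 / z.2).
  move=> hz; have z0 : 0 < z.2 by [].
  rewrite mobiusE /= mul1r invf_div /mden; field; by rewrite gt_eqF.
have f1 z : halfplane z -> (mobius M z).1 / (mobius M z).2 =
    M 0 0 * M 1 0 * ((z.1 ^+ 2 + z.2 ^+ 2) / z.2)
    + (M 0 0 * M 1 1 + M 0 1 * M 1 0) * (z.1 / z.2) + M 0 1 * M 1 1 * (1 / z.2).
  move=> hz; have z0 : 0 < z.2 by []. have n0 := mden_gt0 dM hz.
  by rewrite mobiusE /=; field; rewrite !gt_eqF.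
have f2 z : halfplane z -> ((mobius M z).1 ^+ 2 + (mobius M z).2 ^+ 2) / (mobius M z).2 =
    M 0 0 ^+ 2 * ((z.1 ^+ 2 + z.2 ^+ 2) / z.2)
    + 2 * (M 0 0 * M 0 1) * (z.1 / z.2) + M 0 1 ^+ 2 * (1 / z.2).
  move=> hz; have z0 : 0 < z.2 by []. have n0 := mden_gt0 dM hz.
  have d1 := dM; rewrite det2E in d1.
  rewrite mobiusE /=; set N := (X in X / mden M z).
  have e : N ^+ 2 + z.2 ^+ 2 = mden M z * ((M 0 0 * z.1 + M 0 1) ^+ 2 + M 0 0 ^+ 2 * z.2 ^+ 2).
    transitivity (N ^+ 2 + ((M 0 0 * M 1 1 - M 0 1 * M 1 0) * z.2) ^+ 2).
      by rewrite d1 mul1r.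
    by rewrite /N /mden; ring.
  transitivity ((N ^+ 2 + z.2 ^+ 2) / (mden M z * z.2)).
    by field; rewrite !gt_eqF.
  by rewrite e; field; rewrite !gt_eqF.
split => //.
- transitivity (al * (1 / (mobius M x).2) + be * (1 / (mobius M a).2) + ga * (1 / (mobius M b).2)).
    by rewrite !mul1r.
  rewrite (f0 q) // (f0 x) // (f0 a) // (f0 b) // -e0 -e1 -e2; ring.
- rewrite (f1 q) // (f1 x) // (f1 a) // (f1 b) // -e0 -e1 -e2; ring.
- rewrite (f2 q) // (f2 x) // (f2 a) // (f2 b) // -e0 -e1 -e2; ring.
Qed.

Lemma to_axis a x : halfplane a -> halfplane x -> exists M (h : R),
  [/\ \det M = 1, 1 <= h, mobius M a = (0, 1) & mobius M x = (0, h)].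
Proof.
move=> ha hx; have [e|e] := pselect (a = x).
  have ha' : halfplane (a.1, a.2 * 2) by rewrite /halfplane /= mulr_gt0.
  have [d d0 hd] := cosh_surj (ch_ge1 ha ha').
  have ne : 0 != d.
    apply/negP => /eqP de; move: hd; rewrite -de /cosh oppr0 expR0 => h1.
    have e1 : ch a (a.1, a.2 * 2) = 1 by lra.
    by have := congr1 snd (ch_eq1 ha ha' e1); have a0 : 0 < a.2 by []; rewrite /=; lra.
  have [|M [dM M0 M1]] := two_trans ha ha' ne; first by rewrite subr0.
  exists (invmx M), 1; split => //; first exact: det_invmx2.
    by rewrite -M0 (mobiusK dM (half_axis 0)) expR0.
  by rewrite -e -M0 (mobiusK dM (half_axis 0)) expR0.
have [d d0 hd] := cosh_surj (ch_ge1 ha hx).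
have ne : 0 != d.
  apply/negP => /eqP de; move: hd; rewrite -de /cosh oppr0 expR0 => h1.
  by apply: e; apply: ch_eq1 => //; lra.
have [|M [dM M0 M1]] := two_trans ha hx ne; first by rewrite subr0.
exists (invmx M), (expR d); split; first exact: det_invmx2.
- by have := expR_ge1Dx d; lra.
- by rewrite -M0 (mobiusK dM (half_axis 0)) expR0.
- by rewrite -M1 (mobiusK dM (half_axis d)).
Qed.

(* Moving the vertex above (0, 1) up to oo makes the triangle larger. *)
Lemma triangle_chord (h : R) b q : 1 <= h -> halfplane b -> halfplane q ->
  triangle (0, h) (0, 1) b q -> exists s : R, [/\ 0 <= s, s <= 1, q.1 = s * b.1 &
  1 - s + s * (b.1 ^+ 2 + b.2 ^+ 2) <= q.1 ^+ 2 + q.2 ^+ 2].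
Proof.
move=> h1 hb hq [al [be [ga [[a0 b0 g0]]]]].
have q0 : 0 < q.2 by []. have b20 : 0 < b.2 by [].
move=> /= f0 f1 f2; have h0 : 0 < h by lra.
have e0 : al / h + be + ga / b.2 = 1 / q.2 by rewrite -f0 divr1.
have e1 : ga * (b.1 / b.2) = q.1 / q.2 by rewrite -f1 !mul0r !mulr0 !add0r.
have e2 : al * h + be + ga * ((b.1 ^+ 2 + b.2 ^+ 2) / b.2) = (q.1 ^+ 2 + q.2 ^+ 2) / q.2.
  by rewrite -f2; field; rewrite !gt_eqF.
have gb : 0 <= ga / b.2 by rewrite divr_ge0 // ltW.
have ah : 0 <= al / h by rewrite divr_ge0 // ltW.
exists (ga / b.2 * q.2).
have g1 : ga / b.2 * q.2 = 1 - (al / h + be) * q.2.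
  have : (al / h + be + ga / b.2) * q.2 = 1 by rewrite e0 mul1r mulVf // gt_eqF.
  lra.
split.
- by rewrite mulr_ge0 // ltW.
- rewrite g1 gerBl mulr_ge0 ?addr_ge0 // ltW //.
- have := congr1 (fun u => u * q.2) e1; rewrite divfK ?gt_eqF // => <-; ring.
- have := congr1 (fun u => u * q.2) e2; rewrite [RHS]divfK ?gt_eqF // => <-.
  have k : 0 <= al * q.2 * (h - h^-1).
    have k1 : 0 <= h - h^-1 by rewrite subr_ge0 (le_trans _ h1) // invf_le1.
    exact: mulr_ge0 (mulr_ge0 a0 (ltW q0)) k1.
  by rewrite {1}g1; lra.
Qed.

(** c and rho are the centre and radius of the geodesic through i and b; the inequalities say that q
    lies above it and over its diameter. For b above or below i a small circle under both does the
    same. *)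
Lemma chord_circle b : halfplane b -> exists c rho : R, 0 < rho /\
  forall q s, halfplane q -> 0 <= s -> s <= 1 -> q.1 = s * b.1 ->
    1 - s + s * (b.1 ^+ 2 + b.2 ^+ 2) <= q.1 ^+ 2 + q.2 ^+ 2 ->
    `|q.1 - c| <= rho /\ rho ^+ 2 <= (q.1 - c) ^+ 2 + q.2 ^+ 2.
Proof.
move=> hb; have b0 : 0 < b.2 by [].
have [e|e] := eqVneq b.1 0.
  pose r := Num.min 1 b.2; have r0 : 0 < r by rewrite lt_min b0 ltr01.
  have r1 : r <= 1 by rewrite ge_min lexx.
  have r2 : r <= b.2 by rewrite ge_min lexx orbT.
  exists 0, r; split => // q s hq s0 s1 eq1 h.
  rewrite eq1 e mulr0 subrr normr0 ltW // expr0n /= add0r; split => //.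
  rewrite eq1 e mulr0 expr0n /= !add0r in h; apply: le_trans h.
  have : r ^+ 2 <= 1 by nra.
  have : r ^+ 2 <= b.2 ^+ 2 by nra.
  nra.
pose c := (b.1 ^+ 2 + b.2 ^+ 2 - 1) / (2 * b.1).
have ec : 2 * b.1 * c = b.1 ^+ 2 + b.2 ^+ 2 - 1 by rewrite /c mulrC divfK // mulf_neq0.
pose r := Num.sqrt (c ^+ 2 + 1).
have r2 : r ^+ 2 = c ^+ 2 + 1 by rewrite sqr_sqrtr // addr_ge0 ?sqr_ge0.
have r0 : 0 < r by rewrite sqrtr_gt0 ltr_wpDl ?sqr_ge0.
exists c, r; split => // q s hq s0 s1 eq1 h; split; last first.
  rewrite r2; have : q.1 * (2 * b.1 * c) = q.1 * (b.1 ^+ 2 + b.2 ^+ 2 - 1) by rewrite ec.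
  rewrite eq1 in h *.
  have : (s * b.1 - c) ^+ 2 = (s * b.1) ^+ 2 - s * (2 * b.1 * c) + c ^+ 2 by ring.
  rewrite ec => -> _; lra.
have k : (q.1 - c) ^+ 2 <= r ^+ 2.
  rewrite r2 eq1.
  have -> : (s * b.1 - c) ^+ 2 = s ^+ 2 * b.1 ^+ 2 - s * (2 * b.1 * c) + c ^+ 2 by ring.
  rewrite ec; have k1 := mulr_ge0 s0 (sqr_ge0 b.2).
  have s1' : 0 <= 1 - s by lra.
  have := mulr_ge0 (mulr_ge0 s0 s1') (sqr_ge0 b.1); lra.
rewrite ler_norml; apply/andP; split; nra.
Qed.

Lemma separated_map n M Q : \det M = 1 -> {in Q, forall q, halfplane q} ->
  uniq Q -> separated n Q ->
  uniq [seq mobius M q | q <- Q] /\ separated n [seq mobius M q | q <- Q].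
Proof.
move=> dM hQ uQ sQ.
have inj : {in Q &, injective (mobius M)}.
  by move=> q q' hq hq' e; rewrite -(mobiusK dM (hQ _ hq)) e mobiusK //; exact: hQ.
split; first by rewrite map_inj_in_uniq.
move=> _ _ /mapP[q hq ->] /mapP[q' hq' ->] ne.
rewrite ch_mobius //; try exact: hQ.
by apply: sQ => //; apply: contra ne => /eqP ->.
Qed.

Lemma pow2_big (y : R) : exists K : nat, y < 2 ^+ K.
Proof.
exists (Num.truncn y).+1; apply: lt_le_trans (truncnS_gt y) _.
by rewrite -natrX ler_nat ltnW // ltn_expl.
Qed.

(** An isometry moves the triangle into the region of [normal_count]. Its shape affects only the
    range K of heights, hence only the linear term. *)
Lemma triangle_packing x a b : halfplane x -> halfplane a -> halfplane b ->
  exists K : nat, forall n Q, (0 < n)%N -> uniq Q -> separated n Q ->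
  {in Q, forall q, halfplane q /\ triangle x a b q} ->
  (size Q)%:R <= 24 * n%:R ^+ 2 + 6 * K%:R * n%:R :> R.
Proof.
move=> hx ha hb; have [M [h [dM h1 Ma Mx]]] := to_axis ha hx.
have hMb := mobius_half dM hb.
have [c [rho [r0 hc]]] := chord_circle hMb.
have [sr sr0 sr2] : exists2 sr : R, 0 < sr & sr ^+ 2 = rho.
  by exists (Num.sqrt rho); rewrite ?sqrtr_gt0 // sqr_sqrtr // ltW.
pose N : 'M[R]_2 := mx2 sr^-1 (- c / sr) 0 sr.
have dN : \det N = 1 by rewrite det2E !mx2V mulr0 subr0 mulVf // gt_eqF.
have NE z : mobius N z = ((z.1 - c) / rho, z.2 / rho).
  rewrite mobiusE /mden !mx2V /= -sr2; congr pair; field; by rewrite gt_eqF.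
have hi : halfplane ((0, 1) : R * R) by rewrite /halfplane /=.
have hh : halfplane ((0, h) : R * R) by rewrite /halfplane /=; lra.
pose D := ch (0, 1) (0, h) + 1 + ch (0, 1) (mobius M b).
have D1 := ch_ge1 hi hh; have D2 := ch_ge1 hi hMb.
have D0 : 0 < D by rewrite /D; lra.
have [K1 hK1] := pow2_big (2 * D / rho); have [K2 hK2] := pow2_big (2 * D * rho).
exists (K1 + K2)%N => n Q n0 uQ sQ hQ.
have hQ1 : {in Q, forall q, halfplane q} by move=> q /hQ[].
have [uQ1 sQ1] := separated_map dM hQ1 uQ sQ.
have hQ2 : {in [seq mobius M q | q <- Q], forall q, halfplane q}.
  by move=> _ /mapP[q hq ->]; exact: mobius_half (hQ1 _ hq).
have [uQ2 sQ2] := separated_map dN hQ2 uQ1 sQ1.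
rewrite -(size_map (mobius M)) -(size_map (mobius N)).
apply: normal_count => // _ /mapP[_ /mapP[q hq ->] ->].
have hMq := hQ2 _ (map_f (mobius M) hq).
have [hq0 tq] := hQ _ hq.
have := triangle_mobius dM hx ha hb hq0 tq; rewrite Ma Mx => t.
have [s [s0 s1 e1 e2]] := triangle_chord h1 hMb hMq t.
have [g1 g2] := hc _ _ hMq s0 s1 e1 e2.
have hD : ch (0, 1) (mobius M q) <= D.
  by apply: (triangle_ball hh hi hMb hMq hi t); rewrite ?chzz /D; lra.
have [y1 y2 _ _] := near_axis ltr01 hMq hD.
move: (mobius M q) hMq g1 g2 y1 y2 {t e1 e2 hD} => m hm g1 g2 y1 y2.
have m0 : 0 < m.2 by [].
rewrite NE /=; split.
- by rewrite divr_gt0.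
- rewrite exprD; apply: le_lt_trans (_ : 2 * D / rho < _).
    by rewrite ler_pM2r ?invr_gt0 //; lra.
  by apply: lt_le_trans hK1 _; rewrite ler_peMr ?exprn_ge0 // exprn_ege1 // ler1n.
- rewrite invf_div exprD; apply: le_lt_trans (_ : 2 * D * rho < _).
    by rewrite ler_pdivrMr //; nra.
  by apply: lt_le_trans hK2 _; rewrite ler_peMl ?exprn_ge0 // exprn_ege1 // ler1n.
- by rewrite normrM normfV (gtr0_norm r0) ler_pdivrMr // mul1r.
- rewrite !expr_div_n -mulrDl ler_pdivlMr ?exprn_gt0 // mul1r //.
Qed.
End TrianglePacking.

(** * The packing bound on the surface *)

Section SurfacePacking.
Variables (R : realType) (g : nat) (Gamma : set 'M[R]_2).
Hypothesis hG : hyperbolic_surface g Gamma.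

(** Each point is moved into one of 4g triangles, so that the leading coefficient is 4g * 24. J
    depends on the group, but the area of X is controlled by the coefficient of n^2 alone. *)
Theorem surface_packing : exists J : R, forall n (Q : seq (R * R)), (0 < n)%N -> uniq Q ->
  {in Q, forall q, halfplane q} ->
  (forall q q' A, q \in Q -> q' \in Q -> q != q' -> Gamma A ->
     1 + n%:R ^- 2 < ch q (mobius A q')) ->
  (size Q)%:R <= 96 * g%:R * n%:R ^+ 2 + J * n%:R :> R.
Proof.
have [x [a [hx ha cov]]] := covering hG.
have /choice[K hK] : forall k, exists K : nat, forall n Q, (0 < n)%N -> uniq Q -> separated n Q ->
  {in Q, forall q, halfplane q /\ triangle x (a k) (a k.+1) q} ->
  (size Q)%:R <= 24 * n%:R ^+ 2 + 6 * K%:R * n%:R :> R.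
  by move=> k; exact: triangle_packing.
have /choice[f hf] : forall q, exists Ak : 'M[R]_2 * nat, halfplane q ->
    [/\ Gamma Ak.1, (Ak.2 < 4 * g)%N & triangle x (a Ak.2) (a Ak.2.+1) (mobius Ak.1 q)].
  move=> q; have [hq|nq] := pselect (halfplane q); last by exists (0, 0%N).
  by have [A [k h]] := cov q hq; exists (A, k).
exists (\sum_(k < 4 * g) 6 * (K k)%:R) => n Q n0 uQ hQ sQ.
rewrite (@size_fibers _ (fun q => (f q).2) _ (4 * g)); last first.
  by move=> q hq; have [_ h _] := hf _ (hQ _ hq).
rewrite natr_sum mulr_suml.
apply: le_trans (_ : \sum_(k < 4 * g) (24 * n%:R ^+ 2 + 6 * (K k)%:R * n%:R) <= _); last first.
  rewrite big_split /= sumr_const card_ord -[_ *+ _]mulr_natr natrM lerD2r.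
  by rewrite le_eqVlt; apply/orP; left; apply/eqP; ring.
apply: ler_sum => k _; set Qk := [seq v <- Q | _].
have hk q : q \in Qk -> [/\ q \in Q, (f q).2 = k, Gamma (f q).1 & triangle x (a k) (a k.+1) (mobius (f q).1 q)].
  rewrite mem_filter => /andP[/eqP e hq]; have [h1 h2 h3] := hf _ (hQ _ hq).
  by rewrite e in h3; split.
pose h q := mobius (f q).1 q.
have sep q q' : q \in Qk -> q' \in Qk -> q != q' -> 1 + n%:R ^- 2 < ch (h q) (h q').
  move=> /hk[hq _ Gq _] /hk[hq' _ Gq' _] ne.
  have dq := hs_det hG Gq; have dq' := hs_det hG Gq'; have dqi := det_invmx2 dq.
  have := sQ q q' (invmx (f q).1 *m (f q').1) hq hq' ne (hs_mul hG (hs_inv hG Gq) Gq').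
  rewrite mobius_mul //; last exact: hQ.
  rewrite -(ch_mobius dq (hQ _ hq)); last exact/(mobius_half dqi)/(mobius_half dq')/hQ.
  by rewrite mobiusVK //; apply/(mobius_half dq')/hQ.
have n2 : 0 < (n%:R : R) ^- 2 by rewrite invr_gt0 exprn_gt0 // ltr0n.
have inj : {in Qk &, injective h}.
  move=> q q' hq hq' e; apply/eqP; apply: contrapT => /negP ne.
  by have := sep q q' hq hq' ne; rewrite e chzz; lra.
rewrite -(size_map h); apply: hK => //.
- by rewrite map_inj_in_uniq // filter_uniq.
- move=> _ _ /mapP[q hq ->] /mapP[q' hq' ->] ne; apply: sep => //.
  by apply: contra ne => /eqP ->.
- move=> _ /mapP[q hq ->]; have [h1 h2 h3 h4] := hk _ hq.
  by split => //; apply: mobius_half (hs_det hG h3) (hQ _ h1).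
Qed.
End SurfacePacking.

(** * The systole is bounded in terms of the genus *)

Section SystoleBound.
Variables (R : realType) (g : nat) (Gamma : set 'M[R]_2).
Hypothesis hG : hyperbolic_surface g Gamma.
Implicit Types (z w p q : R * R) (Q : seq (R * R)).

(* 864 = 9 * 96, surface_packing being used with n = 3m. *)
Lemma packing_absurd (G : nat -> seq (R * R)) (al be : R) : 864 * g%:R + 1 <= al ->
  (forall m, (0 < m)%N -> [/\ uniq (G m), {in G m, forall q, halfplane q},
     (forall q q' A, q \in G m -> q' \in G m -> q != q' -> Gamma A ->
       1 + (3 * m)%:R ^- 2 < ch q (mobius A q')) &
     al * m%:R ^+ 2 - be * m%:R <= (size (G m))%:R]) -> False.
Proof.
move=> hal hGm; have [J hJ] := surface_packing hG.
pose m := (Num.truncn (3 * `|J| + `|be|)).+1.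
have m0 : 0 < m%:R :> R by rewrite ltr0n.
have hm : 3 * `|J| + `|be| < m%:R by exact: truncnS_gt.
have [u h s k] := hGm m isT.
have := hJ (3 * m)%N (G m) isT u h s; rewrite natrM => h2.
have : J * (3 * m%:R) <= `|J| * (3 * m%:R) by rewrite ler_wpM2r ?ler_norm // mulr_ge0 // ltW.
have : be * m%:R <= `|be| * m%:R by rewrite ler_wpM2r ?ler_norm // ltW.
have : (3 * `|J| + `|be|) * m%:R < m%:R * m%:R by rewrite ltr_pM2r.
have : (864 * g%:R + 1) * m%:R ^+ 2 <= al * m%:R ^+ 2 by rewrite ler_wpM2r ?sqr_ge0.
lra.
Qed.

Definition grid (N1 N2 : nat) (f : nat -> nat -> R * R) : seq (R * R) :=
  [seq f i j | i <- iota 0 N1, j <- iota 0 N2].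

Lemma mem_grid N1 N2 f q : q \in grid N1 N2 f -> exists i j,
  [/\ (i < N1)%N, (j < N2)%N & q = f i j].
Proof.
move=> /allpairsP[[i j] /= [hi hj ->]]; exists i, j.
by rewrite mem_iota in hi; rewrite mem_iota in hj.
Qed.

Lemma size_grid N1 N2 f : size (grid N1 N2 f) = (N1 * N2)%N.
Proof. by rewrite size_allpairs !size_iota. Qed.

Lemma uniq_grid N1 N2 f :
  (forall i j i' j', f i j = f i' j' -> i = i' /\ j = j') -> uniq (grid N1 N2 f).
Proof.
move=> h; apply: allpairs_uniq; rewrite ?iota_uniq //.
by move=> [i j] [i' j'] _ _ /= /h[-> ->].
Qed.

Lemma nat_gap (i j : nat) : i != j -> 1 <= (i%:R - j%:R : R) ^+ 2.
Proof.
rewrite neq_ltn => /orP[] h.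
- have : (i%:R + 1 <= j%:R :> R) by rewrite natr1 ler_nat.
  nra.
- have : (j%:R + 1 <= i%:R :> R) by rewrite natr1 ler_nat.
  nra.
Qed.

(** Were the systole larger, the Euclidean rectangle [0, X] x [1, 2] would be far from its
    translates, and a grid of spacing 1 / m in it would have too many separated points for
    [packing_absurd]. *)
Lemma sys_bound : cosh (systole Gamma) <= 6 + 2 * (864 * g%:R + 1) ^+ 2.
Proof.
have [X eX] : exists X : R, X = 864 * g%:R + 1 by exists (864 * g%:R + 1).
have [N [XN X1]] : exists N, N%:R = X /\ 1 <= X.
  exists (864 * g + 1)%N; rewrite eX natrD natrM; split => //.
  by have g0 : 0 <= g%:R :> R by []; lra.
rewrite -eX leNgt; apply/negP => hs.
pose G m := grid (N * m) m (fun i j => (i%:R / m%:R, 1 + j%:R / m%:R) : R * R).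
apply: (@packing_absurd G X 0); first by rewrite eX.
clear eX => m m0.
have mR : 0 < m%:R :> R by rewrite ltr0n.
have hy i : (i < m)%N -> 1 <= 1 + (i%:R / m%:R : R) <= 2.
  move=> hi; rewrite lerDl divr_ge0 //= (_ : 2 = 1 + 1) // lerD2l ler_pdivrMr // mul1r.
  by rewrite ler_nat ltnW.
have hx i : (i < N * m)%N -> 0 <= (i%:R / m%:R : R) <= X.
  move=> hi; rewrite divr_ge0 //= ler_pdivrMr // -XN -natrM ler_nat.
  exact: ltnW.
have hG' : {in G m, forall q, [/\ 1 <= q.2, q.2 <= 2, 0 <= q.1 & q.1 <= X]}.
  move=> q /mem_grid[i [j [hi hj ->]]] /=.
  by have /andP[? ?] := hy j hj; have /andP[? ?] := hx i hi.
have half : {in G m, forall q, halfplane q}.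
  by move=> q /hG'[h _ _ _]; rewrite /halfplane /=; apply: lt_le_trans h.
split => //.
- apply: uniq_grid => i j i' j' [] e1 e2.
  have im : m%:R^-1 != 0 :> R by rewrite invr_neq0 // gt_eqF.
  split; apply/eqP; rewrite -(eqr_nat R); apply/eqP; apply: (mulIf im) => //.
  exact: addrI e2.
- move=> q q' A hq hq' ne GA.
  have [y1 y2 x1 x2] := hG' _ hq; have [y1' y2' x1' x2'] := hG' _ hq'.
  have h9 : ((3 * m)%:R : R) ^- 2 = (m%:R ^+ 2)^-1 / 9.
    by rewrite natrM exprMn invfM; field; rewrite gt_eqF.
  have [e|nA] := pselect (eq_pm A 1%:M).
  + have -> : mobius A q' = q' by case: e => ->; rewrite ?mobius_opp mobius1.
    have [i [j [hi hj eq]]] := mem_grid hq; have [i' [j' [hi' hj' eq']]] := mem_grid hq'.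
    (* Heights are at most 2, so distinct grid points have [ch] at least 1 + 1 / (8 m^2), more than
       1 + 1 / (3 m)^2. *)
    rewrite /ch ltrD2l ltr_pdivlMr; last by rewrite !mulr_gt0 //; lra.
    have yy : q.2 * q'.2 <= 2 * 2 by exact: ler_pM1.
    rewrite h9; set im := (m%:R ^+ 2)^-1.
    have im0 : 0 < im by rewrite invr_gt0 exprn_gt0.
    apply: lt_le_trans (_ : im <= _); first by clear -im0 yy; nra.
    have [ii|ii] := eqVneq i i'.
      have jj : j != j' by apply: contra ne => /eqP jj; rewrite eq eq' ii jj.
      rewrite eq eq' ii /= subrr expr0n /= add0r.
      have -> : 1 + j%:R / m%:R - (1 + j'%:R / m%:R) = (j%:R - j'%:R) / m%:R :> R by ring.
      by rewrite expr_div_n -/im -[leLHS]mul1r ler_pM2r // nat_gap.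
    rewrite eq eq' /= -mulrBl expr_div_n -/im.
    apply: le_trans (_ : (i%:R - i'%:R) ^+ 2 * im <= _); last by rewrite lerDl sqr_ge0.
    by rewrite -[leLHS]mul1r ler_pM2r // nat_gap.
  + have dA := hs_det hG GA.
    have hAq := mobius_half dA (half _ hq').
    have t := ch_triangle (half _ hq') hAq (half _ hq).
    have sd := sys_disp hG GA nA (half _ hq').
    have cc : ch q' q <= 3 / 2 + X ^+ 2 / 2.
      suff : ((q'.1 - q.1) ^+ 2 + (q'.2 - q.2) ^+ 2) / (2 * q'.2 * q.2) <= 1 / 2 + X ^+ 2 / 2.
        by rewrite /ch => h; clear -h; lra.
      rewrite ler_pdivrMr; last by rewrite !mulr_gt0 //; lra.
      have : 1 * 1 <= q'.2 * q.2 by apply: ler_pM.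
      have : (q'.1 - q.1) ^+ 2 <= X ^+ 2 by nra.
      have : (q'.2 - q.2) ^+ 2 <= 1 by nra.
      have := sqr_ge0 X; nra.
    have g1 := ch_ge1 (half _ hq) hAq; have g2 := ch_ge1 (half _ hq') (half _ hq).
    (* Otherwise the triangle inequality would bound the displacement of q' by 2 * (3/2 + X^2/2) * 2
       - 1, below the assumed systole. *)
    have : 2 < ch q (mobius A q').
      rewrite ltNge; apply/negP => h2.
      have : ch q' q * ch q (mobius A q') <= (3 / 2 + X ^+ 2 / 2) * 2 by exact: ler_pM1.
      lra.
    have : ((3 * m)%:R : R) ^- 2 <= 1.
      by rewrite invf_le1 ?exprn_gt0 ?ltr0n ?muln_gt0 // exprn_ege1 // ler1n muln_gt0.
    lra.
- by rewrite size_grid mul0r subr0 natrM natrM XN expr2 mulrA.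
Qed.
End SystoleBound.

(** * Half-collars and the lower bound *)

Section ConjGroup.
Variables (R : realType) (g : nat) (Gamma : set 'M[R]_2).
Hypothesis hG : hyperbolic_surface g Gamma.
Variable M : 'M[R]_2.
Hypothesis dM : \det M = 1.
Implicit Types (A B : 'M[R]_2) (z p q : R * R).

(** The group in the frame where the geodesic M(axis) becomes the imaginary axis. *)
Definition conjG B := Gamma (M *m B *m invmx M).

Let uM := unit2 dM.

Lemma conjG_in A : Gamma A -> conjG (invmx M *m A *m M).
Proof. by move=> h; rewrite /conjG !mulmxA mulmxV // mul1mx mulmxK. Qed.

Lemma conjG_det B : conjG B -> \det B = 1.
Proof.
by move=> /(hs_det hG); rewrite !det_mulmx dM det_invmx2 // mulr1 mul1r.
Qed.

Lemma conjG_mul A B : conjG A -> conjG B -> conjG (A *m B).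
Proof.
rewrite /conjG => hA hB; have := hs_mul hG hA hB.
by rewrite !mulmxA mulmxKV.
Qed.

Lemma conjG_inv B : conjG B -> conjG (invmx B).
Proof.
move=> hB; have dB := conjG_det hB; have := hs_inv hG hB.
have dV := det_invmx2 dM.
rewrite invmx_mul2 ?det_mul1 // invmx_mul2 // invmxK mulmxA.
by [].
Qed.

Lemma conjG_opp B : conjG B -> conjG (- B).
Proof. by rewrite /conjG mulmxN mulNmx => /(hs_opp hG). Qed.

Lemma conj_trace B : (M *m B *m invmx M) 0 0 + (M *m B *m invmx M) 1 1 =
  B 0 0 + B 1 1.
Proof.
rewrite !mul2E; have [-> -> -> ->] := invmx2E dM.
by transitivity ((M 0 0 * M 1 1 - M 0 1 * M 1 0) * (B 0 0 + B 1 1));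
  [ring|rewrite -det2E dM mul1r].
Qed.

Lemma conj_pm1 B : eq_pm (M *m B *m invmx M) 1%:M -> eq_pm B 1%:M.
Proof.
have e : invmx M *m (M *m B *m invmx M) *m M = B.
  by rewrite !mulmxA mulVmx // mul1mx mulmxKV.
case=> h; move: e; rewrite h => <-; [left|right].
- by rewrite mulmx1 mulVmx.
- by rewrite mulmxN mulmx1 mulNmx mulVmx.
Qed.

Lemma conjG_hyp B : conjG B -> ~ eq_pm B 1%:M -> 2 < `|B 0 0 + B 1 1|.
Proof. by move=> hB nB; rewrite -conj_trace; apply: (hypG hG hB) => /conj_pm1. Qed.

Lemma conjG_ch B p q : conjG B -> halfplane p -> halfplane q ->
  ch (mobius M p) (mobius (M *m B *m invmx M) (mobius M q)) = ch p (mobius B q).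
Proof.
move=> hB hp hq; have dB := conjG_det hB.
have dV := det_invmx2 dM.
have hMq := mobius_half dM hq.
have e : mobius (M *m B *m invmx M) (mobius M q) = mobius M (mobius B q).
  have hV : halfplane (mobius (invmx M) (mobius M q)) by exact: mobius_half.
  by rewrite (mobius_mul (det_mul1 dM dB) dV hMq) (mobius_mul dM dB hV) mobiusK.
by rewrite e (ch_mobius dM hp (mobius_half dB hq)).
Qed.

Lemma conjG_disp B z : conjG B -> ~ eq_pm B 1%:M -> halfplane z ->
  cosh (systole Gamma) <= ch z (mobius B z).
Proof.
move=> hB nB hz; rewrite -(conjG_ch hB hz hz).
by apply: (sys_disp hG hB); [move=> /conj_pm1|exact: mobius_half].
Qed.

Variables (l : R) (T : 'M[R]_2).
Hypotheses (l0 : 0 < l) (GT : Gamma T) (hT : eq_pm T (M *m dg l *m invmx M)).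

Lemma conjG_dg : conjG (dg l).
Proof.
case: hT => e; rewrite /conjG; first by rewrite -e.
by have := hs_opp hG GT; rewrite e opprK.
Qed.

Let pe := expR (l / 2).
Let qe := expR (- (l / 2)).

Let pq : pe * qe = 1. Proof. by rewrite -expRD subrr expR0. Qed.
Let pneq : qe < pe. Proof. by rewrite /pe /qe ltr_expR; have := l0; lra. Qed.

(** If bc = 0, the commutator of B with the translation has trace 2, so it is trivial since every
    other element is hyperbolic; what commutes with the translation is diagonal. *)
Lemma conjG_par B : conjG B -> B 0 1 * B 1 0 = 0 -> B 0 1 = 0 /\ B 1 0 = 0.
Proof.
move=> hB bc; have dB := conjG_det hB; have hD := conjG_dg.
pose C := B *m dg l *m (invmx B *m invmx (dg l)).
have hC : conjG C by apply: conjG_mul; apply: conjG_mul => //; apply: conjG_inv.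
have [b1 b2 b3 b4] := invmx2E dB; have [d1 d2 d3 d4] := invmx2E (det_dg l).
move: (dB); rewrite det2E bc subr0 => ad.
have tC : C 0 0 + C 1 1 = 2.
  rewrite /C !mul2E b1 b2 b3 b4 d1 d2 d3 d4 /dg !mx2V -/pe -/qe.
  transitivity (2 * (B 0 0 * B 1 1) * (pe * qe) - B 0 1 * B 1 0 * (pe ^+ 2 + qe ^+ 2)).
    by ring.
  by rewrite ad pq bc; ring.
have [e1|n1] := pselect (eq_pm C 1%:M); last first.
  by have := conjG_hyp hC n1; rewrite tC normr_nat ltxx.
have {}e1 : C = 1%:M.
  have m1 : - 1 - 1 <> 2 :> R by lra.
  by case: e1 => // e; case: m1; rewrite -[RHS]tC e !opp2E !id2V.
have e2 : B *m dg l = dg l *m B.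
  have : C *m (dg l *m B) = B *m dg l.
    rewrite /C -!mulmxA (mulmxA _ (dg l) B) mulVmx ?unit2 ?det_dg //.
    by rewrite mul1mx mulVmx ?unit2 // mulmx1.
  by rewrite e1 mul1mx.
have x01 : B 0 1 * qe = pe * B 0 1.
  have := congr1 (fun X : 'M[R]_2 => X 0 1) e2.
  by rewrite /= !mul2E /dg !mx2V mul0r addr0 mulr0 add0r.
have x10 : B 1 0 * pe = qe * B 1 0.
  have := congr1 (fun X : 'M[R]_2 => X 1 0) e2.
  by rewrite /= !mul2E /dg !mx2V mul0r add0r mulr0 addr0.
have nn : pe - qe != 0 by rewrite gt_eqF // subr_gt0.
split; apply: (mulIf nn); rewrite mul0r.
- by rewrite mulrBr x01 [pe * _]mulrC subrr.
- by rewrite mulrBr x10 [qe * _]mulrC subrr.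
Qed.

(** abcd = 0 means that the axis and its image share an end. If bc is not 0, [conjG_par] applied to
    the conjugated translation leaves only a = d = 0, a half-turn, which is not hyperbolic. *)
Lemma conjG_abcd B : conjG B -> B 0 0 * B 1 0 * (B 0 1 * B 1 1) = 0 ->
  B 0 1 = 0 /\ B 1 0 = 0.
Proof.
move=> hB h0; have dB := conjG_det hB.
have [b1 b2 b3 b4] := invmx2E dB.
have [bc|bc] := eqVneq (B 0 1 * B 1 0) 0; first exact: conjG_par.
have ad : B 0 0 * B 1 1 = 0.
  by apply/eqP; rewrite -(mulrI_eq0 _ (mulfI bc)); apply/eqP; rewrite -h0; ring.
have hE : conjG (B *m dg l *m invmx B).
  by apply: conjG_mul; [apply: conjG_mul => //; exact: conjG_dg|exact: conjG_inv].
have [|e1 e2] := conjG_par hE.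
  rewrite !mul2E b1 b2 b3 b4 /dg !mx2V -/pe -/qe.
  transitivity (- (B 0 0 * B 1 0 * (B 0 1 * B 1 1)) * (pe - qe) ^+ 2); first by ring.
  by rewrite h0 oppr0 mul0r.
have nn : pe - qe != 0 by rewrite gt_eqF // subr_gt0.
have ab : B 0 0 * B 0 1 = 0.
  apply: (mulIf nn); rewrite mul0r; move: e1.
  by rewrite !mul2E ?b1 ?b2 ?b3 ?b4 /dg !mx2V -/pe -/qe => e1; rewrite -[RHS]oppr0 -e1; ring.
have cd : B 1 0 * B 1 1 = 0.
  apply: (mulIf nn); rewrite mul0r; move: e2.
  by rewrite !mul2E ?b1 ?b2 ?b3 ?b4 /dg !mx2V -/pe -/qe => e2; rewrite -e2; ring.
move: bc; rewrite mulf_eq0 negb_or => /andP[b0 c0].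
have a0 : B 0 0 = 0 by apply: (mulIf b0); rewrite mul0r.
have d0 : B 1 1 = 0 by apply: (mulfI c0); rewrite mulr0.
have [[e|e]|n1] := pselect (eq_pm B 1%:M).
- by move: a0; rewrite e id2V => /eqP; rewrite oner_eq0.
- by move: a0; rewrite e opp2E id2V => /eqP; rewrite oppr_eq0 oner_eq0.
- by have := conjG_hyp hB n1; rewrite a0 d0 addr0 normr0 ltNge ler0n.
Qed.

Lemma conjG_diag B : conjG B -> B 0 1 = 0 -> B 1 0 = 0 ->
  exists2 t : R, forall z, mobius B z = (expR t * z.1, expR t * z.2) &
    t = 0 \/ systole Gamma <= `|t|.
Proof.
move=> hB b0 c0; have dB := conjG_det hB.
move: (dB); rewrite det2E b0 mul0r subr0 => ad.
have a0 : B 0 0 != 0 by apply/eqP => e; move: ad; rewrite e mul0r; lra.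
have d0 : B 1 1 != 0 by apply/eqP => e; move: ad; rewrite e mulr0; lra.
have pos : 0 < B 0 0 ^+ 2 by rewrite exprn_even_gt0.
have eB z : mobius B z = (expR (ln (B 0 0 ^+ 2)) * z.1, expR (ln (B 0 0 ^+ 2)) * z.2).
  rewrite lnK ?posrE // mobiusE /mden b0 c0 !mulr0 !mul0r !add0r !addr0 expr0n addr0.
  have -> : B 1 1 = (B 0 0)^-1 by apply: (mulfI a0); rewrite ad mulfV.
  by congr pair; field; rewrite a0.
exists (ln (B 0 0 ^+ 2)) => //; set t := ln _ in eB *.
have [e1|n1] := pselect (eq_pm B 1%:M).
  left; have e : mobius B (0, 1) = (0, 1).
    by case: e1 => ->; rewrite ?mobius_opp mobius1.
  move: (e); rewrite eB /= => -[_]; rewrite mulr1 => h.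
  by apply: expR_inj; rewrite h expR0.
right; have := conjG_disp hB n1 (half_axis 0); rewrite eB /= mulr0 expR0 mulr1.
have := ch_axis 0 t; rewrite expR0 sub0r coshN -(cosh_abs t) => ->.
by rewrite cosh_leE ?normr_ge0 //; exact: ltW (sys_gt0 hG).
Qed.
End ConjGroup.

(** * A collar on one side of the axis *)

Section HalfCollar.
Variables (R : realType) (g : nat) (Gamma : set 'M[R]_2).
Hypothesis hG : hyperbolic_surface g Gamma.
Implicit Types (A B : 'M[R]_2) (z p q : R * R).

Lemma cosh_quad (x : R) : 1 + x ^+ 2 / 8 <= cosh x.
Proof.
wlog x0 : x / 0 <= x.
  move=> h; rewrite -cosh_abs -[X in 1 + X / 8]real_normK ?num_real //.
  exact/h/normr_ge0.
rewrite -cosh2 /cosh; have := expR_ge1Dx (x / 2); rewrite expRN.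
have := expR_gt0 (x / 2); move: (expR _) => E E0 hE.
have -> : 2 * ((E + E^-1) / 2) ^+ 2 - 1 = 1 + (E - E^-1) ^+ 2 / 2.
  by field; rewrite gt_eqF.
have : E^-1 <= 1.
  by rewrite invf_le1 //; lra.
set F := E^-1 => hF; have EF : E * F = 1 by rewrite mulfV ?gt_eqF.
nra.
Qed.

(** When the axis and its image are disjoint, |1 + 2bc| = |ad + bc| is the cosine of their distance.
    Both inequalities reduce to sums of two squares. *)
Lemma axis_ch_lower B (y y' : R) : \det B = 1 -> 0 < y -> 0 < y' ->
  `|1 + 2 * (B 0 1 * B 1 0)| <= ch (0, y) (mobius B (0, y')).
Proof.
move=> dB y0 y0'; have hz : halfplane (0, y') by [].
have hy : halfplane (0, y) by [].
have hB := mobius_half dB hz; have n0 := mden_gt0 dB hz.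
have -> : ch (0, y) (mobius B (0, y')) =
    ((B 0 0 * y') ^+ 2 + B 0 1 ^+ 2 + y ^+ 2 * ((B 1 0 * y') ^+ 2 + B 1 1 ^+ 2)) /
    (2 * y * y').
  rewrite chE // mobiusE /=; move: n0.
  have -> : mden B (0, y') = (B 1 0 * y') ^+ 2 + B 1 1 ^+ 2.
    by rewrite /mden /= mulr0 add0r addrC.
  move: dB; rewrite det2E.
  move: (B 0 0) (B 0 1) (B 1 0) (B 1 1) => a b c d dB n0.
  set n := (c * y') ^+ 2 + d ^+ 2 in n0 *.
  have key : (a * c * y' ^+ 2 + b * d) ^+ 2 + y' ^+ 2 = ((a * y') ^+ 2 + b ^+ 2) * n.
    transitivity ((a * c * y' ^+ 2 + b * d) ^+ 2 + y' ^+ 2 * (a * d - b * c) ^+ 2).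
      by rewrite dB expr1n mulr1.
    by rewrite /n; ring.
  transitivity (((a * c * y' ^+ 2 + b * d) ^+ 2 + y' ^+ 2 + y ^+ 2 * n ^+ 2) /
     (2 * y * y' * n)).
    by field; rewrite !gt_eqF.
  by rewrite key; field; rewrite !gt_eqF.
rewrite ler_pdivlMr; last by rewrite !mulr_gt0.
rewrite -[X in _ * X]gtr0_norm; last by rewrite !mulr_gt0.
rewrite -normrM ler_norml; move: dB; rewrite det2E.
move: (B 0 0) (B 0 1) (B 1 0) (B 1 1) => a b c d dB.
have -> : 1 + 2 * (b * c) = a * d + b * c by lra.
apply/andP; split; rewrite -subr_ge0.
- rewrite [leRHS](_ : _ = (a * y' + d * y) ^+ 2 + (b + c * y * y') ^+ 2); last by ring.
  by rewrite addr_ge0 // sqr_ge0.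
- rewrite [leRHS](_ : _ = (a * y' - d * y) ^+ 2 + (b - c * y * y') ^+ 2); last by ring.
  by rewrite addr_ge0 // sqr_ge0.
Qed.

(** p is at distance at least arsinh 1 from the axis and q is not on its side; 10/9 is below the
    resulting bound. *)
Lemma ch_left p q : halfplane p -> halfplane q -> p.2 <= p.1 -> q.1 <= 0 ->
  10 / 9 < ch p q.
Proof.
rewrite /halfplane /= => p0 q0 hp hq; rewrite chE // ltr_pdivlMr; last by rewrite !mulr_gt0.
have : 0 < p.2 * q.2 by rewrite mulr_gt0.
have : p.2 ^+ 2 <= (p.1 - q.1) ^+ 2 by nra.
have := sqr_ge0 (7 * p.2 - 5 * q.2); nra.
Qed.

Lemma ch_ray (x x' a b : R) : cosh (a - b) <= ch (x, expR a) (x', expR b).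
Proof.
rewrite -ch_axis /ch /= lerD2l ler_pM2r ?invr_gt0 ?mulr_gt0 ?expR_gt0 //.
by rewrite lerD2r subr0 expr0n sqr_ge0.
Qed.

Lemma triple_bound (x y w V : R) : 1 <= x -> x <= V -> 1 <= y -> y <= 10 / 9 ->
  1 <= w -> w <= V -> 4 * x * y * w <= 40 / 9 * V ^+ 2.
Proof.
move=> x1 xV y1 y2 w1 wV.
have xw : x * w <= V * V by apply: ler_pM; lra.
have : y * (x * w) <= 10 / 9 * (V * V) by apply: ler_pM; rewrite ?mulr_ge0 //; lra.
rewrite expr2; lra.
Qed.

Variable M : 'M[R]_2.
Hypothesis dM : \det M = 1.
Variables (l : R) (T : 'M[R]_2).
Hypotheses (l0 : 0 < l) (GT : Gamma T) (hT : eq_pm T (M *m dg l *m invmx M)).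
Hypothesis noX : forall B, conjG Gamma M B -> 0 <= B 0 0 * B 1 0 * (B 0 1 * B 1 1).

(* The points (mu y, y) with 1 <= mu < 1 + W and 1 <= y < exp (systole) have area
   of order W * systole on one side of the axis; if every element mapping the
   axis to this side moved it far away, they would stay apart in X. *)
Lemma half_collar (W : nat) : 864 * g%:R + 1 <= W%:R * systole Gamma ->
  exists B, [/\ conjG Gamma M B, 0 < B 0 0 * B 1 0, 0 < B 0 1 * B 1 1 &
    `|1 + 2 * (B 0 1 * B 1 0)| <= 40 / 9 * (1 + (1 + W%:R) ^+ 2 / 2) ^+ 2].
Proof.
move=> hW; apply: contrapT => no.
have s0 := sys_gt0 hG; have W0 : 0 <= W%:R :> R by [].
set s := systole Gamma in hW s0 *.
have far B : conjG Gamma M B -> 0 < B 0 0 * B 1 0 -> 0 < B 0 1 * B 1 1 ->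
    40 / 9 * (1 + (1 + W%:R) ^+ 2 / 2) ^+ 2 < `|1 + 2 * (B 0 1 * B 1 0)|.
  move=> hB b1 b2; rewrite ltNge; apply/negP => h; apply: no; exists B; split => //.
pose f (m i j : nat) : R * R := ((1 + i%:R / m%:R) * expR (j%:R / m%:R), expR (j%:R / m%:R)).
pose G m := grid (m * W) (Num.truncn (m%:R * s)) (fun i j => mobius M (f m i j)).
apply: (@packing_absurd R g Gamma hG G (W%:R * s) W%:R); first exact: hW.
clear hW => m m0.
have mR : 0 < m%:R :> R by rewrite ltr0n.
have fh i j : halfplane (f m i j) by exact: expR_gt0.
have im : m%:R^-1 != 0 :> R by rewrite invr_neq0 // gt_eqF.
have finj i j i' j' : f m i j = f m i' j' -> i = i' /\ j = j'.
  move=> [] e1 /expR_inj /(mulIf im) /eqP; rewrite eqr_nat => /eqP jj; split => //.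
  move: e1; rewrite jj => /(mulIf (lt0r_neq0 (expR_gt0 _))) /addrI /(mulIf im) /eqP.
  by rewrite eqr_nat => /eqP.
have fE i j : f m i j = ((1 + i%:R / m%:R) * expR (j%:R / m%:R), expR (j%:R / m%:R)) by [].
clearbody f; split.
- apply: uniq_grid => i j i' j' e; apply: finj.
  by rewrite -(mobiusK dM (fh i j)) e mobiusK.
- by move=> q /mem_grid[i [j [_ _ ->]]]; exact: mobius_half.
- move=> q q' A /mem_grid[i [j [hi hj ->]]] /mem_grid[i' [j' [hi' hj' ->]]] ne GA.
  set B := invmx M *m A *m M.
  have hB : conjG Gamma M B by exact: conjG_in.
  have dB := conjG_det hG dM hB.
  have eA : A = M *m B *m invmx M.
    by rewrite /B !mulmxA mulmxV ?unit2 // mul1mx mulmxK ?unit2.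
  rewrite {1}eA (conjG_ch hG dM hB) //.
  have h9 : ((3 * m)%:R : R) ^- 2 = (m%:R^-1) ^+ 2 / 9.
    by rewrite natrM exprMn invfM; field; rewrite gt_eqF.
  rewrite h9; set k : R := m%:R^-1 in im *.
  have k0 : 0 < k by rewrite invr_gt0.
  have k1 : k <= 1 by rewrite invf_le1 // ler1n.
  have k2 : 1 + k ^+ 2 / 9 <= 10 / 9 by nra.
  have hx u v : (u < m * W)%N -> 0 < (f m u v).2 /\
      (f m u v).2 <= (f m u v).1 <= (1 + W%:R) * (f m u v).2.
    move=> hu; rewrite fE /=; split; first exact: expR_gt0.
    rewrite ler_peMl ?expR_ge0 ?lerDl ?divr_ge0 //= ler_pM2r ?expR_gt0 // lerD2l.
    by rewrite ler_pdivrMr // mulrC -natrM ler_nat ltnW.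
  have [p0 /andP[p1 p2]] := hx i j hi; have [q0 /andP[q1 q2]] := hx i' j' hi'.
  have hBq := mobius_half dB (fh i' j').
  have chax u v : (u < m * W)%N -> ch (0, (f m u v).2) (f m u v) <= 1 + (1 + W%:R) ^+ 2 / 2.
    move=> hu; have [z0 /andP[z1 z2]] := hx u v hu.
    rewrite /ch /= lerD2l sub0r subrr expr0n addr0 ler_pdivrMr ?mulr_gt0 //.
    move: z0 z1 z2; move: (f m u v).1 (f m u v).2 => X Y Y0 h1 h2.
    rewrite sqrrN [leRHS](_ : _ = ((1 + W%:R) * Y) ^+ 2); last by field.
    have X0 : 0 <= X by apply: ltW; apply: lt_le_trans h1.
    by rewrite ler_sqr ?nnegrE // (le_trans X0 h2).
  (* Here B translates along the axis, by 0 or at least by the systole. The points span less than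
     one period, so only the translation by 0 can bring two of them close. *)
  have [z|nz] := eqVneq (B 0 0 * B 1 0 * (B 0 1 * B 1 1)) 0.
    have [b0 c0] := conjG_abcd hG dM l0 GT hT hB z.
    have [t ht tt] := conjG_diag hG dM hB b0 c0.
    have bound (u v : nat) : (u < Num.truncn (m%:R * s))%N -> u%:R * k - v%:R * k <= s - k.
      move=> hu; have : (u.+1%:R : R) <= m%:R * s.
        have ms0 : 0 <= m%:R * s by rewrite mulr_ge0 // ltW.
        have /andP[h _] := truncn_itv ms0.
        by apply: le_trans h; rewrite ler_nat.
      rewrite -natr1 => h; have : 0 <= v%:R * k by rewrite mulr_ge0 // ltW.
      have : (u%:R + 1) * k <= m%:R * s * k by rewrite ler_pM2r.
      rewrite mulrAC /k mulfV ?gt_eqF // mul1r; clear -k0 noX hT l0 GT; lra.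
    have hlog : ch (f m i j) (mobius B (f m i' j')) =
        ch ((1 + i%:R * k) * expR (j%:R * k), expR (j%:R * k))
           (expR t * ((1 + i'%:R * k) * expR (j'%:R * k)), expR (t + j'%:R * k)).
      by rewrite ht !fE expRD.
    have [big|small] := leP k `|j%:R * k - (t + j'%:R * k)|.
      rewrite hlog; apply: lt_le_trans (ch_ray _ _ _ _).
      apply: lt_le_trans (cosh_quad _).
      have : k ^+ 2 <= (j%:R * k - (t + j'%:R * k)) ^+ 2.
        by rewrite -[leRHS]real_normK ?num_real // ler_sqr ?nnegrE // ltW.
      have : 0 < k ^+ 2 by rewrite exprn_gt0.
      lra.
    have t0 : t = 0.
      case: tt => // tt; exfalso; move: small.
      have b1 := bound j j' hj; have b2 := bound j' j hj'.
      rewrite ltr_norml => /andP[sm1 sm2]; move: tt.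
      by have [t0|t0] := ger0P t => tt; clear -sm1 sm2 b1 b2 tt; lra.
    have jj : j = j'.
      apply/eqP; apply/negPn/negP => nj; move: small.
      rewrite t0 add0r -mulrBl normrM (gtr0_norm k0) -[ltRHS]mul1r ltr_pM2r //.
      have := nat_gap R nj; rewrite leNgt => /negP h h'; apply: h.
      by rewrite -[ltLHS]real_normK ?num_real // expr_lt1 ?normr_ge0.
    rewrite hlog t0 jj expR0 mul1r add0r /ch /= ltrD2l subrr expr0n addr0.
    have ii : i != i' by apply: contra ne => /eqP ->; rewrite jj.
    have := nat_gap R ii; have := expR_gt0 (j'%:R * k); move: (expR _) => Y Y0 h.
    rewrite ltr_pdivlMr ?mulr_gt0 //.
    have -> : (1 + i%:R * k) * Y - (1 + i'%:R * k) * Y = (i%:R - i'%:R) * (k * Y) by ring.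
    rewrite exprMn.
    have kY : 0 < (k * Y) ^+ 2 by rewrite exprn_gt0 // mulr_gt0.
    apply: lt_le_trans (_ : (k * Y) ^+ 2 <= _).
      rewrite [ltLHS](_ : _ = (k * Y) ^+ 2 * (2 / 9)); last by field.
      by rewrite gtr_pMr // ltr_pdivrMr // mul1r ltr_nat.
    by rewrite ler_peMl // ltW.
  apply: le_lt_trans k2 _.
  have pos : 0 < B 0 0 * B 1 0 * (B 0 1 * B 1 1) by rewrite lt_neqAle eq_sym nz noX.
  have viafar : 40 / 9 * (1 + (1 + W%:R) ^+ 2 / 2) ^+ 2 < `|1 + 2 * (B 0 1 * B 1 0)| ->
      10 / 9 < ch (f m i j) (mobius B (f m i' j')).
    move=> h; rewrite ltNge; apply/negP => h2.
    have hq0 : halfplane (0, (f m i' j').2) by [].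
    have hp0 : halfplane (0, (f m i j).2) by [].
    have := axis_ch_lower dB p0 q0.
    have := ch_triangle3 hp0 (fh i j) hBq (mobius_half dB hq0).
    rewrite (ch_mobius dB (fh i' j') hq0) (chC (f m i' j')).
    have c1 := chax i j hi; have c2 := chax i' j' hi'.
    have g1 := ch_ge1 hp0 (fh i j); have g2 := ch_ge1 hq0 (fh i' j').
    have g3 := ch_ge1 (fh i j) hBq.
    move: h h2 c1 c2 g1 g2 g3; set V := 1 + _.
    move: (ch (0, _) (f m i j)) (ch _ (mobius B (f m i' j'))) => C1' C3 h h2 c1 c2 g1 g2 g3.
    move: (ch (0, _) (f m i' j')) c2 g2 => C2 c2 g2 t3 low.
    have ub := triple_bound g1 c1 g3 h2 g2 c2.
    by have := lt_le_trans h (le_trans low (le_trans t3 ub)); rewrite ltxx.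
  have [ac|ac] := ltP 0 (B 0 0 * B 1 0).
    by apply: viafar; apply: far => //; rewrite -(pmulr_rgt0 _ ac).
  have ac' : B 0 0 * B 1 0 < 0.
    by rewrite lt_neqAle ac andbT; apply: contra nz => /eqP ->; rewrite mul0r.
  have bd' : B 0 1 * B 1 1 < 0 by rewrite -(nmulr_rgt0 _ ac').
  (* B sends the axis to the left, but its inverse sends it to the right: [far] applies to the
     inverse, which has the same bc. *)
  have [ab|ab] := ltP (B 0 0 * B 0 1) 0.
    have [e1 e2 e3 e4] := invmx2E dB.
    apply: viafar.
    have -> : B 0 1 * B 1 0 = invmx B 0 1 * invmx B 1 0 by rewrite e2 e3 mulrNN.
    have cd : B 1 0 * B 1 1 < 0.
      rewrite -(nmulr_rgt0 _ ab); suff -> : B 0 0 * B 0 1 * (B 1 0 * B 1 1) =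
          B 0 0 * B 1 0 * (B 0 1 * B 1 1) by [].
      by ring.
    apply: far; first exact: (conjG_inv hG dM hB); rewrite ?e1 ?e2 ?e3 ?e4 ?mulrN ?mulNr oppr_gt0.
      by rewrite mulrC.
    by rewrite mulrC.
  (* In the remaining case B sends the whole right side to the left of the axis. *)
  apply: ch_left => //.
  rewrite mobiusE /= pmulr_lle0 ?invr_gt0 ?mden_gt0 //.
  have adbc : B 0 0 * B 1 1 + B 0 1 * B 1 0 <= 0.
    have : B 0 0 * B 1 1 <= 0.
      have : (B 0 0 * B 1 1) * (B 0 1) ^+ 2 <= 0.
        rewrite [leLHS](_ : _ = (B 0 0 * B 0 1) * (B 0 1 * B 1 1)); last by ring.
        by rewrite mulr_ge0_le0 // ltW.
      rewrite pmulr_lle0 // exprn_even_gt0 //=.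
      by apply/eqP => e; move: bd'; rewrite e mul0r ltxx.
    have : B 0 1 * B 1 0 <= 0.
      have : (B 0 1 * B 1 0) * (B 0 0) ^+ 2 <= 0.
        rewrite [leLHS](_ : _ = (B 0 0 * B 0 1) * (B 0 0 * B 1 0)); last by ring.
        by rewrite mulr_ge0_le0 // ltW.
      rewrite pmulr_lle0 // exprn_even_gt0 //=.
      by apply/eqP => e; move: ac'; rewrite e mul0r ltxx.
    lra.
  have x0 : 0 < (f m i' j').1 by apply: lt_le_trans q1.
  have : (B 0 0 * B 1 1 + B 0 1 * B 1 0) * (f m i' j').1 <= 0 by rewrite mulr_le0_ge0 // ltW.
  have : B 0 0 * B 1 0 * ((f m i' j').1 ^+ 2 + (f m i' j').2 ^+ 2) <= 0.
    by apply: mulr_le0_ge0 => //; apply: addr_ge0; apply: sqr_ge0.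
  lra.
- rewrite size_grid natrM natrM expr2.
  have := truncnS_gt (m%:R * s); rewrite -natr1 => h.
  have : m%:R * W%:R * (m%:R * s - 1) <= m%:R * W%:R * (Num.truncn (m%:R * s))%:R.
    by rewrite ler_wpM2l ?mulr_ge0 //; lra.
  lra.
Qed.
End HalfCollar.

(** * A short geodesic crossing the axis *)

Section LowerBound.
Variables (R : realType) (g : nat).
Implicit Types (A B C M : 'M[R]_2) (z p q : R * R).

(** At the exact balancing exponent both products equal the geometric mean of al and de, at most Q;
    an error r in the exponent costs expR r. *)
Lemma balance (al de Q kap r : R) : 0 < al -> 0 < de -> 0 <= Q -> al * de <= Q ^+ 2 ->
  `|kap - (ln de - ln al) / 2| <= r ->
  al * expR kap <= Q * expR r /\ de * expR (- kap) <= Q * expR r.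
Proof.
move=> al0 de0 Q0 hQ; rewrite ler_norml => /andP[h1 h2].
have hm : expR ((ln al + ln de) / 2) <= Q.
  by rewrite -ler_sqr ?nnegrE ?expR_ge0 // expR_half expRD !lnK.
have eal : al = expR (ln al) by rewrite lnK ?posrE.
have ede : de = expR (ln de) by rewrite lnK ?posrE.
split; [rewrite {1}eal|rewrite {1}ede].
- apply: le_trans (_ : expR ((ln al + ln de) / 2) * expR r <= _).
    by rewrite -!expRD ler_expR; lra.
  by rewrite ler_pM2r // expR_gt0.
- apply: le_trans (_ : expR ((ln al + ln de) / 2) * expR r <= _).
    by rewrite -!expRD ler_expR; lra.
  by rewrite ler_pM2r // expR_gt0.
Qed.

Lemma mixed_gt0 (a x b y a' x' b' y' : R) : 0 < a -> 0 < x -> 0 < b -> 0 < y ->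
  a' < 0 -> 0 < x' -> b' < 0 -> 0 < y' -> 0 < a * x * (b * y) + a' * x' * (b' * y').
Proof.
move=> a0 x0 b0 y0 a1 x1 b1 y1; apply: addr_gt0; first by rewrite !mulr_gt0.
by rewrite mulrACA; apply: mulr_gt0; [rewrite nmulr_rgt0|exact: mulr_gt0].
Qed.

Definition posmx C := [/\ 0 < C 0 0, 0 < C 0 1, 0 < C 1 0 & 0 < C 1 1].

Variable (Gamma : set 'M[R]_2).
Hypothesis hG : hyperbolic_surface g Gamma.

Section Axis.
Variable M : 'M[R]_2.
Hypothesis dM : \det M = 1.
Variables (l : R) (T : 'M[R]_2).
Hypotheses (l0 : 0 < l) (GT : Gamma T) (hT : eq_pm T (M *m dg l *m invmx M)).

Local Notation GG := (conjG Gamma M).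

Lemma conjG_dgn (n : nat) : GG (dg (n%:R * l)).
Proof.
elim: n => [|n ih].
  rewrite mul0r dg0 /conjG mulmx1 mulmxV ?unit2 //; exact: (hs_one hG).
rewrite -natr1 mulrDl mul1r -dg_add; apply: (conjG_mul hG dM) => //.
exact: (conjG_dg hG GT hT).
Qed.

Lemma conjG_dgz (k : int) : GG (dg (k%:~R * l)).
Proof.
case: k => n; first exact: conjG_dgn.
have -> : dg ((Negz n)%:~R * l) = invmx (dg (n.+1%:R * l)).
  have [e1 e2 e3 e4] := invmx2E (det_dg (n.+1%:R * l)).
  rewrite NegzE mulrNz mulNr; apply: mx2P; rewrite ?e1 ?e2 ?e3 ?e4 /dg !mx2V ?oppr0 //.
    by rewrite mulNr.
  by rewrite mulNr opprK.
exact: (conjG_inv hG dM (conjG_dgn _)).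
Qed.

(** The fixed points of C have product - b / c < 0, so they are separated by the imaginary axis. In
    terms of the diagonalising N, bc is minus the product of the four entries of N times a
    square. *)
Lemma pos_crossing C : GG C -> posmx C -> exists N l2,
  [/\ \det (M *m N) = 1, 0 < l2, Gamma ((M *m N) *m dg l2 *m invmx (M *m N)),
      N 0 0 * N 1 0 * (N 0 1 * N 1 1) < 0 & C 0 0 + C 1 1 = 2 * cosh (l2 / 2)].
Proof.
move=> hC [c1 c2 c3 c4]; have dC := conjG_det hG dM hC.
have nC : ~ eq_pm C 1%:M.
  by case=> e; move: c2; rewrite e ?opp2E id2V ?oppr0 ltxx.
have := conjG_hyp hG dM hC nC; rewrite ger0_norm ?addr_ge0 ?ltW // => tC.
have [N [l2 [l20 dN eC tr]]] := hyp_diag dC tC.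
exists N, l2; split => //; first exact: det_mul1.
  by rewrite invmx_mul2 // !mulmxA -(mulmxA M N) -(mulmxA M (N *m _)) -eC.
have : 0 < C 0 1 * C 1 0 by rewrite mulr_gt0.
rewrite {1 2}eC !mul2E; have [-> -> -> ->] := invmx2E dN.
rewrite /dg !mx2V; set P := expR _; set Q := expR _ => h.
have : 0 < - (N 0 0 * N 1 0 * (N 0 1 * N 1 1)) * (P - Q) ^+ 2.
  by apply: lt_le_trans h _; rewrite le_eqVlt; apply/orP; left; apply/eqP; ring.
by rewrite pmulr_lgt0 ?oppr_gt0 // exprn_even_gt0 //= subr_eq0 gt_eqF // ltr_expR; lra.
Qed.

Hypothesis noX : forall B, GG B -> 0 <= B 0 0 * B 1 0 * (B 0 1 * B 1 1).

(** J is the half-turn about i: it reverses the axis and exchanges its sides, so this is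
    [half_collar] in the frame M J. *)
Lemma other_half_collar (W : nat) : 864 * g%:R + 1 <= W%:R * systole Gamma ->
  exists B, [/\ GG B, B 0 0 * B 1 0 < 0, B 0 1 * B 1 1 < 0 &
    `|1 + 2 * (B 0 1 * B 1 0)| <= 40 / 9 * (1 + (1 + W%:R) ^+ 2 / 2) ^+ 2].
Proof.
move=> hW; pose J : 'M[R]_2 := mx2 0 (-1) 1 0.
have dJ : \det J = 1 by rewrite det2E !mx2V; ring.
have dMJ := det_mul1 dM dJ.
have [j1 j2 j3 j4] := invmx2E dJ.
have tr B : conjG Gamma (M *m J) B -> GG (J *m B *m invmx J).
  by rewrite /conjG invmx_mul2 // !mulmxA.
have ent B : [/\ (J *m B *m invmx J) 0 0 = B 1 1, (J *m B *m invmx J) 0 1 = - B 1 0,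
    (J *m B *m invmx J) 1 0 = - B 0 1 & (J *m B *m invmx J) 1 1 = B 0 0].
  by split; rewrite !mul2E ?j1 ?j2 ?j3 ?j4 /J !mx2V; ring.
have hD : Gamma ((M *m J) *m dg l *m invmx (M *m J)).
  have := conjG_inv hG dM (conjG_dg hG GT hT); rewrite /conjG invmx_mul2 //.
  suff -> : invmx (dg l) = J *m dg l *m invmx J by rewrite !mulmxA.
  have [e1 e2 e3 e4] := invmx2E (det_dg l); have [f1 f2 f3 f4] := ent (dg l).
  by apply: mx2P; rewrite ?e1 ?e2 ?e3 ?e4 ?f1 ?f2 ?f3 ?f4 /dg !mx2V.
have noX' B : conjG Gamma (M *m J) B -> 0 <= B 0 0 * B 1 0 * (B 0 1 * B 1 1).
  move=> /tr /noX; have [-> -> -> ->] := ent B => h; apply: le_trans h _.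
  by rewrite le_eqVlt; apply/orP; left; apply/eqP; ring.
have [B [hB b1 b2 b3]] := half_collar hG dMJ l0 hD (or_introl erefl) noX' hW.
exists (J *m B *m invmx J); have [-> -> -> ->] := ent B; split; first exact: tr.
- by rewrite mulrN oppr_lt0 mulrC.
- by rewrite mulNr oppr_lt0 mulrC.
- by rewrite mulrNN [B 1 0 * _]mulrC.
Qed.

(* If neither A nor B^-1 has entries of constant sign, then A = (+ -; + -) and
   B = (+ +; - -) up to sign, so that A D B E is positive for diagonal D and E;
   powers of dg l are chosen to balance the four terms of the trace. *)
Lemma bounded_positive (W : nat) (Q : R) : 864 * g%:R + 1 <= W%:R * systole Gamma ->
  (1 + 40 / 9 * (1 + (1 + W%:R) ^+ 2 / 2) ^+ 2) / 2 <= Q ->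
  exists C, [/\ GG C, posmx C & C 0 0 + C 1 1 <= 4 * Q * expR l].
Proof.
move=> hW hQ; have Q0 : 0 <= Q.
  apply: le_trans hQ; rewrite divr_ge0 // addr_ge0 // mulr_ge0 ?sqr_ge0 //; lra.
have th0 : 0 < l / 2 by rewrite divr_gt0.
set V := 40 / 9 * _ in hQ.
have bds B : GG B -> `|1 + 2 * (B 0 1 * B 1 0)| <= V ->
    `|B 0 0 * B 1 1| <= Q /\ `|B 0 1 * B 1 0| <= Q.
  move=> hB; have := conjG_det hG dM hB; rewrite det2E !ler_norml => d /andP[? ?].
  by split; apply/andP; split; lra.
have dgE k : [/\ (dg (k * l)) 0 0 = expR (k * (l / 2)) :> R, (dg (k * l)) 0 1 = 0 :> R,
    (dg (k * l)) 1 0 = 0 :> R & (dg (k * l)) 1 1 = expR (- (k * (l / 2))) :> R].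
  by rewrite /dg !mx2V mulrA.
have expl : expR (l / 2) <= expR l by rewrite ler_expR; lra.
(* A matrix that is already positive only needs its two diagonal entries balanced by one power of
   [dg l]. *)
have case1 C : GG C -> posmx C -> C 0 0 * C 1 1 <= Q ->
    exists C, [/\ GG C, posmx C & C 0 0 + C 1 1 <= 4 * Q * expR l].
  move=> hC [c1 c2 c3 c4] cQ.
  set ka := (ln (C 1 1) - ln (C 0 0)) / 2; pose k := Num.floor (ka / (l / 2)).
  have [e1 e2 e3 e4] := dgE k%:~R; have hD := conjG_dgz k.
  have Q1 : 1 <= Q.
    apply: le_trans cQ; have := conjG_det hG dM hC; rewrite det2E.
    have : 0 < C 0 1 * C 1 0 by rewrite mulr_gt0.
    lra.
  have [] := @balance (C 0 0) (C 1 1) Q (k%:~R * (l / 2)) (l / 2) c1 c4 Q0.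
  - by rewrite expr2; apply: le_trans cQ _; rewrite ler_peMl.
  - rewrite -/ka -[X in `|_ - X|](divfK (lt0r_neq0 th0)) -mulrBl normrM (gtr0_norm th0).
    rewrite -[leRHS]mul1r ler_pM2r //.
    have /andP[h1 h2] := mem_rg1_floor (ka / (l / 2)).
    by rewrite ler_norml; move: h1 h2; rewrite -/k; lra.
  move=> h1 h2; exists (C *m dg (k%:~R * l)); split; first exact: (conjG_mul hG dM).
  - by split; rewrite mul2E ?e1 ?e2 ?e3 ?e4 ?mulr0 ?addr0 ?add0r mulr_gt0 ?expR_gt0.
  - rewrite !mul2E e1 e2 e3 e4 !mulr0 addr0 add0r.
    have : Q * expR (l / 2) <= Q * expR l by rewrite ler_wpM2l.
    have : 0 <= Q * expR l by rewrite mulr_ge0 ?expR_ge0.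
    lra.
have [A [hA a1 a2 a3]] := half_collar hG dM l0 GT hT noX hW.
have [B [hB b1 b2 b3]] := other_half_collar hW.
have {}a3 := bds _ hA a3; have {}b3 := bds _ hB b3; clear bds.
wlog a00 : A hA a1 a2 a3 / 0 < A 0 0.
  move=> h; have [a0|a0] := ltP 0 (A 0 0); first exact: (h A).
  apply: (h (- A)); rewrite ?opp2E ?mulrNN //; first exact: (conjG_opp hG).
  by rewrite oppr_gt0 lt_neqAle a0 andbT; apply/eqP => e; move: a1; rewrite e mul0r ltxx.
wlog b00 : B hB b1 b2 b3 / 0 < B 0 0.
  move=> h; have [b0|b0] := ltP 0 (B 0 0); first exact: (h B).
  apply: (h (- B)); rewrite ?opp2E ?mulrNN //; first exact: (conjG_opp hG).
  by rewrite oppr_gt0 lt_neqAle b0 andbT; apply/eqP => e; move: b1; rewrite e mul0r ltxx.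
have a10 : 0 < A 1 0 by rewrite -(pmulr_rgt0 _ a00).
have b10 : B 1 0 < 0 by rewrite -(pmulr_rlt0 _ b00).
have [a01|a01] := ltP 0 (A 0 1).
  have a11 : 0 < A 1 1 by rewrite -(pmulr_rgt0 _ a01).
  by apply: (case1 A) => //; case: a3; rewrite ger0_norm // mulr_ge0 // ltW.
have {}a01 : A 0 1 < 0.
  by rewrite lt_neqAle a01 andbT; apply/eqP => e; move: a2; rewrite e mul0r ltxx.
have a11 : A 1 1 < 0 by rewrite -(nmulr_rgt0 _ a01).
have [b01|b01] := ltP (B 0 1) 0.
  have b11 : 0 < B 1 1 by rewrite -(nmulr_rlt0 _ b01).
  have [e1 e2 e3 e4] := invmx2E (conjG_det hG dM hB).
  apply: (case1 (invmx B)); first exact: (conjG_inv hG dM).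
    by split; rewrite ?e1 ?e2 ?e3 ?e4 ?oppr_gt0.
  by rewrite e1 e4 mulrC; case: b3; rewrite ger0_norm // mulr_ge0 // ltW.
have {}b01 : 0 < B 0 1.
  by rewrite lt_neqAle b01 andbT eq_sym; apply/eqP => e; move: b2; rewrite e mul0r ltxx.
have b11 : B 1 1 < 0 by rewrite -(pmulr_rlt0 _ b01).
clear case1 a1 a2 b1 b2.
have al0 : 0 < A 0 0 * B 0 0 by rewrite mulr_gt0.
have de0 : 0 < A 1 1 * B 1 1 by rewrite nmulr_rgt0.
have be0 : 0 < A 0 1 * B 1 0 by rewrite nmulr_rgt0.
have ga0 : 0 < A 1 0 * B 0 1 by rewrite mulr_gt0.
have QQ (x y : R) : `|x| <= Q -> `|y| <= Q -> x * y <= Q ^+ 2.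
  by move=> hx hy; apply: le_trans (ler_norm _) _; rewrite normrM expr2 ler_pM.
have h1 : (A 0 0 * B 0 0) * (A 1 1 * B 1 1) <= Q ^+ 2.
  by rewrite mulrACA; case: a3 => ? _; case: b3 => ? _; apply: QQ.
have h2 : (A 1 0 * B 0 1) * (A 0 1 * B 1 0) <= Q ^+ 2.
  by rewrite mulrACA [A 1 0 * _]mulrC; case: a3 => _ ?; case: b3 => _ ?; apply: QQ.
set k1 := (ln (A 1 1 * B 1 1) - ln (A 0 0 * B 0 0)) / 2.
set k2 := (ln (A 0 1 * B 1 0) - ln (A 1 0 * B 0 1)) / 2.
(* With exponents p + f and - f for D and E, the four terms of the trace carry the exponents p, - p,
   p + 2 f and - (p + 2 f), so the two pairs are balanced one after the other. The step of p + 2 f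
   is twice as large, hence [expR l] in the bound. *)
pose p := Num.floor (k1 / (l / 2)).
pose f := Num.floor ((k2 / (l / 2) - p%:~R) / 2).
have [] := @balance _ _ Q (p%:~R * (l / 2)) (l / 2) al0 de0 Q0 h1.
  rewrite -/k1 -[X in `|_ - X|](divfK (lt0r_neq0 th0)) -mulrBl normrM (gtr0_norm th0).
  rewrite -[leRHS]mul1r ler_pM2r //.
  have /andP[] := mem_rg1_floor (k1 / (l / 2)).
  by rewrite ler_norml -/p; lra.
move=> A1 A2.
have [] := @balance _ _ Q ((p + 2 * f)%:~R * (l / 2)) l ga0 be0 Q0 h2.
  rewrite [leRHS](_ : l = 2 * (l / 2)); last by field.
  rewrite -/k2 -[X in `|_ - X|](divfK (lt0r_neq0 th0)) -mulrBl normrM (gtr0_norm th0).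
  rewrite ler_pM2r // intrD intrM.
  have /andP[] := mem_rg1_floor ((k2 / (l / 2) - p%:~R) / 2).
  by rewrite ler_norml -/f; lra.
move=> A3 A4.
have [e1 e2 e3 e4] := dgE (p + f)%:~R; have [f1 f2 f3 f4] := dgE (- f)%:~R.
have hD := conjG_dgz (p + f); have hE := conjG_dgz (- f).
move: (dg ((p + f)%:~R * l)) (dg ((- f)%:~R * l)) hD hE e1 e2 e3 e4 f1 f2 f3 f4.
move=> D E hD hE e1 e2 e3 e4 f1 f2 f3 f4.
exists (A *m D *m (B *m E)); split.
- by do 2! apply: (conjG_mul hG dM).
- have E1 := expR_gt0 ((p + f)%:~R * (l / 2)); have E2 := expR_gt0 (- ((p + f)%:~R * (l / 2))).
  have F1 := expR_gt0 ((- f)%:~R * (l / 2)); have F2 := expR_gt0 (- ((- f)%:~R * (l / 2))).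
  split; rewrite !mul2E ?e1 ?e2 ?e3 ?e4 ?f1 ?f2 ?f3 ?f4 !mulr0 !addr0 !add0r; exact: mixed_gt0.
- rewrite !mul2E ?e1 ?e2 ?e3 ?e4 ?f1 ?f2 ?f3 ?f4 !mulr0 !addr0 !add0r.
  have -> : A 0 0 * expR ((p + f)%:~R * (l / 2)) * (B 0 0 * expR ((- f)%:~R * (l / 2))) =
      A 0 0 * B 0 0 * expR (p%:~R * (l / 2)).
    by rewrite mulrACA -expRD intrD mulrNz; congr (_ * expR _); ring.
  have -> : A 0 1 * expR (- ((p + f)%:~R * (l / 2))) * (B 1 0 * expR ((- f)%:~R * (l / 2))) =
      A 0 1 * B 1 0 * expR (- ((p + 2 * f)%:~R * (l / 2))).
    by rewrite mulrACA -expRD !intrD intrM mulrNz; congr (_ * expR _); ring.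
  have -> : A 1 0 * expR ((p + f)%:~R * (l / 2)) * (B 0 1 * expR (- ((- f)%:~R * (l / 2)))) =
      A 1 0 * B 0 1 * expR ((p + 2 * f)%:~R * (l / 2)).
    by rewrite mulrACA -expRD !intrD intrM mulrNz; congr (_ * expR _); ring.
  have -> : A 1 1 * expR (- ((p + f)%:~R * (l / 2))) * (B 1 1 * expR (- ((- f)%:~R * (l / 2)))) =
      A 1 1 * B 1 1 * expR (- (p%:~R * (l / 2))).
    by rewrite mulrACA -expRD !intrD mulrNz; congr (_ * expR _); ring.
  have : Q * expR (l / 2) <= Q * expR l by rewrite ler_wpM2l.
  clear -A1 A2 A3 A4 noX hT l0 GT; lra.
Qed.
End Axis.

End LowerBound.

(** * Numerical estimates for the lower bound *)

Section LowerNumerics.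
Variable R : realType.

Lemma ln_inv_ge (s : R) : 0 < s -> s <= 1 / 2 -> 1 / 2 <= ln (1 / s).
Proof.
move=> s0 s2; rewrite -ler_expR lnK ?posrE ?divr_gt0 // ler_pdivlMr //.
have : expR (1 / 2) <= 2 :> R.
  have := expR_ge1Dx (- (1 / 2) : R); rewrite expRN => h.
  have e0 := expR_gt0 (1 / 2 : R); rewrite -[leLHS]invrK invf_ple ?posrE ?invr_gt0 //; lra.
have := expR_gt0 (1 / 2 : R); nra.
Qed.

Lemma poly_bound (w Z : R) : 0 <= w -> 1 + w <= Z -> 2 <= Z ->
  4 * ((1 + 40 / 9 * (1 + (1 + w) ^+ 2 / 2) ^+ 2) / 2) <= 12 * Z ^+ 4.
Proof.
move=> w0 hs Z2.
have h1 : (1 + w) ^+ 2 <= Z ^+ 2 by rewrite ler_sqr ?nnegrE //; lra.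
have Z4 : 4 <= Z ^+ 2 by nra.
rewrite (_ : Z ^+ 4 = (Z ^+ 2) ^+ 2); last by rewrite -exprM.
have := sqr_ge0 (1 + w); move: (Z ^+ 2) ((1 + w) ^+ 2) h1 Z4 => U V h1 U4 V0.
have h3 : (1 + V / 2) ^+ 2 <= U ^+ 2 by rewrite ler_sqr ?nnegrE //; lra.
have : 4 ^+ 2 <= U ^+ 2 by rewrite ler_sqr ?nnegrE //; lra.
lra.
Qed.

Lemma short_length (X s w l l2 : R) : 1 <= X -> 0 < s -> s <= 1 / 2 -> 0 <= w ->
  (1 + w) * s <= X + 2 ->
  expR (l2 / 2) <= 4 * ((1 + 40 / 9 * (1 + (1 + w) ^+ 2 / 2) ^+ 2) / 2) * expR l ->
  l2 <= 2 * (ln (12 * (X + 2) ^+ 4) + 4 * ln (1 / s) + l).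
Proof.
move=> X1 s0 s2 w0 ws e2.
have p1 : 0 < 12 * (X + 2) ^+ 4 by rewrite mulr_gt0 // exprn_gt0 //; lra.
have i0 : 0 < 1 / s by rewrite divr_gt0.
have p2 : 0 < (1 / s) ^+ 4 by rewrite exprn_gt0.
have p4 := mulr_gt0 (mulr_gt0 p1 p2) (expR_gt0 l).
have : expR (l2 / 2) <= 12 * (X + 2) ^+ 4 * (1 / s) ^+ 4 * expR l.
  apply: le_trans e2 _; rewrite ler_pM2r ?expR_gt0 //.
  rewrite [leRHS](_ : _ = 12 * ((X + 2) / s) ^+ 4).
    apply: poly_bound => //; first by rewrite ler_pdivlMr.
    by rewrite ler_pdivlMr //; lra.
  by rewrite !expr_div_n; field; rewrite gt_eqF.
rewrite -ler_ln ?posrE //; last exact: expR_gt0.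
rewrite expRK lnM ?posrE ?expR_gt0 //; last exact: mulr_gt0.
by rewrite lnM ?posrE // expRK lnXn // -[_ *+ 4]mulr_natl; lra.
Qed.

Lemma width_bound (X sys s W : R) : 1 <= X -> 0 < s -> s <= 1 / 2 -> s <= sys ->
  W <= X / sys + 1 -> (1 + W) * s <= X + 2.
Proof.
move=> X1 s0 s2 ss hW; have sys0 : 0 < sys by exact: lt_le_trans ss.
have : X / sys * s <= X by rewrite mulrAC ler_pdivrMr // ler_pM2l //; lra.
have : (1 + W) * s <= (2 + X / sys) * s by rewrite ler_pM2r //; lra.
lra.
Qed.

(** One length is O(s) and the other O(L); bounded terms are absorbed in multiples of L because L is
    at least 1/2. *)
Lemma length_product (S1 s L N l sys : R) : 0 < S1 -> 0 < s -> 1 / 2 <= L -> 0 <= N ->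
  0 < l -> l < 2 * sys -> sys <= S1 -> sys <= (1 + 2 * S1) * s ->
  l * l <= 8 * (1 + 2 * S1) * (N + 4 + 2 * S1) * (s * L) /\
  forall l2, 0 < l2 -> l2 <= 2 * (N + 4 * L + l) ->
    l * l2 <= 8 * (1 + 2 * S1) * (N + 4 + 2 * S1) * (s * L).
Proof.
move=> S10 s0 L2 N0 l0 hl sS1 sS.
have K0 : 0 <= 4 * (1 + 2 * S1) * s by rewrite mulr_ge0 ?(ltW s0) //; lra.
have e : 8 * (1 + 2 * S1) * (N + 4 + 2 * S1) * (s * L) =
  (4 * (1 + 2 * S1) * s) * (2 * ((N + 4 + 2 * S1) * L)) by ring.
have h1 : N * (1 / 2) <= N * L by rewrite ler_wpM2l.
have h2 : S1 * (1 / 2) <= S1 * L by rewrite ler_wpM2l // ltW.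
have l1 : l <= 2 * ((1 + 2 * S1) * s) by lra.
split=> [|l2 l20 hl2].
  apply: le_trans (_ : (2 * ((1 + 2 * S1) * s)) * (2 * S1) <= _).
    by apply: ler_pM => //; lra.
  rewrite e [leLHS](_ : _ = 4 * (1 + 2 * S1) * s * S1); last by ring.
  by rewrite ler_wpM2l //; lra.
apply: le_trans (_ : (2 * ((1 + 2 * S1) * s)) * (2 * (N + 4 * L + 2 * S1)) <= _).
  by apply: ler_pM => //; lra.
rewrite e [leLHS](_ : _ = 4 * (1 + 2 * S1) * s * (N + 4 * L + 2 * S1)); last by ring.
by rewrite ler_wpM2l //; lra.
Qed.

Lemma min_bound (S1 sys : R) : 0 < sys -> sys <= S1 ->
  sys <= (1 + 2 * S1) * Num.min sys (1 / 2).
Proof. by move=> s0 sS; case: (leP sys (1 / 2)) => h; nra. Qed.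
End LowerNumerics.

(** * The lower bound for the interaction strength *)

Section LowerStrength.
Variables (R : realType) (g : nat) (Gamma : set 'M[R]_2).
Hypothesis hG : hyperbolic_surface g Gamma.
Implicit Types (A B C M : 'M[R]_2).

Lemma gi_ge1 M1 l1 T1 M2 l2 T2 A : \det M1 = 1 -> 0 < l1 -> Gamma T1 ->
  eq_pm T1 (M1 *m dg l1 *m invmx M1) -> \det M2 = 1 -> 0 < l2 -> Gamma T2 ->
  eq_pm T2 (M2 *m dg l2 *m invmx M2) -> Gamma A ->
  let B := invmx M1 *m A *m M2 in B 0 0 * B 1 0 * (B 0 1 * B 1 1) < 0 ->
  (1 <= geometric_intersection Gamma (std M1 l1) (std M2 l2))%E.
Proof.
move=> m1 l10 G1 e1 m2 l20 G2 e2 GA B hB.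
apply: le_ereal_inf_tmp => x [n [d1 [d2 [[[c1 _ _] h1] [[c2 _ _] h2] _ card ->]]]].
rewrite lee_fin ler1n lt0n; apply/eqP => n0; move: card; rewrite n0 II0 card_eq0.
have [u hu] := axis_intersect hG m1 l10 G1 e1 m2 l20 G2 e2 GA hB c1 c2 h1 h2.
by move=> /eqP e; move: hu; rewrite e.
Qed.

Lemma strength_ge c1 c2 l1 l2 (K : R) : closed_geodesic Gamma c1 l1 ->
  closed_geodesic Gamma c2 l2 -> (1 <= geometric_intersection Gamma c1 c2)%E ->
  l1 * l2 <= K -> (K^-1%:E <= interaction_strength Gamma)%E.
Proof.
move=> g1 g2 gi hK; have [l10 _ _] := g1; have [l20 _ _] := g2.
have l0 : 0 < l1 * l2 by rewrite mulr_gt0.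
apply: (@le_trans _ _ (geometric_intersection Gamma c1 c2 * ((l1 * l2)^-1)%:E)%E).
  apply: (@le_trans _ _ (1 * ((l1 * l2)^-1)%:E)%E).
    by rewrite mul1e lee_fin lef_pV2 ?posrE //; apply: lt_le_trans hK.
  by rewrite lee_wpmul2r // lee_fin invr_ge0 ltW.
by apply: ereal_sup_ubound; exists c1, c2, l1, l2.
Qed.

(* By sys_bound, S1 bounds the systole; 12 (X + 2)^4 s^-4 bounds the constant
   4 Q of bounded_positive for the least admissible W. *)
Lemma lower_pair (X s S1 K : R) : X = 864 * g%:R + 1 ->
  s = Num.min (systole Gamma) (1 / 2) -> S1 = ln (12 + 4 * X ^+ 2) ->
  K = 8 * (1 + 2 * S1) * (ln (12 * (X + 2) ^+ 4) + 4 + 2 * S1) ->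
  ((K * (s * ln (1 / s)))^-1%:E <= interaction_strength Gamma)%E.
Proof.
move=> eX es eS eK; have s0 := sys_gt0 hG.
have X1 : 1 <= X by have g0 : 0 <= g%:R :> R by []; rewrite eX; lra.
have sb := sys_bound hG; rewrite -eX in sb.
have [c [l [cg hl]]] := sys_approx hG.
have [l0 _ _] := cg.
have [M [dM ec [T GT hT]]] := closed_geodesic_std hG cg.
have {}cg : closed_geodesic Gamma (std M l) l.
  by rewrite (_ : std M l = c) //; apply/funext => t; rewrite ec.
have ss0 : 0 < s by rewrite es lt_min s0; lra.
have ss : s <= systole Gamma by rewrite es ge_min lexx.
have s2 : s <= 1 / 2 by rewrite es ge_min lexx orbT.
have L2 := ln_inv_ge ss0 s2.
have hS1 : systole Gamma <= S1.
  rewrite eS -ler_expR lnK; last by rewrite posrE; have := sqr_ge0 X; lra.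
  move: sb; rewrite /cosh; have := expR_gt0 (- systole Gamma); lra.
have hS : systole Gamma <= (1 + 2 * S1) * s by rewrite es; exact: min_bound.
have S10 : 0 < S1 by apply: lt_le_trans hS1.
have lnX : 0 <= ln (12 * (X + 2) ^+ 4).
  apply: ln_ge0; have : 1 <= (X + 2) ^+ 4 by rewrite exprn_ege1 //; lra.
  lra.
have [prod1 prod2] := length_product S10 ss0 L2 lnX l0 hl hS1 hS.
(* If some translate of the axis crosses it, the geodesic already intersects itself and is paired
   with itself; otherwise the half-collars apply. *)
have [[B hB bX]|noX] := pselect (exists2 B, conjG Gamma M B &
    B 0 0 * B 1 0 * (B 0 1 * B 1 1) < 0).
  apply: (strength_ge cg cg).
    apply: (gi_ge1 dM l0 GT hT dM l0 GT hT hB).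
    by rewrite !mulmxA mulVmx ?unit2 // mul1mx mulmxKV ?unit2.
  by rewrite eK.
have {}noX B : conjG Gamma M B -> 0 <= B 0 0 * B 1 0 * (B 0 1 * B 1 1).
  by move=> hB; rewrite leNgt; apply/negP => h; apply: noX; exists B.
pose W := (Num.truncn (X / systole Gamma)).+1.
have hW : 864 * g%:R + 1 <= W%:R * systole Gamma.
  rewrite -eX -ler_pdivrMr //; apply: ltW; exact: truncnS_gt.
have W1 : (1 + W%:R) * s <= X + 2.
  apply: (width_bound X1 ss0 s2 ss); rewrite /W -natr1 lerD2r.
  have X0 : 0 <= X / systole Gamma by rewrite divr_ge0 // ltW // (lt_le_trans ltr01 X1).
  by have /andP[] := truncn_itv X0.
have [C [hC pC tC]] := bounded_positive hG dM l0 GT hT noX hW (lexx _).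
have [N [l2 [dMN l20 GN crossN trN]]] := pos_crossing hG dM hC pC.
have cg2 := std_closed_geodesic dMN l20 GN.
apply: (strength_ge cg cg2).
  apply: (gi_ge1 dM l0 GT hT dMN l20 GN (or_introl erefl) (hs_one hG)).
  by rewrite mulmx1 mulmxA mulVmx ?unit2 // mul1mx.
rewrite eK; apply: prod2 => //; apply: (short_length X1 ss0 s2 (ler0n _ W) W1).
apply: le_trans tC; rewrite trN /cosh [leRHS]mulrC divfK //.
by rewrite lerDl ltW // expR_gt0.
Qed.
End LowerStrength.

(** * A Margulis lemma *)

Section Norm2.
Variable R : realType.
Implicit Types (A B T M : 'M[R]_2) (z p : R * R).

(** The squared Frobenius norm. *)
Definition sq2 A := A 0 0 ^+ 2 + A 0 1 ^+ 2 + A 1 0 ^+ 2 + A 1 1 ^+ 2.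

Lemma sq2_ge0 A : 0 <= sq2 A.
Proof. by rewrite /sq2 !addr_ge0 ?sqr_ge0. Qed.

Lemma sq2_ch A : \det A = 1 -> sq2 A = 2 * ch (0, 1) (mobius A (0, 1)).
Proof.
move=> dA; rewrite (ch_disp dA) ?/halfplane //= /sq2; move: dA; rewrite det2E.
move: (A 0 0) (A 0 1) (A 1 0) (A 1 1) => a b c d dA.
transitivity (2 * (a * d - b * c) + ((- c - b) ^+ 2 + (d - a) ^+ 2)); first by ring.
by rewrite dA; field.
Qed.

Lemma sq2_near A : \det A = 1 ->
  ch (0, 1) (mobius A (0, 1)) - 1 <= sq2 (A - 1%:M).
Proof.
move=> dA; rewrite (ch_disp dA) ?/halfplane //= /sq2 !mxE /=.
move: (A 0 0) (A 0 1) (A 1 0) (A 1 1) => a b c d.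
rewrite -subr_ge0 [leRHS](_ : _ = ((b - c) ^+ 2 + (a + d - 2) ^+ 2) / 2).
  by rewrite divr_ge0 // addr_ge0 ?sqr_ge0.
by rewrite ?mulr1n ?mulr0n; field.
Qed.

Lemma sq2_sub1 A : \det A = 1 ->
  sq2 (A - 1%:M) = 2 * ch (0, 1) (mobius A (0, 1)) - 2 * (A 0 0 + A 1 1) + 2.
Proof. by move=> dA; rewrite -(sq2_ch dA) /sq2 !mxE /=; ring. Qed.

Lemma sq2_mul A B : sq2 (A *m B) <= sq2 A * sq2 B.
Proof.
rewrite /sq2 !mul2E.
move: (A 0 0) (A 0 1) (A 1 0) (A 1 1) => a b c d.
move: (B 0 0) (B 0 1) (B 1 0) (B 1 1) => x y z w.
rewrite -subr_ge0 [leRHS](_ : _ = (a * z - b * x) ^+ 2 + (a * w - b * y) ^+ 2 +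
  (c * z - d * x) ^+ 2 + (c * w - d * y) ^+ 2); last by ring.
by rewrite !addr_ge0 ?sqr_ge0.
Qed.

Lemma sq2_inv A : \det A = 1 -> sq2 (invmx A) = sq2 A.
Proof. by move=> dA; rewrite /sq2; have [-> -> -> ->] := invmx2E dA; ring. Qed.

Lemma sq2_sub A B : sq2 (A - B) <= 2 * (sq2 A + sq2 B).
Proof.
rewrite /sq2 !mxE.
move: (A 0 0) (A 0 1) (A 1 0) (A 1 1) => a b c d.
move: (B 0 0) (B 0 1) (B 1 0) (B 1 1) => x y z w.
rewrite -subr_ge0 [leRHS](_ : _ = (a + x) ^+ 2 + (b + y) ^+ 2 + (c + z) ^+ 2 +
  (d + w) ^+ 2); last by ring.
by rewrite !addr_ge0 ?sqr_ge0.
Qed.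

Lemma inv400 : 1 / 400 < 1 :> R. Proof. by lra. Qed.

Lemma sq2_m1 : sq2 (- 1%:M - 1%:M) = 8.
Proof. by rewrite /sq2 !mxE /= ?mulr1n ?mulr0n; ring. Qed.

Lemma sq2_bound A : sq2 (A - 1%:M) <= 1 / 400 -> sq2 A <= 5.
Proof.
have := sq2_sub (A - 1%:M) (- 1%:M); rewrite opprK subrK.
have -> : sq2 (- 1%:M) = 2 by rewrite /sq2 !opp2E !id2V; ring.
lra.
Qed.

(** [A, B] - 1 is the additive commutator of A - 1 and B - 1 times A^-1 B^-1. Submultiplicativity
    gives the factor 4 * (1/400) * 25 = 1/4. *)
Lemma sq2_comm A B : \det A = 1 -> \det B = 1 -> sq2 (A - 1%:M) <= 1 / 400 ->
  sq2 (B - 1%:M) <= 1 / 400 ->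
  sq2 (A *m B *m invmx A *m invmx B - 1%:M) <= sq2 (B - 1%:M) / 4.
Proof.
move=> dA dB hA hB.
have -> : A *m B *m invmx A *m invmx B - 1%:M =
    ((A - 1%:M) *m (B - 1%:M) - (B - 1%:M) *m (A - 1%:M)) *m (invmx A *m invmx B).
  have -> : (A - 1%:M) *m (B - 1%:M) - (B - 1%:M) *m (A - 1%:M) = A *m B - B *m A.
    rewrite !(mulmxBl, mulmxBr) !mul1mx !mulmx1 !opprB !addrA.
    by apply/matrixP => i j; rewrite !mxE; ring.
  rewrite mulmxBl !mulmxA; congr (_ - _).
  by rewrite mulmxK ?unit2 // mulmxV ?unit2.
apply: le_trans (sq2_mul _ _) _.
have h1 := sq2_sub ((A - 1%:M) *m (B - 1%:M)) ((B - 1%:M) *m (A - 1%:M)).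
have h2 := sq2_mul (A - 1%:M) (B - 1%:M); have h3 := sq2_mul (B - 1%:M) (A - 1%:M).
have h4 := sq2_mul (invmx A) (invmx B); rewrite !sq2_inv // in h4.
have bA := sq2_bound hA; have bB := sq2_bound hB.
have h5 : sq2 (invmx A *m invmx B) <= 25.
  apply: le_trans h4 _; rewrite (_ : 25 = 5 * 5); last by ring.
  by rewrite ler_pM ?sq2_ge0.
have Y0 := sq2_ge0 (B - 1%:M).
have h6 : sq2 (A - 1%:M) * sq2 (B - 1%:M) <= 1 / 400 * sq2 (B - 1%:M) by rewrite ler_wpM2r.
rewrite [leRHS](_ : _ = sq2 (B - 1%:M) / 100 * 25); last by field.
by apply: ler_pM; rewrite ?sq2_ge0 //; lra.
Qed.

Lemma frame z : halfplane z -> exists M, \det M = 1 /\ mobius M (0, 1) = z.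
Proof.
case: z => x y; rewrite /halfplane /= => y0.
have s0 : 0 < Num.sqrt y by rewrite sqrtr_gt0.
exists (mx2 (Num.sqrt y) (x / Num.sqrt y) 0 (Num.sqrt y)^-1); split.
  by rewrite det2E !mx2V mulr0 subr0 mulfV // gt_eqF.
rewrite mobiusE /mden !mx2V /=; congr pair.
  by field; rewrite gt_eqF.
rewrite -[in RHS](sqr_sqrtr (ltW y0)); move: (Num.sqrt y) s0 => s s0.
by field; rewrite gt_eqF.
Qed.

Lemma ch_frame M A : \det M = 1 -> \det A = 1 ->
  ch (mobius M (0, 1)) (mobius A (mobius M (0, 1))) =
  ch (0, 1) (mobius (invmx M *m A *m M) (0, 1)).
Proof.
move=> dM dA; have h : halfplane ((0, 1) : R * R) by rewrite /halfplane /= ltr01.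
have dV := det_invmx2 dM; have hM := mobius_half dM h; have hA := mobius_half dA hM.
rewrite (mobius_mul (det_mul1 dV dA) dM h) (mobius_mul dV dA hM).
by rewrite -(ch_mobius dV hM hA) (mobiusK dM h).
Qed.

(** Changing the base point from z to p conjugates T - 1 by some h with [sq2 h] = 2 [ch z p]. The
    trace terms of [sq2_sub1] only help, as the trace is at least 2. *)
Lemma disp_spread T z p : \det T = 1 -> 2 <= T 0 0 + T 1 1 -> halfplane z ->
  halfplane p ->
  ch p (mobius T p) - 1 <= 4 * ch z p ^+ 2 * (ch z (mobius T z) - 1).
Proof.
move=> dT tT hz hp; have [g [dg1 ez]] := frame hz; have [k [dk ep]] := frame hp.
have h01 : halfplane ((0, 1) : R * R) by rewrite /halfplane /= ltr01.
have dV := det_invmx2 dg1; have dk' := det_invmx2 dk.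
have dh : \det (invmx g *m k) = 1 by exact: det_mul1.
set h := invmx g *m k in dh; set A := invmx g *m T *m g.
have dA : \det A = 1 by rewrite /A !det_mulmx dV dT dg1 !mulr1.
have trA : A 0 0 + A 1 1 = T 0 0 + T 1 1.
  by have := conj_trace dV T; rewrite invmxK.
have eB : invmx k *m T *m k = invmx h *m A *m h.
  rewrite /h /A invmx_mul2 // invmxK !mulmxA mulmxK ?unit2 //.
  by rewrite -(mulmxA _ g (invmx g)) mulmxV ?unit2 // mulmx1.
have dB : \det (invmx k *m T *m k) = 1 by rewrite !det_mulmx dk' dT dk !mulr1.
have trB : (invmx k *m T *m k) 0 0 + (invmx k *m T *m k) 1 1 = T 0 0 + T 1 1.
  by have := conj_trace dk' T; rewrite invmxK.
have e1 : ch z (mobius T z) = ch (0, 1) (mobius A (0, 1)) by rewrite -ez ch_frame.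
have e2 : ch p (mobius T p) = ch (0, 1) (mobius (invmx k *m T *m k) (0, 1)).
  by rewrite -ep ch_frame.
have e3 : sq2 h = 2 * ch z p.
  rewrite (sq2_ch dh) /h (mobius_mul dV dk h01) ep -[in RHS](mobiusVK dg1 hp) -ez.
  by rewrite (ch_mobius dg1 h01 (mobius_half dV _)).
have : sq2 (invmx k *m T *m k - 1%:M) <= sq2 h * sq2 (A - 1%:M) * sq2 h.
  have -> : invmx k *m T *m k - 1%:M = invmx h *m (A - 1%:M) *m h.
    by rewrite eB mulmxBr mulmx1 mulmxBl mulVmx ?unit2.
  apply: le_trans (sq2_mul _ _) _; rewrite ler_wpM2r ?sq2_ge0 //.
  by apply: le_trans (sq2_mul _ _) _; rewrite sq2_inv.
rewrite (sq2_sub1 dB) (sq2_sub1 dA) trB trA -e1 -e2 e3.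
have := ch_ge1 hz hp; have := ch_ge1 hz (mobius_half dT hz).
move: (ch z p) (ch z _) (ch p _) (T 0 0 + T 1 1) tT => C X Y t t2 X1 C1 h1.
have : 1 <= C ^+ 2 by rewrite exprn_ege1.
move: h1; rewrite expr2; set D := C * C => h1 D1.
have {}h1 : 2 * Y - 2 * t + 2 <= 4 * D * (2 * X - 2 * t + 2) by rewrite /D; lra.
nra.
Qed.
End Norm2.

Section Margulis.
Variables (R : realType) (g : nat) (Gamma : set 'M[R]_2).
Hypothesis hG : hyperbolic_surface g Gamma.
Implicit Types (A B S T M : 'M[R]_2) (z p : R * R).

(** T and its conjugate by S commute, so they have the same axis and S preserves it. S cannot
    reverse the axis, a half-turn not being hyperbolic, so it translates along it. *)
Lemma stab_axis T S : Gamma T -> Gamma S -> ~ eq_pm T 1%:M ->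
  T *m (S *m T *m invmx S) = S *m T *m invmx S *m T -> S *m T = T *m S.
Proof.
move=> GT GS nT hc; have [M [l [l0 dM eT _ _]]] := geodesic_of hG GT nT.
have uM := unit2 dM; have dS := hs_det hG GS.
pose S' := invmx M *m S *m M.
have GS' : conjG Gamma M S' by exact: conjG_in.
have dS' := conjG_det hG dM GS'.
have eS : S = M *m S' *m invmx M.
  by rewrite /S' !mulmxA mulmxV // mul1mx mulmxK.
have sT : S *m T = T *m S <-> S' *m dg l = dg l *m S'.
  have e1 : S *m (M *m dg l *m invmx M) = M *m (S' *m dg l) *m invmx M.
    by rewrite eS !mulmxA mulmxKV.
  have e2 : (M *m dg l *m invmx M) *m S = M *m (dg l *m S') *m invmx M.
    by rewrite eS !mulmxA mulmxKV.
  have inj X Y : M *m X *m invmx M = M *m Y *m invmx M -> X = Y.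
    move=> h; have := congr1 (fun Z => invmx M *m Z *m M) h.
    by rewrite /= !mulmxA !mulmxKV // mulVmx // !mul1mx.
  case: eT => ->; rewrite ?mulmxN ?mulNmx e1 e2; split=> [|->] //.
  - exact: inj.
  - by move/oppr_inj; exact: inj.
apply/sT.
have hc' : dg l *m (S' *m dg l *m invmx S') = S' *m dg l *m invmx S' *m dg l.
  have [iS] : invmx S' = invmx M *m invmx S *m M /\ True.
    by split => //; rewrite /S' !invmx_mul2 ?det_mul1 ?det_invmx2 // invmxK mulmxA.
  have : (M *m dg l *m invmx M) *m (S *m (M *m dg l *m invmx M) *m invmx S) =
     S *m (M *m dg l *m invmx M) *m invmx S *m (M *m dg l *m invmx M).
    by case: eT hc => ->; rewrite ?mulmxN ?mulNmx ?mulmxN ?opprK // => /oppr_inj.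
  move=> h _; have := congr1 (fun Z => invmx M *m Z *m M) h.
  rewrite iS /S' /= !mulmxA mulVmx // mul1mx.
  by rewrite !mulmxKV //.
clearbody S'.
have [e1 e2 e3 e4] := invmx2E dS'.
have := congr1 (fun X : 'M[R]_2 => X 0 1) hc'; have := congr1 (fun X : 'M[R]_2 => X 1 0) hc'.
rewrite /= !mul2E e1 e2 e3 e4 /dg !mx2V.
set P := expR _; set Q := expR _.
have nPQ : P - Q != 0 by rewrite gt_eqF // subr_gt0 ltr_expR; lra.
have PQ2 : (P - Q) ^+ 2 != 0 by rewrite expf_eq0.
move=> h1 h2.
have ab : S' 0 0 * S' 0 1 = 0.
  apply: (mulIf PQ2); rewrite mul0r; move: h2 => /eqP; rewrite -subr_eq0 => /eqP h2.
  by apply: oppr_inj; rewrite oppr0 -h2; ring.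
have [|b0 c0] := conjG_abcd hG dM l0 GT eT GS'.
  by rewrite mulrACA ab mul0r.
by apply: mx2P; rewrite !mul2E /dg !mx2V ?b0 ?c0; ring.
Qed.

(** If A commutes with [A, B], it commutes with B A^-1 B^-1, hence with B A B^-1, and [stab_axis]
    applies. *)
Lemma comm_descend A B : Gamma A -> Gamma B -> ~ eq_pm A 1%:M ->
  let C := A *m B *m invmx A *m invmx B in A *m C = C *m A -> A *m B = B *m A.
Proof.
move=> GA GB nA C hC; have dA := hs_det hG GA; have dB := hs_det hG GB.
have [uA uB] := (unit2 dA, unit2 dB).
have h1 : A *m (B *m invmx A *m invmx B) = (B *m invmx A *m invmx B) *m A.
  have : invmx A *m (A *m C) = invmx A *m (C *m A) by rewrite hC.
  by rewrite /C !mulmxA mulVmx // !mul1mx.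
apply/esym/stab_axis => //.
set E := B *m A *m invmx B; set F := B *m invmx A *m invmx B in h1.
have EF : E *m F = 1%:M.
  by rewrite /E /F !mulmxA mulmxKV // mulmxK // mulmxV.
have FE : F *m E = 1%:M by exact: mulmx1C.
clearbody E F; have <- : E *m (A *m F) *m E = E *m A by rewrite -!mulmxA FE mulmx1.
by rewrite h1 (mulmxA E F A) EF mul1mx.
Qed.

(* The iterated commutators of A with B tend to 1, hence reach it by
   discreteness; comm_descend then climbs back to B. *)
Lemma margulis A B z : halfplane z -> Gamma A -> Gamma B ->
  ch z (mobius A z) <= 1 + 1 / 800 -> ch z (mobius B z) <= 1 + 1 / 800 ->
  A *m B = B *m A.
Proof.
move=> hz; have [e e0 he] := unif_discG hG; have [k [dk ez]] := frame hz.
have dV := det_invmx2 dk; have uk := unit2 dk.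
(* Of B and - B, the one with non-negative trace is near 1 rather than near -1. *)
wlog tB : B / 0 <= B 0 0 + B 1 1.
  move=> h GA GB hA hB; have [t|t] := leP 0 (B 0 0 + B 1 1); first exact: h.
  have : A *m (- B) = - B *m A.
    apply: h => //; [|exact: (hs_opp hG GB)|by rewrite mobius_opp].
    by rewrite !opp2E -opprD oppr_ge0 ltW.
  by rewrite mulmxN mulNmx => /oppr_inj.
wlog tA : A / 0 <= A 0 0 + A 1 1.
  move=> h GA GB hA hB; have [t|t] := leP 0 (A 0 0 + A 1 1); first exact: h.
  have : (- A) *m B = B *m (- A).
    apply: h => //; [|exact: (hs_opp hG GA)|by rewrite mobius_opp].
    by rewrite !opp2E -opprD oppr_ge0 ltW.
  by rewrite mulmxN mulNmx => /oppr_inj.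
move=> GA GB hA hB.
have [[->|->]|nA] := pselect (eq_pm A 1%:M); rewrite ?mulNmx ?mulmxN ?mul1mx ?mulmx1 //.
pose f X := sq2 (invmx k *m X *m k - 1%:M).
have fE X : Gamma X -> 0 <= X 0 0 + X 1 1 -> ch z (mobius X z) <= 1 + 1 / 800 ->
    f X <= 1 / 400.
  move=> GX tX hX; have dX := hs_det hG GX.
  have dX' : \det (invmx k *m X *m k) = 1 by rewrite !det_mulmx dV dX dk !mulr1.
  have t2 : 2 <= X 0 0 + X 1 1.
    have [[e1|e1]|n1] := pselect (eq_pm X 1%:M).
    - by rewrite e1 !id2V.
    - by move: tX; rewrite e1 !opp2E !id2V; lra.
    - by have := hypG hG GX n1; rewrite ger0_norm // => /ltW.
  have tr := conj_trace dV X; rewrite invmxK in tr.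
  rewrite /f (sq2_sub1 dX') tr -ch_frame // ez; lra.
pose cs := fix cs n := if n is n'.+1 then A *m cs n' *m invmx A *m invmx (cs n') else B.
have Gc n : Gamma (cs n).
  elim: n => [//|n ih] /=; apply: (hs_mul hG); last exact: (hs_inv hG).
  apply: (hs_mul hG); last exact: (hs_inv hG).
  exact: (hs_mul hG).
have fA := fE A GA tA hA; have fB := fE B GB tB hB.
have conj X Y : \det X = 1 -> \det Y = 1 -> invmx k *m (X *m Y *m invmx X *m invmx Y) *m k =
   (invmx k *m X *m k) *m (invmx k *m Y *m k) *m invmx (invmx k *m X *m k) *m
   invmx (invmx k *m Y *m k).
  move=> dX dY; rewrite !invmx_mul2 ?det_mul1 // !invmxK !mulmxA.
  by rewrite !(mulmxK uk).
(* The decay is geometric; this weaker rate suffices to get below the constant e of discreteness. *)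
have fc n : f (cs n) * n.+1%:R <= 1 / 400.
  elim: n => [|n ih]; first by rewrite mulr1.
  have f0 : 0 <= f (cs n) by exact: sq2_ge0.
  have fn : f (cs n) <= 1 / 400 by apply: le_trans ih; rewrite ler_peMr // ler1n.
  have dc := hs_det hG (Gc n); have dA := hs_det hG GA.
  have : f (cs n.+1) <= f (cs n) / 4.
    by rewrite /f /= conj //; apply: sq2_comm; rewrite ?det_mulmx ?dV ?dc ?dA ?dk ?mulr1.
  move=> h; apply: le_trans ih.
  apply: le_trans (_ : f (cs n) / 4 * n.+2%:R <= _); first by rewrite ler_wpM2r.
  rewrite -mulrA ler_wpM2l // -[n.+2]addn2 -[n.+1]addn1 !natrD.
  by have : 0 <= n%:R :> R by []; lra.
have [n hn] : exists n : nat, cs n = 1%:M.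
  pose n := Num.truncn e^-1; exists n.
  have hn : e^-1 < n.+1%:R by exact: truncnS_gt.
  have : f (cs n) < e.
    have : f (cs n) * n.+1%:R <= 1 / 400 := fc n.
    rewrite -ler_pdivlMr // => /le_lt_trans; apply.
    rewrite ltr_pdivrMr //; apply: lt_le_trans (_ : e * e^-1 <= _).
      rewrite mulfV; first exact: inv400.
      by rewrite gt_eqF.
    by rewrite ler_wpM2l // ltW.
  have dc := hs_det hG (Gc n).
  have dc' : \det (invmx k *m cs n *m k) = 1 by rewrite !det_mulmx dV dc dk !mulr1.
  move=> fe; have : ch z (mobius (cs n) z) < 1 + e.
    have := sq2_near dc'; rewrite -ch_frame // ez -/(f _); lra.
  move/(he _ _ hz (Gc n)) => [//|e1]; exfalso.
  have := fc n; rewrite /f e1 mulmxN mulNmx mulmx1 mulVmx // sq2_m1 -natrM => h.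
  by have := le_lt_trans h (inv400 R); rewrite ltrn1 mulnS.
have comm : A *m cs n = cs n *m A by rewrite hn mulmx1 mul1mx.
elim: n comm {hn} => [//|n ih] /= h; apply: ih.
exact: (comm_descend GA (Gc n) nA).
Qed.
End Margulis.

(** * Hypercycles and the upper bound *)

Section Hypercycle.
Variable R : realType.
Implicit Types (A B M : 'M[R]_2) (z w u v : R * R) (c : R -> R * R).

Definition hcyc M (dl tau : R) : R * R := mobius M (dl * expR tau, expR tau).

Lemma std_hcyc M l t : std M l t = hcyc M 0 (l * t).
Proof. by rewrite /std /hcyc mul0r. Qed.

Lemma hcyc_half M dl tau : \det M = 1 -> halfplane (hcyc M dl tau).
Proof. by move=> dM; apply: mobius_half => //; exact: expR_gt0. Qed.

Lemma hcyc_ch M dl tau tau' : \det M = 1 -> 0 <= dl -> dl <= 1 ->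
  ch (hcyc M dl tau) (hcyc M dl tau') <= 2 * cosh (tau - tau') - 1.
Proof.
move=> dM d0 d1; rewrite /hcyc (ch_mobius dM); last 2 first.
- exact: expR_gt0.
- exact: expR_gt0.
rewrite -ch_axis /ch /= -mulrBr subrr expr0n /= add0r.
have := expR_gt0 tau; have := expR_gt0 tau'; move: (expR tau) (expR tau') => x y y0 x0.
have : ((dl * (x - y)) ^+ 2 + (x - y) ^+ 2) / (2 * x * y) <= 2 * ((x - y) ^+ 2 / (2 * x * y)).
  rewrite mulrA ler_pM2r ?invr_gt0 ?mulr_gt0 // exprMn.
  have : dl ^+ 2 * (x - y) ^+ 2 <= 1 * (x - y) ^+ 2.
    by rewrite ler_wpM2r ?sqr_ge0 // expr_le1.
  lra.
lra.
Qed.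

Definition has_vel c (t : R) v :=
  is_derive t 1 (fun s => (c s).1) v.1 /\ is_derive t 1 (fun s => (c s).2) v.2.

Lemma has_vel_velocity c t v : has_vel c t v -> velocity c t = v.
Proof.
by case: v => a b [h1 h2]; rewrite /velocity !derive1E !derive_val.
Qed.

Lemma dD (f h : R -> R) (t a b : R) : is_derive t 1 f a -> is_derive t 1 h b ->
  is_derive t 1 (fun s => f s + h s) (a + b).
Proof. by move=> hf hh; exact: is_deriveD. Qed.

Lemma dM (f h : R -> R) (t a b : R) : is_derive t 1 f a -> is_derive t 1 h b ->
  is_derive t 1 (fun s => f s * h s) (f t * b + h t * a).
Proof. by move=> hf hh; exact: is_deriveM. Qed.

Lemma dK (k t : R) : is_derive t 1 (fun=> k) 0.
Proof. exact: is_derive_cst. Qed.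

Lemma dV (f : R -> R) (t a : R) : is_derive t 1 f a -> f t != 0 ->
  is_derive t 1 (fun s => (f s)^-1) (- (f t) ^- 2 * a).
Proof. by move=> hf f0; exact: is_deriveV. Qed.

Lemma dE (l t : R) : is_derive t 1 (fun s => expR (l * s)) (l * expR (l * t)).
Proof.
have h : is_derive t 1 (fun s => l * s) l.
  have := dM (dK l t) (is_derive_id t 1); rewrite mulr1 mulr0 addr0.
  by [].
by have := is_derive1_comp (is_derive_expR (l * t)) h; rewrite mulrC.
Qed.

(* (c z + d)^-2, the derivative of z |-> (a z + b) / (c z + d), times v. *)
Definition mvel M z v : R * R :=
  let p := M 1 0 * z.1 + M 1 1 in let q := M 1 0 * z.2 in
  (((p ^+ 2 - q ^+ 2) * v.1 + 2 * p * q * v.2) / (p ^+ 2 + q ^+ 2) ^+ 2,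
   ((p ^+ 2 - q ^+ 2) * v.2 - 2 * p * q * v.1) / (p ^+ 2 + q ^+ 2) ^+ 2).

Lemma has_vel_mobius M c t v : \det M = 1 -> halfplane (c t) -> has_vel c t v ->
  has_vel (fun s => mobius M (c s)) t (mvel M (c t) v).
Proof.
move=> dM1 hc [hx hy]; have n0 := mden_gt0 dM1 hc.
have hp := dD (dM (dK (M 1 0) t) hx) (dK (M 1 1) t).
have hq := dM (dK (M 1 0) t) hy.
have hn := dD (dM hp hp) (dM hq hq).
have nE s : mden M (c s) = (M 1 0 * (c s).1 + M 1 1) * (M 1 0 * (c s).1 + M 1 1) +
    M 1 0 * (c s).2 * (M 1 0 * (c s).2).
  by rewrite /mden; ring.
have n1 : (M 1 0 * (c t).1 + M 1 1) * (M 1 0 * (c t).1 + M 1 1) +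
    M 1 0 * (c t).2 * (M 1 0 * (c t).2) != 0.
  by rewrite -nE gt_eqF.
have hi := dV hn n1.
have hnum := dD (dD (dM (dK (M 0 0 * M 1 0) t) (dD (dM hx hx) (dM hy hy)))
   (dM (dK (M 0 0 * M 1 1 + M 0 1 * M 1 0) t) hx)) (dK (M 0 1 * M 1 1) t).
move: dM1; rewrite det2E => dM1.
have e : (M 1 0 * (c t).1 + M 1 1) ^+ 2 + (M 1 0 * (c t).2) ^+ 2 != 0.
  by move: n1; rewrite -!expr2.
split.
- rewrite (_ : (fun s => _) = (fun s => (M 0 0 * M 1 0 * ((c s).1 * (c s).1 + (c s).2 * (c s).2) +
     (M 0 0 * M 1 1 + M 0 1 * M 1 0) * (c s).1 + M 0 1 * M 1 1) *
     ((M 1 0 * (c s).1 + M 1 1) * (M 1 0 * (c s).1 + M 1 1) +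
       M 1 0 * (c s).2 * (M 1 0 * (c s).2))^-1)); last first.
    by apply/funext => s; rewrite mobiusE /= nE !expr2.
  apply: is_derive_eq (dM hnum hi) _.
  move: (c t) e n1 {hx hy hp hq hn hi hnum n0 hc} => [x y] /=; case: v => a b /=.
  move: (M 0 0) (M 0 1) (M 1 0) (M 1 1) dM1 => m00 m01 m10 m11 dM1 e n1.
  set r := (_ / _ in RHS); transitivity ((m00 * m11 - m01 * m10) * r).
    by rewrite /r; field; rewrite -?expr2 e.
  by rewrite dM1 mul1r.
- rewrite (_ : (fun s => _) = (fun s => (c s).2 *
     ((M 1 0 * (c s).1 + M 1 1) * (M 1 0 * (c s).1 + M 1 1) +
       M 1 0 * (c s).2 * (M 1 0 * (c s).2))^-1)); last first.
    by apply/funext => s; rewrite mobiusE /= nE.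
  apply: is_derive_eq (dM hy hi) _.
  move: (c t) e n1 {hx hy hp hq hn hi hnum n0 hc} => [x y] /=; case: v => a b /=.
  move: (M 1 0) (M 1 1) => m10 m11 e n1.
  by field; rewrite -?expr2 e.
Qed.

Lemma mvel_cross M z u v : \det M = 1 -> halfplane z ->
  (mvel M z u).1 * (mvel M z v).2 - (mvel M z u).2 * (mvel M z v).1 =
  (u.1 * v.2 - u.2 * v.1) / mden M z ^+ 2.
Proof.
move=> dM1 hz; have n0 := mden_gt0 dM1 hz; move: n0; rewrite /mvel /mden /= => n0.
by field; rewrite gt_eqF.
Qed.

Lemma has_vel_axis (dl l t : R) :
  has_vel (fun s => (dl * expR (l * s), expR (l * s))) t
    (dl * (l * expR (l * t)), l * expR (l * t)).
Proof.
split; last exact: dE.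
by have := dM (dK dl t) (dE l t); rewrite mulr0 addr0.
Qed.

Lemma hcyc_vel M dl l t : \det M = 1 -> has_vel (fun s => hcyc M dl (l * s)) t
  (mvel M (dl * expR (l * t), expR (l * t)) (dl * (l * expR (l * t)), l * expR (l * t))).
Proof.
move=> dM1; apply: (@has_vel_mobius M (fun s => (dl * expR (l * s), expR (l * s)))) => //.
  exact: expR_gt0.
exact: has_vel_axis.
Qed.

(* A tangency would be a double root of the numerator of the real part of
   y |-> (B (dl y, y)), whose discriminant is dl^2 - 4abcd. *)
Lemma cross_neq0 B (dl y : R) : \det B = 1 -> 0 < y ->
  dl ^+ 2 != 4 * (B 0 0 * B 0 1 * (B 1 0 * B 1 1)) ->
  (mobius B (dl * y, y)).1 = 0 -> (mvel B (dl * y, y) (dl, 1)).1 != 0.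
Proof.
move=> dB y0 hdl; have hz : halfplane (dl * y, y) by [].
have n0 := mden_gt0 dB hz.
rewrite mobiusE /= => /eqP; rewrite mulf_eq0 invr_eq0 (gt_eqF n0) orbF => /eqP N0.
apply: contra hdl; rewrite mulf_eq0 invr_eq0 expf_eq0 /= -[_ + _ ^+ 2]/(mden B (dl * y, y)).
rewrite (gt_eqF n0) orbF mulr1 => /eqP Z0.
move: dB n0 N0 Z0; rewrite det2E /mden /=.
move: (B 0 0) (B 0 1) (B 1 0) (B 1 1) => a b c d dB n0 N0 Z0.
have N0' : (a * c * (1 + dl ^+ 2) * y ^+ 2 + (a * d + b * c) * dl * y + b * d) = 0.
  by rewrite -N0; ring.
have D0 : 2 * (a * c * (1 + dl ^+ 2)) * y + (a * d + b * c) * dl = 0.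
  have : (2 * (a * c * (1 + dl ^+ 2)) * y + (a * d + b * c) * dl) *
      ((c * (dl * y) + d) ^+ 2 + (c * y) ^+ 2) = 0.
    transitivity ((a * d - b * c) * (((c * (dl * y) + d) ^+ 2 - (c * y) ^+ 2) * dl +
        2 * (c * (dl * y) + d) * (c * y)) +
      (a * c * (1 + dl ^+ 2) * y ^+ 2 + (a * d + b * c) * dl * y + b * d) *
      (2 * c ^+ 2 * (1 + dl ^+ 2) * y + 2 * c * d * dl)); first by ring.
    by rewrite N0' Z0 mulr0 mul0r addr0.
  by move/eqP; rewrite mulf_eq0 (gt_eqF n0) orbF => /eqP.
have : ((a * d + b * c) * dl) ^+ 2 - 4 * (a * c * (1 + dl ^+ 2)) * (b * d) = 0.
  transitivity ((2 * (a * c * (1 + dl ^+ 2)) * y + (a * d + b * c) * dl) ^+ 2 -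
    4 * (a * c * (1 + dl ^+ 2)) *
    (a * c * (1 + dl ^+ 2) * y ^+ 2 + (a * d + b * c) * dl * y + b * d)); first by ring.
  by rewrite D0 N0' mulr0 expr0n subrr.
have -> : ((a * d + b * c) * dl) ^+ 2 - 4 * (a * c * (1 + dl ^+ 2)) * (b * d) =
    (a * d - b * c) ^+ 2 * dl ^+ 2 - 4 * (a * b * (c * d)) by ring.
by rewrite dB expr1n mul1r => /eqP; rewrite subr_eq0.
Qed.

(** The numerator of the real part is a quadratic polynomial in y. Three roots would make its
    coefficients vanish, so ac = bd = 0 and, as dl > 0, ad + bc = 0; this contradicts (ad + bc)^2 =
    (ad - bc)^2 + 4 ac bd. *)
Lemma hcyc_two B (dl y1 y2 y3 : R) : \det B = 1 -> 0 < dl ->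
  0 < y1 -> 0 < y2 -> 0 < y3 ->
  (mobius B (dl * y1, y1)).1 = 0 -> (mobius B (dl * y2, y2)).1 = 0 ->
  (mobius B (dl * y3, y3)).1 = 0 -> [|| y1 == y2, y1 == y3 | y2 == y3].
Proof.
move=> dB dl0 p1 p2 p3.
have red y : 0 < y -> (mobius B (dl * y, y)).1 = 0 ->
    B 0 0 * B 1 0 * (1 + dl ^+ 2) * y ^+ 2 + (B 0 0 * B 1 1 + B 0 1 * B 1 0) * dl * y +
    B 0 1 * B 1 1 = 0.
  move=> y0; have hz : halfplane (dl * y, y) by [].
  have n0 := mden_gt0 dB hz.
  rewrite mobiusE /= => /eqP; rewrite mulf_eq0 invr_eq0 (gt_eqF n0) orbF => /eqP N0.
  by rewrite -N0; ring.
move=> /(red _ p1) h1 /(red _ p2) h2 /(red _ p3) h3.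
apply/negPn/negP; rewrite !negb_or => /and3P[n12 n13 n23].
rewrite -subr_eq0 in n12; rewrite -subr_eq0 in n13; rewrite -subr_eq0 in n23.
move: dB h1 h2 h3; rewrite det2E.
move: (B 0 0) (B 0 1) (B 1 0) (B 1 1) => a b c d dB.
set al := a * c * _; set be := _ * dl; move=> h1 h2 h3.
have e12 : al * (y1 + y2) + be = 0.
  apply: (mulIf n12); rewrite mul0r.
  transitivity ((al * y1 ^+ 2 + be * y1 + b * d) - (al * y2 ^+ 2 + be * y2 + b * d)); first by ring.
  by rewrite h1 h2 subrr.
have e13 : al * (y1 + y3) + be = 0.
  apply: (mulIf n13); rewrite mul0r.
  transitivity ((al * y1 ^+ 2 + be * y1 + b * d) - (al * y3 ^+ 2 + be * y3 + b * d)); first by ring.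
  by rewrite h1 h3 subrr.
have al0 : al = 0.
  apply: (mulIf n23); rewrite mul0r.
  transitivity ((al * (y1 + y2) + be) - (al * (y1 + y3) + be)); first by ring.
  by rewrite e12 e13 subrr.
have be0 : be = 0 by move: e12; rewrite al0 mul0r add0r.
have bd0 : b * d = 0 by move: h1; rewrite al0 be0 !mul0r !add0r.
have ac0 : a * c = 0.
  have k0 : 1 + dl ^+ 2 != 0 by rewrite gt_eqF // addr_gt0 // exprn_gt0.
  by apply: (mulIf k0); rewrite mul0r.
have ab0 : a * d + b * c = 0 by apply: (mulIf (lt0r_neq0 dl0)); rewrite mul0r.
have : (a * d + b * c) ^+ 2 = (a * d - b * c) ^+ 2 + 4 * (a * c) * (b * d) by ring.
by rewrite ab0 dB ac0 mulr0 mul0r addr0 expr0n expr1n => /eqP; rewrite eq_sym oner_eq0.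
Qed.
End Hypercycle.

(** * Hypercycles as transverse representatives *)

Section HypercycleCurves.
Variables (R : realType) (g : nat) (Gamma : set 'M[R]_2).
Hypothesis hG : hyperbolic_surface g Gamma.
Implicit Types (A B M : 'M[R]_2) (z w u v : R * R).

Lemma ctD (T : topologicalType) (f h : T -> R) : continuous f -> continuous h ->
  continuous (fun s => f s + h s).
Proof. by move=> hf hh s; exact: (cvgD (hf s) (hh s)). Qed.

Lemma ctM (T : topologicalType) (f h : T -> R) : continuous f -> continuous h ->
  continuous (fun s => f s * h s).
Proof. by move=> hf hh s; exact: (cvgM (hf s) (hh s)). Qed.

Lemma ctN (T : topologicalType) (f : T -> R) : continuous f -> continuous (fun s => - f s).
Proof. by move=> hf s; exact: (cvgN (hf s)). Qed.

Lemma ctK {T : topologicalType} (k : R) : continuous (fun _ : T => k).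
Proof. by move=> s; exact: cvg_cst. Qed.
Arguments ctK {T} k.

Lemma ctV (T : topologicalType) (f : T -> R) : (forall s, f s != 0) -> continuous f ->
  continuous (fun s => (f s)^-1).
Proof. by move=> f0 hf s; exact: (cvgV (f0 s) (hf s)). Qed.

Lemma ctE (T : topologicalType) (f : T -> R) : continuous f -> continuous (fun s => expR (f s)).
Proof. by move=> hf s; apply: (continuous_comp (hf s)); exact: continuous_expR. Qed.

Lemma mobius_continuous (T : topologicalType) M (x y : T -> R) : \det M = 1 ->
  (forall s, 0 < y s) -> continuous x -> continuous y ->
  continuous (fun s => (mobius M (x s, y s)).1) /\
  continuous (fun s => (mobius M (x s, y s)).2).
Proof.
move=> dM y0 hx hy.
have n0 s : mden M (x s, y s) != 0 by rewrite (gt_eqF (mden_gt0 dM (y0 s : halfplane (x s, y s)))).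
have hP : continuous (fun s => M 1 0 * x s + M 1 1).
  by apply: ctD; [apply: ctM => //; exact: ctK|exact: ctK].
have hQ : continuous (fun s => M 1 0 * y s) by apply: ctM => //; exact: ctK.
have hn : continuous (fun s => mden M (x s, y s)).
  exact: (ctD (ctM hP hP) (ctM hQ hQ)).
have hi := ctV n0 hn.
split.
- rewrite (_ : (fun s => _) = fun s => (M 0 0 * M 1 0 * (x s * x s + y s * y s) +
    (M 0 0 * M 1 1 + M 0 1 * M 1 0) * x s + M 0 1 * M 1 1) * (mden M (x s, y s))^-1).
    have h1 := ctM (ctK (M 0 0 * M 1 0)) (ctD (ctM hx hx) (ctM hy hy)).
    have h2 := ctM (ctK (M 0 0 * M 1 1 + M 0 1 * M 1 0)) hx.
    exact: (ctM (ctD (ctD h1 h2) (ctK (M 0 1 * M 1 1))) hi).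
  by apply/funext => s; rewrite mobiusE /= !expr2.
- rewrite (_ : (fun s => _) = fun s => y s * (mden M (x s, y s))^-1).
    exact: (ctM hy hi).
  by apply/funext => s; rewrite mobiusE.
Qed.

Lemma mvel_continuous M (x y p q : R -> R) : \det M = 1 -> (forall s, 0 < y s) ->
  continuous x -> continuous y -> continuous p -> continuous q ->
  continuous (fun s => (mvel M (x s, y s) (p s, q s)).1) /\
  continuous (fun s => (mvel M (x s, y s) (p s, q s)).2).
Proof.
move=> dM y0 hx hy hp hq.
have n0 s : ((M 1 0 * x s + M 1 1) * (M 1 0 * x s + M 1 1) +
    M 1 0 * y s * (M 1 0 * y s)) * ((M 1 0 * x s + M 1 1) * (M 1 0 * x s + M 1 1) +
    M 1 0 * y s * (M 1 0 * y s)) != 0.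
  have h : halfplane (x s, y s) by exact: y0.
  have : mden M (x s, y s) != 0 by rewrite (gt_eqF (mden_gt0 dM h)).
  by rewrite /mden /= -!expr2 => n0; rewrite expf_neq0.
have hP : continuous (fun s => M 1 0 * x s + M 1 1).
  by apply: ctD; [apply: ctM => //; exact: ctK|exact: ctK].
have hQ : continuous (fun s => M 1 0 * y s) by apply: ctM => //; exact: ctK.
have hn := ctD (ctM hP hP) (ctM hQ hQ).
have hi := ctV n0 (ctM hn hn).
have h1 := ctD (ctM hP hP) (ctN (ctM hQ hQ)).
have h2 := ctM (ctM (ctK 2) hP) hQ.
split.
- rewrite (_ : (fun s => _) = fun s => (((M 1 0 * x s + M 1 1) * (M 1 0 * x s + M 1 1) -
    M 1 0 * y s * (M 1 0 * y s)) * p s + 2 * (M 1 0 * x s + M 1 1) * (M 1 0 * y s) * q s) *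
    (((M 1 0 * x s + M 1 1) * (M 1 0 * x s + M 1 1) +
    M 1 0 * y s * (M 1 0 * y s)) * ((M 1 0 * x s + M 1 1) * (M 1 0 * x s + M 1 1) +
    M 1 0 * y s * (M 1 0 * y s)))^-1).
    exact: (ctM (ctD (ctM h1 hp) (ctM h2 hq)) hi).
  by apply/funext => s; rewrite /mvel /= !expr2.
- rewrite (_ : (fun s => _) = fun s => (((M 1 0 * x s + M 1 1) * (M 1 0 * x s + M 1 1) -
    M 1 0 * y s * (M 1 0 * y s)) * q s - 2 * (M 1 0 * x s + M 1 1) * (M 1 0 * y s) * p s) *
    (((M 1 0 * x s + M 1 1) * (M 1 0 * x s + M 1 1) +
    M 1 0 * y s * (M 1 0 * y s)) * ((M 1 0 * x s + M 1 1) * (M 1 0 * x s + M 1 1) +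
    M 1 0 * y s * (M 1 0 * y s)))^-1).
    exact: (ctM (ctD (ctM h1 hq) (ctN (ctM h2 hp))) hi).
  by apply/funext => s; rewrite /mvel /= !expr2.
Qed.

Lemma ct_exp (l : R) : continuous (fun s => expR (l * s)).
Proof. by apply: ctE; apply: ctM; [exact: ctK|move=> s; exact: cvg_id]. Qed.
Arguments ct_exp l : clear implicits.

Lemma hcyc_shift M l T dl tau : \det M = 1 -> Gamma T ->
  eq_pm T (M *m dg l *m invmx M) -> mobius T (hcyc M dl tau) = hcyc M dl (l + tau).
Proof.
move=> dM GT eT; rewrite /hcyc.
have h : halfplane (dl * expR tau, expR tau) by exact: expR_gt0.
have hM := mobius_half dM h; have dV := det_invmx2 dM.
have -> : mobius T (mobius M (dl * expR tau, expR tau)) =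
    mobius (M *m dg l *m invmx M) (mobius M (dl * expR tau, expR tau)).
  by case: eT => ->; rewrite ?mobius_opp.
rewrite (mobius_mul (det_mul1 dM (det_dg l)) dV hM) (mobiusK dM h).
by rewrite (mobius_mul dM (det_dg l) h) dg_mob /= expRD mulrCA.
Qed.

Lemma hcyc_closed M l T dl : \det M = 1 -> Gamma T ->
  eq_pm T (M *m dg l *m invmx M) -> closed_in Gamma (fun t => hcyc M dl (l * t)).
Proof.
move=> dM GT eT; split=> t; first exact: hcyc_half.
by exists T => //; rewrite (hcyc_shift dl _ dM GT eT); congr hcyc; ring.
Qed.

Lemma hcyc_C1 M l T dl : \det M = 1 -> Gamma T ->
  eq_pm T (M *m dg l *m invmx M) -> C1_closed_curve Gamma (fun t => hcyc M dl (l * t)).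
Proof.
move=> dM GT eT; have hv t := hcyc_vel dl l t dM.
have he := ct_exp l.
have [c1 c2] := @mvel_continuous M (fun t => dl * expR (l * t)) (fun t => expR (l * t))
  (fun t => dl * (l * expR (l * t))) (fun t => l * expR (l * t)) dM
  (fun t => expR_gt0 _) (ctM (ctK dl) he) he (ctM (ctK dl) (ctM (ctK l) he))
  (ctM (ctK l) he).
split; first exact: (hcyc_closed dl dM GT eT).
- split=> [t|]; first by have [h _] := hv t; exact: ex_derive.
  rewrite (_ : _^`()%classic = fun t => (mvel M (dl * expR (l * t), expR (l * t))
    (dl * (l * expR (l * t)), l * expR (l * t))).1) //.
  by apply/funext => t; have [h _] := hv t; rewrite derive1E derive_val.
- split=> [t|]; first by have [_ h] := hv t; exact: ex_derive.
  rewrite (_ : _^`()%classic = fun t => (mvel M (dl * expR (l * t), expR (l * t))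
    (dl * (l * expR (l * t)), l * expR (l * t))).2) //.
  by apply/funext => t; have [_ h] := hv t; rewrite derive1E derive_val.
Qed.

Lemma hcyc_homotopic M l T dl : \det M = 1 -> Gamma T ->
  eq_pm T (M *m dg l *m invmx M) ->
  freely_homotopic Gamma (std M l) (fun t => hcyc M dl (l * t)).
Proof.
move=> dM GT eT.
exists (fun p : R * R => hcyc M (p.1 * dl) (l * p.2)); split.
- apply: continuous_subspaceT => p.
  have h1 : continuous (fun p : R * R => p.1) by move=> q; exact: cvg_fst.
  have h2 : continuous (fun p : R * R => p.2) by move=> q; exact: cvg_snd.
  have he := ctE (ctM (ctK l) h2).
  have [c1 c2] := @mobius_continuous _ M (fun p : R * R => p.1 * dl * expR (l * p.2))
    (fun p : R * R => expR (l * p.2)) dM (fun p => expR_gt0 _)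
    (ctM (ctM h1 (ctK dl)) he) he.
  suff e : (fun p : R * R => hcyc M (p.1 * dl) (l * p.2)) = fun p : R * R =>
      ((mobius M (p.1 * dl * expR (l * p.2), expR (l * p.2))).1,
       (mobius M (p.1 * dl * expR (l * p.2), expR (l * p.2))).2).
    by rewrite e; exact: (cvg_pair (c1 p) (c2 p)).
  by apply/funext => x; rewrite -surjective_pairing.
- by move=> u _ /=; exact: (hcyc_closed (u * dl) dM GT eT).
- move=> t; exists 1%:M; first exact: (hs_one hG).
  by rewrite mobius1 std_hcyc mul0r.
- move=> t; exists 1%:M; first exact: (hs_one hG).
  by rewrite mobius1 mul1r.
Qed.

Lemma hcyc_relative M1 M2 A dl (tau1 : R) : \det M1 = 1 -> \det M2 = 1 -> Gamma A ->
  mobius A (hcyc M1 dl tau1) =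
  mobius M2 (mobius (invmx M2 *m A *m M1) (dl * expR tau1, expR tau1)).
Proof.
move=> d1 d2 GA; have dA := hs_det hG GA; have dV := det_invmx2 d2.
have h : halfplane (dl * expR tau1, expR tau1) by exact: expR_gt0.
have hM := mobius_half d1 h; have hA := mobius_half dA hM.
rewrite (mobius_mul (det_mul1 dV dA) d1 h) (mobius_mul dV dA hM).
by rewrite (mobiusVK d2 hA).
Qed.

Lemma hcyc_meet M1 M2 A dl (tau1 tau2 : R) : \det M1 = 1 -> \det M2 = 1 -> Gamma A ->
  mobius A (hcyc M1 dl tau1) = hcyc M2 0 tau2 ->
  mobius (invmx M2 *m A *m M1) (dl * expR tau1, expR tau1) = (0, expR tau2).
Proof.
move=> d1 d2 GA; have dA := hs_det hG GA; have dV := det_invmx2 d2.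
rewrite (hcyc_relative _ _ d1 d2 GA) /hcyc mul0r => e.
have h : halfplane (dl * expR tau1, expR tau1) by exact: expR_gt0.
have hB : halfplane (mobius (invmx M2 *m A *m M1) (dl * expR tau1, expR tau1)).
  by apply: mobius_half => //; rewrite !det_mulmx dV dA d1 !mulr1.
by rewrite -(mobiusK d2 hB) e mobiusK //; exact: half_axis.
Qed.

(** Seen from M2 the second curve is the imaginary axis, so transversality says that the velocity of
    the first has non-zero real part, which is [cross_neq0]. *)
Lemma hcyc_transverse M1 l1 M2 l2 dl : \det M1 = 1 -> \det M2 = 1 -> 0 < l1 -> 0 < l2 ->
  (forall A, Gamma A -> let B := invmx M2 *m A *m M1 in
     dl ^+ 2 != 4 * (B 0 0 * B 0 1 * (B 1 0 * B 1 1))) ->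
  transverse Gamma (fun t => hcyc M1 dl (l1 * t)) (fun t => hcyc M2 0 (l2 * t)).
Proof.
move=> d1 d2 l10 l20 hdl A t1 t2 GA eA; cbv zeta.
have dA := hs_det hG GA; have dV := det_invmx2 d2.
have dB : \det (invmx M2 *m A *m M1) = 1 by rewrite !det_mulmx dV dA d1 !mulr1.
have hm := hcyc_meet d1 d2 GA eA.
have h : halfplane (dl * expR (l1 * t1), expR (l1 * t1)) by exact: expR_gt0.
have v1 := has_vel_axis dl l1 t1.
have v2 := has_vel_mobius dB h v1.
have h2 := mobius_half dB h.
have v3 := has_vel_mobius d2 h2 v2.
rewrite (_ : (fun t => mobius A _) = fun s => mobius M2 (mobius (invmx M2 *m A *m M1)
  (dl * expR (l1 * s), expR (l1 * s)))); last first.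
  by apply/funext => s; rewrite (hcyc_relative _ _ d1 d2 GA).
rewrite (has_vel_velocity v3) (has_vel_velocity (hcyc_vel 0 l2 t2 d2)) hm !mul0r.
rewrite (mvel_cross _ _ d2); last exact: half_axis.
have n0 := mden_gt0 d2 (half_axis (l2 * t2)).
set U := mvel _ _ _; set n := mden _ _ in n0 *.
rewrite /= mulr0 subr0 mulf_neq0 //; last by rewrite invr_neq0 // expf_neq0 // gt_eqF.
rewrite mulf_neq0 //; last by rewrite gt_eqF // mulr_gt0 // expR_gt0.
have := cross_neq0 dB (expR_gt0 (l1 * t1)) (hdl A GA).
rewrite hm => /(_ erefl).
apply: contra; rewrite /U => /eqP e; have k0 : l1 * expR (l1 * t1) != 0.
  by rewrite gt_eqF // mulr_gt0 // expR_gt0.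
apply/eqP/(mulfI k0); rewrite mulr0 -e /mvel /=; ring.
Qed.

(** Each element excludes one value of dl, and the group is countable. *)
Lemma generic_width M1 M2 : exists2 dl : R, 0 < dl < 1 &
  forall A, Gamma A -> let B := invmx M2 *m A *m M1 in
    dl ^+ 2 != 4 * (B 0 0 * B 0 1 * (B 1 0 * B 1 1)).
Proof.
have [e he] := enumG hG.
pose v (A : 'M[R]_2) := let B := invmx M2 *m A *m M1 in
  4 * (B 0 0 * B 0 1 * (B 1 0 * B 1 1)).
have [|dl hdl nd] := @notin_countable R (range (fun n => Num.sqrt (v (e n)))).
  exact: (card_le_trans (card_image_le _ _)).
exists dl => // A GA /=; apply/eqP => h; apply: nd.
have [n hn] := he A GA; exists n => //.
have -> : v (e n) = dl ^+ 2.
  rewrite h /v; case: hn => -> //.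
  by rewrite mulmxN mulNmx !opp2E; ring.
by case/andP: hdl => d0 _; rewrite sqrtr_sqr ger0_norm // ltW.
Qed.
End HypercycleCurves.

(** * Meetings of two short arcs *)

Section CellBound.
Variables (R : realType) (g : nat) (Gamma : set 'M[R]_2).
Hypothesis hG : hyperbolic_surface g Gamma.
Implicit Types (A B S T M : 'M[R]_2) (z : R * R) (a b p q : R * R).

Lemma fiber_large (T : eqType) (f : T -> nat) (s : seq T) (m k : nat) :
  {in s, forall v, (f v < m)%N} -> (k * m < size s)%N ->
  exists j : nat, (k < size [seq v <- s | f v == j])%N.
Proof.
move=> h hk; apply: contrapT => no; move: hk; rewrite ltnNge (size_fibers h) => /negP; apply.
rewrite mulnC -[X in (_ <= X * _)%N](card_ord m) -sum_nat_const; apply: leq_sum => j _.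
by rewrite leqNgt; apply/negP => hj; apply: no; exists (j : nat).
Qed.

Lemma three_in_fiber (T : eqType) (f : T -> nat) (s : seq T) (m : nat) : uniq s ->
  {in s, forall v, (f v < m)%N} -> (2 * m < size s)%N ->
  exists x y w, [/\ [/\ x \in s, y \in s & w \in s], [&& x != y, x != w & y != w],
    f x = f y & f x = f w].
Proof.
move=> us hf hs; have [j hj] := fiber_large hf hs.
have := filter_uniq (fun v => f v == j) us.
have : {subset [seq v <- s | f v == j] <= [pred v | (v \in s) && (f v == j)]}.
  by move=> v; rewrite mem_filter inE andbC.
case: [seq v <- s | f v == j] hj => [|x [|y [|w r]]] //= _ sub.
have : (x \in s) && (f x == j) by apply: sub; rewrite !inE eqxx.
have : (y \in s) && (f y == j) by apply: sub; rewrite !inE eqxx orbT.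
have : (w \in s) && (f w == j) by apply: sub; rewrite !inE eqxx !orbT.
move=> /andP[ws /eqP fw] /andP[ys /eqP fy] /andP[xs /eqP fx].
rewrite !inE !negb_or => /and3P[/and3P[xy xw _] /andP[yw _] _].
by exists x, y, w; split; rewrite ?fx ?fy ?fw ?xy ?xw.
Qed.

Lemma code_lt (i j N K : nat) : (i < K)%N -> (j < N)%N -> (i * N + j < K * N)%N.
Proof.
move=> iK jN; apply: leq_trans (_ : i.+1 * N <= _)%N; last by rewrite leq_mul2r iK orbT.
by rewrite mulSn addnC ltn_add2r.
Qed.

Lemma code_inj (i j i' j' N : nat) : (j < N)%N -> (j' < N)%N ->
  (i * N + j)%N = (i' * N + j')%N -> i = i' /\ j = j'.
Proof.
move=> jN jN' e; have N0 : (0 < N)%N by apply: leq_ltn_trans jN.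
split; first by have := congr1 (divn^~ N) e; rewrite !divnMDl // !divn_small // !addn0.
by have := congr1 (modn^~ N) e; rewrite !modnMDl !modn_small.
Qed.

Lemma cosh_small (r : R) : 0 <= r -> r <= 1 / 2 -> cosh r <= 1 + 2 * r ^+ 2.
Proof.
move=> r0 r1; rewrite /cosh expRN.
have E1 := expR_ge1Dx r; have := expR_ge1Dx (- r); rewrite expRN => E2.
have E0 := expR_gt0 r; move: (expR r) E0 E1 E2 => E E0 E1 E2.
have E3 : E - 1 <= 2 * r.
  have : E * (1 - r) <= E * E^-1 by rewrite ler_pM2l //; lra.
  rewrite mulfV ?gt_eqF // => h; nra.
rewrite -subr_ge0 [leRHS](_ : _ = (2 * (2 * r ^+ 2) * E - (E - 1) ^+ 2) / (2 * E)).
  rewrite divr_ge0 ?mulr_ge0 ?(ltW E0) // subr_ge0.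
  have : (E - 1) ^+ 2 <= (2 * r) ^+ 2 by rewrite ler_sqr ?nnegrE //; lra.
  have := sqr_ge0 r; rewrite exprMn; nra.
by field; rewrite gt_eqF.
Qed.

Lemma disp_bounds (X Y c : R) : 1 <= X -> X <= 2 * c - 1 -> 1 <= Y -> Y <= 2 * c - 1 ->
  2 * X * Y - 1 <= 8 * c ^+ 2.
Proof.
move=> X1 Xc Y1 Yc; have := ler_pM1 X1 Xc Y1 Yc; have : 1 <= c by lra.
by move=> c1 h; nra.
Qed.

Lemma disp_bound (c : R) : 1 <= c -> 2 * c - 1 <= 8 * c ^+ 2.
Proof. by move=> c1; nra. Qed.

Lemma disp_bound2 (c : R) : 1 <= c -> 2 * (2 * c - 1) ^+ 2 - 1 <= 8 * c ^+ 2.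
Proof. by move=> c1; nra. Qed.

Lemma disp_small (e c C : R) : 0 <= e -> e <= 1 / 4 -> 1 <= c -> c <= 1 + 2 * e ->
  C <= 2 * (2 * c - 1) ^+ 2 - 1 -> C - 1 <= 24 * e.
Proof.
move=> e0 e1 c1 ce h.
have : (2 * c - 1) ^+ 2 <= (1 + 4 * e) ^+ 2 by rewrite ler_sqr ?nnegrE //; lra.
nra.
Qed.

Lemma close_abs (a b x w : R) : x <= a -> a <= x + w -> x <= b -> b <= x + w ->
  `|a - b| <= w.
Proof. by move=> *; rewrite ler_norml; apply/andP; split; lra. Qed.

Lemma commute_diag T S M l : \det M = 1 -> 0 < l ->
  eq_pm T (M *m dg l *m invmx M) -> S *m T = T *m S ->
  (invmx M *m S *m M) 0 1 = 0 /\ (invmx M *m S *m M) 1 0 = 0.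
Proof.
move=> dM l0 eT hST; have uM := unit2 dM; set S' := invmx M *m S *m M.
have e : S' *m dg l = dg l *m S'.
  have : invmx M *m (S *m (M *m dg l *m invmx M)) *m M =
      invmx M *m ((M *m dg l *m invmx M) *m S) *m M.
    by case: eT hST => ->; [move=> ->|rewrite mulmxN mulNmx => /oppr_inj ->].
  rewrite /S' !mulmxA mulVmx // mul1mx mulmxKV //.
have n : expR (l / 2) - expR (- (l / 2)) != 0 :> R.
  by rewrite gt_eqF // subr_gt0 ltr_expR; lra.
have h1 := congr1 (fun X : 'M[R]_2 => X 0 1) e.
have h2 := congr1 (fun X : 'M[R]_2 => X 1 0) e.
clearbody S'; move: h1 h2; rewrite /= !mul2E /dg !mx2V => h1 h2.
split; apply: (mulIf n); rewrite mul0r.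
- by move: h1 => /eqP; rewrite -subr_eq0 => /eqP h1; apply: oppr_inj; rewrite oppr0 -h1; ring.
- by move: h2 => /eqP; rewrite -subr_eq0 => /eqP h2; rewrite -h2; ring.
Qed.

Variables (M1 M2 : 'M[R]_2) (dl : R).
Hypotheses (d1 : \det M1 = 1) (d2 : \det M2 = 1) (dl0 : 0 < dl) (dl1 : dl < 1).

Local Notation h1 := (hcyc M1 dl).
Local Notation h2 := (hcyc M2 0).

Definition meet p := exists2 A, Gamma A & mobius A (h1 p.1) = h2 p.2.

Let h1h tau : halfplane (h1 tau). Proof. exact: hcyc_half. Qed.
Let h2h tau : halfplane (h2 tau). Proof. exact: hcyc_half. Qed.

Let ch1 (x y w : R) : 0 <= w -> `|x - y| <= w -> ch (h1 x) (h1 y) <= 2 * cosh w - 1.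
Proof.
move=> w0 xy; apply: le_trans (hcyc_ch _ _ d1 (ltW dl0) (ltW dl1)) _.
by rewrite lerD2r ler_pM2l // -cosh_abs cosh_leE.
Qed.

Let ch2 (x y w : R) : 0 <= w -> `|x - y| <= w -> ch (h2 x) (h2 y) <= 2 * cosh w - 1.
Proof.
move=> w0 xy; apply: le_trans (hcyc_ch _ _ d2 _ _) _ => //.
by rewrite lerD2r ler_pM2l // -cosh_abs cosh_leE.
Qed.

(** One group element, up to sign, accounts for at most two meeting points, by [hcyc_two]. This is
    why fibres of three points are looked for below. *)
Lemma meet_two A B1 B2 a b p : Gamma A -> Gamma B1 -> Gamma B2 ->
  eq_pm A B1 -> eq_pm A B2 ->
  mobius A (h1 a.1) = h2 a.2 -> mobius B1 (h1 b.1) = h2 b.2 ->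
  mobius B2 (h1 p.1) = h2 p.2 -> ~~ [&& a != b, a != p & b != p].
Proof.
move=> GA GB1 GB2 e1 e2.
have -> : mobius B1 = mobius A by apply/funext => z; case: e1 => ->; rewrite ?mobius_opp.
have -> : mobius B2 = mobius A by apply/funext => z; case: e2 => ->; rewrite ?mobius_opp.
move=> /(hcyc_meet hG d1 d2 GA) ma /(hcyc_meet hG d1 d2 GA) mb /(hcyc_meet hG d1 d2 GA) mp.
have dB : \det (invmx M2 *m A *m M1) = 1.
  by rewrite !det_mulmx det_invmx2 // (hs_det hG GA) d1 !mulr1.
have inj q q' : mobius (invmx M2 *m A *m M1) (dl * expR q.1, expR q.1) = (0, expR q.2) ->
    mobius (invmx M2 *m A *m M1) (dl * expR q'.1, expR q'.1) = (0, expR q'.2) ->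
    expR q.1 = expR q'.1 -> q = q'.
  case: q q' => x y [x' y'] /= e e' /expR_inj xx; move: e; rewrite xx e' => -[] /expR_inj ->.
  by [].
have := hcyc_two dB dl0 (expR_gt0 a.1) (expR_gt0 b.1) (expR_gt0 p.1).
rewrite ma mb mp => /(_ erefl erefl erefl).
case/or3P => /eqP e; rewrite (inj _ _ _ _ e) ?eqxx ?andbF //.
Qed.

Lemma displacement_cross A a b c : Gamma A -> mobius A (h1 a.1) = h2 a.2 -> 0 <= c ->
  `|a.1 - b.1| <= c -> `|a.2 - b.2| <= c ->
  ch (h2 b.2) (mobius A (h1 b.1)) <= 2 * (2 * cosh c - 1) ^+ 2 - 1.
Proof.
move=> GA eA c0 ab1 ab2; have dA := hs_det hG GA.
have hA := mobius_half dA (h1h b.1).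
apply: le_trans (ch_triangle (h2h b.2) hA (h2h a.2)) _; rewrite lerD2r -mulrA ler_pM2l //.
rewrite expr2 -{2}eA (ch_mobius dA (h1h _) (h1h _)).
have k1 := ch2 c0 ab2; have k2 := ch1 c0 ab1.
apply: ler_pM => //; last by rewrite chC.
- by have := ch_ge1 (h2h b.2) (h2h a.2); lra.
- by have := ch_ge1 (h1h a.1) (h1h b.1); lra.
Qed.

(* If there are too many meeting points, three of them share a box of side r, and
   two of the corresponding elements A a, A b differ. Then T = A b (A a)^-1 moves
   all points of the arcs very little, so by margulis and stab_axis every
   A q (A q')^-1 commutes with T and is a translation along its axis. *)
Lemma cell_bound (Q : seq (R * R)) (x y w r D : R) (N : nat) :
  uniq Q -> {in Q, forall q, meet q} ->
  {in Q, forall q, [/\ x <= q.1, q.1 <= x + w, y <= q.2 & q.2 <= y + w]} ->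
  0 <= w -> 0 < r -> r <= 1 / 2 -> w / r < N%:R ->
  4 * (8 * cosh w ^+ 2) ^+ 2 * (24 * r ^+ 2) <= 1 / 800 ->
  0 <= D -> 8 * cosh w ^+ 2 <= cosh D -> (2 * N ^ 2 < size Q)%N ->
  (size Q <= 2 * (Num.truncn (2 * D / systole Gamma)).+1)%N.
Proof.
move=> uQ mQ bQ w0 r0 r2 wN hr D0 hD big.
have s0 := sys_gt0 hG.
have chA q : exists B, q \in Q -> Gamma B /\ mobius B (h1 q.1) = h2 q.2.
  have [hq|/negP hq] := boolP (q \in Q); last by exists 0.
  by have [B GB eB] := mQ q hq; exists B.
have [A hA] := choice chA; clear chA mQ.
have GA q : q \in Q -> Gamma (A q) by move=> /hA[].
have eA q : q \in Q -> mobius (A q) (h1 q.1) = h2 q.2 by move=> /hA[].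
have close q q' : q \in Q -> q' \in Q -> `|q.1 - q'.1| <= w /\ `|q.2 - q'.2| <= w.
  move=> /bQ[a1 a2 a3 a4] /bQ[b1 b2 b3 b4].
  by split; [exact: (close_abs a1 a2 b1 b2)|exact: (close_abs a3 a4 b3 b4)].
(* The two box indices of q, coded in one number. *)
pose f (q : R * R) := (Num.truncn ((q.1 - x) / r) * N + Num.truncn ((q.2 - y) / r))%N.
have tN (v : R) : 0 <= v -> v <= w -> (Num.truncn (v / r) < N)%N.
  move=> v0 vw; rewrite -(ltr_nat R); apply: le_lt_trans wN.
  apply: le_trans (_ : v / r <= _); last by rewrite ler_pM2r ?invr_gt0.
  by have /andP[] := truncn_itv (divr_ge0 v0 (ltW r0)).
have t1 q : q \in Q -> (Num.truncn ((q.1 - x) / r) < N)%N by move=> /bQ[? ? _ _]; apply: tN; rewrite ?subr_ge0 // lerBlDl.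
have t2 q : q \in Q -> (Num.truncn ((q.2 - y) / r) < N)%N by move=> /bQ[_ _ ? ?]; apply: tN; rewrite ?subr_ge0 // lerBlDl.
have fN : {in Q, forall q, (f q < N ^ 2)%N}.
  by move=> q hq; rewrite -mulnn; apply: code_lt; [exact: t1|exact: t2].
have feq q q' : q \in Q -> q' \in Q -> f q = f q' -> `|q.1 - q'.1| <= r /\ `|q.2 - q'.2| <= r.
  move=> hq hq' e.
  have [e1 e2] := code_inj (t2 q hq) (t2 q' hq') e.
  have [a1 a2 a3 a4] := bQ q hq; have [b1 b2 b3 b4] := bQ q' hq'.
  have dd (u v : R) : `|u / r - v / r| < 1 -> `|u - v| <= r.
    by rewrite -mulrBl normrM (gtr0_norm (_ : 0 < r^-1)) ?invr_gt0 // ltr_pdivrMr // mul1r => /ltW.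
  split.
  - have := trunc_close (divr_ge0 (_ : 0 <= q.1 - x) (ltW r0)) (divr_ge0 (_ : 0 <= q'.1 - x) (ltW r0)) e1.
    by rewrite !subr_ge0 => /(_ a1 b1)/dd; rewrite (_ : q.1 - x - (q'.1 - x) = q.1 - q'.1) //; ring.
  - have := trunc_close (divr_ge0 (_ : 0 <= q.2 - y) (ltW r0)) (divr_ge0 (_ : 0 <= q'.2 - y) (ltW r0)) e2.
    by rewrite !subr_ge0 => /(_ a3 b3)/dd; rewrite (_ : q.2 - y - (q'.2 - y) = q.2 - q'.2) //; ring.
have [a [b [nab [hab [ha hb]]]]] : exists a b, ~ eq_pm (A a) (A b) /\ f a = f b /\ a \in Q /\ b \in Q.
  have [u [v [t [[hu hv ht] nuv e1 e2]]]] := three_in_fiber uQ fN big.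
  have [h|h] := pselect (eq_pm (A u) (A v)); last by exists u, v.
  have [h'|h'] := pselect (eq_pm (A u) (A t)); last by exists u, t.
  by have := meet_two (GA _ hu) (GA _ hv) (GA _ ht) h h' (eA _ hu) (eA _ hv) (eA _ ht); rewrite nuv.
have [T [GT nT trT eT]] : exists T, [/\ Gamma T, ~ eq_pm T 1%:M, 2 <= T 0 0 + T 1 1 &
    forall z, mobius T z = mobius (A b *m invmx (A a)) z].
  have GT := hs_mul hG (GA _ hb) (hs_inv hG (GA _ ha)).
  have nT : ~ eq_pm (A b *m invmx (A a)) 1%:M.
    move=> h; apply: nab; apply: eq_pm_sym; exact: (eq_pm_inv1 (hs_det hG (GA _ ha)) h).
  have := hypG hG GT nT; set T := A b *m _ in GT nT *; have [t|t] := leP 0 (T 0 0 + T 1 1).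
    by move=> t'; exists T; split => //; move: t'; rewrite ger0_norm // => /ltW.
  move=> t'; exists (- T); split; first exact: (hs_opp hG GT).
  - by move=> h; apply: nT; case: h => [<-|/oppr_inj ->]; [right; rewrite opprK|left].
  - by rewrite !opp2E -opprD; move: t'; rewrite ltr0_norm // => /ltW.
  - by move=> z; rewrite mobius_opp.
have dT := hs_det hG GT; set z0 := h2 a.2.
have hz0 : halfplane z0 by exact: h2h.
have Tz0 : mobius T z0 = mobius (A b) (h1 a.1).
  rewrite eT /z0 -(eA _ ha); have dAa := hs_det hG (GA _ ha).
  by rewrite (mobius_mul (hs_det hG (GA _ hb)) (det_invmx2 dAa) (mobius_half dAa (h1h _))) mobiusK.
have small0 : ch z0 (mobius T z0) - 1 <= 24 * r ^+ 2.
  have [c1 c2] := feq b a hb ha (esym hab).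
  have := displacement_cross (GA _ hb) (eA _ hb) (ltW r0) c1 c2; rewrite -Tz0 -/z0.
  apply: disp_small; [exact: sqr_ge0| |exact: cosh_ge1|exact: cosh_small (ltW r0) r2].
  by rewrite (_ : 1 / 4 = (1 / 2) ^+ 2); [rewrite ler_sqr ?nnegrE ?(ltW r0)|field].
have c1 := cosh_ge1 w; set c := cosh w in c1 hr hD.
(* The displacement of T at z0 is so small that it stays below the threshold of [margulis] even
   after the loss of [disp_spread] over a whole arc. *)
have spread z : halfplane z -> ch z0 z <= 8 * c ^+ 2 -> ch z (mobius T z) <= 1 + 1 / 800.
  move=> hz zz; have := disp_spread dT trT hz0 hz; have z1 := ch_ge1 hz0 hz.
  have : ch z0 z ^+ 2 <= (8 * c ^+ 2) ^+ 2.
    by rewrite ler_sqr ?nnegrE ?(le_trans ler01 z1) // mulr_ge0 ?sqr_ge0.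
  have Tz := ch_ge1 hz0 (mobius_half dT hz0).
  move: small0; set e := ch z0 (mobius T z0) - 1 => small0 h k.
  have e0 : 0 <= e by rewrite /e subr_ge0.
  have : 4 * ch z0 z ^+ 2 * e <= 4 * (8 * c ^+ 2) ^+ 2 * (24 * r ^+ 2).
    by apply: ler_pM => //; [rewrite mulr_ge0 ?sqr_ge0|rewrite ler_pM2l].
  by move=> h'; have := le_trans k (le_trans h' hr); rewrite lerBlDl.
have pass q q' : q \in Q -> q' \in Q ->
    ch (h2 q'.2) (mobius (A q) (h1 q'.1)) <= 8 * c ^+ 2.
  move=> hq hq'; have [k1 k2] := close q q' hq hq'.
  by apply: le_trans (displacement_cross (GA _ hq) (eA _ hq) w0 k1 k2) _; rewrite -/c; exact: disp_bound2.
have comm q q' : q \in Q -> q' \in Q ->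
    (A q *m invmx (A q')) *m T = T *m (A q *m invmx (A q')).
  move=> hq hq'; have Gq := GA _ hq; have Gq' := GA _ hq'.
  have dq := hs_det hG Gq; have dq' := hs_det hG Gq'; have dV := det_invmx2 dq'.
  set S := A q *m invmx (A q'); have GS : Gamma S by exact: (hs_mul hG Gq (hs_inv hG Gq')).
  have dS := hs_det hG GS; have hz' := h2h q'.2.
  have Sz : mobius S (h2 q'.2) = mobius (A q) (h1 q'.1).
    by rewrite /S -(eA _ hq') (mobius_mul dq dV (mobius_half dq' (h1h _))) mobiusK.
  have hSz := mobius_half dS hz'.
  have k0 := close a q' ha hq'; have k0' := close q a hq ha.
  apply: (stab_axis hG GT GS nT).
  (* At S h2(q'.2) both elements move little: T because this point is near z0, the conjugate because
     T moves h2(q'.2) little. *)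
  apply: (margulis hG hSz GT); first by apply: (hs_mul hG); [exact: (hs_mul hG)|exact: (hs_inv hG)].
  - apply: spread => //; rewrite Sz.
    have hAq := mobius_half dq (h1h q'.1).
    apply: le_trans (ch_triangle hz0 hAq (h2h q.2)) _.
    rewrite -{2}(eA _ hq) (ch_mobius dq (h1h _) (h1h _)).
    have [k1 k2] := close q q' hq hq'.
    have := ch1 w0 k1; have := ch2 w0 (proj2 (close a q ha hq)); rewrite -/z0 -/c.
    have := ch_ge1 hz0 (h2h q.2); have := ch_ge1 (h1h q.1) (h1h q'.1).
    by move=> Y1 X1 X2 Y2; exact: disp_bounds.
  - have -> : mobius (S *m T *m invmx S) (mobius S (h2 q'.2)) = mobius S (mobius T (h2 q'.2)).
      rewrite (mobius_mul (det_mul1 dS dT) (det_invmx2 dS) hSz) (mobiusK dS hz').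
      by rewrite (mobius_mul dS dT hz').
    rewrite (ch_mobius dS hz' (mobius_half dT hz')); apply: spread => //.
    have := ch2 w0 (proj2 k0); rewrite -/z0 -/c => k; exact: le_trans k (disp_bound c1).
have [M [l [l0 dM eTM _ _]]] := geodesic_of hG GT nT.
have dMV := det_invmx2 dM.
have trans q q' : q \in Q -> q' \in Q -> exists2 t : R,
    forall z, mobius (invmx M *m (A q *m invmx (A q')) *m M) z = (expR t * z.1, expR t * z.2) &
    t = 0 \/ systole Gamma <= `|t|.
  move=> hq hq'; have GS := hs_mul hG (GA _ hq) (hs_inv hG (GA _ hq')).
  have [b0 c0] := commute_diag dM l0 eTM (comm q q' hq hq').
  exact: (conjG_diag hG dM (conjG_in dM GS) b0 c0).
(* The translation length of A q (A a)^-1 along the axis of T, by which the elements are now told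
   apart. *)
have cht q : exists u : R, q \in Q -> forall z,
    mobius (invmx M *m (A q *m invmx (A a)) *m M) z = (expR u * z.1, expR u * z.2).
  have [hq|/negP hq] := boolP (q \in Q); last by exists 0.
  by have [u hu _] := trans q a hq ha; exists u.
have [t ht] := choice cht; clear cht.
have tD q : q \in Q -> `|t q| <= D.
  move=> hq; have Gq := GA _ hq; have Ga := GA _ ha.
  have dq := hs_det hG Gq; have da := hs_det hG Ga; have dV := det_invmx2 da.
  have dS := det_mul1 dq dV.
  rewrite -cosh_leE ?normr_ge0 // cosh_abs; apply: le_trans hD.
  apply: le_trans (pass q a hq ha).
  have -> : mobius (A q) (h1 a.1) = mobius (A q *m invmx (A a)) z0.
    by rewrite /z0 -(eA _ ha) (mobius_mul dq dV (mobius_half da (h1h _))) mobiusK.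
  rewrite -/z0; have hp := mobius_half dMV hz0.
  have -> : ch z0 (mobius (A q *m invmx (A a)) z0) = ch (mobius (invmx M) z0)
      (mobius (invmx M *m (A q *m invmx (A a)) *m M) (mobius (invmx M) z0)).
    rewrite (mobius_mul (det_mul1 dMV dS) dM hp) (mobiusVK dM hz0).
    by rewrite (mobius_mul dMV dS hz0) (ch_mobius dMV hz0 (mobius_half dS hz0)).
  rewrite ht //; move: (mobius (invmx M) z0) hp => [p1 p2]; rewrite /halfplane /= => p20.
  have := ch_ray p1 (expR (t q) * p1) (ln p2) (t q + ln p2).
  by rewrite expRD lnK ?posrE // opprD addrCA subrr addr0 coshN.
(* Cut [- D, D] into intervals of length the systole. Translation lengths in one interval differ by
   less than the systole, so the elements agree up to sign; three points in it would contradict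
   [meet_two]. *)
rewrite leqNgt; apply/negP => big2.
have bin : {in Q, forall q, (Num.truncn ((t q + D) / systole Gamma) < (Num.truncn (2 * D / systole Gamma)).+1)%N}.
  move=> q /tD; rewrite ler_norml => /andP[k1 k2]; rewrite ltnS.
  apply: le_truncn.
  by rewrite ler_pM2r ?invr_gt0 // mulr_natl mulr2n lerD2r.
have [u [v [p [[hu hv hp] nuv e1 e2]]]] := three_in_fiber uQ bin big2.
have same q q' : q \in Q -> q' \in Q ->
    Num.truncn ((t q + D) / systole Gamma) = Num.truncn ((t q' + D) / systole Gamma) ->
    eq_pm (A q) (A q').
  move=> hq hq' e.
  have Gq := GA _ hq; have Gq' := GA _ hq'; have Ga := GA _ ha.
  have dq := hs_det hG Gq; have dq' := hs_det hG Gq'; have da := hs_det hG Ga.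
  have := tD _ hq; have := tD _ hq'; rewrite !ler_norml => /andP[k1 k2] /andP[k3 k4].
  have kD : 0 <= t q + D by rewrite -lerBlDr sub0r.
  have kD' : 0 <= t q' + D by rewrite -lerBlDr sub0r.
  have := trunc_close (divr_ge0 kD (ltW s0)) (divr_ge0 kD' (ltW s0)) e.
  rewrite -mulrBl normrM (gtr0_norm (_ : 0 < (systole Gamma)^-1)) ?invr_gt0 //.
  rewrite ltr_pdivrMr // mul1r (_ : t q + D - (t q' + D) = t q - t q'); last by ring.
  move=> hs; have [k hk kk] := trans q q' hq hq'.
  have h01 : halfplane ((0, 1) : R * R) by rewrite /halfplane /= ltr01.
  have dS1 := det_mul1 dq (det_invmx2 dq'); have dS2 := det_mul1 dq' (det_invmx2 da).
  have ek : t q = k + t q'.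
    have := ht q hq (0, 1).
    have -> : invmx M *m (A q *m invmx (A a)) *m M =
        (invmx M *m (A q *m invmx (A q')) *m M) *m (invmx M *m (A q' *m invmx (A a)) *m M).
      by rewrite !mulmxA mulmxK ?unit2 // mulmxKV ?unit2.
    have D1 := det_mul1 (det_mul1 dMV dS1) dM; have D2 := det_mul1 (det_mul1 dMV dS2) dM.
    rewrite (mobius_mul D1 D2 h01) (ht q' hq') hk /= => -[_]; rewrite !mulr1 -expRD.
    by move/expR_inj => ->.
  have k0 : k = 0.
    case: kk => // kk; move: hs; rewrite ek addrK ltNge => /negP; case; exact: kk.
  have fix1 : mobius (A q *m invmx (A q')) (mobius M (0, 1)) = mobius M (0, 1).
    have := hk (0, 1); rewrite k0 expR0 !mul1r /=.
    have hM := mobius_half dM h01.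
    rewrite (mobius_mul (det_mul1 dMV dS1) dM h01) (mobius_mul dMV dS1 hM) => h.
    by rewrite -[RHS](congr1 (mobius M) h) (mobiusVK dM (mobius_half dS1 hM)).
  apply: (eq_pm_inv1 dq').
  apply: (freeG hG (hs_mul hG Gq (hs_inv hG Gq')) (hs_one hG) (mobius_half dM h01)).
  by rewrite mobius1.
have := meet_two (GA _ hu) (GA _ hv) (GA _ hp) (same _ _ hu hv e1) (same _ _ hu hp e2)
  (eA _ hu) (eA _ hv) (eA _ hp).
by rewrite nuv.
Qed.
End CellBound.

(** * Choice of the arc length and the box size *)

Section Constants.
Variable R : realType.

(* Everything is expressed through u = exp w: cosh w <= u, r = u^-2 / k and
   1 / s = u^16. *)
Lemma cell_constants (k s sys : R) : 4 * 64 * 24 * 800 <= k ^+ 2 -> 2 <= k ->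
  0 < s -> s <= 1 / 2 -> s <= sys ->
  let w := ln (1 / s) / 16 in let r := expR (- (2 * w)) / k in let D := 2 * w + 4 in
  [/\ [/\ 0 < w, 0 < r & r <= 1 / 2],
      4 * (8 * cosh w ^+ 2) ^+ 2 * (24 * r ^+ 2) <= 1 / 800,
      0 <= D /\ 8 * cosh w ^+ 2 <= cosh D,
      2 * (w / r + 1) ^+ 2 <= 2 * (k + 32) ^+ 2 * (w / s) &
      2 * (2 * D / sys + 1) <= 2 * (k + 32) ^+ 2 * (w / s)].
Proof.
move=> hk k2 s0 s2 ss w r D.
have k0 : 0 < k by lra.
have L2 := ln_inv_ge s0 s2.
have w32 : 1 <= 32 * w by rewrite /w; lra.
have w0 : 0 < w by lra.
pose u := expR w; have u0 : 0 < u by exact: expR_gt0.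
have uw : w <= u by have := expR_ge1Dx w; rewrite -/u; lra.
have u1 : 1 <= u by have := expR_ge1Dx w; rewrite -/u; lra.
have us : s^-1 = u ^+ 16.
  rewrite /u -expRM_natl /w -[RHS](_ : expR (ln (1 / s)) = _); last by congr expR; field.
  by rewrite lnK ?posrE ?divr_gt0 // div1r.
have e2 : expR (2 * w) = u ^+ 2 by rewrite /u -expRM_natl.
have er : r = (u ^+ 2)^-1 / k by rewrite /r expRN e2.
have U1 : 1 <= u ^+ 2 by rewrite exprn_ege1.
have U0 : 0 < u ^+ 2 by lra.
have r0 : 0 < r by rewrite er divr_gt0 ?invr_gt0.
have cu : cosh w <= u.
  rewrite /cosh expRN -/u; have : u^-1 <= 1 by rewrite invf_le1.
  by move: (u^-1) => v; lra.
have c1 := cosh_ge1 w.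
have cu2 : cosh w ^+ 2 <= u ^+ 2 by rewrite ler_sqr ?nnegrE //; lra.
have s1 : 1 <= s^-1 by rewrite us exprn_ege1.
have ws : w <= w / s by rewrite ler_peMr // ltW.
split.
- split => //; rewrite er ler_pdivrMr //.
  have : (u ^+ 2)^-1 <= 1 by rewrite invf_le1.
  by move: (_^-1) => v; lra.
(* This requirement is the origin of the constant 4 * 64 * 24 * 800: the left side is at most 4 * 64
   * 24 / k^2. *)
- have cr : cosh w ^+ 2 * r <= k^-1.
    rewrite er mulrA -[leRHS]mul1r ler_pM2r ?invr_gt0 //.
    by rewrite ler_pdivrMr // mul1r.
  have cr0 : 0 <= cosh w ^+ 2 * r by rewrite mulr_ge0 ?sqr_ge0 // ltW.
  have cr2 : (cosh w ^+ 2 * r) ^+ 2 <= (k^-1) ^+ 2.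
    by rewrite ler_sqr ?nnegrE ?invr_ge0 // ltW.
  rewrite [leLHS](_ : _ = 4 * 64 * 24 * (cosh w ^+ 2 * r) ^+ 2); last by ring.
  apply: le_trans (_ : 4 * 64 * 24 * (k^-1) ^+ 2 <= _); first by rewrite ler_pM2l.
  rewrite exprVn ler_pdivrMr ?exprn_gt0 //.
  by move: hk; move: (k ^+ 2) => K; lra.
- split; first by rewrite /D; lra.
  have e1 : 2 <= expR 1 :> R by have := expR_ge1Dx (1 : R); lra.
  have e4 : 16 <= expR 4 :> R.
    have -> : expR 4 = expR 1 ^+ 4 :> R by rewrite -expRM_natl mulr1.
    have : 2 ^+ 2 <= expR 1 ^+ 2 :> R by rewrite ler_sqr ?nnegrE //; lra.
    move=> h; have : (2 ^+ 2) ^+ 2 <= (expR 1 ^+ 2) ^+ 2 :> R by rewrite ler_sqr ?nnegrE ?sqr_ge0.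
    by rewrite -exprM; lra.
  apply: le_trans (_ : 8 * u ^+ 2 <= _); first by rewrite ler_pM2l.
  rewrite /cosh /D expRD e2; have := expR_gt0 (- (2 * w + 4)).
  have : 16 * u ^+ 2 <= u ^+ 2 * expR 4 by rewrite mulrC ler_pM2l.
  move: (expR (- _)) (u ^+ 2 * _) => X Y; lra.
- have wr : w / r = k * (w * u ^+ 2).
    by rewrite er; field; rewrite !gt_eqF.
  have wu : w * 1 <= w * u ^+ 2 by rewrite ler_pM2l.
  have h1 : w / r + 1 <= (k + 32) * (w * u ^+ 2) by rewrite wr; lra.
  have h2 : (w / r + 1) ^+ 2 <= ((k + 32) * (w * u ^+ 2)) ^+ 2.
    have h0 : 0 <= w / r + 1 by have := divr_gt0 w0 r0; lra.
    by rewrite ler_sqr ?nnegrE // (le_trans h0 h1).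
  rewrite -mulrA ler_pM2l //; apply: le_trans h2 _.
  rewrite exprMn ler_pM2l; last by rewrite exprn_gt0 //; lra.
  (* What remains is w u^4 <= u^16, which follows from w <= u with room to spare. *)
  rewrite us exprMn expr2 -mulrA ler_pM2l // -exprM.
  apply: le_trans (_ : u * u ^+ 4 <= _); first by rewrite ler_pM2r ?exprn_gt0.
  by rewrite -exprS ler_weXn2l.
- have h1 : 2 * D / sys <= 260 * (w / s).
    rewrite mulrA ler_pM //; first by rewrite /D; lra.
    - by rewrite invr_ge0; lra.
    - by rewrite /D; lra.
    - by rewrite lef_pV2 ?posrE //; lra.
  have kk : 34 ^+ 2 <= (k + 32) ^+ 2 by rewrite ler_sqr ?nnegrE //; lra.
  have : 34 ^+ 2 * (w / s) <= (k + 32) ^+ 2 * (w / s) by rewrite ler_pM2r // divr_gt0.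
  rewrite -mulrA; lra.
Qed.
End Constants.


(** * Counting the meetings of two closed curves *)

Section UpperBound.
Variables (R : realType) (g : nat) (Gamma : set 'M[R]_2).
Hypothesis hG : hyperbolic_surface g Gamma.
Implicit Types (A B T M : 'M[R]_2) (p q : R * R).

Lemma hcyc_shiftn M l T dl t (n : nat) : \det M = 1 -> Gamma T ->
  eq_pm T (M *m dg l *m invmx M) ->
  exists2 A, Gamma A & hcyc M dl (l * (t + n%:R)) = mobius A (hcyc M dl (l * t)).
Proof.
move=> dM GT eT; elim: n => [|n [A GA eA]].
  by exists 1%:M; [exact: (hs_one hG)|rewrite mobius1 addr0].
exists (T *m A); first exact: (hs_mul hG).
rewrite (mobius_mul (hs_det hG GT) (hs_det hG GA) (hcyc_half _ _ dM)) -eA.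
by rewrite (hcyc_shift dl _ dM GT eT) -natr1; congr hcyc; ring.
Qed.

(** [geometric_intersection] asks for an exact cardinal, whereas the estimates bound the length of
    duplicate-free lists of intersection points. *)
Lemma bounded_finite (S : set (R * R)) (N : nat) :
  (forall s : seq (R * R), uniq s -> {in s, forall x, S x} -> (size s <= N)%N) ->
  exists2 n, (n <= N)%N & (S #= `I_n)%card.
Proof.
move=> h; have inj k : (`I_k #<= S)%card -> (k <= N)%N.
  case: k => [//|k] /pcard_leP[f].
  have hf i : (i < k.+1)%N -> S (f i) by move=> hi; exact: funS.
  rewrite -[k.+1](size_iota 0) -(size_map f); apply: h.
    rewrite map_inj_in_uniq ?iota_uniq // => i j; rewrite !mem_iota /= !add0n => hi hj e.
    by apply: (@inj _ _ _ f) e; rewrite inE.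
  by move=> x /mapP[i]; rewrite mem_iota /= add0n => hi ->; exact: hf.
have [/finite_setP[n hn]|hinf] := pselect (finite_set S).
  exists n => //; apply: inj.
  by rewrite (card_le_eqr hn) card_le_II.
suff : (N.+1 <= N)%N by rewrite ltnn.
apply: inj; apply: card_le_trans (proj1 (infiniteP S) hinf).
exact: subset_card_le.
Qed.

Variables (M1 M2 T1 T2 : 'M[R]_2) (dl l1 l2 : R).
Hypotheses (d1 : \det M1 = 1) (d2 : \det M2 = 1) (dl0 : 0 < dl) (dl1 : dl < 1).
Hypotheses (l10 : 0 < l1) (l20 : 0 < l2) (GT1 : Gamma T1) (GT2 : Gamma T2).
Hypotheses (eT1 : eq_pm T1 (M1 *m dg l1 *m invmx M1))
  (eT2 : eq_pm T2 (M2 *m dg l2 *m invmx M2)).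

Local Notation mt := (meet Gamma M1 M2 dl).

Lemma meet_shift t1 t2 (i j : nat) : mt (l1 * t1, l2 * t2) ->
  mt (l1 * (t1 + i%:R), l2 * (t2 + j%:R)).
Proof.
move=> [A GA /= eA]; rewrite /meet /=.
have [A1 GA1 ->] := hcyc_shiftn dl t1 i d1 GT1 eT1.
have [A2 GA2 ->] := hcyc_shiftn 0 t2 j d2 GT2 eT2.
have [dA dA1 dA2] := And3 (hs_det hG GA) (hs_det hG GA1) (hs_det hG GA2).
have h := hcyc_half dl (l1 * t1) d1; have hA1 := mobius_half dA1 h.
have dV := det_invmx2 dA1.
exists (A2 *m A *m invmx A1).
  by apply: (hs_mul hG); [exact: (hs_mul hG)|exact: (hs_inv hG)].
rewrite (mobius_mul (det_mul1 dA2 dA) dV hA1) (mobiusK dA1 h).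
by rewrite (mobius_mul dA2 dA h) eA.
Qed.

(* Going n and m times around the curves makes their lengths at least w, so that
   rounding up the numbers of arcs costs a factor 4 at most. *)
Lemma count_bound (Q : seq (R * R)) (w : R) (K : nat) : uniq Q -> 0 < w ->
  {in Q, forall q, [/\ 0 <= q.1 < 1, 0 <= q.2 < 1 & mt (l1 * q.1, l2 * q.2)]} ->
  (forall (P : seq (R * R)) (x y : R), uniq P -> {in P, forall p, mt p} ->
     {in P, forall p, [/\ x <= p.1, p.1 <= x + w, y <= p.2 & p.2 <= y + w]} ->
     (size P <= K)%N) ->
  (size Q)%:R <= 4 * K%:R * (l1 * l2) / w ^+ 2.
Proof.
move=> uQ w0 hQ hK.
pose n := (Num.truncn (w / l1)).+1; pose m := (Num.truncn (w / l2)).+1.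
have nw : w <= n%:R * l1.
  by rewrite -ler_pdivrMr //; exact: ltW (truncnS_gt _).
have mw : w <= m%:R * l2.
  by rewrite -ler_pdivrMr //; exact: ltW (truncnS_gt _).
have [n0 m0] : 0 < n%:R :> R /\ 0 < m%:R :> R by [].
clearbody n m.
pose I := [seq (i, j) | i <- iota 0 n, j <- iota 0 m].
have hI ij : ij \in I -> (ij.1 < n)%N /\ (ij.2 < m)%N.
  by move=> /allpairsP[[i j] /= []]; rewrite !mem_iota => hi hj ->.
have uI : uniq I by apply: allpairs_uniq; rewrite ?iota_uniq // => -[a b] [c d].
pose F (q : R * R) (ij : nat * nat) := (l1 * (q.1 + ij.1%:R), l2 * (q.2 + ij.2%:R)).
pose P := [seq F q ij | q <- Q, ij <- I].
have sP : size P = (size Q * (n * m))%N by rewrite !size_allpairs !size_iota.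
have frac (a b : R) (i j : nat) : 0 <= a < 1 -> 0 <= b < 1 -> a + i%:R = b + j%:R -> a = b /\ i = j.
  move=> /andP[a0 a1] /andP[b0 b1] e; suff ij : i = j by split => //; move: e; rewrite ij => /addIr.
  apply/eqP; rewrite eqn_leq -ltnS -[(j <= i)%N]ltnS -!(ltr_nat R) -!natr1.
  by apply/andP; split; lra.
have uP : uniq P.
  apply: allpairs_uniq => // -[q ij] [q' ij'] /allpairsP[[x y] /= [hx hy [-> ->]]].
  move=> /allpairsP[[x' y'] /= [hx' hy' [-> ->]]] [].
  move=> /(mulfI (lt0r_neq0 l10)) e1 /(mulfI (lt0r_neq0 l20)) e2.
  have [a1 a2 _] := hQ _ hx; have [b1 b2 _] := hQ _ hx'.
  have [f1 f2] := frac _ _ _ _ a1 b1 e1; have [f3 f4] := frac _ _ _ _ a2 b2 e2.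
  by rewrite (surjective_pairing x) (surjective_pairing y) f1 f2 f3 f4 -!surjective_pairing.
have hP p : p \in P -> [/\ mt p, 0 <= p.1, p.1 <= n%:R * l1, 0 <= p.2 & p.2 <= m%:R * l2].
  move=> /allpairsP[[q ij] /= [hq /hI[hi hj] ->]]; have [/andP[a0 a1] /andP[b0 b1] hm] := hQ _ hq.
  have i1 : (ij.1%:R + 1 <= n%:R :> R) by rewrite natr1 ler_nat.
  have j1 : (ij.2%:R + 1 <= m%:R :> R) by rewrite natr1 ler_nat.
  have [i0 j0] : 0 <= ij.1%:R :> R /\ 0 <= ij.2%:R :> R by [].
  split; first exact: meet_shift.
  - by rewrite /F /= mulr_ge0 ?(ltW l10) // addr_ge0.
  - by rewrite /F /= mulrC ler_pM2r //; lra.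
  - by rewrite /F /= mulr_ge0 ?(ltW l20) // addr_ge0.
  - by rewrite /F /= mulrC ler_pM2r //; lra.
pose c1 := (Num.truncn (n%:R * l1 / w)).+1; pose c2 := (Num.truncn (m%:R * l2 / w)).+1.
pose f (p : R * R) := (Num.truncn (p.1 / w) * c2 + Num.truncn (p.2 / w))%N.
have b1 p : p \in P -> (Num.truncn (p.1 / w) < c1)%N.
  move=> /hP[_ ? h _ _]; rewrite ltnS; apply: le_truncn.
  by rewrite ler_pM2r ?invr_gt0.
have b2 p : p \in P -> (Num.truncn (p.2 / w) < c2)%N.
  move=> /hP[_ _ _ ? h]; rewrite ltnS; apply: le_truncn.
  by rewrite ler_pM2r ?invr_gt0.
have fb : {in P, forall p, (f p < c1 * c2)%N} by move=> p hp; apply: code_lt; [exact: b1|exact: b2].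
have tru (v : R) (i : nat) : 0 <= v -> Num.truncn (v / w) = i -> i%:R * w <= v /\ v <= i%:R * w + w.
  move=> v0 <-; have /andP[h1 h2] := truncn_itv (divr_ge0 v0 (ltW w0)).
  split; first by rewrite -ler_pdivlMr.
  have : v <= ((Num.truncn (v / w)).+1)%:R * w by rewrite -ler_pdivrMr // ltW.
  by rewrite -natr1 mulrDl mul1r.
have sPK : (size P <= K * (c1 * c2))%N.
  rewrite leqNgt; apply/negP => big; have [j hj] := fiber_large fb big.
  pose Pj := [seq p <- P | f p == j].
  have [Pj0|[p0 hp0]] : Pj = [::] \/ exists p, p \in Pj.
  - by case: (Pj) => [|p r]; [left|right; exists p; rewrite inE eqxx].
  - by move: hj; rewrite -/Pj Pj0.
  have := hp0; rewrite mem_filter => /andP[/eqP fp0 P0].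
  move: hj; rewrite ltnNge => /negP; apply.
  apply: (hK _ ((Num.truncn (p0.1 / w))%:R * w) ((Num.truncn (p0.2 / w))%:R * w)).
  - exact: filter_uniq.
  - by move=> p; rewrite mem_filter => /andP[_ /hP[]].
  - move=> p; rewrite mem_filter => /andP[/eqP fp hp].
    have [e1 e2] := code_inj (b2 p hp) (b2 p0 P0) (etrans fp (esym fp0)).
    have [_ q1 _ q2 _] := hP p hp.
    by have [? ?] := tru _ _ q1 e1; have [? ?] := tru _ _ q2 e2.
have cn : c1%:R <= 2 * (n%:R * l1 / w).
  have h : 1 <= n%:R * l1 / w by rewrite ler_pdivlMr // mul1r.
  have h0 : 0 <= n%:R * l1 / w by lra.
  by have /andP[] := truncn_itv h0; rewrite /c1 -natr1; lra.
have cm : c2%:R <= 2 * (m%:R * l2 / w).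
  have h : 1 <= m%:R * l2 / w by rewrite ler_pdivlMr // mul1r.
  have h0 : 0 <= m%:R * l2 / w by lra.
  by have /andP[] := truncn_itv h0; rewrite /c2 -natr1; lra.
have : (size Q * (n * m))%:R <= (K * (c1 * c2))%:R :> R by rewrite ler_nat -sP.
rewrite !natrM => h.
have h' : K%:R * (c1%:R * c2%:R) <= K%:R * (2 * (n%:R * l1 / w) * (2 * (m%:R * l2 / w))) :> R.
  by rewrite ler_wpM2l // ler_pM.
have nm : 0 < n%:R * m%:R :> R by rewrite mulr_gt0.
rewrite -(ler_pM2r nm); apply: le_trans h (le_trans h' _).
by rewrite le_eqVlt; apply/orP; left; apply/eqP; field; rewrite gt_eqF.
Qed.
End UpperBound.

(** * The upper bound for the interaction strength *)

Section UpperStrength.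
Variables (R : realType) (g : nat) (Gamma : set 'M[R]_2).
Hypothesis hG : hyperbolic_surface g Gamma.

(** [count_bound] gives 4 K l1 l2 / w^2 with K at most 2 (k + 32)^2 w / s; as w = ln (1/s) / 16, the
    factor is 4 * 2 * 16 = 128. *)
Lemma upper_pair (k s : R) c1 c2 l1 l2 : 4 * 64 * 24 * 800 <= k ^+ 2 -> 2 <= k ->
  s = Num.min (systole Gamma) (1 / 2) ->
  closed_geodesic Gamma c1 l1 -> closed_geodesic Gamma c2 l2 ->
  (geometric_intersection Gamma c1 c2 <=
    (128 * (k + 32) ^+ 2 * (l1 * l2 / (s * ln (1 / s))))%:E)%E.
Proof.
move=> hk k2 es g1 g2; have [l10 _ _] := g1; have [l20 _ _] := g2.
have sys0 := sys_gt0 hG.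
have s0 : 0 < s by rewrite es lt_min sys0; lra.
have ss : s <= systole Gamma by rewrite es ge_min lexx.
have s2 : s <= 1 / 2 by rewrite es ge_min lexx orbT.
have [] := cell_constants hk k2 s0 s2 ss.
set w := ln (1 / s) / 16; set r := expR _ / k; set D := 2 * w + 4.
move=> [w0 r0 r2] hr [D0 hD] b1 b2.
have [M1 [dM1 ec1 [T1 GT1 eT1]]] := closed_geodesic_std hG g1.
have [M2 [dM2 ec2 [T2 GT2 eT2]]] := closed_geodesic_std hG g2.
have [dl /andP[dl0 dl1] hdl] := generic_width hG M1 M2.
pose N := (Num.truncn (w / r)).+1; pose K2 := (2 * (Num.truncn (2 * D / systole Gamma)).+1)%N.
(* Either the points are few enough for the boxes, or [cell_bound] applies; K covers both cases. *)
pose K := maxn (2 * N ^ 2) K2.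
have wr : 0 <= w / r by rewrite divr_ge0 ?ltW.
have NR : N%:R <= w / r + 1.
  by rewrite /N -natr1 lerD2r; have /andP[] := truncn_itv wr.
have KR : K%:R <= 2 * (k + 32) ^+ 2 * (w / s).
  rewrite /K; case: leqP => _.
  - apply: le_trans b2.
    have -> : K2%:R = 2 * ((Num.truncn (2 * D / systole Gamma))%:R + 1) :> R.
      by rewrite natr1 -natrM.
    rewrite ler_pM2l // lerD2r.
    have DS : 0 <= 2 * D / systole Gamma by rewrite divr_ge0 ?mulr_ge0 // ltW.
    by have /andP[] := truncn_itv DS.
  - apply: le_trans b1; rewrite natrM natrX ler_pM2l // ler_sqr ?nnegrE //.
    by rewrite addr_ge0.
pose d1 t := hcyc M1 dl (l1 * t); pose d2 t := hcyc M2 0 (l2 * t).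
pose V := 4 * K%:R * (l1 * l2) / w ^+ 2.
have V0 : 0 <= V by rewrite /V divr_ge0 ?sqr_ge0 // mulr_ge0 // mulr_ge0 // ltW.
have [n nV cardn] : exists2 n : nat, (n <= Num.truncn V)%N &
    (intersections Gamma d1 d2 #= `I_n)%card.
  apply: bounded_finite => Q uQ hQ.
  suff : (size Q)%:R <= V.
    by move=> h; rewrite -(natrK (R := R) (size Q)); exact: le_truncn.
  apply: (count_bound (dl := dl) hG dM1 dM2 l10 l20 GT1 GT2 eT1 eT2 uQ w0).
    by move=> q /hQ[h1 h2 [A GA eA]]; split => //; exists A.
  move=> P x y uP mP bP; rewrite leq_max.
  have [//|big] := leqP (size P) (2 * N ^ 2).
  by rewrite (cell_bound hG dM1 dM2 dl0 dl1 uP mP bP (ltW w0) r0 r2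
    (truncnS_gt _) hr D0 hD big) ?orbT.
have gi : (geometric_intersection Gamma c1 c2 <= (n%:R)%:E)%E.
  apply: ereal_inf_lbound; exists n, d1, d2; split; last by [].
  - split; first exact: (hcyc_C1 dl dM1 GT1 eT1).
    rewrite (_ : c1 = std M1 l1); last by apply/funext => t; rewrite ec1.
    exact: (hcyc_homotopic hG dl dM1 GT1 eT1).
  - split; first exact: (hcyc_C1 0 dM2 GT2 eT2).
    rewrite (_ : c2 = std M2 l2); last by apply/funext => t; rewrite ec2.
    exact: (hcyc_homotopic hG 0 dM2 GT2 eT2).
  - exact: (hcyc_transverse hG dM1 dM2 l10 l20 hdl).
  - exact: cardn.
apply: (le_trans gi); rewrite lee_fin.
have nV' : n%:R <= V.
  by have /andP[h _] := truncn_itv V0; apply: le_trans h; rewrite ler_nat.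
apply: le_trans nV' _.
have ll : 0 < l1 * l2 by rewrite mulr_gt0.
apply: le_trans (_ : 4 * (2 * (k + 32) ^+ 2 * (w / s)) * (l1 * l2) / w ^+ 2 <= _).
  by rewrite /V ler_pM2r ?invr_gt0 ?exprn_gt0 // ler_pM2r // ler_pM2l.
rewrite (_ : ln (1 / s) = 16 * w); last by rewrite /w; field.
by rewrite le_eqVlt; apply/orP; left; apply/eqP; field; rewrite !gt_eqF.
Qed.
End UpperStrength.

Theorem corollary4p8 (R : realType) (g : nat) (hg : (2 <= g)%N) :
  exists2 c : R, 0 < c &
    forall Gamma : set 'M[R]_2, hyperbolic_surface g Gamma ->
      let s : R := Num.min (systole Gamma) (1 / 2) in
      ((1 / c * (1 / (s * ln (1 / s))))%:E <= interaction_strength Gamma)%E /\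
      (interaction_strength Gamma <= (c * (1 / (s * ln (1 / s))))%:E)%E.
Proof.
pose X : R := 864 * g%:R + 1; pose S1 := ln (12 + 4 * X ^+ 2).
pose K := 8 * (1 + 2 * S1) * (ln (12 * (X + 2) ^+ 4) + 4 + 2 * S1).
have [k hk k2] : exists2 k : R, 4 * 64 * 24 * 800 <= k ^+ 2 & 2 <= k.
  (* 2500^2 = 6250000 exceeds 4 * 64 * 24 * 800 = 4915200. *)
  by exists (50 * 50); rewrite ?expr2; lra.
pose U : R := 128 * (k + 32) ^+ 2.
have U0 : 0 < U by rewrite mulr_gt0 // exprn_gt0 //; lra.
have S10 : 0 <= S1 by apply: ln_ge0; have := sqr_ge0 X; lra.
have K0 : 0 < K.
  have N0 : 0 <= ln (12 * (X + 2) ^+ 4).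
    apply: ln_ge0; have : 1 <= (X + 2) ^+ 4.
      by rewrite exprn_ege1 // /X; have : 0 <= g%:R :> R by []; lra.
    lra.
  by rewrite /K !mulr_gt0 //; lra.
(* A single constant must serve for both inequalities, so the two are added. *)
exists (K + U); first exact: addr_gt0.
move=> Gamma hG s; have s0 : 0 < s by rewrite lt_min (sys_gt0 hG); lra.
have L0 : 0 < ln (1 / s).
  rewrite ln_gt0 // ltr_pdivlMr // mul1r.
  by apply: le_lt_trans (_ : 1 / 2 < 1); [rewrite ge_min lexx orbT|lra].
have sL : 0 < s * ln (1 / s) by rewrite mulr_gt0.
have lb := lower_pair hG (erefl X) (erefl s) (erefl S1) (erefl K).
have gi c1 c2 l1 l2 g1 g2 := @upper_pair _ _ _ hG k s c1 c2 l1 l2 hk k2 (erefl s) g1 g2.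
have KU : 0 < K + U by exact: addr_gt0.
rewrite -/U in gi; move: K U (s * _) K0 U0 KU sL lb gi {s0 L0 S10}; clear => K U Z K0 U0 KU Z0 lb gi.
split.
  apply: le_trans lb; rewrite lee_fin !div1r -invfM.
  rewrite lef_pV2 ?posrE; [|exact: mulr_gt0|exact: mulr_gt0].
  by rewrite ler_pM2r // lerDl ltW.
apply: ge_ereal_sup => x [c1 [c2 [l1 [l2 [g1 g2 ->]]]]].
have [l10 _ _] := g1; have [l20 _ _] := g2.
have ll : 0 < l1 * l2 by rewrite mulr_gt0.
apply: (@le_trans _ _ ((U * (l1 * l2 / Z))%:E * ((l1 * l2)^-1)%:E)%E).
  by apply: lee_wpmul2r; [rewrite lee_fin invr_ge0 ltW|exact: gi].
rewrite -EFinM lee_fin.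
have -> : U * (l1 * l2 / Z) / (l1 * l2) = U * (1 / Z).
  by field; rewrite !gt_eqF.
by rewrite ler_pM2r ?divr_gt0 // lerDr ltW.
Qed.
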